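(* Let $\Theta$ be a $2\times 4$ matrix of rank $2$ of linear forms in $R=k[x_1,\ldots,x_n]$, $n\ge3$, with the gcd of the entries of each row equal to $1$. Then the Kronecker--Weierstrass normal form of $\Theta$ determines completely the Bourbaki degree $\operatorname{Bour}(\Theta)$, the initial degree $\operatorname{indeg}(\operatorname{Syz}(\Theta))$, and the homological type (minimal graded free resolution type) of $\mathcal Q=\operatorname{coker}(\Theta)$. In particular, each normal form is either free, or nearly free with $\operatorname{Bour}(\Theta)=1$, or of Buchsbaum--Rim type with $\operatorname{Bour}(\Theta)=3$, except for one exceptional type, namely $$\Theta=D_2\mid B_1=\begin{bmatrix}x_1&x_2&0&x_3\\ 0&x_1&x_2&x_4\end{bmatrix},$$ for which $\operatorname{Bour}(\Theta)=2$ and $\mathcal Q$ has a minimal free resolution which is not of Buchsbaum--Rim type.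
   Context: $k$ is algebraically closed of characteristic zero. $\Theta$ defines a graded map $R^4\to R(1)^2$ with kernel $\operatorname{Syz}(\Theta)$ and cokernel $\mathcal Q$. $\operatorname{indeg}(E)=\min\{i:E_i\ne0\}$. Two $2\times m$ matrices of linear forms are equivalent if they differ by left multiplication by $\mathrm{GL}_2(k)$ and right multiplication by $\mathrm{GL}_m(k)$. By the Kronecker--Weierstrass theorem every such matrix is equivalent to a concatenation (written with $\mid$), unique up to permutation of blocks, of blocks of the types $$D_m=\begin{bmatrix}x_1&x_2&\cdots&x_m&0\\ 0&x_1&\cdots&x_{m-1}&x_m\end{bmatrix},\quad J_m(\lambda)=\begin{bmatrix}y_1&y_2&\cdots&y_m\\ \lambda y_1&y_1+\lambda y_2&\cdots&y_{m-1}+\lambda y_m\end{bmatrix}\ (\lambda\in k),\quad B_m=\begin{bmatrix}z_1&z_2&\cdots&z_m\\ z_0&z_1&\cdots&z_{m-1}\end{bmatrix}$$ ($D_0$ being a zero column), where the variables appearing in different blocks are distinct, algebraically independent linear forms; this is the normal form. $\Theta$ is free if $\operatorname{Syz}(\Theta)$ is a free $R$-module. Bourbaki degree: let $e=\operatorname{indeg}(\operatorname{Syz}(\Theta))$ and $0\ne\nu\in\operatorname{Syz}(\Theta)_e$; the cokernel of $R(-e)\xrightarrow{\nu}\operatorname{Syz}(\Theta)$ is torsion-free of rank one, isomorphic up to shift to an ideal $I_\nu$ that is either $R$ or of height two; $\operatorname{Bour}(\Theta)=\deg(R/I_\nu)$ (0 if $I_\nu=R$, i.e. if $\Theta$ is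 free), independent of $\nu$. A non-free $\Theta$ is nearly free if $\operatorname{Bour}(\Theta)=1$. Buchsbaum--Rim type means that the minimal graded free resolution of $\mathcal Q$ is the Buchsbaum--Rim complex $0\to R^2(-3)\to R^4(-2)\to R^4\xrightarrow{\Theta}R^2(1)\to\mathcal Q\to0$. *)

(* Defs.v *)
From HB Require Import structures.
From mathcomp Require Import all_boot all_order all_algebra.
From mathcomp Require Export mpoly.

Set Implicit Arguments.
Unset Strict Implicit.
Unset Printing Implicit Defensive.

Import GRing.Theory.
Local Open Scope ring_scope.

Section PolynomialRing.
Variables (k : fieldType) (n : nat).
Local Notation R := {mpoly k[n]}.

(* The graded piece [R_i] for [i : int]; it is zero for negative [i]. *)
Definition homogZ (i : int) (p : R) : Prop :=
  match i with
  | Posz d => p \is d.-homog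
  | Negz _ => p = 0
  end.

Definition gcd_one (m : nat) (f : 'I_m -> R) : Prop :=
  forall d : R, (forall j, exists q, f j = q * d) -> d \is a GRing.unit.

Definition alg_independent (N : nat) (x : nat -> R) : Prop :=
  forall p : {mpoly k[N]}, p \mPo [tuple x i | i < N] = 0 -> p = 0.

(* Ideals are predicates on [R]. *)
Definition is_ideal (I : R -> Prop) : Prop :=
  [/\ I 0, forall f g, I f -> I g -> I (f + g)
    & forall a f, I f -> I (a * f)].

Definition is_prime_ideal (P : R -> Prop) : Prop :=
  [/\ is_ideal P, ~ P 1 & forall f g, P (f * g) -> P f \/ P g].

(* [h] is at most the height of the prime [P]: there is a chain of primes
   [C 0 < C 1 < ... < C h = P]. *)
Definition prime_height_ge (P : R -> Prop) (h : nat) : Prop :=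
  exists C : nat -> R -> Prop,
    [/\ forall i, (i <= h)%N -> is_prime_ideal (C i),
        forall i, (i < h)%N ->
          (forall f, C i f -> C i.+1 f) /\ (exists f, C i.+1 f /\ ~ C i f)
      & forall f, C h f <-> P f].

(* The infimum of the heights of the primes containing [I] is [h]. *)
Definition has_height (I : R -> Prop) (h : nat) : Prop :=
  (forall P, is_prime_ideal P -> (forall f, I f -> P f) -> prime_height_ge P h)
  /\ (exists P, [/\ is_prime_ideal P, forall f, I f -> P f
                  & ~ prime_height_ge P h.+1]).

(* [dim_k (R/I)_d = h]: the classes of [h] forms [f i] are a basis. *)
Definition hilbert_function (I : R -> Prop) (d h : nat) : Prop :=
  exists f : 'I_h -> R,
    (forall i, f i \is d.-homog) /\
    (forall p : R, p \is d.-homog ->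
       exists! c : 'rV[k]_h, I (p - \sum_(i < h) c 0 i *: f i)).

(* [deg (R/I) = b], where [H] is the Hilbert polynomial of [R/I] and
   [b = (deg H)! * lead_coef H].  This gives 0 when [R/I] has finite length;
   it is only used for [I = R] and for [I] of height 2 with [n >= 3]. *)
Definition has_degree (I : R -> Prop) (b : nat) : Prop :=
  exists H : {poly rat},
    (exists d0 : nat, forall d : nat, (d0 <= d)%N ->
       exists h : nat, hilbert_function I d h /\ h%:R = H.[d%:R])
    /\ ((size H).-1)`!%:R * lead_coef H = b%:R.

Definition KW_equiv (m : nat) (A B : 'M[R]_(2, m)) : Prop :=
  exists (P : 'M[k]_2) (Q : 'M[k]_m),
    [/\ P \in unitmx, Q \in unitmx
      & A = map_mx (@mpolyC n k) P *m B *m map_mx (@mpolyC n k) Q].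

(* The variables [x 0], [x 1], ... of a block are numbered from 0; in [mxB]
   this is the numbering [z_0], ..., [z_m], in [mxD] and [mxJ] it is shifted
   by one from [x_1], ..., [x_m] and [y_1], ..., [y_m]. *)
Definition mxD (m : nat) (x : nat -> R) : 'M[R]_(2, m.+1) :=
  \matrix_(r < 2, c < m.+1)
    if r == 0 then (if (c < m)%N then x c else 0)
    else (if (0 < c)%N then x c.-1 else 0).

Definition mxJ (m : nat) (lam : k) (y : nat -> R) : 'M[R]_(2, m) :=
  \matrix_(r < 2, c < m)
    if r == 0 then y c
    else lam *: y c + (if (0 < c)%N then y c.-1 else 0).

Definition mxB (m : nat) (z : nat -> R) : 'M[R]_(2, m) :=
  \matrix_(r < 2, c < m) if r == 0 then z c.+1 else z c.

End PolynomialRing.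

Inductive KW_block (k : Type) : Type :=
  | KW_D of nat
  | KW_J of nat & k
  | KW_B of nat.

Arguments KW_D {k} _.
Arguments KW_B {k} _.

Section KroneckerWeierstrass.
Variables (k : fieldType) (n : nat).
Local Notation R := {mpoly k[n]}.

Definition block_wf (b : KW_block k) : bool :=
  match b with KW_D _ => true | KW_J m _ => 0 < m | KW_B m => 0 < m end%N.

Definition block_width (b : KW_block k) : nat :=
  match b with KW_D m => m.+1 | KW_J m _ => m | KW_B m => m end.

Definition block_nvars (b : KW_block k) : nat :=
  match b with KW_D m => m | KW_J m _ => m | KW_B m => m.+1 end.

Definition block_mx (b : KW_block k) (x : nat -> R) : 'M[R]_(2, block_width b) :=
  match b with
  | KW_D m => mxD m x
  | KW_J m lam => mxJ m lam x
  | KW_B m => mxB m x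
  end.

Fixpoint KW_width (bs : seq (KW_block k)) : nat :=
  if bs is b :: bs' then (block_width b + KW_width bs')%N else 0%N.

Fixpoint KW_nvars (bs : seq (KW_block k)) : nat :=
  if bs is b :: bs' then (block_nvars b + KW_nvars bs')%N else 0%N.

(* Each block uses the first variables not used by the blocks to its left. *)
Fixpoint KW_mx (bs : seq (KW_block k)) (x : nat -> R) :
    'M[R]_(2, KW_width bs) :=
  match bs with
  | [::] => 0
  | b :: bs' =>
      row_mx (block_mx b x) (KW_mx bs' (fun i => x (block_nvars b + i)%N))
  end.

(* A normal form is recorded by its list of blocks; the order of the list is
   immaterial, since column permutations are equivalences. *)
Definition KW_normal_form (m : nat) (A : 'M[R]_(2, m)) (bs : seq (KW_block k))
    : Prop :=
  all block_wf bs /\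
  exists (x : nat -> R) (w : KW_width bs = m),
    [/\ forall i, (i < KW_nvars bs)%N -> x i \is 1.-homog,
        alg_independent (KW_nvars bs) x
      & KW_equiv A (castmx (erefl 2, w) (KW_mx bs x))].

End KroneckerWeierstrass.

Section Invariants.
Variables (k : fieldType) (n : nat).
Local Notation R := {mpoly k[n]}.
Implicit Type Theta : 'M[R]_(2, 4).

Definition admissible Theta : Prop :=
  [/\ forall i j, Theta i j \is 1.-homog,
      \rank (map_mx (@tofrac R) Theta) = 2%N
    & forall i, gcd_one (fun j => Theta i j)].

Definition Syz Theta (v : 'cV[R]_4) : Prop := Theta *m v = 0.

Definition Syz_deg Theta (d : nat) (v : 'cV[R]_4) : Prop :=
  Syz Theta v /\ forall i, v i 0 \is d.-homog.

Definition indeg_Syz Theta (e : nat) : Prop :=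
  (exists v, Syz_deg Theta e v /\ v <> 0) /\
  (forall d v, (d < e)%N -> Syz_deg Theta d v -> v = 0).

(* The columns of [B] are a basis of [Syz Theta]. *)
Definition is_free Theta : Prop :=
  exists (r : nat) (B : 'M[R]_(4, r)),
    (forall v, Syz Theta v <-> exists c : 'cV[R]_r, v = B *m c) /\
    (forall c : 'cV[R]_r, B *m c = 0 -> c = 0).

(* [phi] induces an isomorphism [Syz Theta / R nu -> I], graded up to the
   shift [s]. *)
Definition bourbaki_ideal Theta (nu : 'cV[R]_4) (I : R -> Prop) : Prop :=
  (exists (phi : 'cV[R]_4 -> R) (s : int),
    [/\ forall a u v, Syz Theta u -> Syz Theta v ->
          phi (a *: u + v) = a * phi u + phi v,
        forall (d : nat) v, Syz_deg Theta d v -> homogZ (d%:Z + s) (phi v),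
        forall v, Syz Theta v -> (phi v = 0 <-> exists c, v = c *: nu)
      & forall f, I f <-> exists v, Syz Theta v /\ phi v = f])
  /\ ((forall f, I f) \/ has_height I 2).

(* [Bour Theta = b]; the second conjunct ranges over all choices of [nu] and
   [I], so that [b] does not depend on them. *)
Definition has_Bour Theta (b : nat) : Prop :=
  exists e : nat,
    [/\ indeg_Syz Theta e,
        exists nu I, [/\ Syz_deg Theta e nu, nu <> 0 & bourbaki_ideal Theta nu I]
      & forall nu I, Syz_deg Theta e nu -> nu <> 0 ->
          bourbaki_ideal Theta nu I -> has_degree I b].

Definition nearly_free Theta : Prop := ~ is_free Theta /\ has_Bour Theta 1.

(* Minimal graded free resolution
     ... -> F_2 --D 1--> F_1 --D 0--> F_0 --> coker Theta --> 0,
   where F_i is the direct sum of the R(-j), j in [a i], and where E lifts the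
   augmentation to a graded map F_0 -> R(1)^2.  Minimality says that the
   entries of the [D i] lie in the ideal of the variables. *)
Definition min_free_resolution Theta (a : nat -> seq int)
    (E : 'M[R]_(2, size (a 0)))
    (D : forall i, 'M[R]_(size (a i), size (a i.+1))) : Prop :=
  [/\ (forall p (q : 'I_(size (a 0))), homogZ ((a 0)`_q + 1) (E p q)) /\
      (forall i (p : 'I_(size (a i))) (q : 'I_(size (a i.+1))),
         homogZ ((a i.+1)`_q - (a i)`_p) (D i p q)),
      forall i p q, (D i p q)@_0%MM = 0,
      forall w : 'cV[R]_2, exists u v, w = E *m u + Theta *m v,
      forall u : 'cV[R]_(size (a 0)),
        (exists v, E *m u = Theta *m v) <-> (exists t, u = D 0 *m t)
    & forall i (u : 'cV[R]_(size (a i.+1))), D i *m u = 0 <-> exists t, u = D i.+1 *m t].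

Definition homological_type Theta (a : nat -> seq int) : Prop :=
  exists E D, @min_free_resolution Theta a E D.

Definition BR_degrees (i : nat) : seq int :=
  match i with
  | 0 => [:: -1; -1]%Z
  | 1 => [:: 0; 0; 0; 0]%Z
  | 2 => [:: 2; 2; 2; 2]%Z
  | 3 => [:: 3; 3]%Z
  | _ => [::]
  end.

(* The map /\^3 R^4 -> R^4 of the Buchsbaum-Rim complex, after the
   identification of /\^3 R^4 with the dual of R^4: the (i, l) entry is, up to
   sign, the 2-minor of [Theta] on the two columns other than i and l.  In this
   basis the last map of the complex is the transpose of [Theta]. *)
Definition BR_middle Theta : 'M[R]_4 :=
  \matrix_(i, l) \det (col_mx (delta_mx 0 i : 'rV[R]_4)
                        (col_mx (delta_mx 0 l : 'rV[R]_4) Theta) : 'M[R]_4).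

Definition BR_maps Theta (i : nat) :
    'M[R]_(size (BR_degrees i), size (BR_degrees i.+1)) :=
  match i with
  | 0 => Theta
  | 1 => BR_middle Theta
  | 2 => Theta^T
  | _ => 0
  end.

Definition BR_type Theta : Prop :=
  @min_free_resolution Theta BR_degrees (1%:M : 'M[R]_2) (BR_maps Theta).

End Invariants.

(* Main.v *)
(* All the invariants are unchanged by equivalence, so one normal form can be
   treated at a time.

   Bourbaki degree. Let delta be the matrix of 2-minors of Theta divided by their
   gcd. For a syzygy nu of least degree e and any syzygy v, the wedge of v and nu
   is a multiple phi(v) delta (up to complementation of indices), and phi identifies
   Syz / R nu with an ideal. This ideal lies in no principal prime, since such a
   prime would allow one to divide a combination of v and nu; it has height two as
   soon as it lies in one prime of height two. Its Hilbert function is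
   determined by that of Syz, hence by a resolution.

   Resolutions. If there is no block D and the eigenvalues of the blocks J are
   distinct, give the blocks B further distinct eigenvalues. Suitable
   specialisations of the variables turn Theta into the pencil (p, T p) on k[T]/chi,
   where chi is the product of the (T - lambda)^m; modulo one more form its 2-minors
   contain the squares of three independent forms, so the Buchsbaum-Rim complex is
   exact, first modulo linear forms and then, by Nakayama, before specialisation.
   The minors of D_3 contain three such squares as well. Otherwise a block D or two blocks J with the same eigenvalue give, up to
   equivalence, two columns (y1, 0), (y2, 0), or a scalar 2 x 2 part, or a zero column,
   or D_2 | B_1, and Syz can be computed by hand.

   Normal form. Write Theta as a pencil (alpha, beta) of maps from U to the linear
   forms with alpha of maximal rank. One removes the blocks B by passing to
   beta^-1(alpha U), then the blocks D by passing to the quotient by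
   ker alpha, and what is left is a Jordan form. *)

Require Import Defs.
From HB Require Import structures.
From mathcomp Require Import all_boot all_order all_algebra perm.
From mathcomp Require Import ring lra zify.
From Stdlib Require Import Classical ClassicalEpsilon Permutation.

Set Implicit Arguments.
Unset Strict Implicit.
Unset Printing Implicit Defensive.

Import GRing.Theory.
Local Open Scope ring_scope.

(** * Bases modulo subspaces *)

(** Heights are defined by chains of primes, so two facts about them are built up first. A prime
    element generates a prime of height at most one, because polynomial rings are factorial. A prime
    of a ring in n variables modulo which n - 2 elements are algebraically independent has height at
    most two, because a longer chain would produce n + 1 independent polynomials. The prime of
    height two around a Bourbaki ideal is generated by two linear forms, except for normal forms
    made of blocks B only: there it is the kernel of a specialisation into the fraction field at
    which three columns become proportional.

    [has_Bour] ranges over all ideals isomorphic to Syz / R nu. Two of them differ by a factor, and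
    the height condition forces this factor to be a unit.

    The functions asserted by the theorem see neither n nor Theta. Each list of blocks is therefore
    treated uniformly in n and Theta, and the functions are obtained by choice at the end. *)

Section RelativeDimension.
Variables (k : fieldType).

Definition subspace (V : lmodType k) (A : V -> Prop) :=
  A 0 /\ forall a u v, A u -> A v -> A (a *: u + v).

(** Says that [B / A] has dimension [h]. Unique coordinates modulo [A] avoid quotient spaces and
    match the shape of [hilbert_function]. *)
Definition basis_mod (V : lmodType k) (B A : V -> Prop) (h : nat) :=
  exists f : 'I_h -> V, (forall i, B (f i)) /\
    (forall p, B p -> exists! c : 'rV[k]_h, A (p - \sum_(i < h) c 0 i *: f i)).

Definition zero_sub (V : lmodType k) (v : V) := v = 0.

Section Subspace.
Variables (V : lmodType k) (A : V -> Prop).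
Hypothesis sA : subspace A.

Lemma subspaceD u v : A u -> A v -> A (u + v).
Proof. by move=> Au Av; rewrite -[u]scale1r; apply: sA.2. Qed.

Lemma subspaceZ a u : A u -> A (a *: u).
Proof. by move=> Au; rewrite -[_ *: _]addr0; apply: sA.2 => //; apply: sA.1. Qed.

Lemma subspaceN u : A u -> A (- u).
Proof. by rewrite -scaleN1r; apply: subspaceZ. Qed.

Lemma subspaceB u v : A u -> A v -> A (u - v).
Proof. by move=> Au Av; apply: subspaceD => //; apply: subspaceN. Qed.

Lemma subspace_sum (I : Type) (r : seq I) (P : pred I) (F : I -> V) :
  (forall i, P i -> A (F i)) -> A (\sum_(i <- r | P i) F i).
Proof. by move=> AF; apply: big_ind => //; [apply: sA.1 | apply: subspaceD]. Qed.

Lemma subspace_comb h (c : 'rV[k]_h) (f : 'I_h -> V) :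
  (forall i, A (f i)) -> A (\sum_i c 0 i *: f i).
Proof. by move=> Af; apply: subspace_sum => i _; apply: subspaceZ. Qed.

Lemma subspace_subC u v : A (u - v) -> A (v - u).
Proof. by move=> /subspaceN; rewrite opprB. Qed.

Lemma subspace_trans u v w : A (u - v) -> A (v - w) -> A (u - w).
Proof. by move=> A1 A2; have := subspaceD A1 A2; rewrite addrA subrK. Qed.

End Subspace.

Lemma subspace_zero (V : lmodType k) : subspace (@zero_sub V).
Proof. by split=> // a u v -> ->; rewrite scaler0 addr0. Qed.

Lemma comb_linear (V : lmodType k) h (a : k) (c d : 'rV[k]_h) (f : 'I_h -> V) :
  \sum_i (a *: c + d) 0 i *: f i
    = a *: (\sum_i c 0 i *: f i) + \sum_i d 0 i *: f i.
Proof.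
rewrite scaler_sumr -big_split /=; apply: eq_bigr => i _.
by rewrite !mxE scalerDl scalerA.
Qed.

Lemma comb_mulmx (V : lmodType k) h m (d : 'rV[k]_m) (M : 'M[k]_(m, h))
    (f : 'I_h -> V) :
  \sum_i (d *m M) 0 i *: f i = \sum_j d 0 j *: (\sum_i M j i *: f i).
Proof.
transitivity (\sum_i \sum_j (d 0 j * M j i) *: f i).
  by apply: eq_bigr => i _; rewrite mxE scaler_suml.
rewrite exchange_big /=; apply: eq_bigr => j _; rewrite scaler_sumr.
by apply: eq_bigr => i _; rewrite scalerA.
Qed.

Lemma comb0 (V : lmodType k) h (f : 'I_h -> V) :
  \sum_i (0 : 'rV[k]_h) 0 i *: f i = 0.
Proof. by rewrite big1 // => i _; rewrite mxE scale0r. Qed.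

Lemma combB (V : lmodType k) h (c d : 'rV[k]_h) (f : 'I_h -> V) :
  \sum_i (c - d) 0 i *: f i = \sum_i c 0 i *: f i - \sum_i d 0 i *: f i.
Proof.
have -> : c - d = (-1) *: d + c by rewrite scaleN1r addrC.
by rewrite comb_linear scaleN1r addrC.
Qed.

Lemma basis_mod_add (V : lmodType k) (A B C : V -> Prop) a b :
    subspace A -> subspace B -> (forall v, A v -> B v) -> (forall v, B v -> C v) ->
  basis_mod B A a -> basis_mod C B b -> basis_mod C A (a + b).
Proof.
move=> sA sB AB BC [f [Bf f_basis]] [g [Cg g_basis]].
pose F (i : 'I_(a + b)) := match split i with inl j => f j | inr j => g j end.
have sumF (c : 'rV[k]_(a + b)) : \sum_i c 0 i *: F i
    = \sum_i (lsubmx c) 0 i *: f i + \sum_i (rsubmx c) 0 i *: g i.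
  rewrite big_split_ord /=; congr (_ + _); apply: eq_bigr => i _; rewrite mxE /F.
    by rewrite (unsplitK (inl i)).
  by rewrite (unsplitK (inr i)).
exists F; split=> [i|p Cp].
  by rewrite /F; case: split => j; [apply: BC | apply: Cg].
have [d [Bd d_uniq]] := g_basis p Cp.
have [c [Ac c_uniq]] := f_basis _ Bd.
exists (row_mx c d); split=> [|e].
  by rewrite sumF row_mxKl row_mxKr opprD addrCA addrC.
rewrite sumF => Ae.
have ed : d = rsubmx e.
  apply: d_uniq.
  set x := \sum_i rsubmx e 0 i *: g i in Ae *.
  have := AB _ Ae; set y := \sum_i _ => By.
  have -> : p - x = (p - (y + x)) + y by rewrite opprD addrA addrAC subrK.
  by apply: (subspaceD sB By); rewrite /y; apply: subspace_comb.
have ec : c = lsubmx e.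
  by apply: c_uniq; rewrite ed -addrA -opprD [X in p - X]addrC.
by rewrite ec ed hsubmxK.
Qed.

(** The matrix [G] of coordinates, modulo [A], of the basis of [B] in that of [C] has independent
    rows; a complement of its row space gives a basis of [C] modulo [B]. *)
Lemma basis_mod_sub (V : lmodType k) (A B C : V -> Prop) b c :
    subspace A -> subspace B -> subspace C ->
    (forall v, A v -> B v) -> (forall v, B v -> C v) ->
  basis_mod C A c -> basis_mod B A b ->
  (b <= c)%N /\ basis_mod C B (c - b).
Proof.
move=> sA sB sC AB BC [f [Cf f_basis]] [g [Bg g_basis]].
have coordP p : C p -> {c : 'rV[k]_c | A (p - \sum_i c 0 i *: f i)}.
  by move=> Cp; apply: constructive_indefinite_description;
     have [d [? _]] := f_basis p Cp; exists d.
pose G := \matrix_(j < b) sval (coordP (g j) (BC _ (Bg j))).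
have GP j : A (g j - \sum_i G j i *: f i).
  rewrite (eq_bigr (fun i => sval (coordP (g j) (BC _ (Bg j))) 0 i *: f i)).
    by case: (coordP _ _).
  by move=> i _; rewrite mxE.
have GPd (d : 'rV_b) : A (\sum_j d 0 j *: g j - \sum_i (d *m G) 0 i *: f i).
  rewrite comb_mulmx -sumrB; apply: subspace_sum => // j _.
  by rewrite -scalerBr; apply: subspaceZ.
have coord_uniq p (c1 c2 : 'rV[k]_c) : C p -> A (p - \sum_i c1 0 i *: f i) ->
    A (p - \sum_i c2 0 i *: f i) -> c1 = c2.
  by move=> Cp A1 A2; have [d [_ du]] := f_basis p Cp; rewrite -(du _ A1) -(du _ A2).
have freeG : row_free G.
  apply: inj_row_free => d dG0.
  have := GPd d; rewrite dG0 comb0 subr0 => Ad.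
  have B0 : B 0 by apply: sB.1.
  have [e [_ eu]] := g_basis 0 B0.
  rewrite -(eu 0) ?comb0 ?subr0; last exact: sA.1.
  by apply/esym/eu; rewrite sub0r; apply: subspaceN.
have rkG : \rank G = b by apply/eqP.
have le_bc : (b <= c)%N by rewrite -rkG rank_leq_col.
have rkC : \rank (G^C)%MS = (c - b)%N by rewrite mxrank_compl rkG.
split=> //.
have memB p (d : 'rV[k]_c) : C p -> A (p - \sum_i d 0 i *: f i) -> B p <-> (d <= G)%MS.
  move=> Cp Ad; split=> [Bp|/submxP[e de]].
    have [e [Ae _]] := g_basis p Bp.
    apply/submxP; exists e; apply: (coord_uniq p) => //.
    exact: subspace_trans Ae (GPd e).
  have A1 : A (p - \sum_j e 0 j *: g j).
    by apply: subspace_trans Ad _ => //; rewrite de; apply: subspace_subC.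
  rewrite -[p](subrK (\sum_j e 0 j *: g j)); apply: subspaceD => //; first exact: AB.
  exact: subspace_comb.
rewrite -rkC; pose F := row_base (G^C)%MS.
exists (fun j => \sum_i F j i *: f i); split=> [j|p Cp].
  by apply: subspace_sum => // i _; apply: subspaceZ.
have [d [Ad _]] := f_basis p Cp.
have memBd (e : 'rV_ _) : B (p - \sum_j e 0 j *: \sum_i F j i *: f i)
     <-> (d - e *m F <= G)%MS.
  apply: memB; last first.
    by rewrite combB comb_mulmx opprB addrA subrK.
  apply: subspaceB => //; apply: subspace_comb => // j.
  by apply: subspace_sum => // i _; apply: subspaceZ.
have /sub_addsmxP[[u v] /= duv] : (d <= G + G^C)%MS.
  by rewrite submx_full // addsmx_compl_full.
have /submxP[e eE] : (v *m (G^C)%MS <= F)%MS by rewrite eq_row_base submxMl.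
exists e; split=> [|e' /memBd].
  by apply/memBd; rewrite duv eE addrK submxMl.
rewrite duv eE -addrA -mulmxBl => le_G.
have le2 : ((e - e') *m F <= G)%MS.
  have /(addmx_sub_adds (submxMl (- u) G)) := le_G.
  rewrite mulNmx addKr => /submx_trans; apply.
  by rewrite addsmx_sub !submx_refl.
have le3 : ((e - e') *m F <= G^C)%MS.
  by apply: submx_trans (submxMl _ _) _; rewrite eq_row_base.
have : ((e - e') *m F <= G :&: G^C)%MS by rewrite sub_capmx le2.
rewrite capmx_compl submx0 => /eqP e0.
apply/eqP; rewrite -subr_eq0; apply/eqP.
have /row_freeP[D FD] : row_free F by apply: row_base_free.
by rewrite -[e - e']mulmx1 -FD mulmxA e0 mul0mx.
Qed.

(** [phi] induces an isomorphism of [B / A] onto [B' / A']. Linearity is asked on [B] only, because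
    the map to the Bourbaki ideal is defined by choice and is linear on syzygies alone. *)
Lemma basis_mod_image (V W : lmodType k) (A B : V -> Prop) (A' B' : W -> Prop)
    (phi : V -> W) h :
    subspace B ->
    (forall a u v, B u -> B v -> phi (a *: u + v) = a *: phi u + phi v) ->
    (forall v, B v -> B' (phi v)) -> (forall w, B' w -> exists2 v, B v & phi v = w) ->
    (forall v, B v -> A' (phi v) <-> A v) ->
  basis_mod B A h <-> basis_mod B' A' h.
Proof.
move=> sB phiL phiB phi_onto phiA.
have phi0 : phi 0 = 0.
  have := phiL (-1) 0 0 sB.1 sB.1.
  by rewrite scaler0 addr0 scaleN1r addNr.
have phi_comb h' (c : 'rV[k]_h') f : (forall i, B (f i)) ->
    phi (\sum_i c 0 i *: f i) = \sum_i c 0 i *: phi (f i).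
  move=> Bf; have : B (\sum_i c 0 i *: f i) /\
     phi (\sum_i c 0 i *: f i) = \sum_i c 0 i *: phi (f i); last by case.
  elim/big_rec2: _ => [|i x y _ [Bx e]]; first by split=> //; apply: sB.1.
  by split; [apply: sB.2 | rewrite phiL // e].
have phiBB u v : B u -> B v -> phi (u - v) = phi u - phi v.
  by move=> Bu Bv; rewrite addrC -scaleN1r phiL // scaleN1r addrC.
split=> [[f [Bf f_basis]]|[f' [Bf' f_basis]]].
  exists (phi \o f); split=> [i|w /phi_onto[v Bv <-]]; first exact: phiB.
  have [c [Ac cu]] := f_basis v Bv.
  have key (d : 'rV[k]_h) : A' (phi v - \sum_i d 0 i *: (phi \o f) i)
       <-> A (v - \sum_i d 0 i *: f i).
    rewrite -(phi_comb _ d f Bf) -phiBB //; last exact: subspace_comb.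
    by apply: phiA; apply: subspaceB => //; apply: subspace_comb.
  by exists c; split=> [|d /key /cu //]; apply/key.
have preP i : {v | B v /\ phi v = f' i}.
  apply: constructive_indefinite_description.
  by have [v Bv e] := phi_onto _ (Bf' i); exists v.
pose f i := sval (preP i).
have Bf i : B (f i) by rewrite /f; case: (preP i) => ? [].
have phif i : phi (f i) = f' i by rewrite /f; case: (preP i) => ? [].
exists f; split=> // v Bv.
have key (d : 'rV[k]_h) : A' (phi v - \sum_i d 0 i *: f' i) <-> A (v - \sum_i d 0 i *: f i).
  rewrite -(eq_bigr _ (fun i _ => congr1 (fun x => d 0 i *: x) (phif i))).
  rewrite -(phi_comb _ d f Bf) -phiBB //; last exact: subspace_comb.
  by apply: phiA; apply: subspaceB => //; apply: subspace_comb.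
have [c [Ac cu]] := f_basis _ (phiB _ Bv).
by exists c; split=> [|d /key /cu //]; apply/key.
Qed.

Lemma basis_mod_iff (V : lmodType k) (A B A' B' : V -> Prop) h :
    (forall v, A v <-> A' v) -> (forall v, B v <-> B' v) ->
  basis_mod B A h -> basis_mod B' A' h.
Proof.
move=> eA eB [f [Bf f_basis]]; exists f; split=> [i|p /eB Bp]; first exact/eB.
have [c [Ac cu]] := f_basis p Bp.
by exists c; split=> [|d /eA /cu //]; apply/eA.
Qed.

End RelativeDimension.

(** * Polynomial rings are factorial *)

Section Divisibility.
Variable A : idomainType.
Implicit Types (a b c p q : A).

Definition rdvd a b := exists c, b = c * a.

Definition prime_elt p :=
  [/\ p != 0, p \isn't a GRing.unit
    & forall a b, rdvd p (a * b) -> rdvd p a \/ rdvd p b].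

Definition factored a (s : seq A) :=
  (forall p, p \in s -> prime_elt p) /\
  exists2 u, u \is a GRing.unit & a = u * \prod_(p <- s) p.

Lemma rdvd_refl a : rdvd a a. Proof. by exists 1; rewrite mul1r. Qed.

Lemma rdvd0 a : rdvd a 0. Proof. by exists 0; rewrite mul0r. Qed.

Lemma rdvd_mull a b c : rdvd a b -> rdvd a (c * b).
Proof. by case=> d ->; exists (c * d); rewrite mulrA. Qed.

Lemma rdvd_mulr a b c : rdvd a b -> rdvd a (b * c).
Proof. by rewrite mulrC; apply: rdvd_mull. Qed.

Lemma rdvd_trans a b c : rdvd a b -> rdvd b c -> rdvd a c.
Proof. by move=> ab [d ->]; apply: rdvd_mull. Qed.

Lemma rdvdD a b c : rdvd a b -> rdvd a c -> rdvd a (b + c).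
Proof. by move=> [d ->] [e ->]; exists (d + e); rewrite mulrDl. Qed.

Lemma rdvdN a b : rdvd a b -> rdvd a (- b).
Proof. by move=> [d ->]; exists (- d); rewrite mulNr. Qed.

Lemma rdvdB a b c : rdvd a b -> rdvd a c -> rdvd a (b - c).
Proof. by move=> ab ac; apply: rdvdD => //; apply: rdvdN. Qed.

Lemma factored_nonunit a s : factored a s -> a \isn't a GRing.unit ->
  exists2 p, prime_elt p & rdvd p a.
Proof.
case: s => [|p s] [s_prime [u Uu ->]]; first by rewrite big_nil mulr1 Uu.
move=> _; exists p; first by apply: s_prime; rewrite mem_head.
by rewrite big_cons mulrCA mulrC; apply/rdvd_mull/rdvd_refl.
Qed.

(** The length of a factorisation is the measure for every induction that divides a prime out
    repeatedly. *)
Lemma factored_div p a b s : prime_elt p -> factored a s -> a = p * b ->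
  exists2 s', factored b s' & (size s' < size s)%N.
Proof.
move=> p_prime [s_prime [u Uu ->]]; have [p0 pU pP] := p_prime.
elim: s b s_prime => [|q s IHs] b s_prime.
  rewrite big_nil mulr1 => e; case/negP: pU.
  by apply/unitrPr; exists (b * u^-1); rewrite mulrA -e mulrV.
rewrite big_cons => e.
have [q0 qU qP] : prime_elt q by apply: s_prime; rewrite mem_head.
have s_prime' r : r \in s -> prime_elt r.
  by move=> s_r; apply: s_prime; rewrite inE s_r orbT.
have : rdvd p (q * (u * \prod_(r <- s) r)).
  by exists b; rewrite mulrCA e mulrC.
case/pP=> [[r qE]|[b' b'E]].
  have : rdvd q (r * p) by rewrite -qE; apply: rdvd_refl.
  case/qP=> [[t tE]|[t tE]].
    case/negP: pU; apply/unitrPr; exists t.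
    by apply: (mulfI q0); rewrite mulr1 [in RHS]qE tE; ring.
  have rt : r * t = 1 by apply: (mulIf q0); rewrite mul1r -mulrA -tE.
  exists s => //=; split=> //; exists (u * r).
    by rewrite unitrM Uu; apply/unitrPr; exists t.
  by apply: (mulfI p0); rewrite -e qE; ring.
have [|s' [s'_prime [v Uv b'E2]] lt_s's] := IHs b' s_prime'.
  by rewrite b'E mulrC.
exists (q :: s') => //=; split; last first.
  exists v => //; rewrite big_cons mulrCA -b'E2.
  by apply: (mulfI p0); rewrite -e mulrCA b'E; ring.
by move=> r; rewrite inE => /predU1P[->|/s'_prime //]; apply: s_prime; rewrite mem_head.
Qed.

End Divisibility.

(** The factors are prime elements, not merely irreducible ones, so uniqueness of factorisation is
    built in. *)
Definition ufd (A : idomainType) := forall a : A, a != 0 -> exists s, factored a s.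

Section Gauss.
Variable A : idomainType.
Hypothesis ufdA : ufd A.
Implicit Types (p c : A) (f g h d q : {poly A}).

Lemma prime_elt_polyC p : prime_elt p -> prime_elt p%:P.
Proof.
move=> [p0 pU pP]; split=> [||f g]; first by rewrite polyC_eq0.
  by apply: contra pU; rewrite poly_unitE size_polyC p0 coefC.
elim: {f g}(size f + size g).+1 {-2}f {-2}g (ltnSn (size f + size g)) => // N IHN f g.
rewrite ltnS => leN dfg.
have [->|f0] := eqVneq f 0; first by left; apply: rdvd0.
have [->|g0] := eqVneq g 0; first by right; apply: rdvd0.
have dlc : rdvd p (lead_coef f * lead_coef g).
  by rewrite -lead_coefM; case: dfg => h ->; rewrite lead_coefM lead_coefC; exists (lead_coef h).
have aux (f1 : {poly A}) : f1 != 0 -> rdvd p (lead_coef f1) ->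
   exists2 f2 : {poly A}, (size f2 < size f1)%N & rdvd p%:P (f1 - f2).
  move=> f10 [c cE]; exists (f1 - lead_coef f1 *: 'X^((size f1).-1)).
    have lt0 : (0 < size f1)%N by rewrite lt0n size_poly_eq0.
    rewrite -{2}(prednK lt0) ltnS; apply/leq_sizeP => j le_j.
    rewrite coefB coefZ coefXn; move: le_j; rewrite leq_eqVlt => /predU1P[<-|lt_j].
      by rewrite eqxx mulr1 subrr.
    by rewrite gtn_eqF // mulr0 subr0 nth_default // -(prednK lt0).
  exists (c *: 'X^((size f1).-1)); rewrite opprB addrC subrK cE.
  by rewrite -!mul_polyC polyCM; ring.
case/pP: dlc => [/(aux _ f0)[f2 lt_f2 d2]|/(aux _ g0)[g2 lt_g2 d2]].
  have [||d3|] := IHN f2 g; last by right.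
  - by apply: leq_trans leN; rewrite ltn_add2r.
  - rewrite -[f2](subKr f) mulrBl; apply: rdvdB => //; exact: rdvd_mulr.
  by left; rewrite -[f](subrK f2); apply: rdvdD.
have [||d3|d3] := IHN f g2; last 1 first.
- by right; rewrite -[g](subrK g2); apply: rdvdD.
- by apply: leq_trans leN; rewrite ltn_add2l.
- rewrite -[g2](subKr g) mulrBr; apply: rdvdB => //; exact: rdvd_mull.
by left.
Qed.

Definition primitive f := forall p, prime_elt p -> ~ rdvd p%:P f.

Lemma content_exists f : f != 0 -> exists c g, [/\ c != 0, primitive g & f = c *: g].
Proof.
move=> f0; have lf0 : lead_coef f != 0 by rewrite lead_coef_eq0.
have [s] := ufdA lf0; elim: {s}(size s).+1 {-2}s (ltnSn (size s)) f f0 {lf0} => // N IHN s.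
rewrite ltnS => leN f f0 fs.
have [f_prim|] := classic (primitive f).
  by exists 1, f; rewrite oner_neq0 scale1r.
move=> nprim; have [p np] := not_all_ex_not _ _ nprim.
have [p_prime /NNPP[g fE]] := imply_to_and _ _ np.
have g0 : g != 0 by apply: contraNneq f0 => g0; rewrite fE g0 mul0r.
have [] := factored_div p_prime fs (b := lead_coef g).
  by rewrite fE lead_coefM lead_coefC mulrC.
move=> s' gs' lt_s'.
have [|c [h [c0 h_prim gE]]] := IHN s' _ g g0 gs'; first exact: leq_trans leN.
exists (p * c), h; split=> //; first by rewrite mulf_neq0 //; case: p_prime.
by rewrite fE gE -!mul_polyC polyCM; ring.
Qed.

Lemma primitive_unit c f : primitive f -> f != 0 -> rdvd c%:P f -> c \is a GRing.unit.
Proof.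
move=> f_prim f0 cf; have c0 : c != 0.
  by apply: contraNneq f0 => c0; case: cf => g ->; rewrite c0 mulr0.
apply/negPn/negP => cU; have [s cs] := ufdA c0.
have [p p_prime [b cE]] := factored_nonunit cs cU.
by apply: (f_prim p p_prime); apply: rdvd_trans cf; rewrite cE polyCM; exists b%:P.
Qed.

(** The primes of c are cancelled one at a time: each divides q or d, and those taken out of d are
    collected in [c2]. *)
Lemma clear_denominator c f q d : c != 0 -> c *: f = q * d ->
  exists c2 q1 d1, [/\ c2 != 0, d = c2 *: d1 & f = q1 * d1].
Proof.
move=> c0; have [s [s_prime [u Uu cE]]] := ufdA c0.
rewrite {c0}cE; elim: s s_prime q d => [|p s IHs] s_prime q d.
  rewrite big_nil mulr1 => e; exists 1, (u^-1 *: q), d.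
  by rewrite oner_neq0 scale1r -scalerAl -e scalerA mulVr ?scale1r.
rewrite big_cons mulrCA => e.
have p_prime : prime_elt p by apply: s_prime; rewrite mem_head.
have s_prime' r : r \in s -> prime_elt r.
  by move=> s_r; apply: s_prime; rewrite inE s_r orbT.
have [p0 _ _] := p_prime; have p0P : p%:P != 0 by rewrite polyC_eq0.
have [_ _ pP] := prime_elt_polyC p_prime.
have : rdvd p%:P (q * d).
  by rewrite -e -scalerA -mul_polyC mulrC; exists ((u * \prod_(r <- s) r) *: f).
case/pP=> [[g gE]|[g gE]].
  apply: (IHs s_prime' g d); apply: (mulfI p0P).
  by rewrite mul_polyC scalerA e gE; ring.
have [|c2 [q1 [d1 [c20 dE fE]]]] := IHs s_prime' q g.
  by apply: (mulfI p0P); rewrite mul_polyC scalerA e gE; ring.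
exists (p * c2), q1, d1; rewrite mulf_neq0 //; split=> //.
by rewrite gE dE -!mul_polyC polyCM; ring.
Qed.

(** Such a d generates the ideal (f, g) over the fraction field of A; minimality of the size finds
    it without forming that field. *)
Lemma min_size_comb f g : f != 0 -> exists d,
  [/\ d != 0, exists a b, d = a * f + b * g
    & forall e, (exists a b, e = a * f + b * g) -> e != 0 -> (size d <= size e)%N].
Proof.
move=> f0; have : exists2 d, d != 0 & exists a b, d = a * f + b * g.
  by exists f => //; exists 1, 0; rewrite mul1r mul0r addr0.
case=> d d0 d_in; elim: {d}(size d).+1 {-2}d (ltnSn (size d)) d0 d_in => // N IHN d.
rewrite ltnS => leN d0 d_in.
have [d_min|] := classic (forall e, (exists a b, e = a * f + b * g) -> e != 0 ->
  (size d <= size e)%N); first by exists d.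
move=> nmin; have [e ne] := not_all_ex_not _ _ nmin.
have [e_in ne'] := imply_to_and _ _ ne; have [e0 /negP] := imply_to_and _ _ ne'.
by rewrite -ltnNge => lt_e; apply: (IHN e) => //; apply: leq_trans leN.
Qed.

Lemma min_size_dvd f g d : d != 0 -> (exists a b, d = a * f + b * g) ->
    (forall e, (exists a b, e = a * f + b * g) -> e != 0 -> (size d <= size e)%N) ->
  forall e, (exists a b, e = a * f + b * g) -> exists c q, c != 0 /\ c *: e = q * d.
Proof.
move=> d0 [a0 [b0 dE]] d_min e [a [b eE]].
exists (lead_coef d ^+ Pdiv.IdomainDefs.scalp e d), (e %/ d); split.
  by rewrite expf_neq0 // lead_coef_eq0.
have := Pdiv.Idomain.divp_eq e d.
suff -> : e %% d = 0 by rewrite addr0.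
apply/eqP/negPn/negP => r0; have := d_min (e %% d).
rewrite leqNgt ltn_modp d0 => absurd; suff : ~~ true by [].
apply: absurd => //.
have -> : e %% d = lead_coef d ^+ Pdiv.IdomainDefs.scalp e d *: e - e %/ d * d.
  by rewrite Pdiv.Idomain.divp_eq addrC addKr.
rewrite -mul_polyC; set c := _%:P; set q := e %/ d.
exists (c * a - q * a0), (c * b - q * b0); rewrite dE eE; ring.
Qed.

(** Bezout's argument with denominators: the generator d of (f, g) divides f up to a constant. By
    irreducibility d is either associated to f, and then f divides g, or constant, and then
    multiplying the relation for d by h shows that f divides h. *)
Lemma irreducible_prime f : (1 < size f)%N -> primitive f ->
    (forall g h, f = g * h -> g \is a GRing.unit \/ h \is a GRing.unit) ->
  prime_elt f.
Proof.
move=> f_gt1 f_prim f_irr.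
have f0 : f != 0 by rewrite -size_poly_gt0 (leq_trans _ f_gt1).
have cancel c h t : c != 0 -> c *: h = t * f -> rdvd f h.
  move=> c0 /(clear_denominator c0)[c2 [q1 [d1 [c20 fE ->]]]].
  have /primitive_unit Uc2 : rdvd c2%:P f by rewrite fE -mul_polyC mulrC; exists d1.
  exists (c2^-1 *: q1); rewrite fE -scalerAr -scalerAl scalerA mulrV ?scale1r //.
  exact: Uc2.
split=> // [|g h [t ghE]].
  by rewrite poly_unitE; apply: contraL f_gt1 => /andP[/eqP ->].
have [d [d0 d_in d_min]] := min_size_comb g f0.
have d_dvd := min_size_dvd d0 d_in d_min.
have [|c [q [c0 cfE]]] := d_dvd f.
  by exists 1, 0; rewrite mul1r mul0r addr0.
have [c2 [q1 [d1 [c20 dE fE]]]] := clear_denominator c0 cfE.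
have [Uq1|Ud1] := f_irr _ _ fE.
  left; have [|c' [q' [c'0 cgE]]] := d_dvd g.
    by exists 0, 1; rewrite mul1r mul0r add0r.
  apply: (cancel c' _ (c2 *: q' * q1^-1)) => //.
  by rewrite cgE dE fE mulrA divrK // -scalerAr -scalerAl.
right; case: d_in => [a [b d_in]].
have : size d1 == 1%N by move: Ud1; rewrite poly_unitE => /andP[].
move/size_poly1P=> [e e0 d1E].
apply: (cancel (c2 * e) _ (a * h + b * t)); first by rewrite mulf_neq0.
have -> : (c2 * e) *: h = d * h by rewrite dE d1E -mul_polyC polyCM -mul_polyC.
by rewrite d_in mulrDl -[b * g * h]mulrA ghE; ring.
Qed.

Lemma factored_polyC c s : factored c s -> factored c%:P (map polyC s).
Proof.
move=> [s_prime [u Uu ->]]; split=> [p /mapP[q s_q ->]|].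
  exact/prime_elt_polyC/s_prime.
exists u%:P.
  rewrite poly_unitE size_polyC coefC /= Uu andbT.
  by have [u0|//] := eqVneq u 0; rewrite u0 unitr0 in Uu.
by rewrite polyCM rmorph_prod big_map.
Qed.

Lemma factoredM (B : idomainType) (a b : B) s t :
  factored a s -> factored b t -> factored (a * b) (s ++ t).
Proof.
move=> [s_prime [u Uu ->]] [t_prime [v Uv ->]]; split=> [p|].
  by rewrite mem_cat => /orP[/s_prime|/t_prime].
by exists (u * v); rewrite ?unitrM ?Uu // big_cat /=; ring.
Qed.

Lemma ufd_poly : ufd {poly A}.
Proof.
move=> f; elim: {f}(size f).+1 {-2}f (ltnSn (size f)) => // N IHN f.
rewrite ltnS => leN f0.
have [c [g [c0 g_prim fE]]] := content_exists f0.
have [s cs] := ufdA c0.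
suff [t gt] : exists t, factored g t.
  by exists (map polyC s ++ t); rewrite fE -mul_polyC; apply: factoredM => //; apply: factored_polyC.
have sz_fg : size f = size g by rewrite fE size_scale.
have g0 : g != 0 by apply: contraNneq f0 => g0; rewrite fE g0 scaler0.
have [le1|gt1] := leqP (size g) 1.
  have gE := size1_polyC le1.
  have Ug : g`_0 \is a GRing.unit.
    by apply: primitive_unit g_prim g0 _; rewrite -gE; apply: rdvd_refl.
  exists [::]; split=> //; exists g; last by rewrite big_nil mulr1.
  by rewrite poly_unitE Ug andbT eqn_leq le1 size_poly_gt0.
have [g_irr|] := classic (forall g1 g2, g = g1 * g2 ->
    g1 \is a GRing.unit \/ g2 \is a GRing.unit).
  exists [:: g]; split=> [p|]; first by rewrite inE => /eqP ->; apply: irreducible_prime.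
  by exists 1; rewrite ?unitr1 // big_seq1 mul1r.
move=> nirr; have [g1 n1] := not_all_ex_not _ _ nirr.
have [g2 n2] := not_all_ex_not _ _ n1; have [gE n3] := imply_to_and _ _ n2.
have [U1 U2] := not_or_and _ _ n3 => {nirr n1 n2 n3}.
(* A nonunit factor of a primitive polynomial is not constant, so both factors have smaller size. *)
have big_factor h1 h2 : g = h1 * h2 -> ~ h1 \is a GRing.unit -> (1 < size h1)%N.
  move=> hE Uh1; rewrite ltnNge; apply/negP => le1; apply: Uh1.
  have h1E := size1_polyC le1.
  have Uh : h1`_0 \is a GRing.unit.
    by apply: primitive_unit g_prim g0 _; rewrite -h1E hE; apply/rdvd_mulr/rdvd_refl.
  rewrite poly_unitE Uh andbT eqn_leq le1 size_poly_gt0.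
  by apply: contraNneq g0 => h10; rewrite hE h10 mul0r.
have gt1_1 := big_factor _ _ gE U1.
have gt1_2 : (1 < size g2)%N by apply: (big_factor g2 g1) => //; rewrite mulrC.
have n1 : g1 != 0 by rewrite -size_poly_gt0 (leq_trans _ gt1_1).
have n2 : g2 != 0 by rewrite -size_poly_gt0 (leq_trans _ gt1_2).
have szE : size g = (size g1 + size g2).-1 by rewrite gE size_mul.
have [|t1 gt_1] := IHN g1 _ n1.
  apply: leq_trans leN; rewrite sz_fg szE -ltnS prednK ?ltnS; last by rewrite addn_gt0 (leq_trans _ gt1_1).
  by rewrite -addn1 -addn1 -addnA leq_add2l.
have [|t2 gt_2] := IHN g2 _ n2.
  apply: leq_trans leN; rewrite sz_fg szE -ltnS prednK ?ltnS; last by rewrite addn_gt0 (leq_trans _ gt1_1).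
  by rewrite addnC -addn1 -addn1 -addnA leq_add2l.
by exists (t1 ++ t2); rewrite gE; apply: factoredM.
Qed.

End Gauss.

Lemma ufd_iso (A B : idomainType) (f : {rmorphism A -> B}) (g : {rmorphism B -> A}) :
  cancel f g -> cancel g f -> ufd B -> ufd A.
Proof.
move=> fK gK ufdB a a0.
have fa0 : f a != 0 by rewrite -(rmorph0 f) (can_eq fK).
have [s [s_prime [u Uu aE]]] := ufdB _ fa0.
exists (map g s); split=> [p /mapP[q /s_prime[q0 qU qP] ->]|].
  split; first by rewrite -(rmorph0 g) (can_eq gK).
    by apply: contra qU => Ug; rewrite -[q]gK rmorph_unit.
  move=> x y [z e]; have : rdvd q (f x * f y).
    by exists (f z); rewrite -rmorphM e rmorphM gK.
  by case/qP=> -[w wE]; [left|right]; exists (g w); rewrite -rmorphM -wE fK.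
exists (g u); first exact: rmorph_unit.
by rewrite -[a]fK aE rmorphM rmorph_prod big_map.
Qed.

Section MpolyUFD.
Variable k : fieldType.

Section Muni.
Variable n : nat.

(** The inverse of [muni]: it identifies polynomials in n + 1 variables with univariate ones over n
    variables, which reduces factoriality to Gauss's lemma. *)
Definition munify (q : {poly {mpoly k[n]}}) : {mpoly k[n.+1]} :=
  (map_poly (@mwiden n k) q).['X_ord_max].

Lemma munify_is_additive : additive munify.
Proof. by move=> p q; rewrite /munify rmorphB hornerD hornerN. Qed.
HB.instance Definition _ := GRing.isAdditive.Build _ _ munify munify_is_additive.

Lemma munify_is_multiplicative : multiplicative munify.
Proof.
split=> [p q|]; first by rewrite /munify rmorphM hornerM.
by rewrite /munify rmorph1 hornerC.
Qed.
HB.instance Definition _ := GRing.isMultiplicative.Build _ _ munify munify_is_multiplicative.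

Lemma muniX (m : 'X_{1..n.+1}) : muni ('X_[m] : {mpoly k[n.+1]}) =
  'X_[[multinom (m (widen_ord (leqnSn n) i)) | i < n]] *: 'X^(m ord_max).
Proof. by rewrite muniE msuppX big_seq1 mcoeffX eqxx scale1r. Qed.

Lemma muniK : cancel (@muni n k) munify.
Proof.
move=> p; rewrite muniE raddf_sum /= [RHS]mpolyE.
apply: eq_bigr => m _; rewrite /munify !map_polyZ map_polyXn /=.
rewrite hornerZ hornerXn /= mwidenZ -scalerAl; congr (_ *: _).
rewrite mwidenX mpolyXn -mpolyXD; congr 'X_[_].
apply/mnmP=> i; rewrite mnmDE mulmnE mnm1E.
case: (unliftP ord_max i) => [j ->|->].
  have -> : lift ord_max j = widen_ord (leqnSn n) j by apply: val_inj; rewrite /= /bump leqNgt ltn_ord.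
  by rewrite mnmwiden_widen mnmE -val_eqE /= gtn_eqF // mul0n addn0.
by rewrite mnmwiden_ordmax eqxx mul1n.
Qed.

Lemma muni_mwiden (a : {mpoly k[n]}) : muni (mwiden a) = a%:P.
Proof.
rewrite (mpolyE a) (raddf_sum (@mwiden n k)) (raddf_sum (@muni n k)).
rewrite (raddf_sum (@polyC _)) /=; apply: eq_bigr => m _.
rewrite mwidenZ muniZ mwidenX muniX mnmwiden_ordmax expr0 alg_polyC.
rewrite -mul_mpolyC polyCM -mul_polyC; congr (_ * _%:P); congr 'X_[_].
by apply/mnmP=> i; rewrite mnmE mnmwiden_widen.
Qed.

Lemma munifyK : cancel munify (@muni n k).
Proof.
move=> q; rewrite /munify horner_coef rmorph_sum /=.
rewrite size_map_inj_poly ?rmorph0 //; last exact: inj_mwiden.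
rewrite -[RHS]coefK poly_def; apply: eq_bigr => i _.
rewrite rmorphM rmorphXn /= coef_map /= muni_mwiden muniX mnm1E eqxx.
rewrite mul_polyC; congr (_ *: _).
rewrite (_ : [multinom _ | _ < n] = 0%MM) ?mpolyX0 ?scale1r ?expr1 //.
by apply/mnmP=> j; rewrite !mnmE -val_eqE /= gtn_eqF.
Qed.

End Muni.

Lemma mpoly_ufd n : ufd {mpoly k[n]}.
Proof.
elim: n => [|n IHn].
  move=> a a0; exists [::]; split=> //; exists a; last by rewrite big_nil mulr1.
  have aE := nvar0_mpolyC a.
  have c0 : a@_0%MM != 0 by apply: contraNneq a0 => c0; rewrite aE c0.
  rewrite aE; apply/unitrPr; exists ((a@_0%MM)^-1)%:MP.
  by rewrite -mpolyCM divff.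
exact: (ufd_iso (@muniK n) (@munifyK n)) (ufd_poly IHn).
Qed.

End MpolyUFD.

(** * Heights of primes *)

Section Heights.
Variables (k : fieldType) (n : nat).
Local Notation R := {mpoly k[n]}.
Implicit Types (P C : R -> Prop) (p f g : R).

Lemma prime_ideal_factor P f s : is_prime_ideal P -> factored f s -> P f ->
  exists2 p, prime_elt p & P p.
Proof.
move=> [[P0 PD PM] P1 Pprime] [s_prime [u Uu ->]].
case/Pprime => [Pu|]; first by case: P1; rewrite -(mulVr Uu); apply: PM.
elim: s s_prime => [|q s IHs] s_prime; first by rewrite big_nil.
rewrite big_cons => /Pprime[Pq|Ps]; first by exists q => //; apply: s_prime; rewrite mem_head.
by apply: IHs Ps => r s_r; apply: s_prime; rewrite inE s_r orbT.
Qed.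

Lemma rdvd_ideal p : is_ideal (rdvd p).
Proof.
by split=> [|f g|f g]; [exact: rdvd0 | exact: rdvdD | exact: rdvd_mull].
Qed.

Lemma rdvd_prime_ideal p : prime_elt p -> is_prime_ideal (rdvd p).
Proof.
move=> [p0 pU pP]; split=> // [|[c e]]; first exact: rdvd_ideal.
by case/negP: pU; apply/unitrPr; exists c; rewrite mulrC.
Qed.

(** Since p is not in [C 1], every element of the prime [C 1] is p times another element of [C 1]. A
    nonzero one, which exists above [C 0], would be divisible by p infinitely often. *)
Lemma rdvd_height p : prime_elt p -> ~ prime_height_ge (rdvd p) 2.
Proof.
move=> p_prime [C [C_prime C_lt CP]].
have [C01 [f [C1f nC0f]]] := C_lt 0%N isT.
have [C12 [g [C2g nC1g]]] := C_lt 1%N isT.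
have [[C10 C1D C1M] nC1 C1P] := C_prime 1%N isT.
have nC1p : ~ C 1%N p by move=> C1p; apply: nC1g; case/CP: C2g => c ->; apply: C1M.
have f0 : f != 0.
  by apply/eqP => f0; apply: nC0f; rewrite f0; have [[]] := C_prime 0%N isT.
have [s] := mpoly_ufd f0.
elim: {s}(size s).+1 {-2}s (ltnSn (size s)) f C1f f0 {nC0f} => // N IHN s.
rewrite ltnS => leN f C1f f0 fs.
have /CP[h fE] := C12 _ C1f.
have [s' hs' lt_s'] := factored_div p_prime fs (etrans fE (mulrC _ _)).
apply: (IHN s' _ h) => //; first exact: leq_trans leN.
  by move: C1f; rewrite fE => /C1P[].
by apply: contraNneq f0 => h0; rewrite fE h0 mul0r.
Qed.

(** The chain is 0 < (p) < P, where p is a prime factor of f lying in P. *)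
Lemma prime_height_ge2 (I : R -> Prop) P f : is_prime_ideal P ->
    (forall g, I g -> P g) -> I f -> f != 0 ->
    (forall p, prime_elt p -> exists2 g, I g & ~ rdvd p g) ->
  prime_height_ge P 2.
Proof.
move=> P_prime IP If f0 I_nondiv; have [s fs] := mpoly_ufd f0.
have [p p_prime Pp] := prime_ideal_factor P_prime fs (IP _ If).
have [g Ig npg] := I_nondiv p p_prime.
have [[P0 PD PM] P1 Pprime] := P_prime.
exists (fun i => match i with 0 => fun f => f = 0 | 1 => rdvd p | _ => P end).
split=> // [[|[|[|]]]|[|[|]]] //.
- move=> _; split=> [|/eqP|a b /eqP]; last by rewrite mulf_eq0 => /orP[]/eqP; [left|right].
    split=> // [a b -> ->|a b ->]; by rewrite ?addr0 ?mulr0.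
  by rewrite oner_eq0.
- by move=> _; apply: rdvd_prime_ideal.
- move=> _; split=> [a ->|]; first exact: rdvd0.
  by exists p; split; [exact: rdvd_refl | move/eqP; apply/negP; case: p_prime].
- move=> _; split=> [a [c ->]|]; first exact: PM.
  by exists g; split=> //; apply: IP.
Qed.

Definition indep_mod P (m : nat) (y : m.-tuple R) :=
  forall p : {mpoly k[m]}, P (p \mPo y) -> p = 0.

Lemma comp_mwiden m (y : m.-tuple R) f (a : {mpoly k[m]}) :
  mwiden a \mPo [tuple of rcons y f] = a \mPo y.
Proof.
rewrite (mpolyE a) (raddf_sum (@mwiden m k)) !raddf_sum /=; apply: eq_bigr => e _.
rewrite mwidenZ !comp_mpolyZ; congr (_ *: _).
rewrite mwidenX !comp_mpolyX big_ord_recr /= mnmwiden_ordmax expr0 mulr1.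
apply: eq_bigr => i _; rewrite mnmwiden_widen; congr (_ ^+ _).
by rewrite !(tnth_nth 0) /= nth_rcons size_tuple ltn_ord.
Qed.

Lemma comp_muni m (y : m.-tuple R) f (F : {mpoly k[m.+1]}) :
  F \mPo [tuple of rcons y f] = (map_poly (comp_mpoly y) (muni F)).[f].
Proof.
rewrite -{1}(muniK F) /munify horner_coef rmorph_sum /=.
rewrite size_map_inj_poly ?rmorph0 //; last exact: inj_mwiden.
rewrite (horner_coef_wide _ (size_poly _ _)); apply: eq_bigr => i _.
rewrite rmorphM rmorphXn /= !coef_map /= comp_mwiden; congr (_ * _ ^+ _).
rewrite comp_mpolyXU nth_rcons size_tuple ltnn eqxx //.
Qed.

(** Each step down a chain of primes gains one independent element. In a relation for f over the y
    modulo C, the constant coefficient lies in P, hence vanishes; the rest is divisible by f, which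
    can be cancelled as f is not in the prime C. *)
Lemma indep_mod_rcons C P m (y : m.-tuple R) f : is_prime_ideal C -> is_prime_ideal P ->
    (forall g, C g -> P g) -> P f -> ~ C f -> indep_mod P y ->
  indep_mod C [tuple of rcons y f].
Proof.
move=> [[C0 CD CM] C1 Cprime] [[P0 PD PM] P1 Pprime] CP Pf nCf y_indep F.
rewrite comp_muni -{2}(muniK F) => CF.
suff -> : muni F = 0 by rewrite /munify rmorph0 horner0.
elim/poly_ind: (muni F) CF => // q c IHq.
rewrite rmorphD rmorphM /= map_polyX map_polyC /= hornerD hornerM hornerX hornerC => Cq.
have c0 : c = 0.
  apply: y_indep; have := CP _ Cq; set a := _.[f]; set b := c \mPo y => Pab.
  by rewrite -[b](addKr (a * f)) addrC; apply: PD => //; rewrite -mulNr; apply: PM.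
rewrite c0 comp_mpoly0 addr0 in Cq; rewrite c0 addr0.
by case: (Cprime _ _ Cq) => // /IHq ->; rewrite mul0r.
Qed.

End Heights.

Lemma card_bmnm_le n b : (#|{: 'X_{1..n < b.+1}}| <= b.+1 ^ n)%N.
Proof.
have <- : #|{ffun 'I_n -> 'I_b.+1}| = (b.+1 ^ n)%N by rewrite card_ffun !card_ord.
pose f (m : 'X_{1..n < b.+1}) : {ffun 'I_n -> 'I_b.+1} := [ffun i => inord (m i)].
apply: (@leq_card _ _ f) => m1 m2 /ffunP e; apply/val_inj/mnmP => i /=.
have := e i; rewrite !ffunE => /(congr1 val) /=.
have lt (m : 'X_{1..n < b.+1}) : (m i < b.+1)%N.
  apply: leq_ltn_trans (bmdeg m); rewrite mdegE (bigD1 i) //=; exact: leq_addr.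
by rewrite !inordK.
Qed.

Lemma dependent_monomials (k : fieldType) (I : finType) n b (F : I -> {mpoly k[n]}) :
    (b.+1 ^ n < #|I|)%N -> (forall i, (msize (F i) <= b.+1)%N) ->
  exists2 c : {ffun I -> k}, c != 0 & \sum_i c i *: F i = 0.
Proof.
move=> ltI szF.
pose M := \matrix_(i < #|I|, j < #|{: 'X_{1..n < b.+1}}|)
  (F (enum_val i))@_(enum_val j : 'X_{1..n < b.+1}).
have : kermx M != 0.
  rewrite kermx_eq0 /row_free; apply: contraL ltI => /eqP <-.
  by rewrite -leqNgt; apply: leq_trans (rank_leq_col _) (card_bmnm_le _ _).
move/rowV0Pn=> [u /sub_kermxP uM u0].
exists [ffun i => u 0 (enum_rank i)].
  apply: contraNneq u0 => /ffunP e; apply/eqP/rowP => j; rewrite !mxE.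
  by have := e (enum_val j); rewrite !ffunE enum_valK.
apply/mpolyP => m; rewrite mcoeff0 raddf_sum /=.
have [lt_m|le_m] := ltnP (mdeg m) b.+1; last first.
  by rewrite big1 // => i _; rewrite mcoeffZ memN_msupp_eq0 ?mulr0 // msize_mdeg_ge // (leq_trans (szF i)).
have := congr1 (fun v : 'rV_ _ => v 0 (enum_rank (BMultinom lt_m))) uM.
rewrite !mxE => e; rewrite -[RHS]e (reindex (@enum_val I I)) /=; last first.
  exact: (onW_bij _ (@enum_val_bij I)).
by apply: eq_bigr => i _; rewrite mcoeffZ ffunE enum_valK !mxE enum_rankK.
Qed.

Lemma msize_prod_le (k : fieldType) n (I : Type) (r : seq I) (F : I -> {mpoly k[n]}) d :
  (forall i, (msize (F i) <= d.+1)%N) -> (msize (\prod_(i <- r) F i) <= (size r * d).+1)%N.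
Proof.
move=> szF; elim: r => [|i r IHr]; first by rewrite big_nil msize1.
rewrite big_cons mulSn; have [->|F0] := eqVneq (F i) 0; first by rewrite mul0r msize0.
have [->|r0] := eqVneq (\prod_(j <- r) F j) 0; first by rewrite mulr0 msize0.
rewrite msizeM //; have := leq_add (szF i) IHr.
by rewrite addSn addnS; case: (_ + _)%N.
Qed.

Lemma algebraic_dependence (k : fieldType) n (y : n.+1.-tuple {mpoly k[n]}) :
  exists2 p : {mpoly k[n.+1]}, p != 0 & p \mPo y = 0.
Proof.
pose D := \max_(i < n.+1) msize (tnth y i).
(* There are (t + 1)^(n+1) products of powers with exponents at most t. Their degrees are below (t +
   1) K, so they involve at most ((t + 1) K)^n = (t + 1)^n t monomials when t = K^n, which is
   fewer. *)
pose K := (n.+1 * D).+1; pose t := (K ^ n)%N.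
pose F (e : {ffun 'I_n.+1 -> 'I_t.+1}) : {mpoly k[n]} := \prod_i tnth y i ^+ e i.
have szy i : (msize (tnth y i) <= D.+1)%N.
  by apply: leqW; apply: (leq_bigmax i).
have szF e : (msize (F e) <= (n.+1 * (t * D)).+1)%N.
  have -> : F e = \prod_(i <- enum 'I_n.+1) tnth y i ^+ e i by rewrite big_enum.
  rewrite -[X in (X * _)%N](size_enum_ord n.+1); apply: msize_prod_le => i.
  have -> : tnth y i ^+ e i = \prod_(j <- iota 0 (e i)) tnth y i.
    by rewrite big_const_seq count_predT size_iota iter_mulr_1.
  apply: leq_trans (msize_prod_le _ (fun=> szy i)) _.
  by rewrite size_iota ltnS leq_mul2r -ltnS ltn_ord orbT.
have [|c c0 cF] := dependent_monomials _ szF.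
  rewrite card_ffun !card_ord.
  have le1 : ((n.+1 * (t * D)).+1 <= t.+1 * K)%N.
    rewrite [(t.+1 * K)%N]mulSn mulnCA; apply: (@leq_ltn_trans (t * K)%N); last by rewrite -addn1 addnC leq_add2r.
    by rewrite leq_mul2l leqnSn orbT.
  apply: (@leq_ltn_trans ((t.+1 * K) ^ n)%N).
    have leX a b e : (a <= b)%N -> (a ^ e <= b ^ e)%N.
      by move=> le_ab; elim: e => // e IHe; rewrite !expnS leq_mul.
    exact: leX.
  by rewrite expnMn expnSr ltn_pmul2l ?expn_gt0.
pose mon (e : {ffun 'I_n.+1 -> 'I_t.+1}) : 'X_{1..n.+1} := [multinom (e i : nat) | i < n.+1].
have mon_inj : injective mon.
  by move=> e1 e2 /mnmP e; apply/ffunP => i; apply: val_inj; have := e i; rewrite !mnmE.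
exists (\sum_e c e *: 'X_[mon e]).
  apply: contraNneq c0 => p0; apply/eqP/ffunP => e; rewrite ffunE.
  have := congr1 (mcoeff (mon e)) p0; rewrite mcoeff0 raddf_sum /= (bigD1 e) //= => <-.
  rewrite mcoeffZ mcoeffX eqxx mulr1 big1 ?addr0 // => e' ne.
  by rewrite mcoeffZ mcoeffX (inj_eq mon_inj) (negPf ne) mulr0.
rewrite raddf_sum /= -[RHS]cF; apply: eq_bigr => e _.
rewrite comp_mpolyZ comp_mpolyX; congr (_ *: _).
by apply: eq_bigr => i _; rewrite mnmE.
Qed.

Section TranscendenceBound.
Variables (k : fieldType) (m : nat).
Local Notation R := {mpoly k[m.+2]}.

(** A chain of length three would add three elements to the m independent ones, giving m + 3
    independent polynomials in m + 2 variables. *)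
Lemma indep_mod_height (P : R -> Prop) (y : m.-tuple R) :
  is_prime_ideal P -> indep_mod P y -> ~ prime_height_ge P 3.
Proof.
move=> P_prime y_indep [C [C_prime C_lt CP]].
have [C01 [f1 [Cf1 nCf1]]] := C_lt 0%N isT.
have [C12 [f2 [Cf2 nCf2]]] := C_lt 1%N isT.
have [C23 [f3 [/CP Pf3 nCf3]]] := C_lt 2%N isT.
have i3 := indep_mod_rcons (C_prime 2%N isT) P_prime (fun g h => (CP g).1 (C23 g h)) Pf3 nCf3 y_indep.
have i2 := indep_mod_rcons (C_prime 1%N isT) (C_prime 2%N isT) C12 Cf2 nCf2 i3.
have i1 := indep_mod_rcons (C_prime 0%N isT) (C_prime 1%N isT) C01 Cf1 nCf1 i2.
have [p p0 pE] := algebraic_dependence [tuple of rcons (rcons (rcons y f3) f2) f1].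
case/eqP: p0; apply: i1; rewrite pE.
by have [[]] := C_prime 0%N isT.
Qed.

End TranscendenceBound.

(** * Linear forms and specialisations into the fraction field *)

Section LinearForms.
Variables (k : fieldType) (n : nat).
Local Notation R := {mpoly k[n]}.

Definition lform (w : 'rV[k]_n) : R := \sum_j w 0 j *: 'X_j.

Lemma lform_is_linear : linear lform.
Proof.
move=> a u v; rewrite /lform scaler_sumr -big_split; apply: eq_bigr => j _ /=.
by rewrite !mxE scalerDl scalerA.
Qed.
HB.instance Definition _ := GRing.isLinear.Build k 'rV[k]_n R _ lform lform_is_linear.

Lemma lform_homog w : lform w \is 1.-homog.
Proof.
by apply: rpred_sum => j _; apply: rpredZ; rewrite dhomogX /= mdeg1.
Qed.

Lemma mcoeff_lform w j : (lform w)@_U_(j) = w 0 j.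
Proof.
rewrite raddf_sum /= (bigD1 j) //= mcoeffZ mcoeffXU eqxx mulr1 big1 ?addr0 // => i ne.
by rewrite mcoeffZ mcoeffXU (negPf ne) mulr0.
Qed.

Lemma lform_inj : injective lform.
Proof. by move=> u v e; apply/rowP => j; rewrite -!mcoeff_lform e. Qed.

Lemma lform_onto p : p \is 1.-homog -> exists w, p = lform w.
Proof.
move=> p1; exists (\row_j p@_U_(j)); apply/mpolyP => m.
have [m1|m1] := eqVneq (mdeg m) 1%N; last first.
  by rewrite (dhomog_nemf_coeff p1) // (dhomog_nemf_coeff (lform_homog _)).
have /mdeg1P[j /eqP ->] : mdeg m == 1%N by apply/eqP.
by rewrite mcoeff_lform mxE.
Qed.

Lemma mmap_lform (S : comRingType) (f : {rmorphism k -> S}) (h : 'I_n -> S) w :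
  mmap f h (lform w) = \sum_j f (w 0 j) * h j.
Proof.
by rewrite raddf_sum /=; apply: eq_bigr => j _; rewrite mmapZ mmapX mmap1U.
Qed.

Lemma mmap_comp_mpoly m (S : comRingType) (f : {rmorphism k -> S}) (h : 'I_n -> S)
    (p : {mpoly k[m]}) (y : m.-tuple R) :
  mmap f h (p \mPo y) = mmap f (fun i => mmap f h (tnth y i)) p.
Proof.
rewrite comp_mpolyE raddf_sum /=; apply: eq_bigr => e _.
rewrite mmapZ rmorph_prod /=; congr (_ * _).
by apply: eq_bigr => i _; rewrite rmorphXn.
Qed.

End LinearForms.

Lemma extend_row_free (k : fieldType) N n (A : 'M[k]_(N, n)) : row_free A ->
  exists2 W : 'M[k]_n, W \in unitmx & pid_mx N *m W = A.
Proof.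
move=> freeA; have rkA : \rank A = N by apply/eqP.
have leN : (N <= n)%N by rewrite -rkA rank_leq_col.
pose P : 'M[k]_(N, n) := pid_mx N; pose Q : 'M[k]_(n, N) := pid_mx N.
(* [Bl L] is the block matrix diag(L, 1); it carries [col_ebase A] across [pid_mx N]. *)
pose Bl (L : 'M[k]_N) : 'M[k]_n := Q *m L *m P + copid_mx N.
have PQ : P *m Q = 1%:M by rewrite /P /Q pid_mx_id // pid_mx_1.
have QP : Q *m P = pid_mx N by rewrite /P /Q pid_mx_id.
have Pc : P *m copid_mx N = 0 by rewrite /copid_mx mulmxBr mulmx1 /P pid_mx_id // subrr.
have cQ : copid_mx N *m Q = 0 by rewrite /copid_mx mulmxBl mul1mx /Q pid_mx_id // subrr.
have cc : copid_mx N *m copid_mx N = copid_mx N :> 'M[k]_n by apply: copid_mx_id.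
have BlM L1 L2 : Bl L1 *m Bl L2 = Bl (L1 *m L2).
  rewrite [LHS]mulmxDl [X in X + _]mulmxDr [X in _ + X]mulmxDr cc.
  rewrite -[Q *m L1 *m P *m copid_mx N]mulmxA Pc mulmx0 addr0.
  rewrite !mulmxA cQ !mul0mx add0r; congr (_ + _).
  by rewrite -[Q *m L1 *m P *m Q]mulmxA PQ mulmx1 -!mulmxA.
have Bl1 : Bl 1%:M = 1%:M by rewrite /Bl mulmx1 QP /copid_mx addrC subrK.
exists (Bl (col_ebase A) *m row_ebase A).
  rewrite unitmx_mul row_ebase_unit andbT.
  have [] := @mulmx1_unit _ _ (Bl (col_ebase A)) (Bl (invmx (col_ebase A))) _ => //.
  by rewrite BlM mulmxV ?col_ebase_unit // Bl1.
rewrite mulmxA /Bl mulmxDr !mulmxA PQ mul1mx Pc addr0.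
by rewrite -[RHS]mulmx_ebase rkA.
Qed.

Section RationalPoint.
Variables (k : fieldType) (m : nat).
Local Notation R := {mpoly k[m.+2]}.
Local Notation F := {fraction R}.
Variables (W : 'M[k]_(m.+2)) (T : 'I_m.+2 -> F).
Hypothesis unitW : W \in unitmx.

Definition fracC : k -> F := @tofrac R \o @mpolyC m.+2 k.
HB.instance Definition _ := GRing.RMorphism.copy fracC (@tofrac R \o @mpolyC m.+2 k).

(** Sends the form given by the i-th row of W to T i. The kernel is a prime, and its height is at
    most two as soon as all T i but the first two are the variables themselves. *)
Definition spec_forms : R -> F :=
  mmap fracC (fun j => \sum_l fracC (invmx W j l) * T l).
HB.instance Definition _ := GRing.RMorphism.copy spec_forms
  (mmap fracC (fun j => \sum_l fracC (invmx W j l) * T l)).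

Lemma spec_formsE i : spec_forms (lform (row i W)) = T i.
Proof.
rewrite /spec_forms mmap_lform.
transitivity (\sum_j \sum_l fracC (W i j * invmx W j l) * T l).
  apply: eq_bigr => j _; rewrite mulr_sumr; apply: eq_bigr => l _.
  by rewrite mxE rmorphM mulrA.
rewrite exchange_big /=.
transitivity (\sum_l fracC ((W *m invmx W) i l) * T l).
  by apply: eq_bigr => l _; rewrite -mulr_suml -rmorph_sum mxE.
rewrite mulmxV // (bigD1 i) //= mxE eqxx rmorph1 mul1r big1 ?addr0 // => l ne.
by rewrite mxE eq_sym (negPf ne) rmorph0 mul0r.
Qed.

Lemma spec_forms_prime : is_prime_ideal (fun f => spec_forms f = 0).
Proof.
split=> [||f g /eqP]; last by rewrite rmorphM mulf_eq0 => /orP[]/eqP; [left|right].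
  split=> [|f g|a f]; first exact: rmorph0.
    by move=> f0 g0; rewrite raddfD /= f0 g0 addr0.
  by move=> f0; rewrite rmorphM /= f0 mulr0.
by rewrite rmorph1; apply/eqP; rewrite oner_eq0.
Qed.

Hypothesis T_rat : forall l : 'I_m, T (rshift 2 l) = tofrac 'X_(rshift 2 l).

Lemma spec_forms_height : ~ prime_height_ge (fun f => spec_forms f = 0) 3.
Proof.
apply: (@indep_mod_height _ _ _ [tuple lform (row (rshift 2 l) W) | l < m]).
  exact: spec_forms_prime.
move=> p; rewrite /spec_forms mmap_comp_mpoly.
pose z := [tuple ('X_(rshift 2 l) : R) | l < m].
rewrite -[mmap _ _ _]/(mmap _ _ p) => e.
have {e} : tofrac (p \mPo z) = 0 :> F.
  rewrite -[RHS]e /comp_mpoly /mmap raddf_sum; apply: eq_bigr => a _.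
  rewrite /= rmorphM rmorph_prod /=; congr (_ * _); apply: eq_bigr => i _.
  rewrite tnth_mktuple rmorphXn; congr (_ ^+ _); rewrite tnth_mktuple.
  exact: esym (etrans (spec_formsE _) (T_rat _)).
move/eqP; rewrite tofrac_eq0 => /eqP pz.
(* Retracts onto the last m variables, so that p is recovered from its value at them. *)
pose back (j : 'I_m.+2) : {mpoly k[m]} :=
  match split (j : 'I_(2 + m)) with inl _ => 0 | inr l => 'X_l end.
have := mmap_comp_mpoly (@mpolyC m k) back p z; rewrite pz rmorph0 => e.
rewrite -[p]comp_mpoly_id [RHS]e /comp_mpoly /mmap; apply: eq_bigr => a _.
congr (_ * _); apply: eq_bigr => i _; rewrite !tnth_mktuple; congr (_ ^+ _).
by rewrite -[RHS]/(mmap _ _ 'X_(rshift 2 i)) mmapX mmap1U /back (unsplitK (inr i)).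
Qed.

End RationalPoint.

(** * Homogeneous components and linear substitutions *)

Section Homogeneous.
Variables (k : fieldType) (n : nat).
Local Notation R := {mpoly k[n]}.
Implicit Types (p q : R).

Local Notation hc d p := (pihomog (@mdeg n) d p).

Lemma pihomog_sum p N : (msize p <= N)%N -> p = \sum_(d < N) hc d p.
Proof. by move=> leN; rewrite {1}(pihomog_partitionE leN). Qed.

Lemma pihomog_eqP p q : (forall d, hc d p = hc d q) -> p = q.
Proof.
move=> e; pose N := maxn (msize p) (msize q).
rewrite (@pihomog_sum p N) ?leq_maxl // (@pihomog_sum q N) ?leq_maxr //.
by apply: eq_bigr => d _; apply: e.
Qed.

Lemma pihomogD d p q : hc d (p + q) = hc d p + hc d q.
Proof. exact: raddfD. Qed.

Lemma pihomog_out b d p : b != d -> p \is d.-homog -> hc b p = 0.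
Proof. by move=> ne; apply: pihomog_ne0; rewrite eq_sym. Qed.

Lemma pihomogM m d p q : q \is m.-homog -> hc (d + m) (p * q) = hc d p * q.
Proof.
move=> qm; have leN : (msize p <= (maxn (msize p) d.+1))%N by rewrite leq_maxl.
rewrite {1}(pihomog_sum leN) mulr_suml raddf_sum /=.
have lt_d : (d < maxn (msize p) d.+1)%N by rewrite leq_maxr.
rewrite (bigD1 (Ordinal lt_d)) //= pihomog_dE; last by apply: dhomogM => //; apply: pihomogP.
rewrite big1 ?addr0 // => i ne; apply: (@pihomog_out _ (i + m)%N).
  by rewrite eqn_add2r eq_sym.
by apply: dhomogM => //; apply: pihomogP.
Qed.

Lemma pihomogM_lt m d p q : q \is m.-homog -> (d < m)%N -> hc d (p * q) = 0.
Proof.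
move=> qm lt_dm; rewrite (pihomog_sum (leqnn (msize p))) mulr_suml raddf_sum /=.
rewrite big1 // => i _; apply: (@pihomog_out _ (i + m)%N).
  by rewrite ltn_eqF // (leq_trans lt_dm) ?leq_addl.
by apply: dhomogM => //; apply: pihomogP.
Qed.

Lemma dhomog_factor m d p q : q != 0 -> q \is m.-homog -> p * q \is (d + m).-homog ->
  p \is d.-homog.
Proof.
move=> q0 qm pq; suff -> : p = hc d p by apply: pihomogP.
apply: pihomog_eqP => i; have [->|ne] := eqVneq i d; first by rewrite pihomog_id.
rewrite (pihomog_out ne (pihomogP _ d p)).
apply: (mulIf q0); rewrite -(pihomogM _ _ qm) mul0r.
by apply: pihomog_out pq; rewrite eqn_add2r.
Qed.

Lemma dhomog_factor_lt m d p q : q != 0 -> q \is m.-homog -> p * q \is d.-homog ->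
  (d < m)%N -> p = 0.
Proof.
move=> q0 qm pq lt_dm; apply: pihomog_eqP => i; rewrite pihomog0.
apply: (mulIf q0); rewrite -(pihomogM _ _ qm) mul0r; apply: pihomog_out pq.
by rewrite gtn_eqF // (leq_trans lt_dm) ?leq_addl.
Qed.

Lemma homog0_const p : p \is 0.-homog -> p = (p@_0%MM)%:MP.
Proof.
move=> p0; apply/mpolyP => m; rewrite mcoeffC.
have [->|ne] := eqVneq 0%MM m; first by rewrite mulr1.
by rewrite mulr0 (dhomog_nemf_coeff p0) // mdeg_eq0 eq_sym.
Qed.

Lemma homog_coef0 d p : p \is d.+1.-homog -> p@_0%MM = 0.
Proof. by move=> pd; apply: (dhomog_nemf_coeff pd); rewrite /= mdeg0. Qed.

Lemma dhomog_msize_le d p : p \is d.-homog -> (msize p <= d.+1)%N.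
Proof.
move=> pd; have [->|p0] := eqVneq p 0; first by rewrite msize0.
by rewrite -(mlead_deg p0) ltnS (dhomog_mf pd) // mlead_supp.
Qed.

Lemma unit_mpolyP p : p \is a GRing.unit -> exists2 c, c != 0 & p = c%:MP.
Proof.
move=> Up; have p0 : p != 0 by apply: contraTneq Up => ->; rewrite unitr0.
have q0 : p^-1 != 0 by rewrite invr_eq0.
have := msizeM p0 q0; rewrite mulrV // msize1.
rewrite -(mlead_deg p0) -(mlead_deg q0) addSn addnS /= => -[/esym/eqP].
rewrite addn_eq0 => /andP[/eqP e _]; apply/msize_poly1P.
by rewrite -(mlead_deg p0) e.
Qed.

End Homogeneous.

Section FormIdeals.
Variables (k : fieldType) (n : nat).
Local Notation R := {mpoly k[n]}.

Definition in_forms r (A : 'M[k]_(r, n)) (f : R) :=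
  exists c : 'I_r -> R, f = \sum_i c i * lform (row i A).

Lemma in_forms_ideal r (A : 'M[k]_(r, n)) : is_ideal (in_forms A).
Proof.
split=> [|f g [c ->] [d ->]|a f [c ->]].
- by exists (fun=> 0); rewrite big1 // => i _; rewrite mul0r.
- by exists (fun i => c i + d i); rewrite -big_split; apply: eq_bigr => i _; rewrite mulrDl.
- by exists (fun i => a * c i); rewrite mulr_sumr; apply: eq_bigr => i _; rewrite mulrA.
Qed.

Lemma in_forms_row r (A : 'M[k]_(r, n)) i : in_forms A (lform (row i A)).
Proof.
exists (fun j => (i == j)%:R); rewrite (bigD1 i) //= eqxx mul1r big1 ?addr0 // => j ne.
by rewrite eq_sym (negPf ne) mul0r.
Qed.

Definition lsubst (E : 'M[k]_n) : R -> R := comp_mpoly [tuple lform (row j E) | j < n].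
HB.instance Definition _ E := GRing.RMorphism.copy (lsubst E)
  (comp_mpoly [tuple lform (row j E) | j < n]).
HB.instance Definition _ E := GRing.Linear.copy (lsubst E)
  (comp_mpoly [tuple lform (row j E) | j < n]).

Lemma lsubst_lform E w : lsubst E (lform w) = lform (w *m E).
Proof.
rewrite /lsubst /lform raddf_sum /=.
under eq_bigr => j _ do rewrite comp_mpolyZ comp_mpolyXU -tnth_nth tnth_mktuple /lform scaler_sumr.
rewrite exchange_big /=; apply: eq_bigr => l _.
rewrite mxE scaler_suml; apply: eq_bigr => j _; by rewrite mxE scalerA.
Qed.

Lemma lsubstC E c : lsubst E c%:MP = c%:MP.
Proof. exact: comp_mpolyC. Qed.

Lemma lsubst_sub_in (I : R -> Prop) E : is_ideal I ->
  (forall w, I (lform w - lform (w *m E))) -> forall f, I (f - lsubst E f).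
Proof.
move=> [I0 ID IM] IE; elim/mpolyind => [|c m p m_p c0 IHp].
  by rewrite raddf0 subr0.
rewrite linearD /= opprD addrACA; apply: (ID) => //.
rewrite linearZ /= -scalerBr -mul_mpolyC; apply: (IM).
rewrite mpolyXE_id rmorph_prod; elim/big_rec2: _ => [|i x y _ IHx].
  by rewrite subrr.
rewrite rmorphXn /=.
have IX : I ('X_i - lsubst E 'X_i).
  have -> : ('X_i : R) = lform (delta_mx 0 i).
    rewrite /lform (bigD1 i) //= mxE !eqxx scale1r big1 ?addr0 // => j ne.
    by rewrite mxE (negPf ne) andbF scale0r.
  by rewrite lsubst_lform; apply: IE.
have -> : 'X_i ^+ m i * x - lsubst E 'X_i ^+ m i * y
   = 'X_i ^+ m i * (x - y) + y * ('X_i ^+ m i - lsubst E 'X_i ^+ m i) by ring.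
have I1 := IM ('X_i ^+ m i) _ IHx.
have I2 : I ('X_i ^+ m i - lsubst E 'X_i ^+ m i).
  by rewrite subrXX mulrC; apply: (IM).
exact: (ID _ _ I1 (IM y _ I2)).
Qed.

(** When A D = 1 this is a projection whose kernel is the row space of A. The substitution by it
    models the quotient by the forms in A inside R itself, so no quotient ring is formed. *)
Definition kill_mx r (A : 'M[k]_(r, n)) (D : 'M[k]_(n, r)) : 'M[k]_n := 1%:M - D *m A.

Section Kill.
Variables (r : nat) (A : 'M[k]_(r, n)) (D : 'M[k]_(n, r)).
Hypothesis AD : A *m D = 1%:M.
Local Notation pr := (lsubst (kill_mx A D)).

Lemma kill_row i : pr (lform (row i A)) = 0.
Proof.
rewrite lsubst_lform /kill_mx mulmxBr mulmx1 mulmxA -row_mul AD.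
by rewrite -row_mul mul1mx subrr raddf0.
Qed.

Lemma kill_sub f : in_forms A (f - pr f).
Proof.
have [i0 iD iM] := in_forms_ideal A.
apply: (lsubst_sub_in (in_forms_ideal A)) => w.
rewrite -raddfB /= /kill_mx mulmxBr mulmx1 opprB addrC subrK mulmxA.
exists (fun i => ((w *m D) 0 i)%:MP).
have -> : w *m D *m A = \sum_i (w *m D) 0 i *: row i A by rewrite mulmx_sum_row.
by rewrite linear_sum; apply: eq_bigr => i _; rewrite linearZ_LR mul_mpolyC.
Qed.

Lemma kill_eq0 f : pr f = 0 <-> in_forms A f.
Proof.
split=> [pf0|[c ->]]; first by rewrite -[f]subr0 -pf0; apply: kill_sub.
by rewrite rmorph_sum big1 // => i _; rewrite rmorphM /= kill_row mulr0.
Qed.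

End Kill.

Lemma row_free_inv r (A : 'M[k]_(r, n)) : row_free A -> exists D, A *m D = 1%:M.
Proof. by move/row_freeP. Qed.

Lemma in_forms_prime r (A : 'M[k]_(r, n)) : row_free A -> is_prime_ideal (in_forms A).
Proof.
move=> /row_freeP[D AD]; split; first exact: in_forms_ideal.
  by move/(kill_eq0 AD); rewrite rmorph1; apply/eqP; rewrite oner_eq0.
move=> f g /(kill_eq0 AD); rewrite rmorphM => /eqP; rewrite mulf_eq0.
by case/orP=> /eqP/(kill_eq0 AD); [left|right].
Qed.

Lemma in_forms_lform r (A : 'M[k]_(r, n)) w : row_free A ->
  in_forms A (lform w) -> (w <= A)%MS.
Proof.
move=> /row_freeP[D AD] /(kill_eq0 AD); rewrite lsubst_lform => e.
have : w *m kill_mx A D = 0 by apply: (@lform_inj k n); rewrite e raddf0.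
rewrite /kill_mx mulmxBr mulmx1 mulmxA => /eqP; rewrite subr_eq0 => /eqP ->.
exact: submxMl.
Qed.

End FormIdeals.

(** * Dimensions of graded pieces and Hilbert polynomials *)

Section GradedDimensions.
Variables (k : fieldType).

Lemma basis_mod_homog n d :
  basis_mod (fun p : {mpoly k[n.+1]} => p \is d.-homog) (@zero_sub k _) 'C(d + n, n).
Proof.
rewrite -bin_sub ?leq_addl // addnK.
have dimE : \dim {: dhomog n.+1 k d} = 'C(d + n, d) by rewrite dimvf.
rewrite -dimE.
pose b := vbasis {: dhomog n.+1 k d}.
have bF : basis_of fullv b by apply: vbasisP.
exists (fun i => mpoly_of_dhomog b`_i); split=> [i|p pd]; first exact: dhomog_is_dhomog.
pose q : dhomog n.+1 k d := DHomog pd.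
have sumE (c : 'rV[k]_(\dim {: dhomog n.+1 k d})) :
    \sum_i c 0 i *: mpoly_of_dhomog b`_i = mpoly_of_dhomog (\sum_i c 0 i *: b`_i).
  by rewrite raddf_sum /=; apply: eq_bigr => i _; apply/esym; exact: linearZ_LR.
exists (\row_i coord b i q); split=> [|c].
  rewrite /zero_sub sumE; apply/eqP; rewrite subr_eq0; apply/eqP.
  have -> : p = mpoly_of_dhomog q by [].
  congr mpoly_of_dhomog; rewrite [LHS](coord_basis bF) ?memvf //.
  by apply: eq_bigr => i _; rewrite mxE.
rewrite /zero_sub sumE => /eqP; rewrite subr_eq0 => /eqP e.
have {}e : q = \sum_i c 0 i *: b`_i by apply: val_inj.
apply/rowP => i; rewrite mxE e coord_sum_free //; exact: basis_free bF.
Qed.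

Lemma subspace_homog n d : subspace (fun p : {mpoly k[n]} => p \is d.-homog).
Proof. by split=> [|a u v ud vd]; [exact: rpred0 | apply: rpredD => //; apply: rpredZ]. Qed.

Lemma basis_mod_refl (V : lmodType k) (A : V -> Prop) : subspace A -> basis_mod A A 0.
Proof.
move=> sA; exists (fun=> 0); split=> [[]|p Ap] //.
exists 0; split=> [|c _]; last by apply/rowP => -[].
by rewrite big_ord0 subr0.
Qed.

Lemma basis_mod_ffun (V : lmodType k) m (B : 'I_m -> V -> Prop) (h : 'I_m -> nat) :
    (forall i, subspace (B i)) -> (forall i, basis_mod (B i) (@zero_sub k _) (h i)) ->
  basis_mod (fun w : {ffun 'I_m -> V} => forall i, B i (w i)) (@zero_sub k _)
    (\sum_i h i).
Proof.
move=> sB hB.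
(* Filtration by the number of coordinates allowed to be nonzero; each step contributes one
   summand. *)
pose P j (w : {ffun 'I_m -> V}) :=
  (forall i, B i (w i)) /\ (forall i : 'I_m, (j <= i)%N -> w i = 0).
have sP j : subspace (P j).
  split=> [|a u v [Bu u0] [Bv v0]].
    by split=> i *; rewrite ffunE //; case: (sB i).
  split=> i *; rewrite !ffunE; first by apply: (sB i).2.
  by rewrite u0 // v0 // scaler0 addr0.
have PS j : forall v, P j v -> P j.+1 v.
  by move=> v [Bv v0]; split=> // i /ltnW; apply: v0.
suff key j : (j <= m)%N ->
    basis_mod (P j) (@zero_sub k _) (\sum_(i < m | (i < j)%N) h i).
  have <- : \sum_(i < m | (i < m)%N) h i = \sum_i h i.
    by apply: eq_bigl => i; rewrite ltn_ord.
  have := key m (leqnn m).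
  apply: basis_mod_iff => // w; split=> [[]|] // Bw; split=> // i.
  by rewrite leqNgt ltn_ord.
elim: j => [_|j IHj lt_jm].
  rewrite big_pred0 //; apply: (basis_mod_iff _ _ (basis_mod_refl (sP 0%N))) => v //.
  split=> [[_ v0]|->]; last exact: (sP 0%N).1.
  by apply/ffunP => i; rewrite v0 // ffunE.
rewrite (bigD1 (Ordinal lt_jm)) //= addnC.
have -> : \sum_(i < m | (i < j.+1)%N && (i != Ordinal lt_jm)) h i = \sum_(i < m | (i < j)%N) h i.
  by apply: eq_bigl => i; rewrite ltnS leq_eqVlt -val_eqE /=; case: ltngtP.
apply: (@basis_mod_add _ _ _ (P j)) => //.
- exact: subspace_zero.
- by move=> v ->; apply: (sP j).1.
- exact: PS.
- by apply: IHj; apply: ltnW.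
apply/(@basis_mod_image _ _ _ _ _ (@zero_sub k _) (B (Ordinal lt_jm))
   (fun w : {ffun 'I_m -> V} => w (Ordinal lt_jm))) => //.
- by move=> a u v _ _; rewrite !ffunE.
- by move=> v [].
- move=> w Bw; exists [ffun i => if i == Ordinal lt_jm then w else 0]; last by rewrite ffunE eqxx.
  split=> i; rewrite ffunE; first by case: eqP => [->|_] //; case: (sB i).
  by rewrite -val_eqE /= => /gtn_eqF ->.
- move=> v [Bv v0]; split=> [e|[_]]; last by apply; rewrite /= leqnn.
  split=> // i; rewrite leq_eqVlt => /predU1P[ji|]; last exact: v0.
  by rewrite -[RHS]e; congr (v _); apply: val_inj.
Qed.

End GradedDimensions.

Section GradedMaps.
Variables (k : fieldType) (n : nat).
Local Notation R := {mpoly k[n.+1]}.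

(** Columns form a module over R, whereas finite functions into R form a k-space, on which
    dimensions are counted; [colf] passes from the latter to the former. *)
Definition colf m (w : {ffun 'I_m -> R}) : 'cV[R]_m := \col_i w i.

(** The subtraction is truncated. The lemmas on graded maps assume that d is at least every shift of
    the source, which is enough for Hilbert polynomials. *)
Definition graded m (t : 'I_m -> nat) d (w : {ffun 'I_m -> R}) :=
  forall i, w i \is (d - t i).-homog.

Lemma colf_linear m a (u v : {ffun 'I_m -> R}) :
  colf (a *: u + v) = a%:MP *: colf u + colf v.
Proof. by apply/colP => i; rewrite !mxE !ffunE mul_mpolyC. Qed.

Lemma colf_inj m : injective (@colf m).
Proof. by move=> u v /colP e; apply/ffunP => i; have := e i; rewrite !mxE. Qed.

Lemma subspace_graded m (t : 'I_m -> nat) d : subspace (graded t d).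
Proof.
split=> [i|a u v gu gv i]; rewrite !ffunE; first exact: rpred0.
by apply: rpredD => //; apply: rpredZ.
Qed.

Lemma basis_mod_graded m (t : 'I_m -> nat) d :
  basis_mod (graded t d) (@zero_sub k _) (\sum_i 'C(d - t i + n, n)).
Proof.
apply: (@basis_mod_ffun _ _ _ (fun i p => p \is (d - t i).-homog)) => i.
  exact: subspace_homog.
exact: basis_mod_homog.
Qed.

Lemma graded_lift p q (A : 'M[R]_(p, q)) (s : 'I_p -> nat) (t : 'I_q -> nat) d
    (v : {ffun 'I_p -> R}) (w : 'cV[R]_q) :
    (forall i j, A i j = 0 \/ (s i <= t j)%N /\ A i j \is (t j - s i).-homog) ->
    (forall j, (t j <= d)%N) -> graded s d v -> colf v = A *m w ->
  exists2 w' : {ffun 'I_q -> R}, graded t d w' & colf v = A *m colf w'.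
Proof.
move=> Ah le_td gv vE.
exists [ffun j => pihomog (@mdeg n.+1) (d - t j) (w j 0)].
  by move=> j; rewrite ffunE; apply: pihomogP.
apply/colP => i; rewrite mxE -(pihomog_dE (gv i)).
have := congr1 (fun u : 'cV_p => u i 0) vE; rewrite !mxE => ->.
rewrite raddf_sum; apply: eq_bigr => j _ /=; rewrite !mxE ffunE.
case: (Ah i j) => [->|[le_st Aij]]; first by rewrite !mul0r pihomog0.
rewrite ![A i j * _]mulrC -(pihomogM _ _ Aij); congr pihomog.
by rewrite addnBA // subnK.
Qed.

(** The step by which dimensions climb a resolution: rank and nullity in degree d, together with the
    fact that homogeneous elements of the image have homogeneous preimages. *)
Lemma basis_mod_im p q (A : 'M[R]_(p, q)) (s : 'I_p -> nat) (t : 'I_q -> nat) d a :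
    (forall i j, A i j = 0 \/ (s i <= t j)%N /\ A i j \is (t j - s i).-homog) ->
    (forall j, (t j <= d)%N) ->
    basis_mod (fun w => graded t d w /\ A *m colf w = 0) (@zero_sub k _) a ->
  basis_mod (fun v => graded s d v /\ exists w, colf v = A *m w) (@zero_sub k _)
    ((\sum_j 'C(d - t j + n, n)) - a)
  /\ (a <= \sum_j 'C(d - t j + n, n))%N.
Proof.
move=> Ah le_td hK.
have sg := subspace_graded t d.
have sK : subspace (fun w => graded t d w /\ A *m colf w = 0).
  split=> [|c u v [gu Au] [gv Av]]; split; try by case: sg => // _; apply.
  - suff -> : colf (0 : {ffun 'I_q -> R}) = 0 by rewrite mulmx0.
    by apply/colP => i; rewrite !mxE ffunE.
  - by rewrite colf_linear mulmxDr -scalemxAr Au Av scaler0 addr0.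
have [||le_a hQ] := basis_mod_sub (@subspace_zero k _) sK sg _ _ (basis_mod_graded t d) hK.
- by move=> v ->; apply: sK.1.
- by move=> v [].
split=> //.
pose phi (w : {ffun 'I_q -> R}) : {ffun 'I_p -> R} := [ffun i => (A *m colf w) i 0].
have colphi w : colf (phi w) = A *m colf w.
  by apply/colP => i; rewrite mxE ffunE.
have key := @basis_mod_image k _ _ (fun w => graded t d w /\ A *m colf w = 0)
  (graded t d) (@zero_sub k _)
  (fun v => graded s d v /\ exists w, colf v = A *m w) phi.
apply: (proj1 (key _ sg _ _ _ _) hQ).
- move=> c u v _ _; apply: colf_inj; rewrite colphi !colf_linear !colphi.
  by rewrite mulmxDr scalemxAr.
- move=> w gw; split; last by exists (colf w).
  move=> i; rewrite ffunE mxE; apply: rpred_sum => j _; rewrite mxE.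
  case: (Ah i j) => [->|[le_st Aij]]; first by rewrite mul0r rpred0.
  have -> : (d - s i = (t j - s i) + (d - t j))%N by rewrite addnC addnBA // subnK.
  exact: dhomogM.
- move=> v [gv [w vE]]; have [w' gw' vE'] := graded_lift Ah le_td gv vE.
  by exists w' => //; apply: colf_inj; rewrite colphi.
- move=> w gw; rewrite /zero_sub; split=> [e|[_ e]].
    by split=> //; rewrite -colphi e; apply/colP => i; rewrite !mxE ffunE.
  by apply: colf_inj; rewrite colphi e; apply/colP => i; rewrite !mxE ffunE.
Qed.

End GradedMaps.

Section HilbertPolynomials.
Variable m : nat.

(** The polynomial of degree m that takes the value C(d - a + m, m) at every d >= a. *)
Definition binpoly (a : nat) : {poly rat} :=
  (m`!%:R)^-1 *: \prod_(i < m) ('X - (a%:R - i.+1%:R)%:P).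

Lemma binpolyE a d : (a <= d)%N -> (binpoly a).[d%:R] = 'C(d - a + m, m)%:R.
Proof.
move=> le_ad; rewrite hornerZ horner_prod.
have f0 : (m`!%:R : rat) != 0 by rewrite Num.Theory.pnatr_eq0 -lt0n fact_gt0.
apply: (mulfI f0); rewrite mulVKf // -natrM mulnC bin_ffact ffact_prod natr_prod.
rewrite (reindex_inj rev_ord_inj) /=; apply: eq_bigr => i _.
rewrite hornerXsubC opprB addrA -natrD -natrB; last by rewrite (leq_trans le_ad) ?leq_addr.
congr (_%:R); have lt_i := ltn_ord i.
by rewrite subnSK // -addnBAC // addnBA // ltnW.
Qed.

(** The three polynomials have the same degree m and the same leading coefficient 1 / m!. The
    weights have positive sum b, so the leading terms do not cancel and the degree is b. *)
Lemma has_degree_binpoly (k : fieldType) n (I : {mpoly k[n]} -> Prop) (b : nat)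
    (w : 'I_3 -> int) (d0 : nat) (h : nat -> nat) :
    (0 < b)%N -> (b%:Z = \sum_j w j) -> (2 <= d0)%N ->
    (forall d, (d0 <= d)%N -> hilbert_function I d (h d) /\
        (h d)%:Z = \sum_(j < 3) w j * 'C(d - j + m, m)%:Z) ->
  has_degree I b.
Proof.
move=> b0 bE le_d0 hI.
exists (\sum_(j < 3) (w j)%:~R *: binpoly j); split.
  exists d0 => d le_d; have [hId hE] := hI d le_d; exists (h d); split=> //.
  rewrite horner_sum -[LHS]/((h d)%:Z%:~R) hE rmorph_sum /=; apply: eq_bigr => j _.
  rewrite hornerZ rmorphM /=; congr (_ * _).
  by rewrite binpolyE //; apply: leq_trans le_d; apply: leq_trans le_d0; rewrite -ltnS.
have f0 : (m`!%:R : rat) != 0 by rewrite Num.Theory.pnatr_eq0 -lt0n fact_gt0.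
have binE a : binpoly a = (m`!%:R)^-1 *:
    \prod_(x <- [seq a%:R - i.+1%:R | i : 'I_m <- enum 'I_m]) ('X - x%:P).
  by rewrite big_map big_enum.
have bin_sz a : size (binpoly a) = m.+1.
  by rewrite binE size_scale ?invr_eq0 // size_prod_XsubC size_map size_enum_ord.
have bin_lead a : (binpoly a)`_m = (m`!%:R)^-1.
  have := monic_prod_XsubC [seq a%:R - i.+1%:R : rat | i : 'I_m <- enum 'I_m] xpredT id.
  by rewrite binE coefZ monicE lead_coefE size_prod_XsubC size_map size_enum_ord => /eqP ->; rewrite mulr1.
set H := \sum_j _.
have Hm : H`_m = b%:R / m`!%:R.
  rewrite coef_sum -[b%:R]/((b%:Z)%:~R) bE rmorph_sum mulr_suml; apply: eq_bigr => j _.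
  by rewrite coefZ bin_lead.
have H_sz : size H = m.+1.
  apply/eqP; rewrite eqn_leq; apply/andP; split.
    apply: leq_trans (size_sum _ _ _) _; apply/bigmax_leqP => j _.
    by apply: leq_trans (size_scale_leq _ _) _; rewrite bin_sz.
  rewrite ltnNge; apply/negP => /leq_sizeP/(_ m (leqnn m))/eqP.
  by rewrite Hm mulf_eq0 invr_eq0 (negPf f0) orbF Num.Theory.pnatr_eq0 gtn_eqF.
by rewrite lead_coefE H_sz /= Hm mulrCA divff ?mulr1.
Qed.

End HilbertPolynomials.

(** * Bourbaki ideals *)

(** Induction on the prime factors of b: each of them fails to divide some f i, hence divides a. *)
Lemma rdvd_family (A : idomainType) (I : Type) (b a : A) (f : I -> A) :
    ufd A -> b != 0 -> (forall p, prime_elt p -> exists i, ~ rdvd p (f i)) ->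
  (forall i, rdvd b (a * f i)) -> rdvd b a.
Proof.
move=> ufdA b0 f_prim; have [s [s_prime [u Uu bE]]] := ufdA b b0.
elim: s b a s_prime {b0} bE => [|p s IHs] b a s_prime ->.
  by rewrite big_nil mulr1 => _; exists (a / u); rewrite divrK.
rewrite big_cons mulrCA => ab.
have p_prime : prime_elt p by apply: s_prime; rewrite mem_head.
have [p0 _ pP] := p_prime; have [i npf] := f_prim p p_prime.
have : rdvd p (a * f i).
  by apply: rdvd_trans (ab i); rewrite mulrC; exists (u * \prod_(j <- s) j).
case/pP=> // -[c aE]; rewrite aE mulrC.
have [||j|d ->] := IHs (u * \prod_(j <- s) j) c.
- by move=> q s_q; apply: s_prime; rewrite inE s_q orbT.
- by [].
- have [d dE] := ab j; exists d; apply: (mulfI p0).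
  transitivity (c * p * f j); first by ring.
  by rewrite -aE dE; ring.
by exists d; ring.
Qed.

Lemma prime_multiplicity (A : idomainType) (p a : A) : prime_elt p ->
  (exists s, factored a s) -> exists l u, a = p ^+ l * u /\ ~ rdvd p u.
Proof.
move=> p_prime [s]; elim: {s}(size s).+1 {-2}s (ltnSn (size s)) a => // N IHN s.
rewrite ltnS => leN a fs.
have [[b aE]|npa] := classic (rdvd p a); last by exists 0%N, a; rewrite expr0 mul1r.
have [s' fs' lt_s'] := factored_div p_prime fs (etrans aE (mulrC _ _)).
have [|l [u [bE npu]]] := IHN s' _ b fs'; first exact: leq_trans leN.
by exists l.+1, u; split=> //; rewrite aE bE exprS; ring.
Qed.

Lemma cancel_proportion (A : idomainType) (a b c p q : A) :
  b != 0 -> b * p = a * q -> a = c * b -> p = c * q.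
Proof. by move=> b0 e1 e2; apply: (mulfI b0); rewrite e1 e2; ring. Qed.

Definition wedge (A : pzRingType) (u v : 'cV[A]_4) (i j : 'I_4) :=
  u i 0 * v j 0 - u j 0 * v i 0.

Section Syzygies.
Variables (k : fieldType) (n : nat).
Local Notation R := {mpoly k[n]}.
Implicit Type (Theta : 'M[R]_(2, 4)).

Lemma SyzD Theta u v : Syz Theta u -> Syz Theta v -> Syz Theta (u + v).
Proof. by rewrite /Syz mulmxDr => -> ->; rewrite addr0. Qed.

Lemma SyzZ Theta a v : Syz Theta v -> Syz Theta (a *: v).
Proof. by rewrite /Syz -scalemxAr => ->; rewrite scaler0. Qed.

Lemma SyzB Theta u v : Syz Theta u -> Syz Theta v -> Syz Theta (u - v).
Proof. by rewrite /Syz mulmxBr => -> ->; rewrite subr0. Qed.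

Lemma Syz_scale Theta a v : a != 0 -> Syz Theta (a *: v) -> Syz Theta v.
Proof.
move=> a0; rewrite /Syz -scalemxAr => /colP e; apply/colP => i.
have := e i; rewrite !mxE => /eqP; rewrite mulf_eq0 (negPf a0) /= => /eqP -> //.
Qed.

Definition pihomog_cv d (v : 'cV[R]_4) : 'cV[R]_4 := \col_i pihomog (@mdeg n) d (v i 0).

Lemma Syz_pihomog Theta d v : (forall i j, Theta i j \is 1.-homog) ->
  Syz Theta v -> Syz_deg Theta d (pihomog_cv d v).
Proof.
move=> Th Sv; split=> [|i]; last by rewrite mxE; apply: pihomogP.
apply/colP => i; have /colP/(_ i) := Sv; rewrite !mxE => e.
have := congr1 (pihomog (@mdeg n) (d + 1)%N) e; rewrite raddf0 raddf_sum /= => e'.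
rewrite -[RHS]e'; apply: eq_bigr => j _.
by rewrite mxE mulrC [in RHS]mulrC pihomogM.
Qed.

Lemma cv_neq0 (v : 'cV[R]_4) : v != 0 -> exists i, v i 0 != 0.
Proof.
move=> v0; apply: NNPP => no; case/negP: v0; apply/eqP/colP => i; rewrite mxE.
by apply/eqP/negPn/negP => vi; apply: no; exists i.
Qed.

End Syzygies.

Section Bourbaki.
Variables (k : fieldType) (n : nat).
Local Notation R := {mpoly k[n.+1]}.
Variables (Theta : 'M[R]_(2, 4)) (e m : nat) (delta : 'I_4 -> 'I_4 -> R).
Hypothesis Theta_lin : forall i j, Theta i j \is 1.-homog.
Hypothesis Syz_low : forall d v, (d < e)%N -> Syz_deg Theta d v -> v = 0.
Hypothesis delta_homog : forall i j, delta i j \is m.-homog.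
Hypothesis delta_prim : forall p, prime_elt p -> exists i j, ~ rdvd p (delta i j).
Hypothesis deltaP : forall u v, Syz Theta u -> Syz Theta v ->
  exists psi, forall i j, wedge u v i j = psi * delta i j.
Hypothesis Syz_rank : exists u v i j, [/\ Syz Theta u, Syz Theta v & wedge u v i j != 0].

Lemma delta_neq0 : exists i j, delta i j != 0.
Proof.
have [u [v [i [j [Su Sv]]]]] := Syz_rank; have [psi ->] := deltaP Su Sv.
by rewrite mulf_eq0 => /norP[_ ?]; exists i, j.
Qed.

Section FixNu.
Variable nu : 'cV[R]_4.
Hypothesis nu_deg : Syz_deg Theta e nu.
Hypothesis nu_neq0 : nu <> 0.

Let nu_neq0' : exists i, nu i 0 != 0.
Proof. by apply: cv_neq0; apply/eqP. Qed.

(** A common prime factor p is not known to be homogeneous. The quotient nu / p is still a syzygy;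
    its components of degree below e vanish by minimality of e, and it has no others because p is
    not constant. *)
Lemma nu_primitive p : prime_elt p -> exists i, ~ rdvd p (nu i 0).
Proof.
move=> p_prime; apply: NNPP => /not_ex_all_not div.
have [p0 pU _] := p_prime.
have qP i : {q | nu i 0 = q * p}.
  by apply: constructive_indefinite_description; apply: NNPP (div i).
pose w : 'cV[R]_4 := \col_i sval (qP i).
have nuE : nu = p *: w.
  by apply/colP => i; rewrite !mxE mulrC; case: (qP i).
have Sw : Syz Theta w by apply: (Syz_scale p0); rewrite -nuE; case: nu_deg.
have w0 : w = 0; last by apply: nu_neq0; rewrite nuE w0 scaler0.
apply/colP => i; rewrite [RHS]mxE; apply: pihomog_eqP => d; rewrite pihomog0.
have [lt_d|le_d] := ltnP d e.
  have /colP/(_ i) := Syz_low lt_d (Syz_pihomog d Theta_lin Sw).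
  by rewrite !mxE.
have [->|wi0] := eqVneq (w i 0) 0; first by rewrite pihomog0.
have sz : (msize (w i ord0) <= d)%N.
  have : (msize (nu i ord0) <= e.+1)%N by apply: dhomog_msize_le; case: nu_deg.
  have -> : nu i ord0 = p * w i ord0 by rewrite nuE mxE.
  rewrite msizeM //.
  have gt1 : (1 < msize p)%N.
    rewrite ltnNge; apply: contra pU => le1; rewrite (msize1_polyC le1).
    have c0 : p@_0%MM != 0.
      by apply: contraNneq p0 => c0; rewrite (msize1_polyC le1) c0.
    by apply/unitrPr; exists (p@_0%MM)^-1%:MP; rewrite -mpolyCM divff.
  case: (msize p) gt1 => [|[|a]] // _; rewrite addSn /= ltnS => le2.
  by apply: leq_trans le_d; apply: leq_trans le2; rewrite leq_addl.
rewrite (pihomog_partitionE (leqnn (msize (w i 0)))) raddf_sum big1 // => j _ /=.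
apply: (@pihomog_out _ _ _ j); last exact: pihomogP.
by rewrite gtn_eqF // (leq_trans (ltn_ord j)).
Qed.

(** Chosen for every column, but meaningful on syzygies only; there the factor is unique because
    some delta is nonzero. *)
Definition nu_phi (v : 'cV[R]_4) : R :=
  epsilon (inhabits 0) (fun f => forall i j, wedge v nu i j = f * delta i j).

Lemma nu_phiP v : Syz Theta v -> forall i j, wedge v nu i j = nu_phi v * delta i j.
Proof.
move=> Sv; have [Snu _] := nu_deg.
exact: (epsilon_spec (inhabits 0) _ (deltaP Sv Snu)).
Qed.

Lemma nu_phi_uniq v f : Syz Theta v -> (forall i j, wedge v nu i j = f * delta i j) ->
  nu_phi v = f.
Proof.
move=> Sv fE; have [i [j d0]] := delta_neq0.
by apply: (mulIf d0); rewrite -nu_phiP.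
Qed.

Lemma nu_phi_linear a u v : Syz Theta u -> Syz Theta v ->
  nu_phi (a *: u + v) = a * nu_phi u + nu_phi v.
Proof.
move=> Su Sv; apply: nu_phi_uniq; first by apply: SyzD => //; apply: SyzZ.
move=> i j; rewrite mulrDl -mulrA -!nu_phiP // /wedge !mxE; ring.
Qed.

(** Value zero makes v and nu proportional, and the ratio is a polynomial because nu is
    primitive. *)
Lemma nu_phi_ker v : Syz Theta v -> (nu_phi v = 0 <-> exists c, v = c *: nu).
Proof.
move=> Sv; split=> [f0|[c ->]]; last first.
  apply: nu_phi_uniq; first by apply: SyzZ; case: nu_deg.
  by move=> i j; rewrite /wedge !mxE mul0r; ring.
have par i j : v i 0 * nu j 0 = v j 0 * nu i 0.
  by apply/eqP; rewrite -subr_eq0 -[_ - _]/(wedge v nu i j) nu_phiP // f0 mul0r.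
have [i nui0] := nu_neq0'.
have [c cE] : rdvd (nu i 0) (v i 0).
  apply: (rdvd_family (f := fun j => nu j 0) (@mpoly_ufd _ _) nui0 nu_primitive) => j.
  by exists (v j 0); rewrite par.
exists c; apply/colP => j; rewrite mxE; apply: (mulIf nui0).
by rewrite -par cE; ring.
Qed.

Lemma nu_phi_homog d v : Syz_deg Theta d v -> homogZ (d%:Z + (e%:Z - m%:Z)) (nu_phi v).
Proof.
move=> [Sv vd]; have [i [j d0]] := delta_neq0.
have : wedge v nu i j \is (d + e).-homog.
  by apply: rpredB; apply: dhomogM => //; case: nu_deg.
rewrite nu_phiP // => fd.
have [le_m|lt_m] := leqP m (d + e).
  have -> : d%:Z + (e%:Z - m%:Z) = (d + e - m)%N by rewrite addrA -PoszD subzn.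
  by apply: (dhomog_factor d0 (delta_homog i j)); rewrite subnK.
rewrite (dhomog_factor_lt d0 (delta_homog i j) fd lt_m).
by case: (_ + _) => // a; apply: rpred0.
Qed.

Lemma nu_phi_neq0 : exists2 v, Syz Theta v & nu_phi v != 0.
Proof.
apply: NNPP => no; have [u [v [i [j [Su Sv /eqP uv]]]]] := Syz_rank.
have phi0 w : Syz Theta w -> exists c, w = c *: nu.
  by move=> Sw; apply/(nu_phi_ker Sw)/eqP/negPn/negP => w0; apply: no; exists w.
have [[a uE] [b vE]] := (phi0 u Su, phi0 v Sv).
by apply: uv; rewrite /wedge uE vE !mxE; ring.
Qed.

(* If p divides nu_phi v, then v and nu are dependent modulo p, and dividing the
   relation by p gives a syzygy whose value has one factor p less. *)
Lemma nu_phi_nondiv p : prime_elt p -> exists2 v, Syz Theta v & ~ rdvd p (nu_phi v).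
Proof.
move=> p_prime; have [v Sv v0] := nu_phi_neq0.
have [l [u [phiE npu]]] := prime_multiplicity p_prime (mpoly_ufd v0).
elim: l v u Sv phiE npu {v0} => [|l IHl] v u Sv phiE npu.
  by exists v => //; rewrite phiE expr0 mul1r.
have [p0 pU pP] := p_prime.
have [i npi] := nu_primitive p_prime.
have [w wE] : exists w, nu i 0 *: v - v i 0 *: nu = p *: w.
  have qP j : {q | nu i 0 * v j 0 - v i 0 * nu j 0 = q * p}.
    apply: constructive_indefinite_description.
    have : rdvd p (wedge v nu j i).
      by rewrite nu_phiP // phiE exprS; do 2![apply: rdvd_mulr]; apply/rdvd_mulr/rdvd_refl.
    by rewrite /wedge => -[q qE]; exists q; rewrite -qE; ring.
  by exists (\col_j sval (qP j)); apply/colP => j; rewrite !mxE [RHS]mulrC; case: (qP j).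
have Snu : Syz Theta nu by case: nu_deg.
have Sw : Syz Theta w.
  by apply: (Syz_scale p0); rewrite -wE; apply: SyzB; apply: SyzZ.
have phiw : p * nu_phi w = nu i 0 * nu_phi v.
  have [a [b d0]] := delta_neq0; apply: (mulIf d0).
  rewrite -!mulrA -(nu_phiP Sw) -(nu_phiP Sv).
  have /colP wa := wE; have := wa a; have := wa b; rewrite !mxE => eb ea.
  have -> : p * wedge w nu a b = (p * w a 0) * nu b 0 - (p * w b 0) * nu a 0.
    by rewrite /wedge; ring.
  by rewrite -ea -eb /wedge; ring.
apply: (IHl w (nu i 0 * u) Sw); last by case/pP.
by apply: (mulfI p0); rewrite phiw phiE exprS; ring.
Qed.

Definition nu_ideal (f : R) := exists v, Syz Theta v /\ nu_phi v = f.

Lemma nu_ideal_is_ideal : is_ideal nu_ideal.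
Proof.
have S0 : Syz Theta 0 by rewrite /Syz mulmx0.
split=> [|f g [u [Su <-]] [v [Sv <-]]|a f [u [Su <-]]].
- by exists 0; split=> //; apply/(nu_phi_ker S0); exists 0; rewrite scale0r.
- by exists (1 *: u + v); split; [rewrite scale1r; apply: SyzD | rewrite nu_phi_linear // mul1r].
- exists (a *: u + 0); split; first by rewrite addr0; apply: SyzZ.
  rewrite nu_phi_linear //; suff -> : nu_phi 0 = 0 by rewrite addr0.
  by apply/(nu_phi_ker S0); exists 0; rewrite scale0r.
Qed.

(** Both maps have kernel R nu, so they are proportional. The values of [nu_phi] have no common
    prime factor, so [phi] is c times [nu_phi] with c in R. If c were not a unit, I would lie in a
    principal prime, which has height at most one. *)
Lemma bourbaki_nu_ideal I : bourbaki_ideal Theta nu I -> forall f, I f <-> nu_ideal f.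
Proof.
move=> [[phi [s [phiL phiH phiK phiI]]] I_height].
have [u Su b0] := nu_phi_neq0.
have S0 : Syz Theta 0 by rewrite /Syz mulmx0.
have phi0 : phi 0 = 0 by apply/(phiK 0 S0); exists 0; rewrite scale0r.
have phiZ a v : Syz Theta v -> phi (a *: v) = a * phi v.
  by move=> Sv; rewrite -[a *: v]addr0 phiL // phi0 addr0.
have nuZ a v : Syz Theta v -> nu_phi (a *: v) = a * nu_phi v.
  move=> Sv; rewrite -[a *: v]addr0 nu_phi_linear //.
  suff -> : nu_phi 0 = 0 by rewrite addr0.
  by apply/(nu_phi_ker S0); exists 0; rewrite scale0r.
have prop v : Syz Theta v -> nu_phi u * phi v = phi u * nu_phi v.
  move=> Sv; pose w := nu_phi u *: v + (- nu_phi v) *: u.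
  have Sw : Syz Theta w by apply: SyzD; apply: SyzZ.
  have Su' : Syz Theta ((- nu_phi v) *: u) by apply: SyzZ.
  have /(nu_phi_ker Sw)/(phiK _ Sw) : nu_phi w = 0.
    by rewrite /w nu_phi_linear // nuZ //; ring.
  rewrite /w phiL // phiZ // => /eqP; rewrite mulNr subr_eq0 => /eqP ->; exact: mulrC.
have [c cE] : rdvd (nu_phi u) (phi u).
  apply: (rdvd_family (f := fun v : {v | Syz Theta v} => nu_phi (sval v)) (@mpoly_ufd _ _) b0).
    by move=> p /nu_phi_nondiv[v Sv nv]; exists (exist _ v Sv).
  by case=> v Sv /=; exists (phi v); rewrite -prop // mulrC.
have phiE v : Syz Theta v -> phi v = c * nu_phi v.
  by move=> Sv; apply: cancel_proportion b0 (prop _ Sv) cE.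
have c0 : c != 0.
  apply: contraNneq b0 => c0; apply/eqP/(nu_phi_ker Su)/(phiK u Su).
  by rewrite phiE // c0 mul0r.
have Uc : c \is a GRing.unit.
  apply/negPn/negP => nUc; have [t ft] := mpoly_ufd c0.
  have [p p_prime pc] := factored_nonunit ft nUc.
  have Ip f : I f -> rdvd p f.
    by move/phiI=> [v [Sv <-]]; rewrite phiE //; apply: rdvd_mulr.
  case: I_height => [I1|[hI _]].
    by have [_ p1 _] := rdvd_prime_ideal p_prime; apply/p1/Ip.
  exact: rdvd_height p_prime (hI _ (rdvd_prime_ideal p_prime) Ip).
move=> f; rewrite phiI; split=> -[v [Sv <-]].
  by exists (c *: v); split; [exact: SyzZ | rewrite (nuZ _ _ Sv) (phiE _ Sv)].
exists (c^-1 *: v); split; first exact: SyzZ.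
by rewrite (phiZ _ _ Sv) (phiE _ Sv) mulKr.
Qed.

Lemma nu_ideal_height P : is_prime_ideal P -> (forall f, nu_ideal f -> P f) ->
  prime_height_ge P 2.
Proof.
move=> P_prime IP; have [v Sv v0] := nu_phi_neq0.
apply: (prime_height_ge2 P_prime IP _ v0); first by exists v.
by move=> p /nu_phi_nondiv[w Sw nw]; exists (nu_phi w) => //; exists w.
Qed.

Lemma nu_ideal_bourbaki P : is_prime_ideal P -> (forall f, nu_ideal f -> P f) ->
  ~ prime_height_ge P 3 -> bourbaki_ideal Theta nu nu_ideal.
Proof.
move=> P_prime IP hP; split.
  exists nu_phi, (e%:Z - m%:Z); split=> //.
  - exact: nu_phi_linear.
  - exact: nu_phi_homog.
  - exact: nu_phi_ker.
by right; split; [exact: nu_ideal_height | exists P].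
Qed.

Definition syz_piece d (w : {ffun 'I_4 -> R}) := Syz_deg Theta d (colf w).

Lemma subspace_syz_piece d : subspace (syz_piece d).
Proof.
split=> [|a u v [Su ud] [Sv vd]].
  by split=> [|i]; rewrite ?mxE ?ffunE ?rpred0 // /Syz; apply/colP => i;
     rewrite !mxE big1 // => j _; rewrite mxE ffunE mulr0.
split; first by rewrite colf_linear; apply: SyzD => //; apply: SyzZ.
move=> i; rewrite mxE !ffunE; apply: rpredD; first by apply: rpredZ; have := ud i; rewrite mxE.
by have := vd i; rewrite mxE.
Qed.

(** Dimensions in the exact sequence of R nu, Syz and the ideal, where the generator nu has degree e
    and the map to the ideal changes degrees by e - m. *)
Lemma nu_ideal_hilbert d a : (e <= d)%N -> (m <= d + e)%N ->
    basis_mod (syz_piece d) (@zero_sub k _) a ->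
  [/\ ('C(d - e + n, n) <= a)%N, (a - 'C(d - e + n, n) <= 'C(d + e - m + n, n))%N
   & hilbert_function nu_ideal (d + e - m)
      ('C(d + e - m + n, n) - (a - 'C(d - e + n, n)))].
Proof.
move=> le_ed le_m ha; have [Snu nu_h] := nu_deg.
have sS := subspace_syz_piece d.
pose K w := syz_piece d w /\ nu_phi (colf w) = 0.
pose ID f := nu_ideal f /\ f \is (d + e - m).-homog.
have [Iz Id Im] := nu_ideal_is_ideal.
have sK : subspace K.
  split=> [|c u v [Su u0] [Sv v0]]; split.
  - exact: sS.1.
  - apply/nu_phi_ker; first by case: sS => -[].
    by exists 0; rewrite scale0r; apply/colP => i; rewrite !mxE ffunE.
  - exact: sS.2.
  by case: Su Sv => [Su _] [Sv _]; rewrite colf_linear nu_phi_linear // u0 v0 mulr0 addr0.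
have sI : subspace ID.
  split=> [|c u v [Iu hu] [Iv hv]]; first by split; rewrite ?rpred0.
  split; first by apply: Id => //; rewrite -mul_mpolyC; apply: Im.
  by apply: rpredD => //; apply: rpredZ.
have phi_homog w : syz_piece d w -> nu_phi (colf w) \is (d + e - m).-homog.
  move/nu_phi_homog; have -> : d%:Z + (e%:Z - m%:Z) = (d + e - m)%N by rewrite addrA -PoszD subzn.
  by [].
have hK : basis_mod K (@zero_sub k _) 'C(d - e + n, n).
  pose f (c : R) : {ffun 'I_4 -> R} := [ffun i => c * nu i 0].
  have fE c : colf (f c) = c *: nu by apply/colP => i; rewrite !mxE ffunE.
  have key := @basis_mod_image k _ _ (@zero_sub k _) (fun c => c \is (d - e).-homog)
    (@zero_sub k _) K f.
  apply: (proj1 (key _ (subspace_homog _ _ _) _ _ _ _) (basis_mod_homog _ _ _)).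
  - by move=> c u v _ _; apply/ffunP => i; rewrite !ffunE mulrDl scalerAl.
  - move=> c hc; split; last by apply/nu_phi_ker; rewrite fE; [apply: SyzZ | exists c].
    split=> [|i]; first by rewrite fE; apply: SyzZ.
    by rewrite mxE ffunE -(subnK le_ed); apply: dhomogM.
  - move=> w [[Sw hw] /(nu_phi_ker Sw)[c wE]]; have [i nui0] := nu_neq0'.
    exists c; last by apply: colf_inj; rewrite fE.
    apply: (dhomog_factor nui0 (nu_h i)); rewrite subnK //.
    by have := hw i; rewrite wE mxE.
  - move=> c _; have [i nui0] := nu_neq0'; split=> [/ffunP/(_ i)|->].
      by rewrite !ffunE => /eqP; rewrite mulf_eq0 (negPf nui0) orbF => /eqP.
    by apply/ffunP => j; rewrite !ffunE mul0r.
have [||le_a hSK] := basis_mod_sub (@subspace_zero k _) sK sS _ _ ha hK.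
- by move=> v ->; apply: sK.1.
- by move=> v [].
have hI : basis_mod ID (@zero_sub k _) (a - 'C(d - e + n, n)).
  have key := @basis_mod_image k _ _ K (syz_piece d) (@zero_sub k _) ID
    (fun w => nu_phi (colf w)).
  apply: (proj1 (key _ sS _ _ _ _) hSK).
  - by move=> c u v [Su _] [Sv _]; rewrite colf_linear nu_phi_linear // mul_mpolyC.
  - by move=> w Sw; split; [exists (colf w); split=> //; case: Sw | apply: phi_homog].
  - move=> f [[v [Sv vf]] hf].
    (* Replacing v by its component of degree d does not change the value f, because f is
       homogeneous of the matching degree. *)
    pose w : {ffun 'I_4 -> R} := [ffun i => pihomog (@mdeg n.+1) d (v i 0)].
    have wE : colf w = pihomog_cv d v by apply/colP => i; rewrite !mxE ffunE.
    have Sw : syz_piece d w by rewrite /syz_piece wE; apply: Syz_pihomog.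
    exists w => //; rewrite wE; apply: nu_phi_uniq; first by have [] := Syz_pihomog d Theta_lin Sv.
    move=> i j; have hw : wedge v nu i j \is (d + e).-homog.
      by rewrite nu_phiP // vf -(subnK le_m); apply: dhomogM.
    by rewrite -vf -nu_phiP // -(pihomog_dE hw) /wedge !mxE raddfB /= !(pihomogM _ _ (nu_h _)).
  - by move=> w Sw; rewrite /K /zero_sub; split=> [|[]].
have [||le_b hRI] := basis_mod_sub (@subspace_zero k _) sI (subspace_homog k n.+1 (d + e - m)) _ _ (basis_mod_homog _ _ _) hI.
- by move=> v ->; apply: sI.1.
- by move=> v [_ hv]; exact: hv.
split=> //; case: hRI => g [gh g_basis]; exists g; split=> // p hp.
have [c [[Ic _] cu]] := g_basis p hp; exists c; split=> // c' Ic'; apply: cu; split=> //.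
exact: (subspaceB (subspace_homog _ _ _) hp (subspace_comb (subspace_homog _ _ _) c' gh)).
Qed.

End FixNu.

(** The prime [P] is needed for a single [nu0], to exhibit a Bourbaki ideal. The degree is then
    computed for every nu, because the Hilbert function of the ideal depends only on the dimensions
    of the pieces of Syz. *)
Theorem has_Bour_of_delta (mv b d0 : nat) (w : 'I_3 -> int) nu0 P :
    Syz_deg Theta e nu0 -> nu0 <> 0 ->
    is_prime_ideal P -> ~ prime_height_ge P 3 ->
    (forall v psi, Syz Theta v -> (forall i j, wedge v nu0 i j = psi * delta i j) -> P psi) ->
    (0 < b)%N -> b%:Z = \sum_j w j ->
    (forall d, (d0 <= d)%N -> exists2 a, basis_mod (syz_piece d) (@zero_sub k _) a &
       'C(d + e - m + n, n)%:Z - a%:Z + 'C(d - e + n, n)%:Z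
         = \sum_(j < 3) w j * 'C(d + e - m - j + mv, mv)%:Z) ->
  has_Bour Theta b /\ indeg_Syz Theta e.
Proof.
move=> nu0_deg nu00 P_prime hP IP b0 bE hilb.
have ind : indeg_Syz Theta e by split; [exists nu0 | exact: Syz_low].
split=> //; exists e; split=> //.
  exists nu0, (nu_ideal nu0); split=> //.
  apply: (nu_ideal_bourbaki nu0_deg nu00 P_prime) => // f [v [Sv <-]].
  by apply: (IP v) => //; apply: nu_phiP.
move=> nu I nu_deg nu_neq0 hI; have IE := bourbaki_nu_ideal nu_deg nu_neq0 hI.
(* Large enough for every truncated subtraction below to be exact. *)
pose D0 := (d0 + e + m + e + 2)%N.
have hD D : exists h, (D0 <= D)%N -> hilbert_function I D h /\
   h%:Z = \sum_(j < 3) w j * 'C(D - j + mv, mv)%:Z.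
  have [le_D|] := leqP D0 D; last by exists 0%N.
  pose d := (D + m - e)%N.
  have DE : D = (d + e - m)%N by rewrite /d subnK ?addnK // (leq_trans _ (leq_addr _ _)) // (leq_trans _ le_D) // /D0; lia.
  have le_d0 : (d0 <= d)%N by rewrite /d /D0 in le_D *; lia.
  have le_ed : (e <= d)%N by rewrite /d /D0 in le_D *; lia.
  have le_m : (m <= d + e)%N by rewrite /d /D0 in le_D *; lia.
  have [a ha hE] := hilb d le_d0.
  have [le1 le2 hil] := nu_ideal_hilbert nu_deg nu_neq0 le_ed le_m ha.
  exists ('C(d + e - m + n, n) - (a - 'C(d - e + n, n)))%N => _; split.
    rewrite DE; case: hil => g [gh gu]; exists g; split=> // p hp.
    have [c [Ic cu]] := gu p hp; exists c; split; first exact/IE.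
    by move=> c' /IE; apply: cu.
  by rewrite DE -hE -subzn // -subzn // opprB addrA addrAC.
apply: (@has_degree_binpoly mv _ _ _ b w D0
  (fun D => epsilon (inhabits 0%N) (fun h => (D0 <= D)%N -> hilbert_function I D h /\
   h%:Z = \sum_(j < 3) w j * 'C(D - j + mv, mv)%:Z))) => //.
  by rewrite /D0 addn2.
move=> D le_D; have := epsilon_spec (inhabits 0%N) _ (hD D); exact.
Qed.

End Bourbaki.

(** * Equivalence, resolutions and free syzygy modules *)

Section ConstantMatrices.
Variables (k : fieldType) (n : nat).
Local Notation R := {mpoly k[n]}.

Definition cmx p q (P : 'M[k]_(p, q)) : 'M[R]_(p, q) := map_mx (@mpolyC n k) P.

Lemma cmxM p q r (P : 'M[k]_(p, q)) (Q : 'M[k]_(q, r)) : cmx (P *m Q) = cmx P *m cmx Q.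
Proof. exact: map_mxM. Qed.

Lemma cmx1 p : cmx (1%:M : 'M[k]_p) = 1%:M.
Proof. exact: map_mx1. Qed.

Lemma cmxV p (P : 'M[k]_p) : P \in unitmx -> cmx (invmx P) *m cmx P = 1%:M.
Proof. by move=> UP; rewrite -cmxM mulVmx // cmx1. Qed.

Lemma cmxKV p (P : 'M[k]_p) : P \in unitmx -> cmx P *m cmx (invmx P) = 1%:M.
Proof. by move=> UP; rewrite -cmxM mulmxV // cmx1. Qed.

Lemma cmx_homog_l p q r (P : 'M[k]_(p, q)) (A : 'M[R]_(q, r)) d :
  (forall i j, A i j \is d.-homog) -> forall i j, (cmx P *m A) i j \is d.-homog.
Proof.
move=> Ah i j; rewrite mxE; apply: rpred_sum => l _.
by rewrite mxE mul_mpolyC; apply: rpredZ.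
Qed.

Lemma cmx_homog_r p q r (P : 'M[k]_(q, r)) (A : 'M[R]_(p, q)) d :
  (forall i j, A i j \is d.-homog) -> forall i j, (A *m cmx P) i j \is d.-homog.
Proof.
move=> Ah i j; rewrite mxE; apply: rpred_sum => l _.
by rewrite mxE mulrC mul_mpolyC; apply: rpredZ.
Qed.

Lemma KW_equiv_refl m (A : 'M[R]_(2, m)) : KW_equiv A A.
Proof.
exists 1%:M, 1%:M; rewrite !unitmx1; split=> //.
by rewrite -/(cmx _) -/(cmx _) !cmx1 mul1mx mulmx1.
Qed.

Lemma KW_equiv_sym m (A B : 'M[R]_(2, m)) : KW_equiv A B -> KW_equiv B A.
Proof.
move=> [P [Q [UP UQ ->]]]; exists (invmx P), (invmx Q).
rewrite !unitmx_inv; split=> //; rewrite -!/(cmx _).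
by rewrite !mulmxA cmxV // mul1mx -mulmxA cmxKV // mulmx1.
Qed.

Lemma KW_equiv_trans m (B A C : 'M[R]_(2, m)) :
  KW_equiv A B -> KW_equiv B C -> KW_equiv A C.
Proof.
move=> [P [Q [UP UQ ->]]] [P' [Q' [UP' UQ' ->]]].
exists (P *m P'), (Q' *m Q); rewrite !unitmx_mul UP UP' UQ UQ'; split=> //.
by rewrite -!/(cmx _) !cmxM !mulmxA.
Qed.

Lemma KW_equiv_mul m (A : 'M[R]_(2, m)) P Q : P \in unitmx -> Q \in unitmx ->
  KW_equiv (cmx P *m A *m cmx Q) A.
Proof. by move=> UP UQ; exists P, Q. Qed.

End ConstantMatrices.

Section Invariance.
Variables (k : fieldType) (n : nat).
Local Notation R := {mpoly k[n]}.
Implicit Types (Theta N : 'M[R]_(2, 4)).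

Section Transport.
Variables (Theta N : 'M[R]_(2, 4)) (P : 'M[k]_2) (Q : 'M[k]_4).
Hypotheses (UP : P \in unitmx) (UQ : Q \in unitmx).
Hypothesis ThetaE : Theta = cmx n P *m N *m cmx n Q.

Local Notation Qc := (cmx n Q).
Local Notation Qi := (cmx n (invmx Q)).

Lemma Syz_transport v : Syz Theta v <-> Syz N (Qc *m v).
Proof.
rewrite /Syz ThetaE -!mulmxA; split=> [e|->]; last by rewrite mulmx0.
by rewrite -[N *m _]mul1mx -(cmxV n UP) -mulmxA e mulmx0.
Qed.

Lemma Syz_deg_transport d v : Syz_deg Theta d v <-> Syz_deg N d (Qc *m v).
Proof.
split=> -[Sv vd]; split; try exact/Syz_transport.
  by move=> i; apply: cmx_homog_l => a b; rewrite ord1.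
move=> i; rewrite -[v]mul1mx -(cmxV n UQ) -mulmxA.
by apply: cmx_homog_l => a b; rewrite ord1.
Qed.

Lemma Qc_eq0 (v : 'cV[R]_4) : Qc *m v = 0 -> v = 0.
Proof. by move=> e; rewrite -[v]mul1mx -(cmxV n UQ) -mulmxA e mulmx0. Qed.

Lemma QcK (v : 'cV[R]_4) : Qc *m (Qi *m v) = v.
Proof. by rewrite mulmxA cmxKV // mul1mx. Qed.

Lemma QiK (v : 'cV[R]_4) : Qi *m (Qc *m v) = v.
Proof. by rewrite mulmxA cmxV // mul1mx. Qed.

Lemma indeg_transport e : indeg_Syz N e -> indeg_Syz Theta e.
Proof.
move=> [[v [Sv v0]] low]; split.
  exists (Qi *m v); split; first by apply/Syz_deg_transport; rewrite QcK.
  by move=> e0; apply: v0; rewrite -[v]QcK e0 mulmx0.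
by move=> d u lt_d /Syz_deg_transport/(low _ _ lt_d); apply: Qc_eq0.
Qed.

Lemma bourbaki_transport nu I : bourbaki_ideal Theta nu I -> bourbaki_ideal N (Qc *m nu) I.
Proof.
move=> [[phi [s [phiL phiH phiK phiI]]] hI]; split=> //.
have SQ v : Syz N v -> Syz Theta (Qi *m v) by move=> Sv; apply/Syz_transport; rewrite QcK.
exists (fun v => phi (Qi *m v)), s; split.
- by move=> a u v Su Sv; rewrite mulmxDr -scalemxAr phiL //; apply: SQ.
- by move=> d v Sv; apply: phiH; apply/Syz_deg_transport; rewrite QcK.
- move=> v Sv; split=> [/(phiK _ (SQ _ Sv))[c e]|[c vE]].
    by exists c; rewrite -[v]QcK e -scalemxAr.
  by apply/(phiK _ (SQ _ Sv)); exists c; rewrite vE -scalemxAr QiK.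
- move=> f; rewrite phiI; split=> -[v [Sv <-]].
    by exists (Qc *m v); rewrite QiK; split=> //; apply/Syz_transport.
  by exists (Qi *m v); split=> //; apply: SQ.
Qed.

Lemma is_free_transport : is_free Theta -> is_free N.
Proof.
move=> [r [B [B_gen B_free]]]; exists r, (Qc *m B); split=> [v|c].
  split=> [Sv|[c ->]]; last by rewrite -mulmxA; apply/Syz_transport/B_gen; exists c.
  have /B_gen[c e] : Syz Theta (Qi *m v) by apply/Syz_transport; rewrite QcK.
  by exists c; rewrite -mulmxA -e QcK.
by rewrite -mulmxA => /Qc_eq0/B_free.
Qed.

Lemma homological_type_transport a : homological_type N a -> homological_type Theta a.
Proof.
move=> [E [D [[Eh Dh] D0 onto ex0 exS]]].
exists (cmx n P *m E), D; split=> //.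
- split=> // p q; case: (_ + _) (Eh^~ q) => d Ed /=.
    rewrite mxE; apply: rpred_sum => l _; rewrite mxE mul_mpolyC; apply: rpredZ.
    exact: Ed.
  rewrite mxE big1 // => l _; by rewrite (Ed l) mulr0.
- move=> w; have [u [v e]] := onto (cmx n (invmx P) *m w).
  exists u, (Qi *m v); rewrite ThetaE -!mulmxA QcK -mulmxDr -e.
  by rewrite mulmxA cmxKV // mul1mx.
move=> u; rewrite -ex0 ThetaE; split=> -[v e].
  exists (Qc *m v); rewrite -[E *m u]mul1mx -(cmxV n UP) -mulmxA [cmx n P *m _]mulmxA e.
  by rewrite -!mulmxA [cmx n (invmx P) *m _]mulmxA cmxV // mul1mx.
by exists (Qi *m v); rewrite -!mulmxA QcK e.
Qed.

End Transport.

Lemma indeg_equiv Theta N e : KW_equiv Theta N -> indeg_Syz N e -> indeg_Syz Theta e.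
Proof. by move=> [P [Q [UP UQ E]]]; apply: indeg_transport UP UQ E _. Qed.

Lemma is_free_equiv Theta N : KW_equiv Theta N -> is_free N -> is_free Theta.
Proof. by move=> /KW_equiv_sym[P [Q [UP UQ E]]]; apply: is_free_transport UP UQ E. Qed.

Lemma homological_type_equiv Theta N a : KW_equiv Theta N ->
  homological_type N a -> homological_type Theta a.
Proof. by move=> [P [Q [UP UQ E]]]; apply: homological_type_transport UP UQ E _. Qed.

Lemma has_Bour_equiv Theta N b : KW_equiv Theta N -> has_Bour N b -> has_Bour Theta b.
Proof.
move=> eqTN [e [ind [nu [I [Snu nu0 hI]]] deg_all]].
exists e; split; first exact: indeg_equiv ind.
  have [P [Q [UP UQ E]]] := KW_equiv_sym eqTN.
  exists (cmx n Q *m nu), I; split.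
  - exact/(Syz_deg_transport UP UQ E).
  - by move/(Qc_eq0 UQ).
  - exact: bourbaki_transport UP UQ E _ _ hI.
have [P [Q [UP UQ E]]] := eqTN.
move=> nu' I' Snu' nu'0 hI'; apply: (deg_all (cmx n Q *m nu')).
- exact/(Syz_deg_transport UP UQ E).
- by move/(Qc_eq0 UQ).
- exact: bourbaki_transport UP UQ E _ _ hI'.
Qed.

End Invariance.

Section Resolutions.
Variables (k : fieldType) (n : nat).
Local Notation R := {mpoly k[n]}.
Implicit Types (Theta : 'M[R]_(2, 4)).

Definition mk_htype (s1 s2 s3 s4 : seq int) (i : nat) : seq int :=
  match i with
  | 0 => [:: -1; -1]%Z | 1 => s1 | 2 => s2 | 3 => s3 | 4 => s4 | _ => [::]
  end.

(** [A1] has the same image as [Theta] but may have fewer columns: a zero column would violate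
    minimality and has to be dropped. *)
Lemma build_resolution Theta (s1 s2 s3 s4 : seq int) (A1 : 'M[R]_(2, size s1))
    (A2 : 'M_(size s1, size s2)) (A3 : 'M_(size s2, size s3)) (A4 : 'M_(size s3, size s4)) :
    (forall (p : 'I_(2)) (q : 'I_(size s1)), homogZ (s1`_q + 1) (A1 p q) /\ (A1 p q)@_0%MM = 0) ->
    (forall (p : 'I_(size s1)) (q : 'I_(size s2)), homogZ (s2`_q - s1`_p) (A2 p q) /\ (A2 p q)@_0%MM = 0) ->
    (forall (p : 'I_(size s2)) (q : 'I_(size s3)), homogZ (s3`_q - s2`_p) (A3 p q) /\ (A3 p q)@_0%MM = 0) ->
    (forall (p : 'I_(size s3)) (q : 'I_(size s4)), homogZ (s4`_q - s3`_p) (A4 p q) /\ (A4 p q)@_0%MM = 0) ->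
    (forall v : 'cV_4, exists u, Theta *m v = A1 *m u) ->
    (forall u : 'cV_(size s1), exists v, A1 *m u = Theta *m v) ->
    (forall u : 'cV_(size s1), A1 *m u = 0 <-> exists t, u = A2 *m t) ->
    (forall u : 'cV_(size s2), A2 *m u = 0 <-> exists t, u = A3 *m t) ->
    (forall u : 'cV_(size s3), A3 *m u = 0 <-> exists t, u = A4 *m t) ->
    (forall u : 'cV_(size s4), A4 *m u = 0 -> u = 0) ->
  homological_type Theta (mk_htype s1 s2 s3 s4).
Proof.
move=> h1 h2 h3 h4 im1 im1' ex1 ex2 ex3 ex4.
pose D i : 'M[R]_(size (mk_htype s1 s2 s3 s4 i), size (mk_htype s1 s2 s3 s4 i.+1)) :=
  match i with 0 => A1 | 1 => A2 | 2 => A3 | 3 => A4 | _ => 0 end.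
exists (1%:M : 'M[R]_2), D; split.
- split=> [p q|].
    have -> : ((mk_htype s1 s2 s3 s4 0)`_q + 1) = 0 by case: q => [[|[|]]].
    by rewrite /= mxE; case: eqP => _; rewrite ?dhomog1 ?rpred0.
  case=> [|[|[|[|i]]]] p q /=; last by case: q.
  + have -> : [:: -1; -1]%Z`_p = -1 by case: p => [[|[|]]].
    by rewrite opprK; case: (h1 p q).
  + by case: (h2 p q).
  + by case: (h3 p q).
  + by case: (h4 p q).
- case=> [|[|[|[|i]]]] p q /=; last by case: q.
  + by case: (h1 p q).
  + by case: (h2 p q).
  + by case: (h3 p q).
  + by case: (h4 p q).
- by move=> w; exists w, 0; rewrite mul1mx mulmx0 addr0.
- move=> u; rewrite mul1mx; split=> -[v ->]; [have [t ->] := im1 v | have [t ->] := im1' v];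
  by exists t.
case=> [|[|[|[|i]]]] //= u.
  split=> [/ex4 ->|[t ->]]; first by exists 0; rewrite mulmx0.
  by rewrite mul0mx mulmx0.
split=> _; last by rewrite mul0mx.
by exists 0; rewrite [u]flatmx0 mul0mx.
Qed.

End Resolutions.

Section ListMatrices.
Variable A : comNzRingType.

Fixpoint dotp (r s : seq A) : A :=
  match r, s with x :: r', y :: s' => x * y + dotp r' s' | _, _ => 0 end.

Definition cvec m (s : seq A) : 'cV[A]_m := \col_i s`_i.

(** Matrices and columns given by lists: products reduce to lists of [dotp], whose entries can be
    settled by [ring]. *)
Definition mxs p q (rows : seq (seq A)) : 'M[A]_(p, q) :=
  \matrix_(i, j) (nth [::] rows i)`_j.

Lemma dotpE q r s : size r = q -> size s = q -> dotp r s = \sum_(j < q) r`_j * s`_j.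
Proof.
elim: q r s => [|q IHq] [|x r] [|y s] //= => [_ _|[sr] [ss]]; first by rewrite big_ord0.
by rewrite big_ord_recl (IHq r s).
Qed.

Lemma mul_mxs p q rows s : size rows = p -> all (fun r => size r == q) rows -> size s = q ->
  mxs p q rows *m cvec q s = cvec p [seq dotp r s | r <- rows].
Proof.
move=> sr ar ss; apply/colP => i; rewrite !mxE.
rewrite (nth_map [::]) ?sr // (@dotpE q) //; last by apply/eqP/(allP ar)/mem_nth; rewrite sr.
by apply: eq_bigr => j _; rewrite !mxE.
Qed.

Lemma cvecP m (v : 'cV[A]_m) : exists2 s, size s = m & v = cvec m s.
Proof.
exists [seq v i 0 | i <- enum 'I_m]; first by rewrite size_map size_enum_ord.
apply/colP => i; rewrite mxE (nth_map i) ?size_enum_ord //.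
by rewrite nth_ord_enum.
Qed.

Lemma cvec0 m : cvec m (nseq m 0) = 0.
Proof. by apply/colP => i; rewrite !mxE nth_nseq ltn_ord. Qed.

End ListMatrices.

Lemma mul_row2 (A : comNzRingType) m (u v : 'cV[A]_m) (c : 'cV[A]_2) :
  row_mx u v *m c = c 0 0 *: u + c 1 0 *: v.
Proof.
pose c' : 'M_(1 + 1, 1) := c; rewrite -[c in LHS]/c' -[c']vsubmxK mul_row_col.
rewrite [usubmx c']mx11_scalar [dsubmx c']mx11_scalar !mul_mx_scalar !mxE /c'.
by congr (c _ _ *: _ + c _ _ *: _); apply: val_inj.
Qed.

Section FreeSyzygies.
Variables (k : fieldType) (n : nat).
Local Notation R := {mpoly k[n]}.
Variable Theta : 'M[R]_(2, 4).
Hypothesis Theta_lin : forall i j, Theta i j \is 1.-homog.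

Definition syz_basis (u v : 'cV[R]_4) :=
  [/\ Syz Theta u, Syz Theta v, forall w, Syz Theta w -> exists a b, w = a *: u + b *: v
    & forall a b, a *: u + b *: v = 0 -> a = 0 /\ b = 0].

Lemma syz_basis_sym u v : syz_basis u v -> syz_basis v u.
Proof.
move=> [Su Sv gen ind]; split=> // [w /gen[a [b ->]]|a b].
  by exists b, a; rewrite addrC.
by rewrite addrC => /ind[].
Qed.

Lemma syz_basis_replace u v (c d : R) : c \is a GRing.unit ->
  syz_basis u v -> syz_basis (c *: u + d *: v) v.
Proof.
move=> Uc [Su Sv gen ind]; split=> // [|w /gen[a [b ->]]|a b e].
- by apply: SyzD; apply: SyzZ.
- exists (a / c), (b - a / c * d).
  rewrite scalerDr !scalerA divrK // scalerBl -addrA; congr (_ + _).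
  by rewrite addrCA subrr addr0.
have [] := ind (a * c) (a * d + b).
  by rewrite -[RHS]e scalerDr !scalerA scalerDl addrA.
move=> /eqP ac; have a0 : a = 0.
  apply/eqP; move: ac; rewrite mulf_eq0 => /orP[//|/eqP c0].
  by rewrite c0 unitr0 in Uc.
by rewrite a0 mul0r add0r => ->.
Qed.

Lemma syz_basis_neq0 u v : syz_basis u v -> u <> 0 /\ v <> 0.
Proof.
move=> [_ _ _ ind]; split=> e.
  have [] := ind 1 0; first by rewrite e scaler0 scale0r addr0.
  by move/eqP; rewrite oner_eq0.
have [] := ind 0 1; first by rewrite e scaler0 scale0r addr0.
by move=> _ /eqP; rewrite oner_eq0.
Qed.

Lemma pihomog_cv_id d (v : 'cV[R]_4) : (forall i, v i 0 \is d.-homog) -> pihomog_cv d v = v.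
Proof. by move=> vd; apply/colP => i; rewrite mxE pihomog_dE. Qed.

Lemma pihomog_cv_comb d d1 d2 (u v : 'cV[R]_4) a b :
    (forall i, u i 0 \is d1.-homog) -> (forall i, v i 0 \is d2.-homog) ->
  pihomog_cv d (a *: u + b *: v) =
    (if (d1 <= d)%N then pihomog (@mdeg n) (d - d1) a else 0) *: u
    + (if (d2 <= d)%N then pihomog (@mdeg n) (d - d2) b else 0) *: v.
Proof.
move=> ud vd; apply/colP => i; rewrite !mxE raddfD /=.
have key e c (w : 'cV[R]_4) : (forall i, w i 0 \is e.-homog) ->
   pihomog (@mdeg n) d (c * w i 0) =
     (if (e <= d)%N then pihomog (@mdeg n) (d - e) c else 0) * w i 0.
  move=> wd; case: leqP => [le|lt]; last by rewrite mul0r (pihomogM_lt _ (wd i)).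
  by rewrite -(pihomogM _ _ (wd i)) subnK.
by rewrite (key _ _ _ ud) (key _ _ _ vd).
Qed.

(** The quotient Syz / R u is generated by the class of v, so I is principal. A proper nonzero
    principal ideal lies in a principal prime, which excludes height two. *)
Lemma bourbaki_of_basis u v I : syz_basis u v -> bourbaki_ideal Theta u I ->
  forall f, I f.
Proof.
move=> [Su Sv gen ind] [[phi [s [phiL phiH phiK phiI]]] hI].
have S0 : Syz Theta 0 by rewrite /Syz mulmx0.
have phi0 : phi 0 = 0 by apply/(phiK 0 S0); exists 0; rewrite scale0r.
have phiZ a w : Syz Theta w -> phi (a *: w) = a * phi w.
  by move=> Sw; rewrite -[a *: w]addr0 phiL // phi0 addr0.
have phiu : phi u = 0 by apply/(phiK u Su); exists 1; rewrite scale1r.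
have If f : I f <-> rdvd (phi v) f.
  rewrite phiI; split=> [[w [/gen[a [b ->]] <-]]|[c ->]].
    by exists b; rewrite phiL // ?phiu ?mulr0 ?add0r ?phiZ //; apply: SyzZ.
  by exists (c *: v); split; [apply: SyzZ | rewrite phiZ].
have v0 : phi v != 0.
  apply/eqP => /(phiK v Sv)[c e]; have [] := ind (- c) 1.
    by rewrite scale1r {1}e scaleNr addNr.
  by move=> _ /eqP; rewrite oner_eq0.
have [Uv|nUv] := boolP (phi v \is a GRing.unit).
  by move=> f; apply/If; exists (f / phi v); rewrite divrK.
have [t ft] := mpoly_ufd v0; have [p p_prime pv] := factored_nonunit ft nUv.
case: hI => // -[hI _]; case: (rdvd_height p_prime).
apply: hI; first exact: rdvd_prime_ideal.
by move=> f /If; apply: rdvd_trans.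
Qed.

Lemma bourbaki_basis_exists d1 d2 u v : syz_basis u v ->
    Syz_deg Theta d1 u -> Syz_deg Theta d2 v ->
  bourbaki_ideal Theta u (fun=> True).
Proof.
move=> [Su Sv gen ind] [_ ud] [_ vd]; split; last by left.
have uniq a b a' b' : a *: u + b *: v = a' *: u + b' *: v -> b = b'.
  move=> e; have [] := ind (a - a') (b - b').
    rewrite !scalerBl addrACA -opprD.
    by apply/eqP; rewrite subr_eq0; apply/eqP.
  by move=> _ /eqP; rewrite subr_eq0 => /eqP.
pose phi w := epsilon (inhabits 0) (fun b => exists a, w = a *: u + b *: v).
have phiP w : Syz Theta w -> exists a, w = a *: u + phi w *: v.
  by move=> /gen[a [b e]]; apply: (epsilon_spec (inhabits 0) (fun b => exists a, w = a *: u + b *: v)); exists b, a.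
have phiE w a b : w = a *: u + b *: v -> phi w = b.
  move=> e; have Sw : Syz Theta w by rewrite e; apply: SyzD; apply: SyzZ.
  by have [a' e'] := phiP w Sw; apply: (uniq a' _ a); rewrite -e' -e.
exists phi, (- d2%:Z); split.
- move=> c w w' /phiP[a e] /phiP[a' e'].
  apply: (phiE _ (c * a + a')); rewrite {1}e {1}e' scalerDr !scalerA !scalerDl.
  by rewrite addrACA.
- move=> e w [Sw wd]; have [a wE] := phiP w Sw.
  have := pihomog_cv_comb e a (phi w) ud vd; rewrite -wE pihomog_cv_id // => wE'.
  rewrite (phiE _ _ _ wE'); case: leqP => [le|lt].
    by rewrite subzn //; apply: pihomogP.
  by rewrite /homogZ; case: (_ + _) => // j; apply: rpred0.
- move=> w Sw; split=> [w0|[c ->]]; last by apply: (phiE _ c 0); rewrite scale0r addr0.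
  by have [a] := phiP w Sw; rewrite w0 scale0r addr0; exists a.
- move=> f; split=> // _; exists (f *: v); split; first exact: SyzZ.
  by apply: (phiE _ 0); rewrite scale0r add0r.
Qed.

Lemma has_degree_full (I : R -> Prop) : (forall f, I f) -> has_degree I 0.
Proof.
move=> If; exists 0; split; last by rewrite lead_coef0 mulr0.
exists 0%N => d _; exists 0%N; split; last by rewrite horner0.
exists (fun=> 0); split=> [[]|p _] //.
by exists 0; split=> // c _; apply/rowP => -[].
Qed.

(** A nonzero syzygy of degree d1 has a nonzero constant coefficient at u or, if the two degrees
    agree, at v. Hence it is part of a basis, and every Bourbaki ideal is R. *)
Lemma free_syzygies d1 d2 u v : syz_basis u v ->
    Syz_deg Theta d1 u -> Syz_deg Theta d2 v -> (d1 <= d2)%N ->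
  [/\ is_free Theta, indeg_Syz Theta d1 & has_Bour Theta 0].
Proof.
move=> uv Su Sv le_d; have [u0 v0] := syz_basis_neq0 uv.
have [_ _ gen ind] := uv; have [[_ ud] [_ vd]] := (Su, Sv).
have indeg : indeg_Syz Theta d1.
  split=> [|d w lt_d [Sw wd]]; first by exists u.
  have [a [b wE]] := gen w Sw.
  rewrite -(pihomog_cv_id wd) wE (pihomog_cv_comb _ _ _ ud vd).
  by rewrite leqNgt lt_d leqNgt (leq_trans lt_d le_d) !scale0r addr0.
split=> //.
  exists 2%N, (row_mx u v); split=> [w|c].
    split=> [/gen[a [b ->]]|[c ->]].
      by exists (cvec 2 [:: a; b]); rewrite mul_row2 !mxE.
    by rewrite mul_row2; have [Su' Sv' _ _] := uv; apply: SyzD; apply: SyzZ.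
  rewrite mul_row2 => /ind[c0 c1]; apply/colP => i; rewrite mxE.
  by case: i => [[|[|]]] // lt_i; [rewrite -[RHS]c0|rewrite -[RHS]c1]; congr (c _ _); apply: val_inj.
have extend nu : Syz_deg Theta d1 nu -> nu <> 0 -> exists mu, syz_basis nu mu.
  move=> [Snu nud] nu0; have [a [b nuE]] := gen nu Snu.
  have := pihomog_cv_comb d1 a b ud vd; rewrite -nuE pihomog_cv_id //.
  rewrite leqnn subnn (homog0_const (pihomogP (@mdeg n) 0 a)).
  set al := (_@_0%MM); have unitC (c : k) : c != 0 -> (c%:MP : R) \is a GRing.unit.
    by move=> c0; apply/unitrPr; exists (c^-1)%:MP; rewrite -mpolyCM divff.
  have [al0|al0] := eqVneq al 0; last first.
    by move=> ->; exists v; apply: syz_basis_replace => //; apply: unitC.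
  rewrite al0 mpolyC0 scale0r add0r; case: leqP => [le2|_]; last by rewrite scale0r => /nu0.
  have -> : (d1 - d2)%N = 0%N by apply/eqP; rewrite subn_eq0.
  rewrite (homog0_const (pihomogP (@mdeg n) 0 b)); set be := (_@_0%MM) => nuE'.
  have be0 : be != 0 by apply/eqP => be0; apply: nu0; rewrite nuE' be0 mpolyC0 scale0r.
  exists u; rewrite nuE' -[_ *: v]addr0 -(scale0r u).
  by apply: syz_basis_replace; [apply: unitC | apply: syz_basis_sym].
exists d1; split=> //.
  by exists u, (fun=> True); split=> //; apply: bourbaki_basis_exists uv Su Sv.
move=> nu I Snu nu0 hI; have [mu nm] := extend nu Snu nu0.
by apply: has_degree_full; apply: bourbaki_of_basis nm hI.
Qed.

End FreeSyzygies.

(** * The Buchsbaum-Rim complex *)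

Section Cofactors.
Variable A : comNzRingType.

Lemma eq_cofactor n (M N : 'M[A]_n) i j : (forall a b, a != i -> M a b = N a b) ->
  cofactor M i j = cofactor N i j.
Proof.
move=> e; rewrite /cofactor; congr (_ * \det _); apply/matrixP => a b.
by rewrite !mxE; apply: e; rewrite eq_sym neq_lift.
Qed.

Lemma det_replace_row n (M : 'M[A]_n) i j (N : 'M[A]_n) :
    (forall a b, a != i -> N a b = M a b) -> (forall b, N i b = (b == j)%:R) ->
  \det N = cofactor M i j.
Proof.
move=> eN eNi; rewrite (expand_det_row _ i) (bigD1 j) //= eNi eqxx mul1r big1 ?addr0.
  exact: eq_cofactor.
by move=> b ne; rewrite eNi (negPf ne) mul0r.
Qed.

End Cofactors.

Section BuchsbaumRim.
Variables (k : fieldType) (n : nat).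
Local Notation R := {mpoly k[n]}.
Implicit Types (Theta : 'M[R]_(2, 4)) (u w : 'rV[R]_4).

Definition br_mx Theta u w : 'M[R]_4 := col_mx u (col_mx w Theta).
Definition br_form Theta u w : R := \det (br_mx Theta u w).

Let r0 : 'I_4 := ord0.
Let r1 : 'I_4 := Ordinal (isT : (1 < 4)%N).
Let r2 : 'I_4 := Ordinal (isT : (2 < 4)%N).
Let r3 : 'I_4 := Ordinal (isT : (3 < 4)%N).

Lemma br_mx0 Theta u w j : br_mx Theta u w r0 j = u 0 j.
Proof.
have -> : r0 = lshift 3 (0 : 'I_1) by apply: val_inj.
exact: (@col_mxEu _ 1 3).
Qed.

Lemma br_mx1 Theta u w j : br_mx Theta u w r1 j = w 0 j.
Proof.
have -> : r1 = rshift 1 (lshift 2 (0 : 'I_1)) by apply: val_inj.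
by rewrite /br_mx (@col_mxEd _ 1 3) (@col_mxEu _ 1 2).
Qed.

Lemma br_mx2 Theta u w j : br_mx Theta u w r2 j = Theta 0 j.
Proof.
have -> : r2 = rshift 1 (rshift 1 (0 : 'I_2)) by apply: val_inj.
by rewrite /br_mx (@col_mxEd _ 1 3) (@col_mxEd _ 1 2).
Qed.

Lemma br_mx3 Theta u w j : br_mx Theta u w r3 j = Theta 1 j.
Proof.
have -> : r3 = rshift 1 (rshift 1 (1 : 'I_2)) by apply: val_inj.
by rewrite /br_mx (@col_mxEd _ 1 3) (@col_mxEd _ 1 2).
Qed.

Definition br_mxE := (br_mx0, br_mx1, br_mx2, br_mx3).

Lemma ord4P (i : 'I_4) : [\/ i = r0, i = r1, i = r2 | i = r3].
Proof.
by case: i => [[|[|[|[|]]]]] // lt_i; [constructor 1|constructor 2|constructor 3|constructor 4]; apply: val_inj.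
Qed.

Lemma sum4 (V : nmodType) (F : 'I_4 -> V) : \sum_i F i = F r0 + F r1 + F r2 + F r3.
Proof.
rewrite !big_ord_recr big_ord0 /= add0r; congr (F _ + F _ + F _ + F _); exact: val_inj.
Qed.

Lemma br_cof0 Theta u w i : cofactor (br_mx Theta u w) r0 i = br_form Theta (delta_mx 0 i) w.
Proof.
rewrite /br_form (@det_replace_row _ _ (br_mx Theta u w) r0 i) // => [a b|b].
  by case: (ord4P a) => -> //; rewrite !br_mxE.
by rewrite br_mxE mxE eqxx.
Qed.

Lemma br_cof1 Theta u w i : cofactor (br_mx Theta u w) r1 i = br_form Theta u (delta_mx 0 i).
Proof.
rewrite /br_form (@det_replace_row _ _ (br_mx Theta u w) r1 i) // => [a b|b].
  by case: (ord4P a) => -> //; rewrite !br_mxE.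
by rewrite br_mxE mxE eqxx.
Qed.

Lemma br_form_suml Theta u w : br_form Theta u w = \sum_i u 0 i * br_form Theta (delta_mx 0 i) w.
Proof.
rewrite {1}/br_form (expand_det_row _ r0); apply: eq_bigr => i _.
by rewrite br_mx0 br_cof0.
Qed.

Lemma br_form_sumr Theta u w : br_form Theta u w = \sum_i w 0 i * br_form Theta u (delta_mx 0 i).
Proof.
rewrite {1}/br_form (expand_det_row _ r1); apply: eq_bigr => i _.
by rewrite br_mx1 br_cof1.
Qed.

Lemma br_form_alt Theta u : br_form Theta u u = 0.
Proof.
by rewrite /br_form (@determinant_alternate _ _ _ r0 r1) // => j; rewrite !br_mxE.
Qed.

Lemma br_formDl Theta u u' w : br_form Theta (u + u') w = br_form Theta u w + br_form Theta u' w.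
Proof.
rewrite ![br_form _ _ w]br_form_suml -big_split; apply: eq_bigr => i _.
by rewrite mxE mulrDl.
Qed.

Lemma br_formDr Theta u w w' : br_form Theta u (w + w') = br_form Theta u w + br_form Theta u w'.
Proof.
rewrite ![br_form _ u _]br_form_sumr -big_split; apply: eq_bigr => i _.
by rewrite mxE mulrDl.
Qed.

Lemma br_formC Theta u w : br_form Theta u w = - br_form Theta w u.
Proof.
have := br_form_alt Theta (u + w).
rewrite br_formDl !br_formDr !br_form_alt add0r addr0 => /eqP.
by rewrite addr_eq0 => /eqP.
Qed.

Lemma BR_middleE Theta i l : BR_middle Theta i l = br_form Theta (delta_mx 0 i) (delta_mx 0 l).
Proof. by rewrite mxE. Qed.

Lemma br_form_mx Theta u w : (u *m BR_middle Theta *m w^T) 0 0 = br_form Theta u w.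
Proof.
rewrite br_form_sumr mxE; apply: eq_bigr => l _; rewrite mulrC [w^T l 0]mxE.
congr (_ * _); rewrite mxE br_form_suml; apply: eq_bigr => i _.
by rewrite BR_middleE.
Qed.

Lemma BR_middle_col Theta (x : 'cV[R]_4) i :
  (BR_middle Theta *m x) i 0 = br_form Theta (delta_mx 0 i) x^T.
Proof.
by rewrite -br_form_mx trmxK -mulmxA -rowE [RHS]mxE.
Qed.

Lemma br_form_row Theta a w : br_form Theta (row a Theta) w = 0.
Proof.
have [-> | ->] : a = 0 \/ a = 1.
- by case: a => [[|[|]]] // ?; [left|right]; apply: val_inj.
- by rewrite /br_form (@determinant_alternate _ _ _ r0 r2) // => j; rewrite !br_mxE mxE.
- by rewrite /br_form (@determinant_alternate _ _ _ r0 r3) // => j; rewrite !br_mxE mxE.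
Qed.

Lemma Theta_BR_middle Theta : Theta *m BR_middle Theta = 0.
Proof.
apply/matrixP => a l; rewrite [RHS]mxE -[RHS](br_form_row Theta a (delta_mx 0 l)) -br_form_mx.
by rewrite trmx_delta -[_ *m delta_mx _ _]colE -row_mul !mxE.
Qed.

Lemma BR_middle_tr Theta : (BR_middle Theta)^T = - BR_middle Theta.
Proof. by apply/matrixP => i j; rewrite mxE [RHS]mxE !BR_middleE br_formC. Qed.

Lemma BR_middle_Theta Theta : BR_middle Theta *m Theta^T = 0.
Proof.
apply: trmx_inj; rewrite trmx_mul trmxK BR_middle_tr mulmxN Theta_BR_middle.
by rewrite oppr0 trmx0.
Qed.

(** Cramer's rule: for the matrix N with rows u, w and those of Theta, the column N v has only two
    possibly nonzero entries, and adj(N) N v is det(N) v. With the two dual statements that follow,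
    this says that minors annihilate the homology of the Buchsbaum-Rim complex. *)
Lemma br_syz Theta u w (v : 'cV[R]_4) : Theta *m v = 0 ->
  br_form Theta u w *: v = BR_middle Theta *m ((u *m v) 0 0 *: w^T - (w *m v) 0 0 *: u^T).
Proof.
move=> Tv; have := mul_adj_mx (br_mx Theta u w).
move/(congr1 (fun X => X *m v)); rewrite mul_scalar_mx -mulmxA => /colP e.
apply/colP => i; rewrite -[LHS]e BR_middle_col linearB !linearZ /= !trmxK.
rewrite br_formDr scalerN -scaleNr.
have formZ a x : br_form Theta (delta_mx 0 i) (a *: x) = a * br_form Theta (delta_mx 0 i) x.
  rewrite ![br_form _ _ _]br_form_sumr mulr_sumr; apply: eq_bigr => l _.
  by rewrite mxE mulrA.
rewrite !formZ mulNr mxE sum4 !mxE ?br_cof0 ?br_cof1.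
have Tv0 : \sum_j br_mx Theta u w r2 j * v j 0 = 0.
  have /colP/(_ 0) := Tv; rewrite !mxE => E; rewrite -[RHS]E.
  by apply: eq_bigr => j _; rewrite br_mx2.
have Tv1 : \sum_j br_mx Theta u w r3 j * v j 0 = 0.
  have /colP/(_ 1) := Tv; rewrite !mxE => E; rewrite -[RHS]E.
  by apply: eq_bigr => j _; rewrite br_mx3.
have drop0 (a b c d : R) : a + b + c * 0 + d * 0 = a + b by rewrite !mulr0 !addr0.
rewrite Tv0 Tv1 drop0; congr (_ + _).
  by rewrite mulrC; congr (_ * _); apply: eq_bigr => j _; rewrite br_mx0.
rewrite br_formC mulNr mulrC; congr (- (_ * _)).
by apply: eq_bigr => j _; rewrite br_mx1.
Qed.

(** Expand p^T adj(N) N. The first two coordinates of p^T adj(N) are values of the alternating form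
    at p and vanish, so only the rows of Theta remain. *)
Lemma br_row Theta u w (p : 'cV[R]_4) : BR_middle Theta *m p = 0 ->
  exists r, br_form Theta u w *: p = Theta^T *m r.
Proof.
move=> Mp; pose c := p^T *m \adj (br_mx Theta u w).
have c0 : c 0 r0 = 0.
  rewrite mxE; under eq_bigr => i _ do rewrite [p^T _ _]mxE [X in _ * X]mxE br_cof0.
  transitivity (br_form Theta p^T w).
    by rewrite br_form_suml; apply: eq_bigr => i _; rewrite [p^T _ _]mxE.
  by rewrite br_formC -br_form_mx trmxK -mulmxA Mp mulmx0 mxE oppr0.
have c1 : c 0 r1 = 0.
  rewrite mxE; under eq_bigr => i _ do rewrite [p^T _ _]mxE [X in _ * X]mxE br_cof1.
  transitivity (br_form Theta u p^T).
    by rewrite br_form_sumr; apply: eq_bigr => i _; rewrite [p^T _ _]mxE.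
  by rewrite -br_form_mx trmxK -mulmxA Mp mulmx0 mxE.
exists (cvec 2 [:: c 0 r2; c 0 r3]).
have := congr1 (mulmx p^T) (mul_adj_mx (br_mx Theta u w)).
rewrite mulmxA -/c mul_mx_scalar => /rowP e; apply/colP => i.
have := e i; rewrite [RHS]mxE [X in _ = _ * X]mxE => E.
rewrite mxE -E mxE sum4 c0 c1 !mul0r !add0r.
rewrite [RHS]mxE !big_ord_recl big_ord0 addr0 ![Theta^T _ _]mxE ![cvec _ _ _ _]mxE /=.
by rewrite br_mx2 br_mx3 [c 0 r2 * _]mulrC [c 0 r3 * _]mulrC; congr (_ + Theta _ _ * _); apply: val_inj.
Qed.

Lemma br_coker (I : R -> Prop) Theta u w (r : 'cV[R]_2) : is_ideal I ->
    (forall i, I ((Theta^T *m r) i 0)) -> forall a, I (br_form Theta u w * r a 0).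
Proof.
move=> [I0 ID IM] Ir a.
pose c : 'cV[R]_4 := cvec 4 [:: 0; 0; r 0 0; r 1 0].
have pE : Theta^T *m r = (br_mx Theta u w)^T *m c.
  have trE a1 b1 : (br_mx Theta u w)^T a1 b1 = br_mx Theta u w b1 a1 by rewrite mxE.
  apply/colP => i; rewrite [RHS]mxE sum4 !trE br_mx2 br_mx3 ![c _ _]mxE /= !mulr0 !add0r.
  by rewrite mxE !big_ord_recl big_ord0 addr0 ![Theta^T _ _]mxE; congr (_ + Theta _ _ * r _ _); apply: val_inj.
have := congr1 (mulmx c^T) (mul_mx_adj (br_mx Theta u w)).
rewrite mulmxA mul_mx_scalar -[c^T *m _](_ : (Theta^T *m r)^T = _); last first.
  by rewrite pE trmx_mul trmxK.
move=> e; have key j : I (br_form Theta u w * c j 0).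
  have := congr1 (fun X : 'rV_4 => X 0 j) e; rewrite mxE [RHS]mxE [X in _ = _ * X]mxE => <-.
  elim/big_ind: _ => // i _; rewrite [X in X * _]mxE mulrC; apply: IM; exact: Ir.
have [-> | ->] : a = 0 \/ a = 1.
- by case: a => [[|[|]]] // ?; [left|right]; apply: val_inj.
- by have := key r2; rewrite mxE.
- by have := key r3; rewrite mxE.
Qed.

Definition in_minors Theta (f : R) :=
  exists C : 'M[R]_4, f = \sum_i \sum_l C i l * br_form Theta (delta_mx 0 i) (delta_mx 0 l).

Definition BR_exact Theta :=
  [/\ forall v : 'cV_4, Theta *m v = 0 -> exists t, v = BR_middle Theta *m t,
      forall p : 'cV_4, BR_middle Theta *m p = 0 -> exists r, p = Theta^T *m r
    & forall r : 'cV_2, Theta^T *m r = 0 -> r = 0].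

(** The acyclicity lemma by hand: f, g, h is a regular sequence of elements that annihilate the
    homology. Injectivity at the end of the complex uses f, the next place uses f and g, the last
    one uses all three. *)
Lemma BR_exact_criterion Theta f g h :
    in_minors Theta f -> in_minors Theta g -> in_minors Theta h -> f != 0 ->
    (forall x, rdvd f (g * x) -> rdvd f x) ->
    (forall x, (exists a b, h * x = a * f + b * g) -> exists a b, x = a * f + b * g) ->
  BR_exact Theta.
Proof.
move=> mf mg mh f0 fg fgh.
pose M := BR_middle Theta.
have im_M x (v : 'cV[R]_4) : in_minors Theta x -> Theta *m v = 0 -> exists t, x *: v = M *m t.
  move=> [C ->] Tv.
  pose t (i l : 'I_4) : 'cV[R]_4 := ((delta_mx 0 i : 'rV_4) *m v) 0 0 *: (delta_mx 0 l : 'rV_4)^T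
    - ((delta_mx 0 l : 'rV_4) *m v) 0 0 *: (delta_mx 0 i : 'rV_4)^T.
  exists (\sum_i \sum_l C i l *: t i l).
  rewrite mulmx_sumr scaler_suml; apply: eq_bigr => i _.
  rewrite mulmx_sumr scaler_suml; apply: eq_bigr => l _.
  by rewrite -scalemxAr -scalerA (br_syz _ _ Tv).
have im_T x (p : 'cV[R]_4) : in_minors Theta x -> M *m p = 0 -> exists t, x *: p = Theta^T *m t.
  move=> [C ->] Mp.
  have tP i l : {t | br_form Theta (delta_mx 0 i) (delta_mx 0 l) *: p = Theta^T *m t}.
    by apply: constructive_indefinite_description; apply: br_row.
  exists (\sum_i \sum_l C i l *: sval (tP i l)).
  rewrite mulmx_sumr scaler_suml; apply: eq_bigr => i _.
  rewrite mulmx_sumr scaler_suml; apply: eq_bigr => l _.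
  by rewrite -scalemxAr -scalerA; congr (_ *: _); exact: proj2_sig (tP i l).
have coker (I : R -> Prop) x (r : 'cV[R]_2) : is_ideal I -> in_minors Theta x ->
    (forall i, I ((Theta^T *m r) i 0)) -> forall a, I (x * r a 0).
  move=> II [C ->] Ir a; have [I0 ID IM] := II.
  rewrite mulr_suml; elim/big_ind: _ => // i _; rewrite mulr_suml; elim/big_ind: _ => // l _.
  by rewrite -mulrA; apply: IM; apply: br_coker.
have injT (r : 'cV[R]_2) : Theta^T *m r = 0 -> r = 0.
  move=> Tr; apply/colP => a; rewrite mxE.
  have : f * r a 0 = 0.
    apply: (coker (fun x => x = 0)) mf _ a; last by move=> i; rewrite Tr mxE.
    by split=> // [x y -> ->|x y ->]; rewrite ?addr0 ?mulr0.
  by move/eqP; rewrite mulf_eq0 (negPf f0) => /eqP.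
have exM (p : 'cV[R]_4) : M *m p = 0 -> exists r, p = Theta^T *m r.
  move=> Mp; have [s fE] := im_T f p mf Mp; have [s' gE] := im_T g p mg Mp.
  have e : g *: s = f *: s'.
    apply/eqP; rewrite -subr_eq0; apply/eqP/injT.
    by rewrite mulmxBr -!scalemxAr -fE -gE !scalerA mulrC subrr.
  have sP a : {q | s a 0 = q * f}.
    apply: constructive_indefinite_description; apply: fg.
    by have /colP/(_ a) := e; rewrite !mxE => ->; exists (s' a 0); rewrite mulrC.
  exists (\col_a sval (sP a)); apply/eqP; rewrite -subr_eq0; apply/eqP.
  have : f *: (p - Theta^T *m (\col_a sval (sP a))) = 0.
    rewrite scalerBr fE scalemxAr -mulmxBr; suff -> : f *: (\col_a sval (sP a)) = s by rewrite subrr mulmx0.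
    by apply/colP => a; rewrite !mxE mulrC; case: (sP a).
  move/colP => z; apply/colP => i; have := z i; rewrite [LHS]mxE [RHS]mxE => /eqP.
  by rewrite mulf_eq0 (negPf f0) => /eqP ->; rewrite mxE.
split=> // v Tv; have [p fE] := im_M f v mf Tv; have [q gE] := im_M g v mg Tv.
have [r rE] : exists r, g *: p - f *: q = Theta^T *m r.
  by apply: exM; rewrite mulmxBr -!scalemxAr -fE -gE !scalerA mulrC subrr.
(* [h] shows that r has entries in (f, g). Correcting p and q accordingly gives g p' = f q', so p'
   is divisible by f. *)
pose I x := exists a b, x = a * f + b * g.
have II : is_ideal I.
  split=> [|x y [a [b ->]] [a' [b' ->]]|x y [a [b ->]]].
  - by exists 0, 0; rewrite !mul0r addr0.
  - by exists (a + a'), (b + b'); ring.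
  - by exists (x * a), (x * b); ring.
have rI a : I (r a 0).
  apply: fgh; apply: (coker I) mh _ a => // i.
  by rewrite -rE !mxE; exists (- q i 0), (p i 0); ring.
have rP a : {c : R * R | r a 0 = c.1 * f + c.2 * g}.
  by apply: constructive_indefinite_description; have [b [c e]] := rI a; exists (b, c).
pose r1' : 'cV[R]_2 := \col_a (sval (rP a)).2; pose r2' : 'cV[R]_2 := \col_a (sval (rP a)).1.
have rE2 : r = g *: r1' + f *: r2'.
  by apply/colP => a; rewrite !mxE addrC [g * _]mulrC [f * _]mulrC; case: (rP a).
have e : g *: (p - Theta^T *m r1') = f *: (q + Theta^T *m r2').
  rewrite scalerBr scalerDr !scalemxAr; apply/eqP; rewrite subr_eq addrAC -addrA -subr_eq0.
  move/eqP: rE; rewrite -subr_eq0 rE2 mulmxDr => /eqP <-; apply/eqP.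
  by rewrite !opprD !addrA.
have sP a : {c | (p - Theta^T *m r1') a 0 = c * f}.
  apply: constructive_indefinite_description; apply: fg.
  have /colP/(_ a) := e; rewrite [LHS]mxE [RHS]mxE => ->.
  by exists ((q + Theta^T *m r2') a 0); rewrite mulrC.
pose t : 'cV[R]_4 := \col_a sval (sP a).
have tE : f *: t = p - Theta^T *m r1'.
  by apply/colP => a; rewrite [LHS]mxE [t a 0]mxE mulrC; case: (sP a).
exists t; apply/eqP; rewrite -subr_eq0; apply/eqP.
have : f *: (v - M *m t) = 0.
  by rewrite scalerBr fE scalemxAr tE mulmxBr mulmxA BR_middle_Theta mul0mx subr0 subrr.
move/colP => z; apply/colP => i; have := z i; rewrite [LHS]mxE [RHS]mxE => /eqP.
by rewrite mulf_eq0 (negPf f0) => /eqP ->; rewrite mxE.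
Qed.

End BuchsbaumRim.

(** * Lifting exactness from a quotient by linear forms *)

Section Lifting.
Variables (k : fieldType) (n : nat).
Local Notation R := {mpoly k[n]}.
Local Notation hc d p := (pihomog (@mdeg n) d p).

Definition homog_mx p q d (B : 'M[R]_(p, q)) := forall i j, B i j \is d.-homog.

Definition pih_mx p q d (B : 'M[R]_(p, q)) : 'M[R]_(p, q) := map_mx (pihomog (@mdeg n) d) B.

Lemma pih_mx_homog p q d (B : 'M[R]_(p, q)) : homog_mx d (pih_mx d B).
Proof. by move=> i j; rewrite mxE; apply: pihomogP. Qed.

Lemma pih_mx_id p q d (B : 'M[R]_(p, q)) : homog_mx d B -> pih_mx d B = B.
Proof. by move=> Bd; apply/matrixP => i j; rewrite mxE pihomog_dE. Qed.

Lemma pih_mxM p q r b d (B : 'M[R]_(p, q)) (z : 'M[R]_(q, r)) : homog_mx b B ->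
  pih_mx (d + b) (B *m z) = B *m pih_mx d z.
Proof.
move=> Bb; apply/matrixP => i j; rewrite !mxE raddf_sum; apply: eq_bigr => l _ /=.
by rewrite mxE mulrC (pihomogM _ _ (Bb i l)) mulrC.
Qed.

Lemma pih_mxM_lt p q r b d (B : 'M[R]_(p, q)) (z : 'M[R]_(q, r)) : homog_mx b B ->
  (d < b)%N -> pih_mx d (B *m z) = 0.
Proof.
move=> Bb lt; apply/matrixP => i j; rewrite !mxE raddf_sum big1 // => l _ /=.
by rewrite mulrC (pihomogM_lt _ (Bb i l)).
Qed.

Lemma pih_mx_sum p q (B : 'M[R]_(p, q)) : exists N, B = \sum_(d < N) pih_mx d B.
Proof.
exists (\max_(i < p) \max_(j < q) msize (B i j))%N; apply/matrixP => i j.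
rewrite summxE; under eq_bigr do rewrite mxE.
apply: pihomog_partitionE; apply: leq_trans (leq_bigmax i).
exact: (leq_bigmax j).
Qed.

Lemma in_forms_pihomog r (A : 'M[k]_(r, n)) f d : in_forms A f -> in_forms A (hc d f).
Proof.
move=> [c ->]; case: d => [|d].
  exists (fun=> 0); rewrite raddf_sum; apply: eq_bigr => i _ /=.
  by rewrite mul0r (pihomogM_lt _ (lform_homog _)).
exists (fun i => hc d (c i)); rewrite raddf_sum; apply: eq_bigr => i _ /=.
by rewrite -addn1 (pihomogM _ _ (lform_homog _)).
Qed.

Lemma in_forms_col_mx r (a : 'rV[k]_n) (A : 'M[k]_(r, n)) f :
  in_forms (col_mx a A) f -> exists x, in_forms A (f - lform a * x).
Proof.
move=> [c ->]; exists (c (lshift r 0)), (fun i => c (rshift 1 i)).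
rewrite (@big_split_ord _ _ _ 1 r) /= big_ord1.
have -> : row (lshift r 0) (col_mx a A) = a by apply/rowP => j; rewrite mxE col_mxEu.
rewrite mulrC addrAC subrr add0r; apply: eq_bigr => i _.
by congr (_ * lform _); apply/rowP => j; rewrite mxE [RHS]mxE; exact: (col_mxEd a A).
Qed.

Lemma in_forms_colr r (a : 'rV[k]_n) (A : 'M[k]_(r, n)) f :
  in_forms A f -> in_forms (col_mx a A) f.
Proof.
move=> [c ->]; exists (fun i => match split i with inl _ => 0 | inr j => c j end).
rewrite (@big_split_ord _ _ _ 1 r) /= big_ord1 (unsplitK (inl ord0)) mul0r add0r.
apply: eq_bigr => i _; rewrite (unsplitK (inr i)).
by congr (_ * lform _); apply/rowP => j; rewrite mxE [RHS]mxE; exact/esym/(col_mxEd a A).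
Qed.

Definition in_formsV r (A : 'M[k]_(r, n)) m (v : 'cV[R]_m) := forall i, in_forms A (v i 0).

Lemma in_formsV_mul r (A : 'M[k]_(r, n)) p q (B : 'M[R]_(p, q)) (v : 'cV[R]_q) :
  in_formsV A v -> in_formsV A (B *m v).
Proof.
have [I0 ID IM] := in_forms_ideal A.
by move=> Iv i; rewrite mxE; elim/big_ind: _ => // j _; apply: IM.
Qed.

Lemma in_formsVD r (A : 'M[k]_(r, n)) m (u v : 'cV[R]_m) :
  in_formsV A u -> in_formsV A v -> in_formsV A (u + v).
Proof. by have [I0 ID IM] := in_forms_ideal A; move=> Iu Iv i; rewrite mxE; apply: ID. Qed.

Lemma in_formsVN r (A : 'M[k]_(r, n)) m (u : 'cV[R]_m) :
  in_formsV A u -> in_formsV A (- u).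
Proof.
have [I0 ID IM] := in_forms_ideal A.
by move=> Iu i; rewrite mxE -mulN1r; apply: IM.
Qed.

(** Exactness modulo the ideal of A. Only homogeneous columns are tested, so that the degree is
    available for induction. *)
Definition exact_mod r (A : 'M[k]_(r, n)) p q s (B : 'M[R]_(p, q)) (C : 'M[R]_(q, s)) :=
  forall d (z : 'cV[R]_q), homog_mx d z -> in_formsV A (B *m z) ->
    exists w, in_formsV A (z - C *m w).

(* Nakayama: modulo [A] the form [lform a] is a nonzerodivisor, so an obstruction
   of degree d is divisible by it and yields one of degree d - 1. *)
Lemma exact_mod_step r (a : 'rV[k]_n) (A : 'M[k]_(r, n)) p q s b c
    (B : 'M[R]_(p, q)) (C : 'M[R]_(q, s)) :
    row_free (col_mx a A) -> homog_mx b B -> homog_mx c C -> B *m C = 0 ->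
  exact_mod (col_mx a A) B C -> exact_mod A B C.
Proof.
move=> freeA Bb Cc BC ex d; have [I0 ID IM] := in_forms_ideal A.
have freeA' : row_free A.
  have /row_freeP[D] := freeA; rewrite -[D]hsubmxK mul_col_row => e.
  apply/row_freeP; exists (rsubmx D).
  by move: e; rewrite (@scalar_mx_block _ 1 r) => /eq_block_mx[].
have [_ _ A_prime] := in_forms_prime freeA'.
have nAl : ~ in_forms A (lform a).
  move/(in_forms_lform freeA') => le_aA.
  have := mxrankS (_ : (col_mx a A <= A)%MS); rewrite col_mx_sub le_aA submx_refl.
  by move=> /(_ isT); rewrite (eqP freeA) (eqP freeA') ltnn.
have pihC e (w : 'cV[R]_s) : exists w', pih_mx e (C *m w) = C *m w'.
  have [le|lt] := leqP c e; last by exists 0; rewrite mulmx0 (pih_mxM_lt _ Cc).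
  by exists (pih_mx (e - c) w); rewrite -(pih_mxM _ _ Cc) subnK.
have pih_in e m (v : 'cV[R]_m) : in_formsV A v -> in_formsV A (pih_mx e v).
  by move=> Iv i; rewrite mxE; apply: in_forms_pihomog.
have pihB e m (u v : 'cV[R]_m) : pih_mx e (u - v) = pih_mx e u - pih_mx e v.
  by apply/colP => i; rewrite !mxE raddfB.
have start e (z : 'cV[R]_q) : homog_mx e z -> in_formsV A (B *m z) ->
    exists w (x : 'cV[R]_q), in_formsV A (z - C *m w - pih_mx e (lform a *: x)).
  move=> ze Bz; have [w hw] := ex e z ze (fun i => in_forms_colr a (Bz i)).
  have xP i : {x | in_forms A ((z - C *m w) i 0 - lform a * x)}.
    by apply: constructive_indefinite_description; apply: in_forms_col_mx.
  have hx : in_formsV A (z - C *m w - lform a *: \col_i sval (xP i)).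
    move=> i; have := proj2_sig (xP i); set x := proj1_sig _; congr in_forms.
    by rewrite mxE [RHS]mxE; congr (_ + _); rewrite !mxE.
  have [w' w'E] := pihC e w.
  exists w', (\col_i sval (xP i)).
  by have := pih_in e _ _ hx; rewrite !pihB (pih_mx_id ze) w'E.
elim: d => [|d IHd] z zd Bz; have [w [x hx]] := start _ z zd Bz.
  exists w; move: hx.
  suff -> : pih_mx 0 (lform a *: x) = 0 by rewrite subr0.
  by apply/colP => i; rewrite !mxE mulrC (pihomogM_lt _ (lform_homog _)).
have lE : pih_mx d.+1 (lform a *: x) = lform a *: pih_mx d x.
  apply/colP => i; rewrite !mxE mulrC -addn1 (pihomogM _ _ (lform_homog _)).
  exact: mulrC.
rewrite lE in hx.
have Bx : in_formsV A (B *m pih_mx d x).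
  have hx' : in_formsV A (lform a *: (B *m pih_mx d x)).
    have -> : lform a *: (B *m pih_mx d x)
        = B *m z - B *m (z - C *m w - lform a *: pih_mx d x).
      rewrite !mulmxBr mulmxA BC mul0mx subr0 -scalemxAr.
      by rewrite opprB addrC subrK.
    apply: in_formsVD => //; apply: in_formsVN; exact: in_formsV_mul.
  by move=> i; have := hx' i; rewrite mxE => /A_prime[/nAl|].
have [w' hw'] := IHd _ (@pih_mx_homog _ _ d x) Bx.
exists (w + lform a *: w').
have -> : z - C *m (w + lform a *: w')
   = (z - C *m w - lform a *: pih_mx d x) + lform a *: (pih_mx d x - C *m w').
  by rewrite scalerBr mulmxDr -scalemxAr opprD !addrA subrK.
apply: in_formsVD => //; move=> i; rewrite mxE; apply: IM; exact: hw'.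
Qed.

Lemma exact_mod0 r (A : 'M[k]_(r, n)) p q s b c (B : 'M[R]_(p, q)) (C : 'M[R]_(q, s)) :
    row_free A -> homog_mx b B -> homog_mx c C -> B *m C = 0 ->
  exact_mod A B C -> exact_mod (0 : 'M[k]_(0, n)) B C.
Proof.
elim: r A => [|r IHr] A freeA Bb Cc BC ex.
  by rewrite -[0](flatmx0 A).
have AE : A = col_mx (usubmx (A : 'M_(1 + r, n))) (dsubmx (A : 'M_(1 + r, n))) by rewrite vsubmxK.
have freeA' : row_free (col_mx (usubmx (A : 'M_(1 + r, n))) (dsubmx (A : 'M_(1 + r, n)))).
  by rewrite vsubmxK.
apply: (IHr (dsubmx (A : 'M_(1 + r, n)))) => //; last first.
  by apply: exact_mod_step freeA' Bb Cc BC _; rewrite vsubmxK.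
have /row_freeP[D] := freeA'; rewrite -[D](@hsubmxK _ _ 1 r) mul_col_row.
by rewrite (@scalar_mx_block _ 1 r) => /eq_block_mx[_ _ _ e]; apply/row_freeP; exists (rsubmx (D : 'M_(n, 1 + r))).
Qed.

Lemma exact_of_mod0 p q s b (B : 'M[R]_(p, q)) (C : 'M[R]_(q, s)) : homog_mx b B ->
  exact_mod (0 : 'M[k]_(0, n)) B C -> forall z : 'cV_q, B *m z = 0 -> exists w, z = C *m w.
Proof.
move=> Bb ex z Bz.
have zP d : {w | pih_mx d z = C *m w}.
  apply: constructive_indefinite_description.
  have [|w hw] := ex d (pih_mx d z) (pih_mx_homog _ _).
    move=> i; rewrite -(pih_mxM _ _ Bb) Bz !mxE raddf0.
    by have [] := in_forms_ideal (0 : 'M[k]_(0, n)).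
  exists w; apply/eqP; rewrite -subr_eq0; apply/eqP/colP => i.
  by have [c ->] := hw i; rewrite big_ord0 mxE.
have [N ->] := pih_mx_sum z; exists (\sum_(d < N) sval (zP d)).
rewrite mulmx_sumr; apply: eq_bigr => d _; exact: proj2_sig (zP d).
Qed.

(** Exactness after the substitution [pr] is exactness modulo the forms in A; these are then
    released one at a time. *)
Lemma lift_exact r (A : 'M[k]_(r, n)) (D : 'M[k]_(n, r)) p q s b c
    (B : 'M[R]_(p, q)) (C : 'M[R]_(q, s)) (pr := lsubst (kill_mx A D)) :
    A *m D = 1%:M -> homog_mx b B -> homog_mx c C -> B *m C = 0 ->
    (forall z : 'cV_q, map_mx pr B *m z = 0 -> exists w, z = map_mx pr C *m w) ->
  forall z : 'cV_q, B *m z = 0 -> exists w, z = C *m w.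
Proof.
move=> AD Bb Cc BC ex; apply: (exact_of_mod0 Bb).
have freeA : row_free A by apply/row_freeP; exists D.
apply: (exact_mod0 freeA Bb Cc BC) => d z _ Bz.
have [I0 ID IM] := in_forms_ideal A.
have [|w wE] := ex (map_mx pr z).
  rewrite -map_mxM; apply/colP => i; rewrite !mxE.
  by have /(kill_eq0 AD) := Bz i; rewrite mxE.
have prI m1 m2 (X : 'M[R]_(m1, m2)) i j : in_forms A ((X - map_mx pr X) i j).
  by rewrite !mxE; apply: kill_sub.
exists w; have -> : z - C *m w = (z - map_mx pr z) - (C - map_mx pr C) *m w.
  by rewrite mulmxBl -wE opprB addrA subrK.
apply: in_formsVD; first by move=> i; apply: prI.
apply: in_formsVN => i; rewrite mxE; elim/big_ind: _ => // j _.
by rewrite mulrC; apply: IM; apply: prI.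
Qed.

End Lifting.

Section BRType.
Variables (k : fieldType) (n : nat).
Local Notation R := {mpoly k[n]}.
Variable Theta : 'M[R]_(2, 4).
Hypothesis Theta_lin : homog_mx 1 Theta.

Lemma homog_prod_ord m (F : 'I_m -> R) (d : 'I_m -> nat) :
  (forall i, F i \is (d i).-homog) -> \prod_i F i \is (\sum_i d i).-homog.
Proof.
move=> Fd; elim/big_rec2: _ => [|i x y _ hx]; first exact: dhomog1.
exact: dhomogM.
Qed.

Lemma homog_BR_middle : homog_mx 2 (BR_middle Theta).
Proof.
move=> i l; rewrite BR_middleE /br_form /determinant; apply: rpred_sum => s _.
suff h (t : 'I_4 -> 'I_4) : \prod_j br_mx Theta (delta_mx 0 i) (delta_mx 0 l) j (t j) \is 2.-homog.
  by rewrite mulr_sign; case: ifP => _; rewrite ?rpredN; apply: h.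
pose dg (j : 'I_4) := (if (j < 2)%N then 0 else 1)%N.
have dgE : (\sum_(j < 4) dg j)%N = 2%N by rewrite !big_ord_recl big_ord0.
have := @homog_prod_ord _ (fun j => br_mx Theta (delta_mx 0 i) (delta_mx 0 l) j (t j)) dg.
rewrite dgE; apply => j; case: (ord4P j) => ->; rewrite ?br_mxE /=.
- by rewrite mxE; case: (_ && _); rewrite ?dhomog1 ?rpred0.
- by rewrite mxE; case: (_ && _); rewrite ?dhomog1 ?rpred0.
- exact: Theta_lin.
- exact: Theta_lin.
Qed.

Lemma homog_tr p q d (B : 'M[R]_(p, q)) : homog_mx d B -> homog_mx d B^T.
Proof. by move=> Bd i j; rewrite mxE. Qed.

Lemma map_BR_middle (f : {rmorphism R -> R}) : map_mx f (BR_middle Theta) = BR_middle (map_mx f Theta).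
Proof.
apply/matrixP => i l; rewrite mxE !BR_middleE /br_form -det_map_mx; congr (\det _).
apply/matrixP => a b; case: (ord4P a) => ->; rewrite mxE !br_mxE ?mxE //;
by case: (_ && _); rewrite ?rmorph1 ?rmorph0.
Qed.

Lemma BR_exact_lift r (A : 'M[k]_(r, n)) (D : 'M[k]_(n, r)) : A *m D = 1%:M ->
  BR_exact (map_mx (lsubst (kill_mx A D)) Theta) -> BR_exact Theta.
Proof.
move=> AD [ex1 ex2 ex3]; have Mh := homog_BR_middle; have Th := homog_tr Theta_lin.
split.
- apply: (lift_exact AD Theta_lin Mh (Theta_BR_middle Theta)) => z.
  by rewrite map_BR_middle; apply: ex1.
- apply: (lift_exact AD Mh Th (BR_middle_Theta Theta)) => z.
  by rewrite map_BR_middle -map_trmx; apply: ex2.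
(* Injectivity of the transpose is treated as exactness with an empty matrix to its right. *)
move=> z Tz; suff [w ->] : exists w : 'cV[R]_0, z = (0 : 'M_(2, 0)) *m w by rewrite mul0mx.
have h0 : homog_mx 0 (0 : 'M[R]_(2, 0)) by move=> i [].
apply: (lift_exact AD Th h0 _ _ Tz) => [|z']; first by rewrite mulmx0.
by rewrite -map_trmx => /ex3 ->; exists 0; rewrite mulmx0.
Qed.

Lemma BR_type_of_exact : BR_exact Theta -> BR_type Theta.
Proof.
move=> [ex1 ex2 ex3]; have Mh := homog_BR_middle.
have lt4 (s : seq int) (p : 'I_4) : (p < 4)%N by [].
split.
- split=> [p q|].
    have -> : ((BR_degrees 0)`_q + 1) = 0 by case: q => [[|[|]]].
    by rewrite /= mxE; case: eqP => _; rewrite ?dhomog1 ?rpred0.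
  case=> [|[|[|i]]] p q /=; last by case: q.
  + have -> : [:: -1; -1]%Z`_p = -1 by case: p => [[|[|]]].
    have -> : [:: 0; 0; 0; 0]%Z`_q = 0 by case: q => [[|[|[|[|]]]]].
    exact: Theta_lin.
  + have -> : [:: 0; 0; 0; 0]%Z`_p = 0 by case: p => [[|[|[|[|]]]]].
    have -> : [:: 2; 2; 2; 2]%Z`_q = 2 by case: q => [[|[|[|[|]]]]].
    exact: Mh.
  + have -> : [:: 2; 2; 2; 2]%Z`_p = 2 by case: p => [[|[|[|[|]]]]].
    have -> : [:: 3; 3]%Z`_q = 3 by case: q => [[|[|]]].
    by rewrite mxE; apply: Theta_lin.
- case=> [|[|[|i]]] p q /=; last by case: q.
  + exact: homog_coef0 (Theta_lin _ _).
  + exact: homog_coef0 (Mh _ _).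
  + by rewrite mxE; apply: homog_coef0 (Theta_lin _ _).
- by move=> w; exists w, 0; rewrite mul1mx mulmx0 addr0.
- move=> u; rewrite mul1mx /=; split=> -[v ->]; by exists v.
case=> [|[|[|i]]] /= u.
- split=> [/ex1//|[t ->]]; by rewrite mulmxA Theta_BR_middle mul0mx.
- split=> [/ex2//|[t ->]]; by rewrite mulmxA BR_middle_Theta mul0mx.
- split=> [/ex3 ->|[t ->]]; first by exists 0; rewrite mulmx0.
  by rewrite mul0mx mulmx0.
split=> _; last by rewrite mul0mx.
by exists 0; rewrite [u]flatmx0 mul0mx.
Qed.

End BRType.

(** * Bourbaki degree read off a resolution *)

Section BRBourbaki.
Variables (k : fieldType).

Lemma dim_syz n (Theta : 'M[{mpoly k[n.+1]}]_(2, 4)) q r s (A2 : 'M_(4, q)) (A3 : 'M_(q, r))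
    (A4 : 'M_(r, s)) (t2 : 'I_q -> nat) (t3 : 'I_r -> nat) (t4 : 'I_s -> nat) d :
    (forall i j, A2 i j \is (t2 j).-homog) ->
    (forall i j, A3 i j = 0 \/ (t2 i <= t3 j)%N /\ A3 i j \is (t3 j - t2 i).-homog) ->
    (forall i j, A4 i j = 0 \/ (t3 i <= t4 j)%N /\ A4 i j \is (t4 j - t3 i).-homog) ->
    (forall u : 'cV_4, Theta *m u = 0 <-> exists w, u = A2 *m w) ->
    (forall u : 'cV_q, A2 *m u = 0 <-> exists w, u = A3 *m w) ->
    (forall u : 'cV_r, A3 *m u = 0 <-> exists w, u = A4 *m w) ->
    (forall u : 'cV_s, A4 *m u = 0 -> u = 0) ->
    (forall j, (t2 j <= d)%N) -> (forall j, (t3 j <= d)%N) -> (forall j, (t4 j <= d)%N) ->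
  let S m (t : 'I_m -> nat) := (\sum_j 'C(d - t j + n, n))%N in
  [/\ basis_mod (syz_piece Theta d) (@zero_sub k _) (S _ t2 - (S _ t3 - S _ t4)),
      (S _ t4 <= S _ t3)%N & (S _ t3 - S _ t4 <= S _ t2)%N].
Proof.
move=> h2 h3 h4 ex1 ex2 ex3 ex4 le2 le3 le4 S.
have K4 : basis_mod (fun w => graded t4 d w /\ A4 *m colf w = 0) (@zero_sub k _) 0.
  apply: basis_mod_iff (basis_mod_refl (subspace_zero _)) => // w.
  split=> [->|[_ /ex4 e]]; last first.
    by apply: colf_inj; rewrite e; apply/colP => i; rewrite !mxE ffunE.
  split; first by have [] := @subspace_graded k n s t4 d.
  by apply/colP => i; rewrite !mxE big1 // => j _; rewrite mxE ffunE mulr0.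
have [I4 _] := basis_mod_im h4 le4 K4; rewrite subn0 in I4.
have K3 : basis_mod (fun w => graded t3 d w /\ A3 *m colf w = 0) (@zero_sub k _) (S _ t4).
  by apply: basis_mod_iff I4 => // w; split=> -[gw /ex3].
have [I3 le_43] := basis_mod_im h3 le3 K3.
have K2 : basis_mod (fun w => graded t2 d w /\ A2 *m colf w = 0) (@zero_sub k _) (S _ t3 - S _ t4).
  by apply: basis_mod_iff I3 => // w; split=> -[gw /ex2].
have h2' i j : A2 i j = 0 \/ (0 <= t2 j)%N /\ A2 i j \is (t2 j - 0).-homog.
  by right; rewrite subn0.
have [I2 le_32] := basis_mod_im (s := fun=> 0%N) h2' le2 K2.
split=> //; apply: basis_mod_iff I2 => // w; split=> [[gw /ex1 Sw]|[Sw wd]].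
  by split=> // i; have := gw i; rewrite subn0 mxE.
split; last exact/ex1.
by move=> i; have := wd i; rewrite subn0 mxE.
Qed.

Lemma syz_low n (Theta : 'M[{mpoly k[n]}]_(2, 4)) q (A2 : 'M_(4, q)) e :
    (forall i j, exists2 t, (e <= t)%N & A2 i j \is t.-homog) ->
    (forall u : 'cV_4, Theta *m u = 0 -> exists w, u = A2 *m w) ->
  forall d v, (d < e)%N -> Syz_deg Theta d v -> v = 0.
Proof.
move=> h2 ex1 d v lt_d [/ex1[w ->] vd]; apply/colP => i; rewrite [RHS]mxE.
rewrite -(pihomog_dE (vd i)) mxE raddf_sum big1 // => j _ /=.
have [t le_t At] := h2 i j; rewrite mulrC (pihomogM_lt _ At) //.
exact: leq_trans lt_d le_t.
Qed.

(** Pascal's rule twice. It trades dimensions in a ring with m + 3 variables for those in a ring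
    with m + 1 variables, the size of a quotient by an ideal of height two. *)
Lemma bin_diff2 m d : ('C(d.+2 + m.+2, m.+2) + 'C(d + m.+2, m.+2)
  = 2 * 'C(d.+1 + m.+2, m.+2) + 'C(d.+2 + m, m))%N.
Proof.
rewrite !addSn !addnS !binS; lia.
Qed.

Section Parallel.
Variables (n : nat).
Local Notation R := {mpoly k[n]}.
Variable Theta : 'M[R]_(2, 4).
Local Notation M := (BR_middle Theta).

Lemma BR_middle_anti i j : M i j = - M j i.
Proof. by rewrite !BR_middleE br_formC. Qed.

Lemma syz_minor (v : 'cV[R]_4) a b i : Syz Theta v ->
  M a b * v i 0 = v a 0 * M i b - v b 0 * M i a.
Proof.
move=> Sv; have := br_syz (delta_mx 0 a) (delta_mx 0 b) Sv.
move/(congr1 (fun X : 'cV_4 => X i 0)); rewrite mxE -BR_middleE => ->.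
rewrite -!rowE !trmx_delta mulmxBr -!scalemxAr -!colE.
by rewrite !mxE.
Qed.

(** Syz has rank two, so the wedge of two syzygies is proportional to the vector of complementary
    minors. Applying Cramer's rule three times gives this without a division. *)
Lemma wedge_minor (u v : 'cV[R]_4) a b i j : Syz Theta u -> Syz Theta v ->
  M a b * wedge u v i j = wedge u v a b * M i j.
Proof.
move=> Su Sv.
have e1 : M a b * wedge u v i j = (M a b * u i 0) * v j 0 - (M a b * u j 0) * v i 0.
  by rewrite /wedge; ring.
rewrite e1 (syz_minor a b i Su) (syz_minor a b j Su).
have h1 := syz_minor j b i Sv; have h2 := syz_minor j a i Sv.
have e2 : M i b * v j 0 - M j b * v i 0 = v b 0 * M i j by rewrite h1; ring.
have e3 : M i a * v j 0 - M j a * v i 0 = v a 0 * M i j by rewrite h2; ring.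
transitivity (u a 0 * (M i b * v j 0 - M j b * v i 0) - u b 0 * (M i a * v j 0 - M j a * v i 0)).
  by ring.
by rewrite e2 e3 /wedge; ring.
Qed.

Lemma delta_of_minors (g : R) (delta : 'I_4 -> 'I_4 -> R) a b :
    (forall i j, M i j = g * delta i j) -> M a b != 0 ->
    (forall p, prime_elt p -> exists i j, ~ rdvd p (delta i j)) ->
  forall u v, Syz Theta u -> Syz Theta v ->
  exists psi, forall i j, wedge u v i j = psi * delta i j.
Proof.
move=> ME Mab prim u v Su Sv.
have := Mab; rewrite ME mulf_eq0 => /norP[g0 d0].
have key i j : delta a b * wedge u v i j = wedge u v a b * delta i j.
  have := wedge_minor a b i j Su Sv; rewrite !ME => e.
  by apply: (mulfI g0); rewrite mulrA e; ring.
have [psi psiE] : rdvd (delta a b) (wedge u v a b).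
  apply: (rdvd_family (f := fun ij : 'I_4 * 'I_4 => delta ij.1 ij.2) (@mpoly_ufd _ _) d0).
    by move=> p /prim[i [j nd]]; exists (i, j).
  by case=> i j /=; exists (wedge u v i j); rewrite -key mulrC.
exists psi => i j; apply: (mulfI d0); rewrite key psiE; ring.
Qed.

End Parallel.

Section BRType1.
Variable m : nat.
Local Notation R := {mpoly k[m.+3]}.
Variable Theta : 'M[R]_(2, 4).
Local Notation M := (BR_middle Theta).
Hypothesis Theta_lin : homog_mx 1 Theta.
Hypothesis Theta_BR : BR_exact Theta.

Lemma unit_vec_notin (l : 'I_4) : ~ exists r, (delta_mx l 0 : 'cV[R]_4) = Theta^T *m r.
Proof.
move=> [r /(congr1 (fun X : 'cV_4 => mcoeff 0%MM (X l 0)))].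
rewrite mxE !eqxx mcoeff1 eqxx mxE raddf_sum big1 => [|j _] /=; first by move/eqP; rewrite oner_eq0.
by rewrite rmorphM /= mxE (homog_coef0 (Theta_lin _ _)) mul0r.
Qed.

Lemma BR_col_neq0 l : M *m (delta_mx l 0 : 'cV_4) <> 0.
Proof. by have [_ ex2 _] := Theta_BR; move/ex2; apply: unit_vec_notin. Qed.

(* A common factor p of the minors would give M = p M' with M' = M T = p M' T, hence
   M' divisible by all powers of p. *)
Lemma BR_primitive p : prime_elt p -> exists i j, ~ rdvd p (M i j).
Proof.
move=> p_prime; apply: NNPP => no; have [ex1 _ _] := Theta_BR; have [p0 _ _] := p_prime.
have qP i j : {q | M i j = q * p}.
  apply: constructive_indefinite_description; apply: NNPP => nd; apply: no.
  by exists i, j.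
pose M' : 'M[R]_4 := \matrix_(i, j) sval (qP i j).
have ME : M = p *: M'.
  by apply/matrixP => i j; rewrite [RHS]mxE [M' _ _]mxE mulrC; exact: proj2_sig (qP i j).
have TM' : Theta *m M' = 0.
  have := Theta_BR_middle Theta; rewrite ME -scalemxAr => /matrixP e.
  apply/matrixP => i j; have := e i j; rewrite [LHS]mxE [RHS]mxE => /eqP.
  by rewrite mulf_eq0 (negPf p0) => /eqP ->; rewrite mxE.
have tP j : {t : 'cV_4 | col j M' = M *m t}.
  apply: constructive_indefinite_description; apply: ex1.
  by rewrite colE mulmxA TM' mul0mx.
pose T : 'M[R]_4 := \matrix_(i, j) sval (tP j) i 0.
have M'E : M' = p *: (M' *m T).
  rewrite scalemxAl -ME; apply/matrixP => i j.
  have := congr1 (fun X : 'cV_4 => X i 0) (proj2_sig (tP j)); rewrite [LHS]mxE => ->.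
  by rewrite !mxE; apply: eq_bigr => l _; rewrite [T _ _]mxE.
have div N i j : rdvd (p ^+ N) (M' i j).
  elim: N i j => [|N IHN] i j; first by exists (M' i j); rewrite mulr1.
  have -> : M' i j = p * (M' *m T) i j by rewrite {1}M'E mxE.
  rewrite exprS mxE; have : rdvd (p ^+ N) (\sum_l M' i l * T l j).
    by elim/big_ind: _ => [|x y|l _]; [exact: rdvd0 | exact: rdvdD | exact: rdvd_mulr].
  by case=> c ->; exists c; ring.
apply: (@BR_col_neq0 0); suff -> : M = 0 by rewrite mul0mx.
suff M'0 : M' = 0 by rewrite ME M'0 scaler0.
apply/matrixP => i j; rewrite [RHS]mxE; apply/eqP/negPn/negP => nz.
have [l [u [e npu]]] := prime_multiplicity p_prime (mpoly_ufd nz).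
have [c e'] := div l.+1 i j; apply: npu; exists c.
apply: (mulfI (expf_neq0 l p0)); rewrite -e e' exprS; ring.
Qed.

(** The minors have no common factor, so [M] itself serves as delta, and nu is its column l. If P
    contains this column, it contains phi(v) M i j for every syzygy v; since P is prime and misses
    one of the minors, it contains phi(v). *)
Theorem BR_has_Bour (P : R -> Prop) l :
    is_prime_ideal P -> ~ prime_height_ge P 3 ->
    (forall i, P (M i l)) -> (exists i j, ~ P (M i j)) ->
  has_Bour Theta 3 /\ indeg_Syz Theta 2.
Proof.
move=> P_prime hP Pl [i0 [j0 nP]]; have [ex1 ex2 ex3] := Theta_BR.
have Mh := homog_BR_middle Theta_lin.
have [[P0 PD PM] _ Pp] := P_prime.
pose nu0 : 'cV[R]_4 := M *m delta_mx l 0.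
have nu0E i : nu0 i 0 = M i l by rewrite /nu0 -colE mxE.
have ex1' (u : 'cV[R]_4) : Theta *m u = 0 <-> exists w, u = M *m w.
  by split=> [/ex1|[w ->]] //; rewrite mulmxA Theta_BR_middle mul0mx.
have ex2' (u : 'cV[R]_4) : M *m u = 0 <-> exists w, u = Theta^T *m w.
  by split=> [/ex2|[w ->]] //; rewrite mulmxA BR_middle_Theta mul0mx.
have M0 : M i0 j0 != 0 by apply: contra_not_neq nP => ->.
(* The quotient by the Bourbaki ideal has h-polynomial 1 + 2 t, with value 3 at t = 1. *)
pose w3 (j : 'I_3) : int := nth 0 [:: 1; 2; 0] j.
apply: (@has_Bour_of_delta _ _ Theta 2 2 M Theta_lin _ Mh _ _ m 3 5 w3 nu0 P) => //.
- apply: (@syz_low _ _ _ M) => [i j|u /ex1] //; by exists 2%N.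
- apply: (@delta_of_minors _ _ 1 M i0 j0) => // [i j|]; first by rewrite mul1r.
  exact: BR_primitive.
- exists (M *m delta_mx i0 0), (M *m delta_mx j0 0), i0, j0; split.
  + by rewrite /Syz mulmxA Theta_BR_middle mul0mx.
  + by rewrite /Syz mulmxA Theta_BR_middle mul0mx.
  have M00 i : M i i = 0 by rewrite BR_middleE br_form_alt.
  have colM a i : (M *m (delta_mx a 0 : 'cV_4)) i 0 = M i a by rewrite -colE mxE.
  rewrite /wedge !colM !M00 mul0r sub0r (BR_middle_anti _ j0 i0) mulNr opprK.
  by rewrite mulf_neq0.
- by split=> [|i]; [rewrite /Syz mulmxA Theta_BR_middle mul0mx | rewrite nu0E].
- exact: BR_col_neq0.
- move=> v psi Sv e; have : P (psi * M i0 j0).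
    by rewrite -e /wedge !nu0E; apply: PD; [|rewrite -mulNr]; apply: PM.
  by case/Pp.
- by rewrite !big_ord_recl big_ord0.
move=> d le_d.
have [||||||||||ha le1 le2] := @dim_syz _ Theta 4 2 0 M Theta^T 0 (fun=> 2%N) (fun=> 3%N) (fun=> 0%N) d.
- exact: Mh.
- by move=> i j; right; rewrite mxE.
- by move=> i [].
- exact: ex1'.
- exact: ex2'.
- move=> u; split=> [/ex3 ->|[w ->]]; first by exists 0; rewrite mulmx0.
  by rewrite mul0mx mulmx0.
- by move=> u _; apply: flatmx0.
- by move=> j; apply: leq_trans le_d.
- by move=> j; apply: leq_trans le_d.
- by move=> [].
eexists; first exact: ha.
move: le1 le2; rewrite [(d + 2 - 2)%N]addnK !big_ord_recl !big_ord0 /= => _ le2.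
case: d le_d {ha} le2 => [|[|[|d]]] // _.
have b1 := bin_diff2 m d.+1; have b2 := bin_diff2 m d.
rewrite !subSS !subn0 /w3 /=; move: b1 b2.
set x0 := 'C(d.+3 + m.+2, m.+2); set x1 := 'C(d.+2 + m.+2, m.+2).
set x2 := 'C(d.+1 + m.+2, m.+2); set x3 := 'C(d + m.+2, m.+2).
lia.
Qed.

End BRType1.
End BRBourbaki.

(** * Lists of linear forms *)

Section FormLists.
Variables (k : fieldType) (n : nat).
Local Notation R := {mpoly k[n]}.
Implicit Types (s t : seq 'rV[k]_n) (w y : 'rV[k]_n) (p : 'cV[k]_n).

Definition lmx s : 'M[k]_(size s, n) := \matrix_i s`_i.

Definition inF s (f : R) := in_forms (lmx s) f.

Definition fv w p : k := (w *m p) 0 0.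

Lemma fvD w y p : fv (w + y) p = fv w p + fv y p.
Proof. by rewrite /fv mulmxDl mxE. Qed.

Lemma fvZ a w p : fv (a *: w) p = a * fv w p.
Proof. by rewrite /fv -scalemxAl mxE. Qed.

Lemma fvN w p : fv (- w) p = - fv w p.
Proof. by rewrite /fv mulNmx mxE. Qed.

Lemma fv0 p : fv 0 p = 0.
Proof. by rewrite /fv mul0mx mxE. Qed.

Lemma fvB w y p : fv (w - y) p = fv w p - fv y p.
Proof. by rewrite fvD fvN. Qed.

Definition fvE := (fvD, fvB, fvZ, fvN, fv0).

Lemma free_lmx s : free s -> row_free (lmx s).
Proof.
move=> /(@freeP _ _ _ (in_tuple s)) fr; apply: inj_row_free => c e; apply/rowP => i.
rewrite [RHS]mxE; apply: (fr (fun i => c 0 i)) => /=; move: e.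
rewrite mulmx_sum_row => e; rewrite -[RHS]e; apply: eq_bigr => j _; congr (_ *: _).
by apply/rowP => l; rewrite mxE mxE.
Qed.

(** Points with prescribed values at independent forms. Later, nonvanishing and independence of
    forms are checked by evaluation at such points. *)
Lemma free_points s (vs : seq k) : free s ->
  exists p, forall i, (i < size s)%N -> fv s`_i p = vs`_i.
Proof.
move=> /free_lmx/row_free_inv[D LD]; exists (D *m \col_i vs`_i) => i lt_i.
rewrite /fv mulmxA; have -> : s`_i = row (Ordinal lt_i) (lmx s) by apply/rowP => j; rewrite mxE mxE.
by rewrite -row_mul LD row1 -rowE !mxE.
Qed.

Lemma free_sub s (idx : seq nat) : uniq idx -> all (fun i => i < size s)%N idx ->
  free s -> free [seq s`_i | i <- idx].
Proof.
move=> u_idx /allP lt_idx fr; have us := free_uniq fr.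
have ->: free [seq s`_i | i <- idx] = free [seq x <- s | x \in [seq s`_i | i <- idx]].
  apply: perm_free; apply: uniq_perm; last first.
  - move=> x; rewrite mem_filter; case: mapP => //= -[i /lt_idx lt_i ->].
    by rewrite mem_nth.
  - exact: filter_uniq.
  rewrite map_inj_in_uniq // => i j /lt_idx lt_i /lt_idx lt_j e.
  by apply/eqP; rewrite -(nth_uniq 0 lt_i lt_j us) e.
exact: filter_free.
Qed.

Lemma free2 (l1 l2 : 'rV[k]_n) p1 p2 :
  fv l1 p1 * fv l2 p2 - fv l2 p1 * fv l1 p2 != 0 -> free [:: l1; l2].
Proof.
move=> nz; apply/(@freeP _ _ _ (in_tuple _)) => c; rewrite !big_ord_recl big_ord0 /= addr0 => e.
have e1 : c ord0 * fv l1 p1 + c (lift ord0 ord0) * fv l2 p1 = 0 by rewrite -!fvZ -fvD e fv0.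
have e2 : c ord0 * fv l1 p2 + c (lift ord0 ord0) * fv l2 p2 = 0 by rewrite -!fvZ -fvD e fv0.
have z0 : c ord0 = 0.
  apply: (mulIf nz); rewrite mul0r.
  transitivity ((c ord0 * fv l1 p1 + c (lift ord0 ord0) * fv l2 p1) * fv l2 p2 -
    (c ord0 * fv l1 p2 + c (lift ord0 ord0) * fv l2 p2) * fv l2 p1); first by ring.
  by rewrite e1 e2 !mul0r subr0.
have z1 : c (lift ord0 ord0) = 0.
  apply: (mulIf nz); rewrite mul0r.
  transitivity ((c ord0 * fv l1 p2 + c (lift ord0 ord0) * fv l2 p2) * fv l1 p1 -
    (c ord0 * fv l1 p1 + c (lift ord0 ord0) * fv l2 p1) * fv l1 p2); first by ring.
  by rewrite e1 e2 !mul0r subr0.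
case=> -[|[|//]] lt_i; [rewrite -[RHS]z0 | rewrite -[RHS]z1]; congr c; exact/val_inj.
Qed.

Lemma fv_meval w p : (lform w).@[fun i => p i 0] = fv w p.
Proof.
rewrite /lform raddf_sum /fv mxE; apply: eq_bigr => j _ /=.
by rewrite mevalZ mevalXU.
Qed.

Lemma inF_row s i : (i < size s)%N -> inF s (lform s`_i).
Proof.
move=> lt_i; have := in_forms_row (lmx s) (Ordinal lt_i); congr (inF _ (lform _)).
by apply/rowP => j; rewrite mxE mxE.
Qed.

Lemma inF_cons w s f : inF (w :: s) f <-> exists x, inF s (f - x * lform w).
Proof.
split=> [[c ->]|[x [c e]]].
  exists (c ord0), (fun i => c (lift ord0 i)); rewrite big_ord_recl.
  have -> : row ord0 (lmx (w :: s)) = w by apply/rowP => j; rewrite mxE mxE.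
  rewrite addrAC subrr add0r; apply: eq_bigr => i _; congr (_ * lform _).
  by apply/rowP => j; rewrite !mxE.
exists (fun i => if unlift ord0 i is Some j then c j else x); rewrite big_ord_recl unlift_none.
have -> : row ord0 (lmx (w :: s)) = w by apply/rowP => j; rewrite mxE mxE.
rewrite -[LHS](subrK (x * lform w)) e addrC; congr (_ + _).
apply: eq_bigr => i _; rewrite liftK; congr (_ * lform _).
by apply/rowP => j; rewrite !mxE.
Qed.

Lemma inF_nil f : inF [::] f <-> f = 0.
Proof.
split=> [[c ->]|->]; first by rewrite big_ord0.
by exists (fun=> 0); rewrite big_ord0.
Qed.

Lemma inF1 w f : inF [:: w] f <-> exists x, f = x * lform w.
Proof.
rewrite inF_cons; split=> -[x]; first by move/inF_nil/eqP; rewrite subr_eq0 => /eqP; exists x.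
by move=> ->; exists x; apply/inF_nil; rewrite subrr.
Qed.

Lemma inF2 w y f : inF [:: w; y] f <-> exists a b, f = a * lform w + b * lform y.
Proof.
rewrite inF_cons; split=> [[x /inF1[z e]]|[a [b ->]]].
  by exists x, z; rewrite -e; ring.
by exists a; apply/inF1; exists b; ring.
Qed.

Lemma inF3 w y z f : inF [:: w; y; z] f <->
  exists a b c, f = a * lform w + b * lform y + c * lform z.
Proof.
rewrite inF_cons; split=> [[x /inF2[b [c e]]]|[a [b [c ->]]]].
  by exists x, b, c; rewrite -addrA -e; ring.
by exists a; apply/inF2; exists b, c; ring.
Qed.

Lemma inF_prime s : free s -> is_prime_ideal (inF s).
Proof. by move/free_lmx; apply: in_forms_prime. Qed.

Lemma inF_notin w s : free (w :: s) -> ~ inF s (lform w).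
Proof.
move=> fr; have fs : free s by move: fr; rewrite free_cons => /andP[].
move=> [c e]; have [p pE] := free_points [:: 1] fr.
have := congr1 (fun f => f.@[fun i => p i 0]) e.
rewrite fv_meval raddf_sum (pE 0) //= big1 => [/eqP|i _ /=]; first by rewrite oner_eq0.
rewrite mevalM fv_meval (_ : row i _ = s`_i); last by apply/rowP => j; rewrite mxE mxE.
by have := pE i.+1 (ltn_ord i); rewrite /= nth_nil => ->; rewrite mulr0.
Qed.

Lemma inF_vanish s f p : (forall i, (i < size s)%N -> fv s`_i p = 0) -> inF s f ->
  f.@[fun i => p i 0] = 0.
Proof.
move=> s0 [c ->]; rewrite raddf_sum big1 // => i _ /=.
rewrite mevalM fv_meval (_ : row i _ = s`_i) ?s0 ?mulr0 //.
by apply/rowP => j; rewrite mxE mxE.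
Qed.

Lemma lform_neq0 w s : free (w :: s) -> lform w != 0.
Proof.
move=> fr; apply/eqP => e; have := inF_notin fr; rewrite e; apply.
by have [] := in_forms_ideal (lmx s).
Qed.

Lemma koszul2 w y f g : free [:: w; y] -> lform w * f + lform y * g = 0 ->
  exists s : R, f = s * lform y /\ g = - s * lform w.
Proof.
move=> fr e; have fry : free [:: y] by move: fr; rewrite free_cons => /andP[].
have [_ _ P_prime] := inF_prime fry.
have : inF [:: y] (lform w * f).
  by apply/inF1; exists (- g); move/eqP: e; rewrite addr_eq0 => /eqP ->; ring.
case/P_prime => [/(inF_notin fr)//|/inF1[s sE]]; exists s; split=> //.
apply: (mulfI (lform_neq0 fry)).
transitivity (lform w * f + lform y * g - lform w * f); first by ring.
by rewrite e sE; ring.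
Qed.

Lemma koszul3 w y z f g h : free [:: z; w; y] -> lform w * f + lform y * g + lform z * h = 0 ->
  exists a b s : R, [/\ f = s * lform y - a * lform z, g = - s * lform w - b * lform z
                  & h = a * lform w + b * lform y].
Proof.
move=> fr e; have frwy : free [:: w; y] by move: fr; rewrite free_cons => /andP[].
have [_ _ P_prime] := inF_prime frwy.
have : inF [:: w; y] (lform z * h).
  apply/inF2; exists (- f), (- g).
  transitivity (lform w * f + lform y * g + lform z * h - lform w * f - lform y * g).
    by ring.
  by rewrite e; ring.
case/P_prime => [/(inF_notin fr)//|/inF2[a [b hE]]]; exists a, b.
have [|s [fE gE]] := @koszul2 w y (f + a * lform z) (g + b * lform z) frwy.
  by rewrite -[RHS]e hE; ring.
by exists s; split=> //; apply/eqP; rewrite eq_sym subr_eq; apply/eqP.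
Qed.

Lemma prime_lform w s : free (w :: s) -> prime_elt (lform w).
Proof.
move=> fr; have fw : free [:: w] by apply: (@catl_free _ _ s [:: w]).
have [_ n1 P_prime] := inF_prime fw.
have dvdE f : rdvd (lform w) f <-> inF [:: w] f by rewrite inF1.
split=> [||a b].
- exact: lform_neq0 fr.
- apply/negP => u; apply: n1; apply/dvdE; exists (lform w)^-1; by rewrite mulVr.
by rewrite !dvdE; apply: P_prime.
Qed.

Lemma coprime_forms w y (p : R) : free [:: w; y] -> prime_elt p ->
  rdvd p (lform w) -> rdvd p (lform y) -> False.
Proof.
move=> fr [p0 pu _] [a wE] [b yE].
have w0 := lform_neq0 fr.
have [|s [bE _]] := @koszul2 w y b (- a) fr; first by rewrite wE yE; ring.
have b0 : b != 0.
  have := @lform_neq0 y [:: w]; rewrite yE mulf_eq0 negb_or => h.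
  have /h/andP[] // : free [:: y; w] by rewrite -(@perm_free _ _ [:: w; y]) // (perm_catC [:: w] [:: y]).
move/negP: pu; apply; apply/unitrPr; exists s; apply: (mulfI b0).
by rewrite mulr1 [RHS]bE yE; ring.
Qed.

End FormLists.

Section HeightTwo.
Variables (k : fieldType) (m : nat).
Local Notation R := {mpoly k[m.+2]}.

Lemma prime_height_ge_iff (P Q : R -> Prop) h : (forall f, P f <-> Q f) ->
  prime_height_ge P h -> prime_height_ge Q h.
Proof.
by move=> PQ [C [C1 C2 C3]]; exists C; split=> // f; rewrite C3.
Qed.

(** The ideal of the two forms is the kernel of the specialisation that sends both to 0 and the rest
    of a basis of forms to variables. *)
Lemma inF2_height (w y : 'rV[k]_(m.+2)) : free [:: w; y] ->
  ~ prime_height_ge (inF [:: w; y]) 3.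
Proof.
move=> fr; have [W uW WE] := extend_row_free (free_lmx fr).
pose T (l : 'I_m.+2) : {fraction R} := if (l < 2)%N then 0 else tofrac 'X_l.
have hT := @spec_forms_height k m W T uW; move=> h; apply: hT.
  by move=> l; rewrite /T /=.
have rW i : (i < 2)%N -> row (inord i) W = [:: w; y]`_i.
  move=> lt_i; have -> : [:: w; y]`_i = row (Ordinal lt_i : 'I_2) (lmx [:: w; y]).
    by apply/rowP => j; rewrite mxE mxE.
  rewrite -WE; apply/rowP => j; rewrite [RHS]mxE [RHS]mxE (bigD1 (inord i)) //= big1 => [|l nl].
    have e2 : (inord i : 'I_m.+2) = i :> nat by rewrite inordK // (leq_trans lt_i).
    by rewrite addr0 [LHS]mxE [pid_mx _ _ _]mxE /= e2 eqxx lt_i mul1r.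
  rewrite mxE; case: eqP => [e|_]; last by rewrite mul0r.
  by move/eqP: nl; case; apply/val_inj; rewrite /= inordK ?(leq_trans lt_i).
have [I0 ID IM] := in_forms_ideal (lmx [:: w; y]).
have sp_row i : (i < 2)%N -> spec_forms W T (lform [:: w; y]`_i) = 0.
  by move=> lt_i; rewrite -rW // spec_formsE // /T inordK ?lt_i // (leq_trans lt_i).
apply: prime_height_ge_iff h => f; split.
  move/inF2 => [a [b ->]]; rewrite rmorphD !rmorphM /=.
  by rewrite (sp_row 0%N) // (sp_row 1%N) // !mulr0 addr0.
(* [Z] erases the two coordinates in question. The specialisation is the substitution [E] followed
   by the embedding into the fraction field, and substituting [W] back recovers a polynomial modulo
   the two forms. *)
pose Z : 'M[k]_m.+2 := diag_mx (\row_l (2 <= l)%N%:R).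
pose E := invmx W *m Z.
have spE g : spec_forms W T g = tofrac (lsubst E g).
  have tofracE (f' : R) : tofrac f' = mmap (@fracC k m) (fun i => tofrac 'X_i) f'.
    rewrite {1}[f']mpolyE raddf_sum /mmap; apply: eq_bigr => mm _ /=.
    rewrite -mul_mpolyC rmorphM /=; congr (_ * _).
    rewrite mpolyXE_id rmorph_prod /mmap1; apply: eq_bigr => i _ /=.
    by rewrite rmorphXn.
  rewrite tofracE /lsubst mmap_comp_mpoly /spec_forms /mmap; apply: eq_bigr => mm _.
  congr (_ * _); apply: eq_bigr => i _; congr (_ ^+ _).
  rewrite tnth_mktuple -/(mmap _ _ _) mmap_lform; apply: eq_bigr => l _.
  rewrite [row _ _ _ _]mxE /E mul_mx_diag !mxE /T.
  case: (ltnP l 2) => _; rewrite ?mulr1 //= !mulr0.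
  by rewrite rmorph0 mul0r.
rewrite spE => /eqP; rewrite tofrac_eq0 => /eqP f0.
suff h g : inF [:: w; y] (g - lsubst W (lsubst E g)).
  by have := h f; rewrite f0 rmorph0 subr0.
have -> : lsubst W (lsubst E g) = lsubst (E *m W) g.
  transitivity (mmap (@mpolyC _ k) (fun i => lsubst W (tnth [tuple lform (row j E) | j < m.+2] i)) g).
    exact: (mmap_comp_mpoly (@mpolyC _ k) (tnth [tuple lform (row j W) | j < m.+2])).
  rewrite [RHS]/lsubst /comp_mpoly /mmap; apply: eq_bigr => mm _; congr (_ * _).
  apply: eq_bigr => i _; congr (_ ^+ _).
  by rewrite !tnth_mktuple lsubst_lform -row_mul.
apply: lsubst_sub_in => // v.
pose c l : k := (v *m invmx W) 0 l * (1 - (2 <= l)%N%:R).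
have -> : lform v - lform (v *m (E *m W)) = \sum_l (c l)%:MP * lform (row l W).
  have e1 : v = \sum_l (v *m invmx W) 0 l *: row l W by rewrite -mulmx_sum_row mulmxKV.
  have e2 : v *m (E *m W) = \sum_l ((v *m invmx W) 0 l * (2 <= l)%N%:R) *: row l W.
    rewrite /E !mulmxA mulmx_sum_row; apply: eq_bigr => l _; congr (_ *: _).
    by rewrite mul_mx_diag !mxE.
  rewrite e2 {1}e1 -raddfB -sumrB raddf_sum; apply: eq_bigr => l _ /=.
  by rewrite -scalerBl linearZ /= mul_mpolyC /c mulrBr mulr1.
elim/big_ind: _ => // l _; case: (ltnP l 2) => lt_l; last first.
  by rewrite /c lt_l subrr mulr0 mpolyC0 mul0r.
apply: IM; have -> : row l W = [:: w; y]`_l.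
  by rewrite -rW //; congr row; apply/val_inj; rewrite /= inordK.
exact: inF_row.
Qed.

End HeightTwo.

(** * Explicit resolutions *)

Section Determinants.
Variable A : comNzRingType.

Lemma det2 (M : 'M[A]_2) : \det M = M 0 0 * M 1 1 - M 0 1 * M 1 0.
Proof.
rewrite (expand_det_row _ ord0) !big_ord_recl big_ord0 /cofactor !det_mx11 !mxE.
have e0 : lift ord0 ord0 = 1 :> 'I_2 by exact/val_inj.
have e1 : lift (1 : 'I_2) (0 : 'I_1) = 0 :> 'I_2 by exact/val_inj.
by rewrite !e0 !e1 /= expr0 expr1; ring.
Qed.

Lemma det3 (a b c d e f g h i : A) :
  \det (mxs 3 3 [:: [:: a; b; c]; [:: d; e; f]; [:: g; h; i]])
  = a * (e * i - f * h) - b * (d * i - f * g) + c * (d * h - e * g).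
Proof.
rewrite (expand_det_row _ ord0) !big_ord_recl big_ord0 /cofactor !det2 !mxE /=.
by rewrite !expr0 expr1 /= expr2; ring.
Qed.

(** Laplace expansion along the first two rows, which exhibits the minors of the last two. *)
Lemma det4 (r0 r1 r2 r3 : nat -> A) :
  \det (\matrix_(i < 4, j < 4) nth 0 [:: r0 j; r1 j; r2 j; r3 j] i)
  = let m a b := r2 a * r3 b - r2 b * r3 a in let l a b := r0 a * r1 b - r0 b * r1 a in
    l 0%N 1%N * m 2%N 3%N - l 0%N 2%N * m 1%N 3%N + l 0%N 3%N * m 1%N 2%N
    + l 1%N 2%N * m 0%N 3%N - l 1%N 3%N * m 0%N 2%N + l 2%N 3%N * m 0%N 1%N.
Proof.
pose M (i j : nat) := nth 0 [:: r0 j; r1 j; r2 j; r3 j] i.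
rewrite (expand_det_row _ ord0) !big_ord_recl big_ord0 /cofactor.
have E j : row' ord0 (col' j (\matrix_(i < 4, j < 4) nth 0 [:: r0 j; r1 j; r2 j; r3 j] i))
  = mxs 3 3 [seq [seq M i (bump j c) | c <- iota 0 3] | i <- iota 1 3].
  by apply/matrixP => -[[|[|[|//]]] ?] [[|[|[|//]]] ?]; rewrite !mxE.
rewrite !E /= !det3 !mxE /= /bump /M /=; ring.
Qed.

End Determinants.

Section Minors.
Variables (k : fieldType) (n : nat).
Local Notation R := {mpoly k[n]}.

Lemma BR_middle_mxs (a0 a1 a2 a3 b0 b1 b2 b3 : R) :
  BR_middle (mxs 2 4 [:: [:: a0; a1; a2; a3]; [:: b0; b1; b2; b3]]) =
  mxs 4 4 [:: [:: 0; a2 * b3 - a3 * b2; - (a1 * b3 - a3 * b1); a1 * b2 - a2 * b1];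
              [:: - (a2 * b3 - a3 * b2); 0; a0 * b3 - a3 * b0; - (a0 * b2 - a2 * b0)];
              [:: a1 * b3 - a3 * b1; - (a0 * b3 - a3 * b0); 0; a0 * b1 - a1 * b0];
              [:: - (a1 * b2 - a2 * b1); a0 * b2 - a2 * b0; - (a0 * b1 - a1 * b0); 0]].
Proof.
set T := mxs 2 4 _; apply/matrixP => i l; rewrite BR_middleE /br_form.
have -> : br_mx T (delta_mx 0 i) (delta_mx 0 l)
  = \matrix_(r < 4, j < 4) nth 0 [:: (j == i :> nat)%:R; (j == l :> nat)%:R;
      [:: a0; a1; a2; a3]`_j; [:: b0; b1; b2; b3]`_j] r.
  by apply/matrixP => r j; rewrite [RHS]mxE; case: (ord4P r) => ->; rewrite br_mxE ?mxE ?eqxx.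
rewrite (det4 (fun j => (j == i :> nat)%:R) (fun j => (j == l :> nat)%:R)
  (fun j => [:: a0; a1; a2; a3]`_j) (fun j => [:: b0; b1; b2; b3]`_j)) mxE.
by case: (ord4P i) => ->; case: (ord4P l) => -> /=; ring.
Qed.

End Minors.

Section Resolved.
Variables (k : fieldType) (n : nat).
Local Notation R := {mpoly k[n]}.
Variable Theta : 'M[R]_(2, 4).
Hypothesis Theta_lin : homog_mx 1 Theta.

(** The strict inequality gives the nonzero entries positive degree, which is minimality. *)
Definition homog_between p q (s : nat -> nat) (t : nat -> nat) (B : 'M[R]_(p, q)) :=
  forall i j, B i j = 0 \/ (s i < t j)%N /\ B i j \is (t j - s i).-homog.

Local Notation zs := (map Posz).

Definition resolved (s2 s3 s4 : seq nat) (A2 : 'M[R]_(4, size (zs s2)))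
    (A3 : 'M[R]_(size (zs s2), size (zs s3))) (A4 : 'M[R]_(size (zs s3), size (zs s4))) :=
  [/\ [/\ homog_between (fun=> 0%N) (nth 0%N s2) A2,
          homog_between (nth 0%N s2) (nth 0%N s3) A3
        & homog_between (nth 0%N s3) (nth 0%N s4) A4],
      forall u : 'cV_4, Theta *m u = 0 <-> exists w, u = A2 *m w,
      forall u : 'cV_(size (zs s2)), A2 *m u = 0 <-> exists w, u = A3 *m w,
      forall u : 'cV_(size (zs s3)), A3 *m u = 0 <-> exists w, u = A4 *m w
    & forall u : 'cV_(size (zs s4)), A4 *m u = 0 -> u = 0].

Lemma homog_betweenZ p q s t (B : 'M[R]_(p, q)) (i : 'I_p) (j : 'I_q) : homog_between s t B ->
  homogZ (Posz (t j) - Posz (s i)) (B i j) /\ (B i j)@_0%MM = 0.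
Proof.
move=> /(_ i j)[->|[lt_st Bh]].
  by rewrite mcoeff0; split=> //; case: (_ - _) => [d|d] //=; apply: rpred0.
rewrite subzn ?(ltnW lt_st) //=; split=> //.
by move: Bh; case: (t j - s i)%N (subn_gt0 (s i) (t j)) => [|d _]; [rewrite lt_st | apply: homog_coef0].
Qed.

Lemma resolved_type s2 s3 s4 A2 A3 A4 : @resolved s2 s3 s4 A2 A3 A4 ->
  homological_type Theta (mk_htype [:: 0; 0; 0; 0]%Z (zs s2) (zs s3) (zs s4)).
Proof.
move=> [[h2 h3 h4] ex1 ex2 ex3 ex4].
have nz s (i : 'I_(size (zs s))) : (zs s)`_i = nth 0%N s i.
  by rewrite (nth_map 0%N) // -(size_map Posz).
apply: (@build_resolution _ _ Theta [:: 0; 0; 0; 0]%Z _ _ _ (Theta : 'M_(2, 4)) A2 A3 A4) => //.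
- move=> p q; have -> : [:: 0; 0; 0; 0]%Z`_q = 0 by case: q => [[|[|[|[|]]]]].
  by split; [exact: Theta_lin | exact: homog_coef0 (Theta_lin _ _)].
- move=> p q; have -> : [:: 0; 0; 0; 0]%Z`_p = 0 by case: p => [[|[|[|[|]]]]].
  by rewrite nz; apply: homog_betweenZ h2.
- by move=> p q; rewrite !nz; apply: homog_betweenZ h3.
- by move=> p q; rewrite !nz; apply: homog_betweenZ h4.
- by move=> v; exists v.
- by move=> u; exists u.
Qed.

(* The entries of A3 lie in the ideal of the variables, so the columns of A2 are a
   minimal set of generators. *)
Lemma resolved_gens s2 s3 s4 A2 A3 A4 r (B : 'M[R]_(4, r)) :
    @resolved s2 s3 s4 A2 A3 A4 -> (forall v, Syz Theta v <-> exists c, v = B *m c) ->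
  (size (zs s2) <= r)%N /\ exists2 X, B = A2 *m X & exists Y, A2 = B *m Y.
Proof.
move=> [[_ h3 _] ex1 ex2 _ _] genB.
have XP j : {x | col j B = A2 *m x}.
  apply: constructive_indefinite_description; apply/ex1/genB.
  by exists (delta_mx j 0); rewrite colE.
have YP j : {y | col j A2 = B *m y}.
  apply: constructive_indefinite_description; apply/genB/ex1.
  by exists (delta_mx j 0); rewrite colE.
pose X := \matrix_(i, j) sval (XP j) i 0; pose Y := \matrix_(i, j) sval (YP j) i 0.
have BE : B = A2 *m X.
  apply/matrixP => i j; have /colP/(_ i) := proj2_sig (XP j); rewrite mxE => ->.
  by rewrite !mxE; apply: eq_bigr => l _; rewrite mxE.
have AE : A2 = B *m Y.
  apply/matrixP => i j; have /colP/(_ i) := proj2_sig (YP j); rewrite mxE => ->.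
  by rewrite !mxE; apply: eq_bigr => l _; rewrite mxE.
have WP j : {w | col j (X *m Y - 1%:M) = A3 *m w}.
  apply: constructive_indefinite_description; apply/ex2.
  by rewrite colE mulmxA mulmxBr mulmxA -BE -AE mulmx1 subrr mul0mx.
pose c0f : {rmorphism R -> k} := mcoeff 0%MM.
have XY0 : map_mx c0f X *m map_mx c0f Y = 1%:M.
  rewrite -map_mxM -[X *m Y](subrK 1%:M) map_mxD map_mx1 (_ : map_mx _ _ = 0) ?add0r //.
  apply/matrixP => i j; have /colP/(_ i) := proj2_sig (WP j).
  rewrite [LHS]mxE [RHS]mxE => e; rewrite [LHS]mxE [RHS]mxE e raddf_sum big1 // => l _ /=.
  by rewrite rmorphM /= (proj2 (homog_betweenZ i l h3)) mul0r.
by split; [exact: mulmx1_min XY0 | exists X => //; exists Y].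
Qed.

(** A basis of Syz would have as many elements as [A2] has columns, and the two matrices of change
    of generators would be inverse to each other. Then [A2] would be injective, against the relation
    c. *)
Lemma resolved_not_free s2 s3 s4 A2 A3 A4 (c : 'cV_(size (zs s2))) :
  @resolved s2 s3 s4 A2 A3 A4 -> A2 *m c = 0 -> c != 0 -> ~ is_free Theta.
Proof.
move=> res Ac c0 [r [B [genB injB]]].
have [le_r [X BE [Y AE]]] := resolved_gens res genB.
have YX : Y *m X = 1%:M.
  apply/matrixP => i j; have /colP/(_ i) : col j (Y *m X - 1%:M) = 0.
    by apply: injB; rewrite colE mulmxA mulmxBr mulmxA -AE -BE mulmx1 subrr mul0mx.
  by rewrite !mxE => /eqP; rewrite subr_eq0 => /eqP.
have er : r = size (zs s2) by apply/eqP; rewrite eqn_leq (mulmx1_min YX) le_r.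
subst r; have Yc : Y *m c = 0 by apply: injB; rewrite mulmxA -AE.
by case/eqP: c0; rewrite -[c]mul1mx -(mulmx1C YX) -mulmxA Yc mulmx0.
Qed.

End Resolved.

(** * Special families of matrices *)

Section ResolvedBourbaki.
Variables (k : fieldType) (m : nat).
Local Notation R := {mpoly k[m.+3]}.
Variable Theta : 'M[R]_(2, 4).
Hypothesis Theta_lin : homog_mx 1 Theta.
Local Notation M := (BR_middle Theta).
Local Notation zs := (map Posz).

Lemma minors_wedge a b : M a b != 0 ->
  exists u v i j, [/\ Syz Theta u, Syz Theta v & wedge u v i j != 0].
Proof.
move=> Mab; exists (M *m delta_mx a 0), (M *m delta_mx b 0), a, b; split.
- by rewrite /Syz mulmxA Theta_BR_middle mul0mx.
- by rewrite /Syz mulmxA Theta_BR_middle mul0mx.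
have colM c i : (M *m (delta_mx c 0 : 'cV_4)) i 0 = M i c by rewrite -colE mxE.
have M0 i : M i i = 0 by rewrite BR_middleE br_form_alt.
by rewrite /wedge !colM !M0 mul0r sub0r (BR_middle_anti _ b a) mulNr opprK mulf_neq0.
Qed.

Definition bin_sum (s : seq nat) d := (\sum_(t <- s) 'C(d - t + m.+2, m.+2))%N.

Lemma bin_sumE s d : (\sum_(j < size (zs s)) 'C(d - nth 0%N s j + m.+2, m.+2))%N = bin_sum s d.
Proof.
rewrite /bin_sum (big_nth 0%N) big_mkord size_map.
by apply: eq_bigr => i _.
Qed.

Lemma resolved_Bour s2 s3 s4 A2 A3 A4 e md (g : R) (delta : 'I_4 -> 'I_4 -> R) a b P nu0
    (w : 'I_3 -> int) bb d0 :
    @resolved _ _ Theta s2 s3 s4 A2 A3 A4 -> all (leq e) s2 ->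
    all (fun t => t <= d0)%N (s2 ++ s3 ++ s4) ->
    (forall i j, M i j = g * delta i j) -> M a b != 0 ->
    (forall i j, delta i j \is md.-homog) ->
    (forall p, prime_elt p -> exists i j, ~ rdvd p (delta i j)) ->
    Syz_deg Theta e nu0 -> nu0 <> 0 -> is_prime_ideal P -> ~ prime_height_ge P 3 ->
    (forall v psi, Syz Theta v -> (forall i j, wedge v nu0 i j = psi * delta i j) -> P psi) ->
    (0 < bb)%N -> bb%:Z = \sum_j w j ->
    (forall d, (d0 <= d)%N ->
      'C(d + e - md + m.+2, m.+2)%:Z - ((bin_sum s2 d)%:Z - ((bin_sum s3 d)%:Z - (bin_sum s4 d)%:Z))
        + 'C(d - e + m.+2, m.+2)%:Z = \sum_(j < 3) w j * 'C(d + e - md - j + m, m)%:Z) ->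
  has_Bour Theta bb /\ indeg_Syz Theta e.
Proof.
move=> [[h2 h3 h4] ex1 ex2 ex3 ex4] le_e.
rewrite !all_cat => /and3P[le2 le3 le4] ME Mab dh dprim nu0S nu0n P_prime Ph Pw bb0 bbE num.
have le_nth s j : all (fun t => t <= d0)%N s -> (nth 0 s j <= d0)%N.
  by move=> le; case: (ltnP j (size s)) => lt; [apply: (all_nthP 0%N le) | rewrite nth_default].
apply: (@has_Bour_of_delta k m.+2 Theta e md delta Theta_lin _ dh _ _ m bb d0 w nu0 P) => //.
- apply: (@syz_low _ _ _ _ A2) => [i j|u /ex1//]; exists (nth 0%N s2 j).
    by have /(all_nthP 0%N) := le_e; apply; rewrite -(size_map Posz).
  by case: (h2 i j) => [->|[_]]; rewrite ?subn0 // rpred0.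
- exact: delta_of_minors ME Mab dprim.
- exact: minors_wedge Mab.
move=> d le_d.
have [||||||||||ha l1 l2] := @dim_syz k m.+2 Theta _ _ _ A2 A3 A4 (fun j => nth 0%N s2 j)
  (fun j => nth 0%N s3 j) (fun j => nth 0%N s4 j) d.
- by move=> i j; case: (h2 i j) => [->|[_]]; rewrite ?subn0 // rpred0.
- by move=> i j; case: (h3 i j) => [->|[lt hh]]; [left | right; split=> //; apply: ltnW].
- by move=> i j; case: (h4 i j) => [->|[lt hh]]; [left | right; split=> //; apply: ltnW].
- exact: ex1.
- exact: ex2.
- exact: ex3.
- exact: ex4.
- by move=> j; apply: leq_trans le_d; apply: le_nth.
- by move=> j; apply: leq_trans le_d; apply: le_nth.
- by move=> j; apply: leq_trans le_d; apply: le_nth.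
eexists; first exact: ha.
by rewrite -num // -subzn // -subzn // !bin_sumE.
Qed.

End ResolvedBourbaki.

Definition invariants (k : fieldType) n (Theta : 'M[{mpoly k[n]}]_(2, 4)) b e h :=
  [/\ has_Bour Theta b, indeg_Syz Theta e & homological_type Theta h].

Lemma invariants_equiv (k : fieldType) n (Theta N : 'M[{mpoly k[n]}]_(2, 4)) b e h :
  KW_equiv Theta N -> invariants N b e h -> invariants Theta b e h.
Proof.
move=> eqv [hb he hh]; split.
- exact: has_Bour_equiv eqv hb.
- exact: indeg_equiv eqv he.
- exact: homological_type_equiv eqv hh.
Qed.

Ltac mx_entries := move=> [[|[|[|[|[|//]]]]] ?] [[|[|[|[|[|//]]]]] ?] //; rewrite mxE /=.

Ltac homog_entries := first
  [ by left
  | by right; split=> //; rewrite ?rpredN; first [exact: lform_homog | assumption] ].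

Section Classes.
Variables (k : fieldType).

Section Linear.
Variable n : nat.
Local Notation R := {mpoly k[n]}.

Lemma lform2_homog (a b : 'rV[k]_n) : lform a * lform b \is 2.-homog.
Proof. exact: (dhomogM (lform_homog _) (lform_homog _)). Qed.

(** A matrix is given by the list of its columns, each a pair of coefficient vectors, so that blocks
    are concatenated and permuted as lists. *)
Definition form_mx (c : seq ('rV[k]_n * 'rV[k]_n)) : 'M[R]_(2, 4) :=
  mxs 2 4 [:: [seq lform x.1 | x <- c]; [seq lform x.2 | x <- c]].

Lemma form_mx_lin c : homog_mx 1 (form_mx c).
Proof.
move=> i j; rewrite mxE.
have h (f : 'rV_n * 'rV_n -> 'rV_n) : [seq lform (f x) | x <- c]`_j \is 1.-homog.
  case: (ltnP j (size c)) => lt; last by rewrite nth_default ?size_map // rpred0.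
  by rewrite (nth_map (0, 0)) // lform_homog.
by case: i => [[|[|//]] ?] /=; apply: (h).
Qed.

Lemma cvec_nth p (s t : seq R) i : (i < p)%N -> cvec p s = cvec p t -> s`_i = t`_i.
Proof. by move=> lt /colP/(_ (Ordinal lt)); rewrite !mxE. Qed.

Lemma syz_form_mx c0 c1 c2 c3 (v0 v1 v2 v3 : R) :
  Syz (form_mx [:: c0; c1; c2; c3]) (cvec 4 [:: v0; v1; v2; v3]) <->
  lform c0.1 * v0 + lform c1.1 * v1 + lform c2.1 * v2 + lform c3.1 * v3 = 0 /\
  lform c0.2 * v0 + lform c1.2 * v1 + lform c2.2 * v2 + lform c3.2 * v3 = 0.
Proof.
rewrite /Syz mul_mxs // -(cvec0 _ 2) /=; split.
  move=> e; have e1 := cvec_nth (isT : 0 < 2)%N e.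
  have e2 := cvec_nth (isT : 1 < 2)%N e; rewrite /= in e1 e2.
  by rewrite -[X in _ = X /\ _]e1 -[X in _ /\ _ = X]e2; split; ring.
move=> [e1 e2]; congr (cvec 2 [:: _; _]); first by rewrite -[RHS]e1; ring.
by rewrite -[RHS]e2; ring.
Qed.

Lemma cvec4P (P : 'cV[R]_4 -> Prop) : (forall v0 v1 v2 v3, P (cvec 4 [:: v0; v1; v2; v3])) ->
  forall v, P v.
Proof. by move=> h v; have [[|a [|b [|c [|d []]]]] // _ ->] := cvecP v. Qed.

Lemma cvec1E (v : 'cV[R]_1) : exists a, v = cvec 1 [:: a].
Proof. by have [[|a []] // _ ->] := cvecP v; exists a. Qed.

Lemma cvec3E (v : 'cV[R]_3) : exists a b c, v = cvec 3 [:: a; b; c].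
Proof. by have [[|a [|b [|c []]]] // _ ->] := cvecP v; exists a, b, c. Qed.

Lemma cvec_eqP p (s t : seq R) : size s = p -> size t = p ->
  (forall i, (i < p)%N -> s`_i = t`_i) -> cvec p s = cvec p t.
Proof. by move=> ss st e; apply/colP => i; rewrite !mxE e. Qed.

Lemma mxs_vec p q (rows : seq (seq R)) (s : seq R) (t : seq R) :
    size rows = p -> all (fun r => size r == q) rows -> size s = q -> size t = p ->
    (forall i, (i < p)%N -> dotp (nth [::] rows i) s = t`_i) ->
  mxs p q rows *m cvec q s = cvec p t.
Proof.
move=> sr ar ss st e; rewrite mul_mxs //; apply: cvec_eqP => // [|i lt]; first by rewrite size_map.
by rewrite (nth_map [::]) ?sr // e.
Qed.

Lemma mxs_ker p q (rows : seq (seq R)) (s : seq R) : mxs p q rows *m cvec q s = 0 ->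
    size rows = p -> all (fun r => size r == q) rows -> size s = q ->
  forall i, (i < p)%N -> dotp (nth [::] rows i) s = 0.
Proof.
move=> e sr ar ss i lt; move: e; rewrite mul_mxs // -(cvec0 _ p) => /(cvec_nth lt).
by rewrite (nth_map [::]) ?sr // nth_nseq lt.
Qed.

Lemma free_rotate (a b : seq 'rV[k]_n) : free (a ++ b) = free (b ++ a).
Proof. by apply: perm_free; rewrite perm_catC. Qed.

Section SplitRow.
Variables (y1 y2 a b l1 l2 : 'rV[k]_n).
Hypotheses (fy : free [:: y1; y2]) (fl : free [:: l1; l2]).
Local Notation N := (form_mx [:: (y1, 0); (y2, 0); (a, l1); (b, l2)]).
Local Notation Y1 := (lform y1).
Local Notation Y2 := (lform y2).
Local Notation L1 := (lform l1).
Local Notation L2 := (lform l2).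
Local Notation q := (lform a * L2 - lform b * L1).

(** The second row forces (v2, v3) to be a multiple t of (L2, - L1), which leaves the condition that
    t q lies in (y1, y2). The type depends on whether q itself lies there: free if it does, nearly
    free if it does not. *)
Lemma split_syz v0 v1 v2 v3 : Syz N (cvec 4 [:: v0; v1; v2; v3]) <->
  exists t, [/\ v2 = t * L2, v3 = - t * L1 & Y1 * v0 + Y2 * v1 + t * q = 0].
Proof.
rewrite syz_form_mx /= raddf0 !mul0r !add0r; split=> [[e1 /(koszul2 fl)[t [e2 e3]]]|[t [-> -> e]]].
  by exists t; split=> //; rewrite -[RHS]e1 e2 e3; ring.
by split; [rewrite -[RHS]e; ring | ring].
Qed.

Lemma split_basis al be : q = Y1 * al + Y2 * be ->
  syz_basis N (cvec 4 [:: Y2; - Y1; 0; 0]) (cvec 4 [:: - al; - be; L2; - L1]).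
Proof.
move=> qE; have L20 : L2 != 0.
  by apply: (@lform_neq0 _ _ _ [:: l1]); rewrite -[[:: l2; l1]]/([:: l2] ++ [:: l1]) free_rotate.
have Y20 : Y2 != 0.
  by apply: (@lform_neq0 _ _ _ [:: y1]); rewrite -[[:: y2; y1]]/([:: y2] ++ [:: y1]) free_rotate.
split.
- by apply/split_syz; exists 0; split; ring.
- by apply/split_syz; exists 1; split; rewrite ?qE; ring.
- apply: cvec4P => v0 v1 v2 v3 /split_syz[t [-> -> e]].
  have [|s [e0 e1]] := @koszul2 _ _ y1 y2 (v0 + t * al) (v1 + t * be) fy.
    by rewrite -[RHS]e qE; ring.
  exists s, t; apply/colP => i; rewrite !mxE.
  case: i => [[|[|[|[|//]]]] ?] /=; try ring.
    by rewrite -[v0](addrK (t * al)) e0; ring.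
  by rewrite -[v1](addrK (t * be)) e1; ring.
move=> c d /colP e; have := e (inord 2); have := e 0; rewrite !mxE inordK //= mulr0 add0r.
move=> e0 /eqP; rewrite mulf_eq0 (negPf L20) orbF => /eqP d0; split=> //.
move: e0; rewrite d0 mul0r addr0 => /eqP.
by rewrite mulf_eq0 (negPf Y20) orbF => /eqP.
Qed.

End SplitRow.

Lemma free_invariants (N : 'M[R]_(2, 4)) d1 d2 u v : homog_mx 1 N -> syz_basis N u v ->
    Syz_deg N d1 u -> Syz_deg N d2 v -> (0 < d1)%N -> (d1 <= d2)%N ->
  is_free N /\ invariants N 0 d1 (mk_htype [:: 0; 0; 0; 0]%Z [:: d1%:Z; d2%:Z] [::] [::]).
Proof.
move=> Nlin bas ud vd d1p le12; have [fr ind bo] := free_syzygies bas ud vd le12.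
split=> //; split=> //; have [Su Sv gen inj] := bas.
apply: (@resolved_type _ _ N Nlin [:: d1; d2] [::] [::] (row_mx u v : 'M_(4, 1 + 1)) 0 0).
split.
- split; [move=> i j | by move=> i [] | by move=> []].
  right; have [_ uh] := ud; have [_ vh] := vd.
  case: j => -[|[|//]] lt_j /=; rewrite subn0.
    split=> //; have := uh i; rewrite -(row_mxEl u v); congr (row_mx _ _ _ _ \is _); exact/val_inj.
  split; first exact: leq_trans le12.
  have := vh i; rewrite -(row_mxEr u v); congr (row_mx _ _ _ _ \is _); exact/val_inj.
- move=> w; split=> [/gen[a [b ->]]|[c ->]].
    by exists (cvec 2 [:: a; b]); rewrite mul_row2 !mxE.
  by rewrite mul_row2; apply: SyzD; apply: SyzZ.
- move=> c; split=> [|[w ->]]; last by rewrite !(mul0mx, mulmx0).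
  rewrite mul_row2 => /inj[c0 c1]; exists 0; rewrite mul0mx.
  apply/colP => -[[|[|//]] lt]; rewrite [RHS]mxE; [rewrite -[RHS]c0 | rewrite -[RHS]c1];
  congr (c _ _); exact/val_inj.
- move=> c; split=> [_|[w ->]]; last by rewrite !(mul0mx, mulmx0).
  by exists 0; apply/matrixP => -[].
by move=> c _; apply/matrixP => -[].
Qed.

Section ScalarPart.
Variables (x a b c d : 'rV[k]_n) (p : 'cV[k]_n).
Hypotheses (fx : free [:: x]) (xp : fv x p = 0).
Hypothesis detp : fv a p * fv d p - fv b p * fv c p != 0.
Local Notation N := (form_mx [:: (x, 0); (0, x); (a, c); (b, d)]).

(** The point p shows that the determinant a d - b c is not divisible by the prime x. By Cramer's
    rule modulo x, the last two coordinates of a syzygy are divisible by x, and they determine the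
    others. *)
Lemma scalar_basis : syz_basis N (cvec 4 [:: - lform a; - lform c; lform x; 0])
  (cvec 4 [:: - lform b; - lform d; 0; lform x]).
Proof.
have x0 := lform_neq0 fx; have [_ _ P_prime] := inF_prime fx.
have nd : ~ inF [:: x] (lform a * lform d - lform b * lform c).
  move=> /(@inF_vanish _ _ _ _ p) h; move/eqP: detp; apply.
  have : (lform a * lform d - lform b * lform c).@[fun i => p i 0] = 0.
    by apply: h => -[].
  by rewrite rmorphB !rmorphM /= !fv_meval.
split.
- by apply/syz_form_mx; rewrite /= raddf0; split; ring.
- by apply/syz_form_mx; rewrite /= raddf0; split; ring.
- apply: cvec4P => v0 v1 v2 v3 /syz_form_mx; rewrite /= raddf0 !mul0r !addr0 !add0r => -[e1 e2].
  have : inF [:: x] ((lform a * lform d - lform b * lform c) * v2).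
    apply/inF1; exists (lform b * v1 - lform d * v0).
    transitivity (lform d * (lform x * v0 + lform a * v2 + lform b * v3)
      - lform b * (lform x * v1 + lform c * v2 + lform d * v3)
      + (lform b * v1 - lform d * v0) * lform x); first by ring.
    by rewrite e1 e2; ring.
  have : inF [:: x] ((lform a * lform d - lform b * lform c) * v3).
    apply/inF1; exists (lform c * v0 - lform a * v1).
    transitivity (lform a * (lform x * v1 + lform c * v2 + lform d * v3)
      - lform c * (lform x * v0 + lform a * v2 + lform b * v3)
      + (lform c * v0 - lform a * v1) * lform x); first by ring.
    by rewrite e1 e2; ring.
  case/P_prime => [//|/inF1[t tE]]; case/P_prime => [//|/inF1[s sE]].
  exists s, t; apply/colP => i; rewrite !mxE.
  case: i => [[|[|[|[|//]]]] ?] /=; last 2 first.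
  + by rewrite sE; ring.
  + by rewrite tE; ring.
  + apply: (mulfI x0); rewrite -[LHS]subr0 -[in LHS]e1 sE tE; ring.
  apply: (mulfI x0); rewrite -[LHS]subr0 -[in LHS]e2 sE tE; ring.
move=> s t /colP e; have := e (inord 3); have := e (inord 2); rewrite !mxE !inordK //=.
rewrite !mulr0 addr0 add0r => /eqP + /eqP; rewrite !mulf_eq0 (negPf x0) !orbF.
by move=> /eqP -> /eqP ->.
Qed.

Lemma scalar_invariants :
  is_free N /\ invariants N 0 1 (mk_htype [:: 0; 0; 0; 0]%Z [:: 1; 1]%Z [::] [::]).
Proof.
have [S1 S2 _ _] := scalar_basis.
apply: (free_invariants (d2 := 1) (form_mx_lin _) scalar_basis) => //.
  by split=> // -[[|[|[|[|//]]]] ?]; rewrite mxE /= ?rpredN ?lform_homog ?rpred0.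
by split=> // -[[|[|[|[|//]]]] ?]; rewrite mxE /= ?rpredN ?lform_homog ?rpred0.
Qed.

End ScalarPart.

Lemma split_free (y1 y2 a b l1 l2 al be : 'rV[k]_n) :
    free [:: y1; y2] -> free [:: l1; l2] ->
    lform a * lform l2 - lform b * lform l1 = lform y1 * lform al + lform y2 * lform be ->
    let N := form_mx [:: (y1, 0); (y2, 0); (a, l1); (b, l2)] in
  is_free N /\ invariants N 0 1 (mk_htype [:: 0; 0; 0; 0]%Z [:: 1; 1]%Z [::] [::]).
Proof.
move=> fy fl qE N; have bas := split_basis fy fl qE; have [S1 S2 _ _] := bas.
apply: (free_invariants (d2 := 1) (form_mx_lin _) bas) => //.
  by split=> // -[[|[|[|[|//]]]] ?]; rewrite mxE /= ?rpredN ?lform_homog ?rpred0.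
by split=> // -[[|[|[|[|//]]]] ?]; rewrite mxE /= ?rpredN ?lform_homog ?rpred0.
Qed.

End Linear.

(** The h-polynomial is 1: the quotient by the Bourbaki ideal has the Hilbert function of a
    polynomial ring with two variables less. *)
Lemma split_count m d : (3 <= d)%N ->
  'C(d + 1 - 2 + m.+2, m.+2)%:Z - ((bin_sum m [:: 1; 2; 2]%N d)%:Z
     - ((bin_sum m [:: 3]%N d)%:Z - (bin_sum m [::] d)%:Z)) + 'C(d - 1 + m.+2, m.+2)%:Z
  = \sum_(j < 3) nth 0 [:: 1; 0; 0] j * 'C(d + 1 - 2 - j + m, m)%:Z.
Proof.
case: d => [|[|[|d]]] // _; rewrite /bin_sum !big_cons !big_nil !big_ord_recl big_ord0 /=.
rewrite addn1 !subSS !subn0 /=; have := bin_diff2 m d; lia.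
Qed.

Section NearlyFree.
Variable m : nat.
Local Notation R := {mpoly k[m.+3]}.

Lemma split_nearly_free (y1 y2 a b l1 l2 : 'rV[k]_m.+3) p :
    free [:: y1; y2] -> free [:: l1; l2] -> fv y1 p = 0 -> fv y2 p = 0 ->
    fv a p * fv l2 p - fv b p * fv l1 p != 0 ->
    let N := form_mx [:: (y1, 0); (y2, 0); (a, l1); (b, l2)] in
  ~ is_free N /\ invariants N 1 1 (mk_htype [:: 0; 0; 0; 0]%Z [:: 1; 2; 2]%Z [:: 3]%Z [::]).
Proof.
move=> fy fl y1p y2p qp N.
pose Y1 : R := lform y1; pose Y2 : R := lform y2; pose L1 : R := lform l1; pose L2 : R := lform l2.
pose q : R := lform a * L2 - lform b * L1.
have hq : q \is 2.-homog by apply: rpredB; apply: lform2_homog.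
have h11 : Y1 * L1 \is 2.-homog by apply: lform2_homog.
have h12 : Y1 * L2 \is 2.-homog by apply: lform2_homog.
have h21 : Y2 * L1 \is 2.-homog by apply: lform2_homog.
have h22 : Y2 * L2 \is 2.-homog by apply: lform2_homog.
have P_prime := inF_prime fy; have [[I0 ID IM] _ Pp] := P_prime.
have fy' : free [:: y2; y1] by rewrite -[[:: y2; y1]]/([:: y2] ++ [:: y1]) free_rotate.
have fl' : free [:: l2; l1] by rewrite -[[:: l2; l1]]/([:: l2] ++ [:: l1]) free_rotate.
have Y10 : Y1 != 0 := lform_neq0 fy; have Y20 : Y2 != 0 := lform_neq0 fy'.
have L10 : L1 != 0 := lform_neq0 fl; have L20 : L2 != 0 := lform_neq0 fl'.
have nq : ~ inF [:: y1; y2] q.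
  move=> /(@inF_vanish _ _ _ _ p) h; move/eqP: qp; apply.
  by rewrite -!fv_meval -!rmorphM -rmorphB /=; apply: h => -[|[|]].
have q0 : q != 0 by apply: contra_not_neq nq => ->.
(* Column 0 is the Koszul syzygy of y1 and y2; columns 1 and 2 are the syzygies with t = y1 and t =
   y2. *)
pose A2 := mxs 4 3 [:: [:: Y2; - q; 0]; [:: - Y1; 0; - q]; [:: 0; Y1 * L2; Y2 * L2];
  [:: 0; - (Y1 * L1); - (Y2 * L1)]].
pose A3 := mxs 3 1 [:: [:: q]; [:: Y2]; [:: - Y1]].
have Nlin := form_mx_lin [:: (y1, 0); (y2, 0); (a, l1); (b, l2)].
have A23 : A2 *m cvec 3 [:: q; Y2; - Y1] = 0.
  rewrite -(cvec0 _ 4); apply: mxs_vec => // -[|[|[|[|//]]]] _ /=; ring.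
have res : @resolved _ _ N [:: 1; 2; 2]%N [:: 3]%N [::] A2 A3 0.
  split.
  - split; last by move=> i [].
      by mx_entries; homog_entries.
    by mx_entries; homog_entries.
  - apply: cvec4P => v0 v1 v2 v3; split.
      move/(split_syz y1 y2 a b fl) => [t [-> -> e]].
      rewrite -/Y1 -/Y2 -/L1 -/L2 -/q in e *.
      have : inF [:: y1; y2] (t * q).
        by apply/inF2; exists (- v0), (- v1); rewrite -/Y1 -/Y2 -[LHS]subr0 -[in LHS]e; ring.
      case/Pp => [/inF2[t1 [t2 tE]]|//].
      have [|s [e0 e1]] := @koszul2 _ _ y1 y2 (v0 + t1 * q) (v1 + t2 * q) fy.
        by rewrite -[RHS]e tE -/Y1 -/Y2; ring.
      rewrite -/Y1 -/Y2 in e0 e1 tE.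
      exists (cvec 3 [:: s; t1; t2]); rewrite mul_mxs //; apply: cvec_eqP => //.
      case=> [|[|[|[|//]]]] _ /=.
      + by rewrite -[v0](addrK (t1 * q)) e0; ring.
      + by rewrite -[v1](addrK (t2 * q)) e1; ring.
      + by rewrite tE; ring.
      by rewrite tE; ring.
    move=> [w ->]; have [s [t1 [t2 ->]]] := cvec3E w.
    rewrite mul_mxs //; apply/(split_syz y1 y2 a b fl); exists (t1 * Y1 + t2 * Y2).
    by rewrite -/Y1 -/Y2 -/L1 -/L2 -/q; split=> /=; ring.
  - move=> w; have [s [t1 [t2 ->]]] := cvec3E w; split=> [e|[c ->]].
      have E := mxs_ker e erefl isT erefl.
      have e0 := E 0%N isT; have e1 := E 1%N isT; have e2 := E 2%N isT.
      rewrite /= in e0 e1 e2.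
      have [|u [e3 e4]] := @koszul2 _ _ y1 y2 t1 t2 fy.
        apply: (mulfI L20); rewrite mulr0 -[RHS]e2 -/Y1 -/Y2; ring.
      exists (cvec 1 [:: u]); rewrite mul_mxs //; apply: cvec_eqP => // -[|[|[|//]]] _ /=.
      + apply: (mulfI Y20); rewrite -[LHS]subr0 -[in LHS]e0 e3 -/Y2; ring.
      + by rewrite e3 -/Y2; ring.
      by rewrite e4 -/Y1; ring.
    have [u ->] := cvec1E c; rewrite mul_mxs //.
    have -> : [seq dotp r [:: u] | r <- [:: [:: q]; [:: Y2]; [:: - Y1]]]
      = [seq u * z | z <- [:: q; Y2; - Y1]].
      by rewrite /=; congr [:: _; _; _]; ring.
    have -> : cvec 3 [seq u * z | z <- [:: q; Y2; - Y1]] = u *: cvec 3 [:: q; Y2; - Y1].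
      by apply/colP => i; rewrite !mxE (nth_map 0) ?size_tuple //; case: i.
    by rewrite -scalemxAr A23 scaler0.
  - move=> w; have [u ->] := cvec1E w; split=> [e|[c ->]]; last by rewrite !(mul0mx, mulmx0).
    have := mxs_ker e erefl isT erefl (isT : 0 < 3)%N; rewrite /= addr0 => /eqP; rewrite mulf_eq0 (negPf q0) => /eqP ->.
    by exists 0; rewrite mul0mx; apply/colP => i; rewrite !mxE; case: i => -[|].
  by move=> w _; apply/matrixP => -[].
have NE : N = mxs 2 4 [:: [:: Y1; Y2; lform a; lform b]; [:: 0; 0; L1; L2]].
  by rewrite /N /form_mx /= raddf0.
have M01 : BR_middle N 0 1 = q by rewrite NE BR_middle_mxs mxE.
split.
  apply: (resolved_not_free res A23); apply/eqP => /colP/(_ 0); rewrite !mxE /=.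
  exact/eqP.
have nu_syz : Syz_deg N 1 (cvec 4 [:: Y2; - Y1; 0; 0]).
  split; first by apply/(split_syz y1 y2 a b fl); exists 0; split; rewrite -/Y1 -/Y2; ring.
  by move=> [[|[|[|[|//]]]] ?]; rewrite mxE /= ?rpredN ?lform_homog ?rpred0.
suff [hB hi] : has_Bour N 1 /\ indeg_Syz N 1 by split=> //; apply: resolved_type res.
(* The entry 0 1 of the wedge of any syzygy with nu lies in (y1, y2), whereas the corresponding
   minor q does not. *)
apply: (@resolved_Bour k m N Nlin _ _ _ _ _ _ 1 2 1 (BR_middle N) 0 1 (inF [:: y1; y2])
  (cvec 4 [:: Y2; - Y1; 0; 0]) (fun j => nth 0 [:: 1; 0; 0] j) 1 3 res) => //.
- by move=> i j; rewrite mul1r.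
- by rewrite M01.
- exact: homog_BR_middle.
- move=> pr pr_prime; apply: NNPP => no; have [_ _ pp] := pr_prime.
  have dv i j : rdvd pr (BR_middle N i j) by apply: NNPP => nd; apply: no; exists i, j.
  have d11 : rdvd pr (Y1 * L1).
    by have := rdvdN (dv 1 (inord 3)); rewrite NE BR_middle_mxs mxE /= inordK //= mulr0 subr0 opprK.
  have d12 : rdvd pr (Y1 * L2).
    by have := dv 1 (inord 2); rewrite NE BR_middle_mxs mxE /= inordK //= mulr0 subr0.
  have d21 : rdvd pr (Y2 * L1).
    by have := dv 0 (inord 3); rewrite NE BR_middle_mxs mxE /= inordK //= mulr0 subr0.
  have d22 : rdvd pr (Y2 * L2).
    by have := rdvdN (dv 0 (inord 2)); rewrite NE BR_middle_mxs mxE /= inordK //= mulr0 subr0 opprK.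
  have nL : ~ (rdvd pr L1 /\ rdvd pr L2) by case; apply: (coprime_forms fl pr_prime).
  have nY : ~ (rdvd pr Y1 /\ rdvd pr Y2) by case; apply: (coprime_forms fy pr_prime).
  have [y|l1d] := pp _ _ d11; have [y'|l1d'] := pp _ _ d21; have [y''|l2d] := pp _ _ d12;
  have [y3|l2d'] := pp _ _ d22; by tauto.
- by move/colP/(_ 0); rewrite !mxE /=; apply/eqP.
- exact: inF2_height.
- move=> v psi Sv /(_ 0 1); rewrite M01 /wedge !mxE /= => e.
  have : inF [:: y1; y2] (psi * q).
    by apply/inF2; exists (- v 0 0), (- v 1 0); rewrite -e -/Y1 -/Y2; ring.
  by case/Pp.
- by rewrite !big_ord_recl big_ord0.
exact: split_count.
Qed.

End NearlyFree.

End Classes.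

Section MoreClasses.
Variable k : fieldType.

Lemma free_swap2 n (a b : 'rV[k]_n) : free [:: a; b] -> free [:: b; a].
Proof. by rewrite -[[:: b; a]]/([:: b] ++ [:: a]) free_rotate. Qed.

Lemma koszul_count m d : (2 <= d)%N ->
  'C(d + 1 - 1 + m.+2, m.+2)%:Z - ((bin_sum m [:: 1; 1; 1]%N d)%:Z
     - ((bin_sum m [:: 2]%N d)%:Z - (bin_sum m [::] d)%:Z)) + 'C(d - 1 + m.+2, m.+2)%:Z
  = \sum_(j < 3) nth 0 [:: 1; 0; 0] j * 'C(d + 1 - 1 - j + m, m)%:Z.
Proof.
case: d => [|[|d]] // _; rewrite /bin_sum !big_cons !big_nil !big_ord_recl big_ord0 /=.
rewrite addn1 !subSS !subn0 /=; have := bin_diff2 m d; lia.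
Qed.

(** The h-polynomial is 1 + 2 t - t^2, whose value 2 at t = 1 is the Bourbaki degree of the
    exceptional type. *)
Lemma exceptional_count m d : (4 <= d)%N ->
  'C(d + 2 - 2 + m.+2, m.+2)%:Z - ((bin_sum m [:: 2; 2; 2; 2; 2]%N d)%:Z
     - ((bin_sum m [:: 3; 3; 3; 3]%N d)%:Z - (bin_sum m [:: 4]%N d)%:Z)) + 'C(d - 2 + m.+2, m.+2)%:Z
  = \sum_(j < 3) nth 0 [:: 1; 2; -1] j * 'C(d + 2 - 2 - j + m, m)%:Z.
Proof.
case: d => [|[|[|[|d]]]] // _; rewrite /bin_sum !big_cons !big_nil !big_ord_recl big_ord0 /=.
rewrite addn2 !subSS !subn0 /=; have := bin_diff2 m d; have := bin_diff2 m d.+1.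
have := bin_diff2 m d.+2; lia.
Qed.

Section NearlyFree.
Variable m : nat.
Local Notation R := {mpoly k[m.+3]}.

(** The last coordinate of a syzygy vanishes, so Syz is the module of Koszul syzygies of three
    forms. All minors are multiples of l; delta is what remains after division by l and has degree
    one. *)
Lemma koszul_nearly_free (y1 y2 y3 a l : 'rV[k]_m.+3) :
    free [:: y3; y1; y2] -> l != 0 ->
    let N := form_mx [:: (y1, 0); (y2, 0); (y3, 0); (a, l)] in
  ~ is_free N /\ invariants N 1 1 (mk_htype [:: 0; 0; 0; 0]%Z [:: 1; 1; 1]%Z [:: 2]%Z [::]).
Proof.
move=> fy l0 N.
have fy12 : free [:: y1; y2] by move: fy; rewrite free_cons => /andP[].
pose Y1 : R := lform y1; pose Y2 : R := lform y2; pose Y3 : R := lform y3; pose L : R := lform l.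
have P_prime := inF_prime fy12; have [[I0 ID IM] _ Pp] := P_prime.
have Y10 : Y1 != 0 := lform_neq0 fy12; have Y20 : Y2 != 0 := lform_neq0 (free_swap2 fy12).
have Y30 : Y3 != 0 := lform_neq0 fy.
have L0 : L != 0 by apply: contra_neq l0 => e; apply: lform_inj; rewrite raddf0.
have nY3 : ~ inF [:: y1; y2] Y3 := inF_notin fy.
pose A2 := mxs 4 3 [:: [:: Y2; Y3; 0]; [:: - Y1; 0; Y3]; [:: 0; - Y1; - Y2]; [:: 0; 0; 0]].
pose A3 := mxs 3 1 [:: [:: Y3]; [:: - Y2]; [:: Y1]].
have Nlin := form_mx_lin [:: (y1, 0); (y2, 0); (y3, 0); (a, l)].
have A23 : A2 *m cvec 3 [:: Y3; - Y2; Y1] = 0.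
  rewrite -(cvec0 _ 4); apply: mxs_vec => // -[|[|[|[|//]]]] _ /=; ring.
have syzE v0 v1 v2 v3 : Syz N (cvec 4 [:: v0; v1; v2; v3]) <->
    v3 = 0 /\ Y1 * v0 + Y2 * v1 + Y3 * v2 = 0.
  rewrite syz_form_mx /= raddf0 !mul0r !add0r; split=> [[e1 /eqP]|[-> e]].
    rewrite mulf_eq0 (negPf L0) => /eqP v30; split=> //.
    by rewrite -[RHS]e1 v30 mulr0 addr0.
  by rewrite !mulr0 addr0.
have res : @resolved _ _ N [:: 1; 1; 1]%N [:: 2]%N [::] A2 A3 0.
  split.
  - split; last by move=> i [].
      by mx_entries; homog_entries.
    by mx_entries; homog_entries.
  - apply: cvec4P => v0 v1 v2 v3; split.
      move/syzE => [-> /(koszul3 fy)[p [q [s [e0 e1 e2]]]]]; rewrite -/Y1 -/Y2 -/Y3 in e0 e1 e2.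
      exists (cvec 3 [:: s; - p; - q]); rewrite mul_mxs //; apply: cvec_eqP => //.
      by case=> [|[|[|[|//]]]] _ /=; rewrite ?e0 ?e1 ?e2; ring.
    move=> [w ->]; have [s [t1 [t2 ->]]] := cvec3E w.
    by rewrite mul_mxs //; apply/syzE => /=; split; ring.
  - move=> w; have [s [t1 [t2 ->]]] := cvec3E w; split=> [e|[c ->]].
      have E := mxs_ker e erefl isT erefl.
      have e0 := E 0%N isT; have e2 := E 2%N isT; rewrite /= in e0 e2.
      have [|u [e3 e4]] := @koszul2 _ _ y1 y2 t1 t2 fy12.
        by rewrite -/Y1 -/Y2 -oppr0 -e2; ring.
      rewrite -/Y1 -/Y2 in e3 e4.
      exists (cvec 1 [:: - u]); rewrite mul_mxs //; apply: cvec_eqP => // -[|[|[|//]]] _ /=.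
      + apply: (mulfI Y20); rewrite -[LHS]subr0 -[in LHS]e0 e3; ring.
      + by rewrite e3; ring.
      by rewrite e4; ring.
    have [u ->] := cvec1E c; rewrite mul_mxs //.
    have -> : cvec 3 [seq dotp r [:: u] | r <- [:: [:: Y3]; [:: - Y2]; [:: Y1]]]
      = u *: cvec 3 [:: Y3; - Y2; Y1].
      by apply/colP => -[[|[|[|//]]] ?]; rewrite !mxE /=; ring.
    by rewrite -scalemxAr A23 scaler0.
  - move=> w; have [u ->] := cvec1E w; split=> [e|[c ->]]; last by rewrite !(mul0mx, mulmx0).
    have := mxs_ker e erefl isT erefl (isT : 0 < 3)%N; rewrite /= addr0 => /eqP.
    rewrite mulf_eq0 (negPf Y30) => /eqP ->.
    by exists 0; rewrite mul0mx; apply/colP => i; rewrite !mxE; case: i => -[|].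
  by move=> w _; apply/matrixP => -[].
have NE : N = mxs 2 4 [:: [:: Y1; Y2; Y3; lform a]; [:: 0; 0; 0; L]].
  by rewrite /N /form_mx /= raddf0.
pose de := mxs 4 4 [:: [:: 0; Y3; - Y2; 0]; [:: - Y3; 0; Y1; 0]; [:: Y2; - Y1; 0; 0];
  [:: 0; 0; 0; 0]].
split.
  by apply: (resolved_not_free res A23); apply/eqP => /colP/(_ 0); rewrite !mxE; apply/eqP.
have nu_syz : Syz_deg N 1 (cvec 4 [:: Y2; - Y1; 0; 0]).
  split; first by apply/syzE; split=> //; ring.
  by move=> [[|[|[|[|//]]]] ?]; rewrite mxE /= ?rpredN ?lform_homog ?rpred0.
have ME i j : BR_middle N i j = L * de i j.
  rewrite NE BR_middle_mxs ![mxs _ _ _ _ _]mxE.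
  by case: (ord4P i) => ->; case: (ord4P j) => -> /=; ring.
suff [hB hi] : has_Bour N 1 /\ indeg_Syz N 1 by split=> //; apply: resolved_type res.
apply: (@resolved_Bour k m N Nlin _ _ _ _ _ _ 1 1 L de 0 1 (inF [:: y1; y2])
  (cvec 4 [:: Y2; - Y1; 0; 0]) (fun j => nth 0 [:: 1; 0; 0] j) 1 2 res) => //.
- by rewrite ME mxE /= mulf_neq0.
- by mx_entries; rewrite ?rpredN ?lform_homog ?rpred0.
- move=> pr pr_prime; apply: NNPP => no.
  have dv i j : rdvd pr (de i j) by apply: NNPP => nd; apply: no; exists i, j.
  apply: (coprime_forms fy12 pr_prime).
    by have := dv 1 (inord 2); rewrite mxE /= inordK.
  by have := dv (inord 2) 0; rewrite mxE /= inordK.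
- by move/colP/(_ 0); rewrite !mxE /=; apply/eqP.
- exact: inF2_height.
- move=> v psi Sv /(_ 0 1); rewrite /wedge !mxE /= => e.
  have : inF [:: y1; y2] (psi * Y3).
    by apply/inF2; exists (- v 0 0), (- v 1 0); rewrite -e -/Y1 -/Y2; ring.
  by case/Pp.
- by rewrite !big_ord_recl big_ord0.
exact: koszul_count.
Qed.

Section Exceptional.
Variables (x1 x2 x3 x4 : 'rV[k]_m.+3).
Hypothesis fx : free [:: x4; x3; x1; x2].
Local Notation X1 := (lform x1 : R).
Local Notation X2 := (lform x2 : R).
Local Notation X3 := (lform x3 : R).
Local Notation X4 := (lform x4 : R).
Local Notation N := (form_mx [:: (x1, 0); (x2, x1); (0, x2); (x3, x4)]).

Let f312 : free [:: x3; x1; x2].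
Proof. by move: fx; rewrite free_cons => /andP[]. Qed.
Let f12 : free [:: x1; x2].
Proof. by move: f312; rewrite free_cons => /andP[]. Qed.
Let X10 : X1 != 0. Proof. exact: lform_neq0 f12. Qed.
Let X20 : X2 != 0. Proof. exact: lform_neq0 (free_swap2 f12). Qed.

(** Column 0 is the syzygy of [D_2] alone. The last entries of the other columns generate the ideal
    of all last coordinates of syzygies, which lies in (x1, x2). *)
Definition exc_gens := mxs 4 5 [::
  [:: X2 * X2; X2 * X4 - X1 * X3; - (X2 * X3); 0; - (X3 * X3)];
  [:: - (X1 * X2); - (X1 * X4); 0; - (X2 * X3); - (X3 * X4)];
  [:: X1 * X1; 0; - (X1 * X4); X1 * X3 - X2 * X4; - (X4 * X4)];
  [:: 0; X1 * X1; X1 * X2; X2 * X2; X1 * X3 + X2 * X4]].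

Definition exc_rels := mxs 5 4 [::
  [:: - X4; X3; 0; 0]; [:: X2; 0; X3; 0]; [:: - X1; X2; X4; X3]; [:: 0; - X1; 0; X4];
  [:: 0; 0; - X1; - X2]].

Definition exc_last := mxs 4 1 [:: [:: X3]; [:: X4]; [:: - X2]; [:: X1]].

Lemma exc_syz v0 v1 v2 v3 : Syz N (cvec 4 [:: v0; v1; v2; v3]) <->
  X1 * v0 + X2 * v1 + X3 * v3 = 0 /\ X1 * v1 + X2 * v2 + X4 * v3 = 0.
Proof. by rewrite syz_form_mx /= raddf0 !mul0r addr0 add0r. Qed.

Lemma exc_syz_last v0 v1 v2 v3 : Syz N (cvec 4 [:: v0; v1; v2; v3]) -> inF [:: x1; x2] v3.
Proof.
move=> /exc_syz[e1 _]; have [_ _ Pp] := inF_prime f12.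
have : inF [:: x1; x2] (X3 * v3).
  by apply/inF2; exists (- v0), (- v1); rewrite -[LHS]subr0 -[in LHS]e1; ring.
by case/Pp => // /(inF_notin f312).
Qed.

(** Writing v3 = f x1 + g x2 turns both equations into Koszul relations. Comparing the two resulting
    values of v1 gives x4 f - x3 g in (x1, x2), so that (f, g) is a multiple of (x3, x4) modulo (x1,
    x2). *)
Lemma exc_gensP v : Syz N v <-> exists w : 'cV_5, v = exc_gens *m w.
Proof.
have [_ _ Pp] := inF_prime f12; have [_ _ Pp3] := inF_prime f312.
move: v; apply: cvec4P => v0 v1 v2 v3; split; last first.
  move=> [w ->]; have [[|a [|b [|c [|d [|e []]]]]] // _ ->] := cvecP w.
  by rewrite mul_mxs //; apply/exc_syz => /=; split; ring.
move=> S; have [e1 e2] := (proj1 (exc_syz _ _ _ _) S).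
have /inF2[f [g v3E]] := exc_syz_last S.
have [|s [v0E v1E]] := @koszul2 _ _ x1 x2 (v0 + X3 * f) (v1 + X3 * g) f12.
  by rewrite -[RHS]e1 v3E; ring.
have [|t [v1E' v2E]] := @koszul2 _ _ x1 x2 (v1 + X4 * f) (v2 + X4 * g) f12.
  by rewrite -[RHS]e2 v3E; ring.
have fg : X4 * f - X3 * g = s * X1 + t * X2.
  transitivity ((v1 + X4 * f) - (v1 + X3 * g)); first by ring.
  by rewrite v1E v1E'; ring.
have : inF [:: x3; x1; x2] (X4 * f).
  by apply/inF3; exists g, s, t; rewrite -[LHS](subrK (X3 * g)) fg; ring.
case/Pp3 => [/(inF_notin fx)//|/inF3[h [f1 [f2 fE]]]].
have : inF [:: x1; x2] (X3 * (g - X4 * h)).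
  apply/inF2; exists (X4 * f1 - s), (X4 * f2 - t).
  transitivity (X4 * f - (s * X1 + t * X2) - X4 * X3 * h); first by rewrite -fg; ring.
  by rewrite fE; ring.
case/Pp => [/(inF_notin f312)//|/inF2[g1 [g2 gE]]].
have {}gE : g = X4 * h + (g1 * X1 + g2 * X2) by rewrite -gE; ring.
have [|c [cE1 cE2]] := @koszul2 _ _ x1 x2 (s - X4 * f1 + X3 * g1) (t - X4 * f2 + X3 * g2) f12.
  transitivity (s * X1 + t * X2 - (X4 * f - X3 * g)).
    by rewrite fE gE; ring.
  by rewrite fg subrr.
exists (cvec 5 [:: c; f1; f2 + g1; g2; h]); rewrite mul_mxs //.
have sE : s = c * X2 + X4 * f1 - X3 * g1 by rewrite -cE1; ring.
have tE : t = - c * X1 + X4 * f2 - X3 * g2 by rewrite -cE2; ring.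
apply: cvec_eqP => // -[|[|[|[|//]]]] _ /=.
- by rewrite -[v0](addrK (X3 * f)) v0E sE fE; ring.
- by rewrite -[v1](addrK (X3 * g)) v1E sE gE; ring.
- by rewrite -[v2](addrK (X4 * g)) v2E tE gE; ring.
by rewrite v3E fE gE; ring.
Qed.

Lemma exc_relsP w : exc_gens *m w = 0 <-> exists u : 'cV_4, w = exc_rels *m u.
Proof.
have [_ _ Pp] := inF_prime f12.
have f412 : free [:: x4; x1; x2].
  have : free ([:: x4; x3] ++ [:: x1; x2]) := fx.
  by rewrite -[[:: x4; x1; x2]]/([seq [:: x4; x3; x1; x2]`_i | i <- [:: 0; 2; 3]%N]); apply: free_sub.
have [[|w0 [|w1 [|w2 [|w3 [|w4 []]]]]] // _ ->] := cvecP w; split; last first.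
  move=> [u ->]; have [[|a [|b [|c [|d []]]]] // _ ->] := cvecP u.
  rewrite mul_mxs // mul_mxs // -(cvec0 _ 4); apply: cvec_eqP => // -[|[|[|[|//]]]] _ /=; ring.
move=> e; have E := mxs_ker e erefl isT erefl.
have e0 := E 0%N isT; have e3 := E 3%N isT; rewrite /= in e0 e3.
have [|s [e4 e5]] := @koszul2 _ _ x1 x2 (w1 * X1 + w2 * X2 + w4 * X3) (w3 * X2 + w4 * X4) f12.
  by rewrite -[RHS]e3; ring.
have : inF [:: x1; x2] (X4 * w4).
  apply/inF2; exists (- s), (- w3).
  by rewrite -[LHS](addrK (w3 * X2)) [X4 * w4 + _]addrC [X4 * w4]mulrC e5; ring.
case/Pp => [/(inF_notin f412)//|/inF2[a [b w4E]]].
have [|s' [e6 e7]] := @koszul2 _ _ x1 x2 ((w1 + a * X3) * X1 + (w2 + a * X4 + b * X3) * X2)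
    ((w3 + b * X4) * X2) f12.
  by rewrite -[RHS]e3 w4E; ring.
have [|c [s'E w3E]] := @koszul2 _ _ x1 x2 s' (w3 + b * X4) f12.
  by rewrite [X2 * _]mulrC e7; ring.
have [|d [w1E w2E]] := @koszul2 _ _ x1 x2 (w1 + a * X3) (w2 + a * X4 + b * X3 - c * X2) f12.
  transitivity ((w1 + a * X3) * X1 + (w2 + a * X4 + b * X3) * X2 - s' * X2).
    by rewrite s'E; ring.
  by rewrite e6 subrr.
have {}w1E : w1 = d * X2 - a * X3 by rewrite -w1E; ring.
have {}w2E : w2 = c * X2 - d * X1 - a * X4 - b * X3.
  by rewrite -[w2](addrK (a * X4 + b * X3 - c * X2)) !addrA w2E; ring.
have {}w3E : w3 = - c * X1 - b * X4 by rewrite -w3E; ring.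
exists (cvec 4 [:: d; c; - a; - b]); rewrite mul_mxs //; apply: cvec_eqP => // -[|[|[|[|[|//]]]]] _ /=.
- apply: (mulfI (mulf_neq0 X20 X20)); rewrite -[LHS]subr0 -[in LHS]e0 w1E w2E w3E w4E; ring.
- by rewrite w1E; ring.
- by rewrite w2E; ring.
- by rewrite w3E; ring.
by rewrite w4E; ring.
Qed.

Lemma exc_lastP u : exc_rels *m u = 0 <-> exists c : 'cV_1, u = exc_last *m c.
Proof.
have [[|a [|b [|c [|d []]]]] // _ ->] := cvecP u; split; last first.
  move=> [v ->]; have [t ->] := cvec1E v.
  rewrite mul_mxs // mul_mxs // -(cvec0 _ 5); apply: cvec_eqP => // -[|[|[|[|[|//]]]]] _ /=; ring.
move=> e; have E := mxs_ker e erefl isT erefl.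
have e1 := E 1%N isT; have e3 := E 3%N isT; have e4 := E 4%N isT; rewrite /= in e1 e3 e4.
have [|t [cE dE]] := @koszul2 _ _ x1 x2 c d f12.
  by rewrite -oppr0 -e4; ring.
exists (cvec 1 [:: - t]); rewrite mul_mxs //; apply: cvec_eqP => // -[|[|[|[|//]]]] _ /=.
- apply: (mulfI X20); rewrite -[LHS]subr0 -[in LHS]e1 cE; ring.
- apply: (mulfI X10); rewrite -[LHS]addr0 -[in LHS]e3 dE; ring.
- by rewrite cE; ring.
by rewrite dE; ring.
Qed.

Lemma exc_resolved : @resolved _ _ N [:: 2; 2; 2; 2; 2]%N [:: 3; 3; 3; 3]%N [:: 4]%N
  exc_gens exc_rels exc_last.
Proof.
have h (a b : 'rV[k]_m.+3) : lform a * lform b \is 2.-homog := lform2_homog a b.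
have h24 : X2 * X4 - X1 * X3 \is 2.-homog by apply: rpredB; apply: h.
have h13 : X1 * X3 - X2 * X4 \is 2.-homog by apply: rpredB; apply: h.
have hq : X1 * X3 + X2 * X4 \is 2.-homog by apply: rpredD; apply: h.
split.
- split.
  + by mx_entries; first [by left | by right; split=> //; rewrite ?rpredN; first [exact: h | assumption]].
  + by mx_entries; homog_entries.
  by mx_entries; homog_entries.
- exact: exc_gensP.
- exact: exc_relsP.
- exact: exc_lastP.
move=> w; have [u ->] := cvec1E w => e.
have := mxs_ker e erefl isT erefl (isT : 3 < 4)%N; rewrite /= addr0 => /eqP.
rewrite mulf_eq0 (negPf X10) => /eqP ->.
by apply/colP => i; rewrite !mxE; case: i => -[|].
Qed.

(** With nu the first generator, the entry of the wedge at 0 and 3 gives phi(v) = - v3. The Bourbaki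
    ideal thus consists of last coordinates of syzygies and lies in (x1, x2). *)
Theorem exc_invariants :
  invariants N 2 2 (mk_htype [:: 0; 0; 0; 0]%Z [:: 2; 2; 2; 2; 2]%Z [:: 3; 3; 3; 3]%Z [:: 4]%Z).
Proof.
have res := exc_resolved; have Nlin := form_mx_lin [:: (x1, 0); (x2, x1); (0, x2); (x3, x4)].
have NE : N = mxs 2 4 [:: [:: X1; X2; 0; X3]; [:: 0; X1; X2; X4]].
  by rewrite /form_mx /= raddf0.
have M03 : BR_middle N 0 (inord 3) = X2 * X2.
  by rewrite NE BR_middle_mxs mxE /= inordK //= mul0r subr0.
have M23 : BR_middle N (inord 2) (inord 3) = X1 * X1.
  by rewrite NE BR_middle_mxs mxE /= !inordK //= mulr0 subr0.
pose nu := cvec 4 [:: X2 * X2; - (X1 * X2); X1 * X1; 0].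
have nu_syz : Syz_deg N 2 nu.
  split; first by apply/exc_syz; split; ring.
  by move=> [[|[|[|[|//]]]] ?]; rewrite mxE /= ?rpredN ?lform2_homog ?rpred0.
suff [hB hi] : has_Bour N 2 /\ indeg_Syz N 2 by split=> //; apply: resolved_type res.
apply: (@resolved_Bour k m N Nlin _ _ _ _ _ _ 2 2 1 (BR_middle N) 0 (inord 3) (inF [:: x1; x2])
  nu (fun j => nth 0 [:: 1; 2; -1] j) 2 4 res) => //.
- by move=> i j; rewrite mul1r.
- by rewrite M03 mulf_neq0.
- exact: homog_BR_middle.
- move=> pr pr_prime; apply: NNPP => no; have [_ _ pp] := pr_prime.
  have dv i j : rdvd pr (BR_middle N i j) by apply: NNPP => nd; apply: no; exists i, j.
  have := dv 0 (inord 3); have := dv (inord 2) (inord 3); rewrite M03 M23 => d1 d2.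
  by apply: (coprime_forms f12 pr_prime); [have [] := pp _ _ d1 | have [] := pp _ _ d2].
- by move/colP/(_ 0); rewrite !mxE /=; apply/eqP/mulf_neq0.
- exact: inF_prime.
- exact: inF2_height.
- apply: cvec4P => v0 v1 v2 v3 psi Sv /(_ 0 (inord 3)).
  rewrite M03 /wedge !mxE !inordK //= mulr0 sub0r => e.
  have -> : psi = - v3.
    by apply: (mulIf (mulf_neq0 X20 X20)); rewrite -e; ring.
  rewrite -mulN1r; have [[_ _ IM] _ _] := inF_prime f12; apply: IM.
  exact: exc_syz_last Sv.
- by rewrite !big_ord_recl big_ord0.
exact: exceptional_count.
Qed.

(** The Buchsbaum-Rim complex would generate Syz by four elements, while the minimal resolution has
    five generators. *)
Lemma exc_not_BR Theta : KW_equiv Theta N -> ~ BR_type Theta.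
Proof.
move=> [P [Q [UP UQ E]]] [_ _ _ _ ex].
have exT (u : 'cV_4) : Theta *m u = 0 <-> exists t, u = BR_middle Theta *m t := ex 0%N u.
have TN := Syz_transport UP E.
have [|le _] := resolved_gens exc_resolved (B := cmx _ Q *m BR_middle Theta); last by [].
move=> v.
rewrite -{1}[v](QcK UQ); split=> [/TN/exT[t e]|[t ->]].
  by exists t; rewrite -mulmxA -e QcK.
by rewrite QcK // -mulmxA; apply/TN/exT; exists t.
Qed.

End Exceptional.
End NearlyFree.

Section ZeroColumns.
Variable n : nat.
Local Notation R := {mpoly k[n]}.

Lemma zero2_invariants (a b c d : 'rV[k]_n) : lform a * lform d - lform b * lform c != 0 ->
    let N := form_mx [:: (0, 0); (0, 0); (a, c); (b, d)] in
  is_free N /\ invariants N 0 0 (mk_htype [:: 0; 0]%Z [::] [::] [::]).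
Proof.
move=> det0 N.
have inj (v w : R) : lform a * v + lform b * w = 0 -> lform c * v + lform d * w = 0 ->
    v = 0 /\ w = 0.
  move=> e1 e2; split; apply: (mulfI det0); rewrite mulr0.
    transitivity (lform d * (lform a * v + lform b * w) - lform b * (lform c * v + lform d * w)).
      by ring.
    by rewrite e1 e2; ring.
  transitivity (lform a * (lform c * v + lform d * w) - lform c * (lform a * v + lform b * w)).
    by ring.
  by rewrite e1 e2; ring.
have bas : syz_basis N (cvec 4 [:: 1; 0; 0; 0]) (cvec 4 [:: 0; 1; 0; 0]).
  split.
  - by apply/syz_form_mx; rewrite /= raddf0; split; ring.
  - by apply/syz_form_mx; rewrite /= raddf0; split; ring.
  - apply: cvec4P => v0 v1 v2 v3 /syz_form_mx; rewrite /= raddf0 !mul0r !add0r.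
    move=> [/inj + /[dup] e2] => /(_ e2)[-> ->].
    by exists v0, v1; apply/colP => -[[|[|[|[|//]]]] ?]; rewrite !mxE /=; ring.
  move=> s t /colP e; have := e 0; have := e 1; rewrite !mxE /=.
  by rewrite !mulr0 !mulr1 addr0 add0r.
have S0 : Syz_deg N 0 (cvec 4 [:: 1; 0; 0; 0]).
  by split; [have [] := bas | case=> [[|[|[|[|//]]]] ?]; rewrite mxE /= ?dhomog1 ?rpred0].
have S1 : Syz_deg N 0 (cvec 4 [:: 0; 1; 0; 0]).
  by split; [have [] := bas | case=> [[|[|[|[|//]]]] ?]; rewrite mxE /= ?dhomog1 ?rpred0].
have [fr ind bo] := free_syzygies bas S0 S1 isT; split=> //; split=> //.
pose A1 := mxs 2 2 [:: [:: lform a; lform b]; [:: lform c; lform d]].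
apply: (@build_resolution _ _ N [:: 0; 0]%Z [::] [::] [::] A1 0 0 0) => //=.
- move=> i j; have -> : [:: 0; 0]%Z`_j = 0 by case: j => [[|[|]]].
  have h : A1 i j \is 1.-homog.
    by case: i j => [[|[|//]] ?] [[|[|//]] ?]; rewrite mxE /= lform_homog.
  by split=> //; apply: homog_coef0 h.
- by move=> i [].
- by move=> [].
- by move=> [].
- apply: cvec4P => v0 v1 v2 v3; exists (cvec 2 [:: v2; v3]).
  rewrite /N /form_mx !mul_mxs //; apply: cvec_eqP => // -[|[|//]] _ /=; rewrite raddf0; ring.
- move=> u; have [[|v2 [|v3 []]] // _ ->] := cvecP u; exists (cvec 4 [:: 0; 0; v2; v3]).
  rewrite /N /form_mx !mul_mxs //; apply: cvec_eqP => // -[|[|//]] _ /=; rewrite raddf0; ring.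
- move=> u; have [[|v2 [|v3 []]] // _ ->] := cvecP u; split=> [e|[t ->]]; last first.
    by rewrite !(mul0mx, mulmx0).
  have E := mxs_ker e erefl isT erefl; have e1 := E 0%N isT; have e2 := E 1%N isT.
  have [|| -> ->] := @inj v2 v3.
  + by rewrite -[RHS]e1 /=; ring.
  + by rewrite -[RHS]e2 /=; ring.
  by exists 0; rewrite mul0mx; apply/colP => -[[|[|//]] ?]; rewrite !mxE.
- by move=> u; split=> [_|[t ->]]; [exists 0; apply/matrixP => -[] | rewrite !(mul0mx, mulmx0)].
- by move=> u; split=> [_|[t ->]]; [exists 0; apply/matrixP => -[] | rewrite !(mul0mx, mulmx0)].
by move=> u _; apply/matrixP => -[].
Qed.

(** The zero column splits a free summand of degree 0 off Syz; the rest consists of the syzygies of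
    the other three columns, assumed to be generated by one of them. The resolution starts from
    these three columns. *)
Lemma zero1_invariants (c1 c2 c3 : 'rV[k]_n * 'rV[k]_n) (g1 g2 g3 : R) e :
    let N := form_mx [:: (0, 0); c1; c2; c3] in
    (0 < e)%N -> g1 \is e.-homog -> g2 \is e.-homog -> g3 \is e.-homog ->
    [|| g1 != 0, g2 != 0 | g3 != 0] ->
    Syz N (cvec 4 [:: 0; g1; g2; g3]) ->
    (forall v1 v2 v3, Syz N (cvec 4 [:: 0; v1; v2; v3]) ->
       exists t, [/\ v1 = t * g1, v2 = t * g2 & v3 = t * g3]) ->
  is_free N /\ invariants N 0 0 (mk_htype [:: 0; 0; 0]%Z [:: e%:Z] [::] [::]).
Proof.
move=> N e0 h1 h2 h3 g0 Sg gen.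
have gK (t : R) : t * g1 = 0 -> t * g2 = 0 -> t * g3 = 0 -> t = 0.
  move=> /eqP + /eqP + /eqP; rewrite !mulf_eq0; case/or3P: g0 => /negPf ->; rewrite ?orbF.
  - by move=> /eqP.
  - by move=> _ /eqP.
  by move=> _ _ /eqP.
have bas : syz_basis N (cvec 4 [:: 1; 0; 0; 0]) (cvec 4 [:: 0; g1; g2; g3]).
  split=> //.
  - by apply/syz_form_mx; rewrite /= raddf0; split; ring.
  - apply: cvec4P => v0 v1 v2 v3 S.
    have /gen[t [-> -> ->]] : Syz N (cvec 4 [:: 0; v1; v2; v3]).
      move/syz_form_mx: S; rewrite /= raddf0 !mul0r => S.
      by apply/syz_form_mx; rewrite /= raddf0 !mul0r.
    by exists v0, t; apply/colP => -[[|[|[|[|//]]]] ?]; rewrite !mxE /=; ring.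
  move=> s t /colP E; have := E 0; have := E 1; have := E (inord 2); have := E (inord 3).
  rewrite !mxE !inordK //= !mulr0 !add0r mulr1 addr0 => e3 e2 e1 es.
  by split=> //; apply: gK.
have S0 : Syz_deg N 0 (cvec 4 [:: 1; 0; 0; 0]).
  by split; [have [] := bas | case=> [[|[|[|[|//]]]] ?]; rewrite mxE /= ?dhomog1 ?rpred0].
have S1 : Syz_deg N e (cvec 4 [:: 0; g1; g2; g3]).
  by split=> //; case=> [[|[|[|[|//]]]] ?]; rewrite mxE /= ?rpred0.
have [fr ind bo] := free_syzygies bas S0 S1 (leq0n e); split=> //; split=> //.
pose A1 := mxs 2 3 [:: [:: lform c1.1; lform c2.1; lform c3.1]; [:: lform c1.2; lform c2.2; lform c3.2]].
pose A2 := mxs 3 1 [:: [:: g1]; [:: g2]; [:: g3]].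
have A1E v1 v2 v3 : A1 *m cvec 3 [:: v1; v2; v3] = N *m cvec 4 [:: 0; v1; v2; v3].
  rewrite /N /form_mx !mul_mxs //; apply: cvec_eqP => // -[|[|//]] _ /=; rewrite raddf0; ring.
apply: (@build_resolution _ _ N [:: 0; 0; 0]%Z [:: e%:Z] [::] [::] A1 A2 0 0) => //=.
- move=> i j; have -> : [:: 0; 0; 0]%Z`_j = 0 by case: j => [[|[|[|]]]].
  have h : A1 i j \is 1.-homog.
    by case: i j => [[|[|//]] ?] [[|[|[|//]]] ?]; rewrite mxE /= lform_homog.
  by split=> //; apply: homog_coef0 h.
- move=> i j; have -> : [:: 0; 0; 0]%Z`_i = 0 by case: i => [[|[|[|]]]].
  rewrite subr0; have -> : [:: e%:Z]`_j = e%:Z by case: j => [[|]].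
  have h : A2 i j \is e.-homog by case: i j => [[|[|[|//]]] ?] [[|//] ?]; rewrite mxE.
  by split=> //; case: (e) e0 h => // d _; apply: homog_coef0.
- by move=> i [].
- by move=> [].
- apply: cvec4P => v0 v1 v2 v3; exists (cvec 3 [:: v1; v2; v3]); rewrite A1E.
  rewrite /N /form_mx !mul_mxs //; apply: cvec_eqP => // -[|[|//]] _ /=; rewrite raddf0; ring.
- by move=> u; have [v1 [v2 [v3 ->]]] := cvec3E u; exists (cvec 4 [:: 0; v1; v2; v3]).
- move=> u; have [v1 [v2 [v3 ->]]] := cvec3E u; rewrite A1E; split=> [/gen[t [-> -> ->]]|].
    exists (cvec 1 [:: t]); rewrite mul_mxs //; apply: cvec_eqP => // -[|[|[|//]]] _ /=; ring.
  move=> [t]; have [s ->] := cvec1E t; rewrite mul_mxs // -A1E => ->.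
  have -> : cvec 3 [seq dotp r [:: s] | r <- [:: [:: g1]; [:: g2]; [:: g3]]]
    = s *: cvec 3 [:: g1; g2; g3].
    by apply/colP => -[[|[|[|//]]] ?]; rewrite !mxE /=; ring.
  by rewrite -scalemxAr A1E (Sg : _ = 0) scaler0.
- move=> u; have [t ->] := cvec1E u; split=> [E|[c ->]]; last by rewrite !(mul0mx, mulmx0).
  have {}E := mxs_ker E erefl isT erefl.
  have e1 := E 0%N isT; have e2 := E 1%N isT; have e3 := E 2%N isT; rewrite /= in e1 e2 e3.
  exists 0; rewrite mul0mx (gK t); [ | by rewrite mulrC -[RHS]e1 addr0 | by rewrite mulrC -[RHS]e2 addr0
    | by rewrite mulrC -[RHS]e3 addr0].
  by apply/colP => -[[|//] ?]; rewrite !mxE.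
- by move=> u; split=> [_|[t ->]]; [exists 0; apply/matrixP => -[] | rewrite !(mul0mx, mulmx0)].
by move=> u _; apply/matrixP => -[].
Qed.

End ZeroColumns.
End MoreClasses.

(** * Normal forms as lists of blocks *)

Section Pencils.
Variables (k : fieldType) (n : nat).
Local Notation R := {mpoly k[n]}.
Local Notation V := 'rV[k]_n.
Implicit Types (c : seq (V * V)).

(** Row j of A and of B holds the coefficients of column j, so column operations on the matrix are
    multiplications from the left on A and B. *)
Definition pform (A B : 'M[k]_(4, n)) : 'M[R]_(2, 4) :=
  \matrix_(i, j) lform (row j (if i == 0 then A else B)).

Definition mx1 c : 'M[k]_(4, n) := \matrix_j (nth (0, 0) c j).1.
Definition mx2 c : 'M[k]_(4, n) := \matrix_j (nth (0, 0) c j).2.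

Lemma rowM c j : row j (mx1 c) = (nth (0, 0) c j).1 /\ row j (mx2 c) = (nth (0, 0) c j).2.
Proof. by split; apply/rowP => l; rewrite mxE mxE. Qed.

Lemma form_mxE c : form_mx c = pform (mx1 c) (mx2 c).
Proof.
apply/matrixP => i j; rewrite !mxE.
have h (f : V * V -> V) : f (0, 0) = 0 -> [seq lform (f x) | x <- c]`_j = lform (f (nth (0, 0) c j)).
  move=> f0; case: (ltnP j (size c)) => lt; first by rewrite (nth_map (0, 0)).
  by rewrite !nth_default ?size_map // f0 raddf0.
by have [r1 r2] := rowM c j; case: i => [[|[|//]] ?] /=; rewrite (h fst, h snd) ?r1 ?r2.
Qed.

Lemma pform_col (A B : 'M[k]_(4, n)) (Q : 'M[k]_4) :
  pform (Q *m A) (Q *m B) = pform A B *m cmx n Q^T.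
Proof.
apply/matrixP => i j; rewrite !mxE.
rewrite (_ : row j _ = \sum_l Q j l *: row l (if i == 0 then A else B)); last first.
  by case: ifP => _; rewrite row_mul mulmx_sum_row; apply: eq_bigr => l _; rewrite mxE.
rewrite raddf_sum; apply: eq_bigr => l _ /=.
by rewrite linearZ /= !mxE -mul_mpolyC mulrC.
Qed.

Lemma pform_col_equiv (A B : 'M[k]_(4, n)) Q : Q \in unitmx ->
  KW_equiv (pform A B) (pform (Q *m A) (Q *m B)).
Proof.
move=> uQ; apply: KW_equiv_sym; rewrite pform_col.
by have := KW_equiv_mul (pform A B) (unitmx1 _ 2) (_ : Q^T \in unitmx);
  rewrite /cmx map_mx1 mul1mx unitmx_tr; apply.
Qed.

Lemma pform_row_equiv (A B : 'M[k]_(4, n)) lam : KW_equiv (pform A B) (pform A (B - lam *: A)).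
Proof.
apply: KW_equiv_sym; pose P : 'M[k]_2 := \matrix_(i, j) if i == 0 then (j == 0)%:R else
  if j == 0 then - lam else 1.
have uP : P \in unitmx by rewrite unitmxE det2 !mxE /= mul0r subr0 mulr1 unitr1.
have -> : pform A (B - lam *: A) = cmx n P *m pform A B *m cmx n 1%:M.
  rewrite cmx1 mulmx1; apply/matrixP => i j; rewrite [RHS]mxE !big_ord_recl big_ord0 !mxE.
  case: i => [[|[|//]] ?] /=; first by rewrite mpolyC1 mul1r mpolyC0 mul0r !addr0.
  rewrite addr0 mpolyC1 mul1r mul_mpolyC raddfB raddfB /= -linearZ addrC; congr (_ + _).
  by rewrite -raddfN /=; congr lform; apply/rowP => l; rewrite !mxE mulNr.
exact: KW_equiv_mul uP (unitmx1 _ _).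
Qed.

Lemma form_mx_row c lam : size c = 4 ->
  KW_equiv (form_mx c) (form_mx [seq (x.1, x.2 - lam *: x.1) | x <- c]).
Proof.
move=> sc; rewrite !form_mxE; have -> : mx1 [seq (x.1, x.2 - lam *: x.1) | x <- c] = mx1 c.
  by apply/row_matrixP => j; rewrite !(proj1 (rowM _ _)) (nth_map (0, 0)) ?sc.
have -> : mx2 [seq (x.1, x.2 - lam *: x.1) | x <- c] = mx2 c - lam *: mx1 c.
  apply/row_matrixP => j; rewrite raddfB /= (proj2 (rowM _ _)) (nth_map (0, 0)) ?sc //=.
  rewrite (proj2 (rowM _ _)); congr (_ - _); apply/rowP => l.
  by have /rowP/(_ l) := proj1 (rowM c j); rewrite !mxE => ->.
exact: pform_row_equiv.
Qed.

Lemma form_mx_perm c c' : size c = 4 -> perm_eq c c' -> KW_equiv (form_mx c) (form_mx c').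
Proof.
move=> sc pc; have sc' : size c' == 4 by rewrite -(perm_size pc) sc.
have [s sE] := tuple_permP (t := Tuple sc') pc.
have cE (j : 'I_4) : nth (0, 0) c j = nth (0, 0) c' (s j).
  rewrite sE (nth_map ord0) ?size_enum_ord // nth_ord_enum.
  exact: (tnth_nth (0, 0)).
rewrite !form_mxE.
have -> : mx1 c = perm_mx s *m mx1 c'.
  by rewrite -row_permE; apply/matrixP => j l; rewrite !mxE cE.
have -> : mx2 c = perm_mx s *m mx2 c'.
  by rewrite -row_permE; apply/matrixP => j l; rewrite !mxE cE.
by apply: KW_equiv_sym; apply: pform_col_equiv; apply: unitmx_perm.
Qed.

End Pencils.

Section BlockData.
Variables (k : fieldType).

Definition bcols n (b : KW_block k) (x : nat -> 'rV[k]_n) : seq ('rV[k]_n * 'rV[k]_n) :=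
  match b with
  | KW_D m => [seq (if (c < m)%N then x c else 0, if (0 < c)%N then x c.-1 else 0) | c <- iota 0 m.+1]
  | KW_J m lam => [seq (x c, lam *: x c + (if (0 < c)%N then x c.-1 else 0)) | c <- iota 0 m]
  | KW_B m => [seq (x c.+1, x c) | c <- iota 0 m]
  end.

Lemma size_bcols n b (x : nat -> 'rV[k]_n) : size (bcols b x) = block_width b.
Proof. by case: b => [m|m l|m] /=; rewrite !size_map size_iota. Qed.

Definition lcols n (L : seq (KW_block k * seq 'rV[k]_n)) :=
  flatten [seq bcols b.1 (nth 0 b.2) | b <- L].

Definition lforms n (L : seq (KW_block k * seq 'rV[k]_n)) := flatten [seq b.2 | b <- L].

Definition wf_data n (L : seq (KW_block k * seq 'rV[k]_n)) :=
  all (fun b => block_wf b.1 && (size b.2 == block_nvars b.1)) L.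

Definition blocks n (L : seq (KW_block k * seq 'rV[k]_n)) := [seq b.1 | b <- L].

Lemma size_lcols n (L : seq (KW_block k * seq 'rV[k]_n)) : size (lcols L) = KW_width (blocks L).
Proof. by elim: L => //= b L IH; rewrite size_cat size_bcols IH. Qed.

Fixpoint mk_data n (bs : seq (KW_block k)) (v : nat -> 'rV[k]_n) :=
  if bs is b :: bs' then (b, mkseq v (block_nvars b)) :: mk_data bs' (fun i => v (block_nvars b + i)%N)
  else [::].

Lemma eq_mk_data n bs (v w : nat -> 'rV[k]_n) : (forall i, v i = w i) -> mk_data bs v = mk_data bs w.
Proof.
elim: bs v w => //= b bs IH v w vw; rewrite (eq_mkseq vw); congr (_ :: _).
by apply: IH => i; apply: vw.
Qed.

Lemma blocks_mk n bs (v : nat -> 'rV[k]_n) : blocks (mk_data bs v) = bs.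
Proof. by elim: bs v => //= b bs IH v; rewrite IH. Qed.

Lemma lforms_mk n bs (v : nat -> 'rV[k]_n) : lforms (mk_data bs v) = mkseq v (KW_nvars bs).
Proof.
elim: bs v => //= b bs IH v; rewrite /lforms /= -/(lforms _) IH /mkseq iotaD map_cat.
by congr (_ ++ _); rewrite add0n -[in RHS](addn0 (block_nvars b)) iotaDl -map_comp.
Qed.

Lemma wf_mk n bs (v : nat -> 'rV[k]_n) : wf_data (mk_data bs v) = all (@block_wf k) bs.
Proof. by elim: bs v => //= b bs IH v; rewrite size_mkseq eqxx andbT IH. Qed.

Lemma mk_lforms n (L : seq (KW_block k * seq 'rV[k]_n)) : wf_data L ->
  mk_data (blocks L) (nth 0 (lforms L)) = L.
Proof.
elim: L => //= -[b s] L IH /= /andP[/andP[_ /eqP ss] /IH LE].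
rewrite /lforms /= -/(lforms L); congr (_ :: _).
  congr (_, _); apply: (@eq_from_nth _ 0); rewrite size_mkseq ?ss // => i lt.
  by rewrite nth_mkseq // nth_cat ss lt.
rewrite -[RHS]LE; apply: eq_mk_data => i.
by rewrite nth_cat ss ltnNge leq_addr /= addKn.
Qed.

Lemma bcols_ext n b (x y : nat -> 'rV[k]_n) : (forall i, (i < block_nvars b)%N -> x i = y i) ->
  bcols b x = bcols b y.
Proof.
case: b => [m|m l|m]; rewrite /block_nvars /bcols => xy; apply/eq_in_map => c; rewrite mem_iota add0n => /andP[_ lt].
- congr (_, _); first by case: ifP => // /xy.
  by case: (c) lt => // c' lt /=; apply: xy.
- rewrite xy //; congr (_, _ + _); case: ifP => // c0; apply: xy; exact: leq_ltn_trans (leq_pred _) lt.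
by rewrite !xy // ltnW.
Qed.

Lemma block_mx_cols n b (x : nat -> {mpoly k[n]}) (v : nat -> 'rV[k]_n) i j :
    (forall i, (i < block_nvars b)%N -> x i = lform (v i)) ->
  Defs.block_mx b x i j = lform ((if i == 0 then fst else snd) (nth (0, 0) (bcols b v) j)).
Proof.
move=> xv; have lt_j := ltn_ord j.
case: b xv j lt_j => [m|m l|m]; rewrite /block_nvars /block_width /bcols => xv j lt_j;
  rewrite /Defs.block_mx (nth_map 0%N) ?size_iota // nth_iota // add0n mxE; case: eqP => _ /=.
- by case: ifP => [/xv//|_]; rewrite raddf0.
- case: ifP => [j0|_]; last by rewrite raddf0.
  by apply: xv; rewrite -ltnS prednK.
- exact: xv.
- rewrite xv // linearD linearZ /=; congr (_ + _); case: ifP => [j0|_]; last by rewrite raddf0.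
  by apply: xv; apply: leq_ltn_trans (leq_pred _) lt_j.
- exact: xv.
by apply: xv; apply: ltnW.
Qed.

Lemma KW_mx_cols n bs (x : nat -> {mpoly k[n]}) (v : nat -> 'rV[k]_n) i j :
    (forall i, (i < KW_nvars bs)%N -> x i = lform (v i)) ->
  KW_mx bs x i j = lform ((if i == 0 then fst else snd) (nth (0, 0) (lcols (mk_data bs v)) j)).
Proof.
elim: bs x v j => [|b bs IH] x v j xv /=; first by case: j.
rewrite /lcols /= -/(lcols _) mxE nth_cat size_bcols.
rewrite (@bcols_ext _ b _ v) => [|l lt]; last by rewrite nth_mkseq.
case: splitP => l jl; rewrite jl.
  apply: block_mx_cols => p lt; apply: xv; exact: ltn_addr.
rewrite addKn; apply: IH => p lt.
by apply: xv; rewrite /= ltn_add2l.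
Qed.

Lemma free_alg_independent n N (v : nat -> 'rV[k]_n) : free (mkseq v N) ->
  alg_independent N (fun i => lform (v i)).
Proof.
move=> fr p p0; have [D LD] := row_free_inv (free_lmx fr).
(* The columns of [D] are points dual to the forms, so substituting y for the variables sends the
   i-th form back to the i-th variable. *)
pose y (j : 'I_n) : {mpoly k[N]} := \sum_(i < N) D j (cast_ord (esym (size_mkseq v N)) i) *: 'X_i.
have <- : mmap (@mpolyC N k) y (p \mPo [tuple lform (v i) | i < N]) = p; last first.
  by rewrite p0 raddf0.
rewrite mmap_comp_mpoly -[RHS]comp_mpoly_id /comp_mpoly /mmap; apply: eq_bigr => mm _.
congr (_ * _); apply: eq_bigr => i _; congr (_ ^+ _).
rewrite -/(mmap _ _ _) !tnth_mktuple mmap_lform.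
under eq_bigr do rewrite /y mulr_sumr.
rewrite exchange_big (bigD1 i) //= [X in _ + X]big1 ?addr0.
  under eq_bigr do rewrite mul_mpolyC scalerA.
  rewrite -scaler_suml -[RHS]scale1r; congr (_ *: _).
  have /matrixP/(_ (cast_ord (esym (size_mkseq v N)) i) (cast_ord (esym (size_mkseq v N)) i)) := LD.
  rewrite [LHS]mxE [RHS]mxE eqxx => e; rewrite -[RHS]/(true%:R) -e; apply: eq_bigr => j _.
  by congr (_ * _); rewrite [RHS]mxE nth_mkseq //=.
move=> l li; under eq_bigr do rewrite mul_mpolyC scalerA.
rewrite -scaler_suml -[RHS](scale0r 'X_l); congr (_ *: _).
have /matrixP/(_ (cast_ord (esym (size_mkseq v N)) i) (cast_ord (esym (size_mkseq v N)) l)) := LD.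
rewrite [LHS]mxE [RHS]mxE (inj_eq (@cast_ord_inj _ _ _)) eq_sym (negPf li) => e.
rewrite -[RHS]/(false%:R) -e; apply: eq_bigr => j _.
by congr (_ * _); rewrite [RHS]mxE nth_mkseq //=.
Qed.

Lemma alg_independent_free n N (v : nat -> 'rV[k]_n) :
  alg_independent N (fun i => lform (v i)) -> free (mkseq v N).
Proof.
move=> ind; apply/(@freeP _ _ _ (in_tuple _)) => /= c e i.
have lt_i : (i < N)%N by have := ltn_ord i; rewrite {2}size_mkseq.
pose p : {mpoly k[N]} := \sum_(j < N) c (cast_ord (esym (size_mkseq v N)) j) *: 'X_j.
have p0 : p = 0.
  apply: ind; rewrite raddf_sum /=; under eq_bigr do rewrite comp_mpolyZ comp_mpolyXU -tnth_nth tnth_mktuple -linearZ.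
  rewrite -raddf_sum /= -[RHS](raddf0 (@lform k n)); congr lform; rewrite -[RHS]e.
  rewrite (reindex (cast_ord (size_mkseq v N))) /=; last first.
    by exists (cast_ord (esym (size_mkseq v N))) => j _; rewrite (cast_ordK, cast_ordKV).
  apply: eq_bigr => j _; rewrite cast_ordK nth_mkseq //.
  by have := ltn_ord j; rewrite {2}size_mkseq.
have := congr1 (mcoeff U_(Ordinal lt_i)) p0; rewrite mcoeff0 raddf_sum (bigD1 (Ordinal lt_i)) //=.
rewrite big1 ?addr0 => [|j ji]; last by rewrite mcoeffZ mcoeffX eq_mnm1 (negPf ji) mulr0.
by rewrite mcoeffZ mcoeffX eqxx mulr1 => <-; congr c; apply/val_inj.
Qed.

(** A normal form whose variables are recorded as coefficient vectors, block by block. Algebraic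
    independence of the forms has become linear independence. *)
Definition nf_data n (Theta : 'M[{mpoly k[n]}]_(2, 4)) L :=
  [/\ wf_data L, free (lforms L), size (lcols L) = 4 & KW_equiv Theta (form_mx (lcols L))].

Lemma castmx_cols n bs (x : nat -> {mpoly k[n]}) (v : nat -> 'rV[k]_n) (w : KW_width bs = 4) :
    (forall i, (i < KW_nvars bs)%N -> x i = lform (v i)) ->
  castmx (erefl 2, w) (KW_mx bs x) = form_mx (lcols (mk_data bs v)).
Proof.
move=> xv; apply/matrixP => i j; rewrite castmxE /= cast_ord_id (KW_mx_cols _ _ xv) /= form_mxE mxE.
by congr lform; have [r1 r2] := rowM (lcols (mk_data bs v)) j; case: ifP; rewrite ?r1 ?r2.
Qed.

Lemma normal_form_data n (Theta : 'M[{mpoly k[n]}]_(2, 4)) bs :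
  KW_normal_form Theta bs <-> exists2 L, blocks L = bs & nf_data Theta L.
Proof.
split=> [[wf [x [w [xh xi eqv]]]]|[L <- [wf fr sz eqv]]].
  have vP i : {v | (i < KW_nvars bs)%N -> x i = lform v}.
    apply: constructive_indefinite_description.
    case: (ltnP i (KW_nvars bs)) => lt; last by exists 0.
    by have [v ->] := lform_onto (xh i lt); exists v.
  pose v i := sval (vP i); have xv i : (i < KW_nvars bs)%N -> x i = lform (v i) := proj2_sig (vP i).
  exists (mk_data bs v); first exact: blocks_mk.
  split.
  - by rewrite wf_mk.
  - rewrite lforms_mk; apply: alg_independent_free => p p0; apply: xi; rewrite -[RHS]p0.
    by congr (p \mPo _); apply: eq_from_tnth => i; rewrite !tnth_mktuple xv.
  - by rewrite size_lcols blocks_mk.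
  by rewrite -(castmx_cols w xv).
have w : KW_width (blocks L) = 4 by rewrite -size_lcols.
have LE := mk_lforms wf; pose v := nth 0 (lforms L).
split; first by rewrite -(wf_mk _ v) LE.
exists (fun i => lform (v i)), w; split.
- by move=> i _; apply: lform_homog.
- by apply: free_alg_independent; rewrite -lforms_mk LE.
by rewrite (castmx_cols w (v := v) (fun _ _ => erefl)) LE.
Qed.

Lemma nf_data_perm n (Theta : 'M[{mpoly k[n]}]_(2, 4)) L L' : Permutation L L' ->
  nf_data Theta L -> nf_data Theta L'.
Proof.
move=> pL; have [pc pf pw] : [/\ perm_eq (lcols L) (lcols L'), perm_eq (lforms L) (lforms L')
    & wf_data L = wf_data L'].
  elim: L L' / pL => [|b L L' _ [p1 p2 p3]|b c L|L1 L2 L3 _ [p1 p2 p3] _ [q1 q2 q3]].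
  - by [].
  - rewrite /lcols /lforms /= -/(lcols _) -/(lcols _) -/(lforms _) -/(lforms _).
    by rewrite !perm_cat2l p3.
  - rewrite /lcols /lforms /= !catA !perm_cat2r; split; try exact/permPl/perm_catC.
    by rewrite andbCA.
  split; [exact: (seq.perm_trans p1 q1) | exact: (seq.perm_trans p2 q2) | by rewrite p3].
move=> [wf fr sz eqv]; split; [by rewrite -pw | by rewrite -(perm_free pf) | by rewrite -(perm_size pc) |].
exact: KW_equiv_trans eqv (form_mx_perm sz pc).
Qed.

Lemma normal_form_perm n (Theta : 'M[{mpoly k[n]}]_(2, 4)) bs bs' : Permutation bs bs' ->
  KW_normal_form Theta bs -> KW_normal_form Theta bs'.
Proof.
move=> pb /normal_form_data[L Lb dL].
have [L' [bE pL]] : exists L', bs' = [seq b.1 | b <- L'] /\ Permutation L L'.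
  apply: (@Permutation_map_inv _ _ (fun b => b.1)).
  by rewrite -[List.map _ L]/(blocks L) Lb; apply: Permutation_sym.
by apply/normal_form_data; exists L'; [exact: esym bE | exact: nf_data_perm pL dL].
Qed.

End BlockData.

(** * Blocks with distinct eigenvalues *)

Section RegularSquares.
Variables (k : fieldType) (n : nat).
Local Notation R := {mpoly k[n]}.

Section ThreeForms.
Variables (x1 x2 x3 : 'rV[k]_n).
Hypothesis fx : free [:: x1; x2; x3].
Local Notation X1 := (lform x1 : R).
Local Notation X2 := (lform x2 : R).
Local Notation X3 := (lform x3 : R).

Let f23 : free [:: x2; x3].
Proof. by move: fx; rewrite free_cons => /andP[]. Qed.
Let f3 : free [:: x3].
Proof. by move: f23; rewrite free_cons => /andP[]. Qed.
Let f13 : free [:: x1; x3].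
Proof. by have := @free_sub k n [:: x1; x2; x3] [:: 0; 2]%N isT isT fx. Qed.
Let f12 : free [:: x1; x2].
Proof. by have := @free_sub k n [:: x1; x2; x3] [:: 0; 1]%N isT isT fx. Qed.

(** The third form is regular modulo the squares of the other two. Only primes generated by forms
    are used: the coefficients a and b are reduced modulo x2 and x3 one power of x1 or x2 at a
    time. *)
Lemma squares_regular3 x a b : X3 * x = a * X1 ^+ 2 + b * X2 ^+ 2 ->
  exists a' b', x = a' * X1 ^+ 2 + b' * X2 ^+ 2.
Proof.
move=> e; have [_ _ P3] := inF_prime f3; have [_ _ P23] := inF_prime f23.
have n1 : ~ inF [:: x3] X1 := inF_notin f13.
have n2 : ~ inF [:: x3] X2 := inF_notin f23.
have : inF [:: x2; x3] (X1 * (X1 * a)).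
  by apply/inF2; exists (- b * X2), x; rewrite -[x * _]mulrC e; ring.
case/P23 => [/(inF_notin fx)//|]; case/P23 => [/(inF_notin fx)//|/inF2[a1 [a2 aE]]].
have : inF [:: x3] (X2 * (a1 * X1 ^+ 2 + b * X2)).
  by apply/inF1; exists (x - a2 * X1 ^+ 2); rewrite mulrBl -[x * _]mulrC e aE; ring.
case/P3 => [//|/inF1[c cE]].
have [_ _ P13] := inF_prime f13.
have [_ _ P23'] := inF_prime f23.
have : inF [:: x2; x3] (X1 * (X1 * a1)).
  by apply/inF2; exists (- b), c; rewrite -cE; ring.
case/P23' => [/(inF_notin fx)//|]; case/P23' => [/(inF_notin fx)//|/inF2[d [d' a1E]]].
have : inF [:: x3] (X2 * (d * X1 ^+ 2 + b)).
  by apply/inF1; exists (c - d' * X1 ^+ 2); rewrite mulrBl -cE a1E; ring.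
case/P3 => [//|/inF1[g gE]].
have bE : b = g * X3 - d * X1 ^+ 2 by rewrite -gE; ring.
exists (d' * X2 + a2), g; apply: (mulfI (lform_neq0 f3)).
by rewrite e aE a1E bE; ring.
Qed.

Lemma squares_exact (Theta : 'M[R]_(2, 4)) :
  in_minors Theta (X1 ^+ 2) -> in_minors Theta (X2 ^+ 2) -> in_minors Theta (X3 ^+ 2) ->
  BR_exact Theta.
Proof.
move=> m1 m2 m3; have X10 : X1 != 0 := lform_neq0 fx.
have [_ _ dv1] := prime_lform fx.
have n12 : ~ rdvd X1 X2.
  by move=> h; apply: (@inF_notin _ _ x2 [:: x1]); [exact: free_swap2 | exact/inF1].
apply: (BR_exact_criterion m1 m2 m3); first exact: expf_neq0.
  move=> x [c]; rewrite !expr2 => e.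
  have : rdvd X1 (X2 * (X2 * x)) by exists (c * X1); rewrite mulrA e; ring.
  case/dv1 => [//|]; case/dv1 => [//|[t tE]].
  have : rdvd X1 (X2 * (X2 * t)).
    by exists c; apply: (mulIf X10); move: e; rewrite tE => e; rewrite -[RHS]mulrA -e; ring.
  by case/dv1 => [//|]; case/dv1 => [//|[s sE]]; exists s; rewrite tE sE; ring.
move=> x [a [b e]].
have [|a1 [b1 e1]] := @squares_regular3 (X3 * x) a b; first by rewrite -e; ring.
exact: squares_regular3 e1.
Qed.

End ThreeForms.

Lemma in_minors_ideal (Theta : 'M[R]_(2, 4)) : is_ideal (in_minors Theta).
Proof.
split=> [|f g [C ->] [D ->]|a f [C ->]].
- by exists 0; rewrite big1 // => i _; rewrite big1 // => l _; rewrite mxE mul0r.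
- exists (C + D); rewrite -big_split; apply: eq_bigr => i _ /=.
  by rewrite -big_split; apply: eq_bigr => l _ /=; rewrite mxE mulrDl.
exists (a *: C); rewrite mulr_sumr; apply: eq_bigr => i _.
by rewrite mulr_sumr; apply: eq_bigr => l _; rewrite mxE mulrA.
Qed.

Lemma in_minors_form (Theta : 'M[R]_(2, 4)) u w : in_minors Theta (br_form Theta u w).
Proof.
exists (\matrix_(i, l) (u 0 i * w 0 l)); rewrite br_form_suml; apply: eq_bigr => i _.
rewrite br_form_sumr mulr_sumr; apply: eq_bigr => l _.
by rewrite mxE mulrA.
Qed.

Lemma br_form_mull (P : 'M[R]_2) (X : 'M[R]_(2, 4)) u w :
  br_form (P *m X) u w = \det P * br_form X u w.
Proof.
rewrite /br_form /br_mx.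
have -> : col_mx u (col_mx w (P *m X)) =
    matrix.block_mx (1%:M : 'M_1) 0 0 (matrix.block_mx (1%:M : 'M_1) 0 0 P)
    *m col_mx u (col_mx w X).
  by rewrite !mul_block_col !mul1mx !mul0mx !add0r !addr0.
by rewrite (@det_mulmx _ (1 + (1 + 2))) (@det_lblock _ 1 (1 + 2)) (@det_lblock _ 1 2) !det1 !mul1r.
Qed.

Lemma br_form_mulr (X : 'M[R]_(2, 4)) (Q : 'M[R]_4) u w :
  br_form (X *m Q) (u *m Q) (w *m Q) = br_form X u w * \det Q.
Proof. by rewrite /br_form /br_mx -!mul_col_mx det_mulmx. Qed.

Lemma in_minors_equiv (A B : 'M[R]_(2, 4)) f : KW_equiv A B -> in_minors A f -> in_minors B f.
Proof.
move=> [P [Q [uP uQ E]]] [C ->]; have [I0 ID IM] := in_minors_ideal B.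
elim/big_ind: _ => // i _; elim/big_ind: _ => // l _; apply: (IM).
rewrite E -mulmxA br_form_mull; apply: (IM).
have UQ (v : 'rV[R]_4) : v = v *m cmx n (invmx Q) *m cmx n Q by rewrite -mulmxA cmxV // mulmx1.
rewrite (UQ (delta_mx 0 i)) (UQ (delta_mx 0 l)) br_form_mulr mulrC.
by apply: (IM); apply: in_minors_form.
Qed.

(** The input of [BR_exact_lift] and [squares_exact], packed so that it is invariant under
    equivalence. The killed forms, the rows of A, are part of the data. *)
Definition small (Theta : 'M[R]_(2, 4)) :=
  homog_mx 1 Theta /\ exists r (A : 'M[k]_(r, n)) (D : 'M[k]_(n, r)) (x1 x2 x3 : 'rV[k]_n),
    let T := map_mx (lsubst (kill_mx A D)) Theta in
    [/\ A *m D = 1%:M, free [:: x1; x2; x3], in_minors T (lform x1 ^+ 2),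
        in_minors T (lform x2 ^+ 2) & in_minors T (lform x3 ^+ 2)].

Lemma map_lsubst_equiv (E : 'M[k]_n) (A B : 'M[R]_(2, 4)) : KW_equiv A B ->
  KW_equiv (map_mx (lsubst E) A) (map_mx (lsubst E) B).
Proof.
move=> [P [Q [uP uQ ->]]]; exists P, Q; split=> //; rewrite !map_mxM.
have h p q (X : 'M[k]_(p, q)) : map_mx (lsubst E) (map_mx (@mpolyC n k) X) = map_mx (@mpolyC n k) X.
  by apply/matrixP => i j; rewrite !mxE lsubstC.
by rewrite !h.
Qed.

Lemma KW_equiv_lin (A B : 'M[R]_(2, 4)) : KW_equiv A B -> homog_mx 1 B -> homog_mx 1 A.
Proof.
move=> [P [Q [_ _ ->]]] Bl i j.
by apply: cmx_homog_r => i' j'; apply: cmx_homog_l.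
Qed.

Lemma small_equiv (A B : 'M[R]_(2, 4)) : KW_equiv A B -> small B -> small A.
Proof.
move=> eqv [Bl [r [K [D [x1 [x2 [x3 [KD fx m1 m2 m3]]]]]]]].
split; first exact: KW_equiv_lin eqv Bl.
have h f := @in_minors_equiv _ _ f (KW_equiv_sym (map_lsubst_equiv (kill_mx K D) eqv)).
exists r, K, D, x1, x2, x3; split; [exact: KD | exact: fx | exact: h m1 | exact: h m2 | exact: h m3].
Qed.

Lemma small_BR_exact (Theta : 'M[R]_(2, 4)) : small Theta -> BR_exact Theta.
Proof.
move=> [Tl [r [K [D [x1 [x2 [x3 [KD fx m1 m2 m3]]]]]]]].
exact: (BR_exact_lift Tl KD (squares_exact fx m1 m2 m3)).
Qed.

End RegularSquares.

(** * Specialisation to a cyclic module over k[T] *)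

Section CyclicData.
Variable k : fieldType.

Lemma comp_poly_expr (p q : {poly k}) i : (p ^+ i) \Po q = (p \Po q) ^+ i.
Proof. by elim: i => [|i IH]; rewrite ?expr0 ?comp_polyC // !exprS comp_polyM IH. Qed.

Section Phi.
Variables (N o m : nat) (lam : k).

(* The Taylor coefficients of p at lam below order m, placed from position o on. *)
Definition phi (p : {poly k}) : 'rV[k]_N :=
  \row_i if (o <= i < o + m)%N then (p \Po ('X + lam%:P))`_(i - o) else 0.

Lemma phi_is_linear : linear phi.
Proof.
move=> a p q; apply/rowP => i; rewrite !mxE; case: ifP => _; last by rewrite mulr0 addr0.
by rewrite comp_polyD comp_polyZ coefD coefZ.
Qed.

HB.instance Definition _ := GRing.isLinear.Build k {poly k} 'rV[k]_N _ phi phi_is_linear.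

Hypothesis le_N : (o + m <= N)%N.

Lemma phi_coef p i : phi p = 0 -> (i < m)%N -> (p \Po ('X + lam%:P))`_i = 0.
Proof.
move=> /rowP e lt; have lt' : (o + i < N)%N by apply: leq_trans le_N; rewrite ltn_add2l.
by have := e (Ordinal lt'); rewrite !mxE /= leq_addr ltn_add2l lt addKn.
Qed.

Lemma phi_dvd p : phi p = 0 <-> ('X - lam%:P) ^+ m %| p.
Proof.
have sK : ('X + lam%:P) \Po ('X - lam%:P) = 'X :> {poly k}.
  by rewrite comp_polyD comp_polyX comp_polyC subrK.
split=> [p0|/dvdpP[q ->]].
  pose q := \poly_(i < size (p \Po ('X + lam%:P))) (p \Po ('X + lam%:P))`_(i + m).
  have e : p \Po ('X + lam%:P) = q * 'X^m.
    apply/polyP => i; rewrite coefMXn; case: ltnP => [|le]; first exact: phi_coef.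
    rewrite coef_poly subnK //; case: ltnP => // le'.
    by rewrite nth_default // (leq_trans le') // leq_subr.
  have -> : p = (q \Po ('X - lam%:P)) * ('X - lam%:P) ^+ m.
    have -> : p = (p \Po ('X + lam%:P)) \Po ('X - lam%:P).
      by rewrite -comp_polyA sK comp_polyXr.
    by rewrite e comp_polyM comp_poly_expr comp_polyX.
  exact: dvdp_mull.
apply/rowP => i; rewrite !mxE; case: ifP => // /andP[le lt].
rewrite comp_polyM comp_poly_expr comp_polyB comp_polyX comp_polyC addrK coefMXn.
by rewrite ltn_subLR // lt.
Qed.

Lemma phi_mulX p q : phi p = phi q -> phi ('X * p) = phi ('X * q).
Proof.
move=> e; apply/eqP; rewrite -subr_eq0 -raddfB /=; apply/eqP/phi_dvd.
rewrite -mulrBr; apply: dvdp_mull; apply/phi_dvd.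
by rewrite raddfB /= e subrr.
Qed.

Lemma phi_powers p : phi p = \sum_(i < m) (p \Po ('X + lam%:P))`_i *: phi (('X - lam%:P) ^+ i).
Proof.
have h i : ('X - lam%:P) ^+ i \Po ('X + lam%:P) = 'X^i :> {poly k}.
  by rewrite comp_poly_expr comp_polyB comp_polyX comp_polyC addrK.
apply/rowP => j; rewrite summxE !mxE; under eq_bigr do rewrite !mxE h coefXn.
case: ifP => [/andP[le lt]|_]; last by rewrite big1 // => i _; rewrite mulr0.
have lt' : (j - o < m)%N by rewrite ltn_subLR.
rewrite (bigD1 (Ordinal lt')) //= eqxx mulr1 big1 ?addr0 // => i ne.
by rewrite (_ : (_ == _) = false) ?mulr0 //; apply/negbTE; rewrite eq_sym.
Qed.

Lemma phi_monomials p : exists2 r : {poly k}, (size r <= m)%N & phi p = \sum_(i < m) r`_i *: phi 'X^i.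
Proof.
have n0 : ('X - lam%:P) ^+ m != 0 by rewrite expf_neq0 // monic_neq0 // monicXsubC.
have le : (size (p %% ('X - lam%:P) ^+ m)%R <= m)%N.
  by have := ltn_modp p (('X - lam%:P) ^+ m); rewrite n0 size_exp_XsubC ltnS.
exists (p %% ('X - lam%:P) ^+ m) => //.
have -> : phi p = phi (p %% ('X - lam%:P) ^+ m).
  apply/eqP; rewrite -subr_eq0 -raddfB /=; apply/eqP/phi_dvd.
  by rewrite {1}(divp_eq p (('X - lam%:P) ^+ m)) addrK dvdp_mull.
rewrite -[in LHS](take_poly_id le) /take_poly poly_def raddf_sum; apply: eq_bigr => i _ /=.
by rewrite linearZ.
Qed.

End Phi.
Definition is_D (b : KW_block k) := if b is KW_D _ then true else false.

Definition eigen_compat (b : KW_block k) (lam : k) := if b is KW_J _ mu then mu == lam else true.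

Definition comb n (cs : seq k) (c : seq ('rV[k]_n * 'rV[k]_n)) (f : 'rV[k]_n * 'rV[k]_n -> 'rV[k]_n) :=
  \sum_(x <- zip cs c) x.1 *: f x.2.

Lemma comb_cat n cs cs' (c c' : seq ('rV[k]_n * 'rV[k]_n)) f : size cs = size c ->
  comb (cs ++ cs') (c ++ c') f = comb cs c f + comb cs' c' f.
Proof. by move=> sz; rewrite /comb zip_cat // big_cat. Qed.

Lemma comb_nth n cs (c : seq ('rV[k]_n * 'rV[k]_n)) f : size cs = size c ->
  comb cs c f = \sum_(j < size c) cs`_j *: f (nth (0, 0) c j).
Proof.
move=> sz; rewrite /comb (big_nth (0, (0, 0))) size_zip sz minnn big_mkord.
by apply: eq_bigr => j _; rewrite nth_zip.
Qed.

(** A block becomes the pencil (p, T p) on k[T] / (T - lam)^m. With variables numbered from 0, a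
    block J takes its c-th variable to (T - lam)^(m-1-c); a block B admits any lam and takes its
    i-th variable to T^(m-i). *)
Lemma block_cyclic N o b lam : block_wf b -> ~~ is_D b -> eigen_compat b lam ->
    (o + block_width b <= N)%N ->
  exists2 v : seq 'rV[k]_N, size v = block_nvars b & forall p, exists2 cs : seq k,
    size cs = block_width b &
    comb cs (bcols b (nth 0 v)) fst = phi N o (block_width b) lam p /\
    comb cs (bcols b (nth 0 v)) snd = phi N o (block_width b) lam ('X * p).
Proof.
move=> wf nD comp le; set m := block_width b; set f := phi N o m lam.
suff [v sv [g gE spn]] : exists2 v : seq 'rV[k]_N, size v = block_nvars b &
    exists2 g : nat -> {poly k},
      forall c, (c < m)%N -> nth (0, 0) (bcols b (nth 0 v)) c = (f (g c), f ('X * g c)) &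
      forall p, exists cs : nat -> k, f p = \sum_(c < m) cs c *: f (g c).
  exists v => // p; have [cs csE] := spn p; exists (mkseq cs m); first by rewrite size_mkseq.
  have e (F : 'rV[k]_N * 'rV[k]_N -> 'rV[k]_N) : comb (mkseq cs m) (bcols b (nth 0 v)) F
      = \sum_(c < m) cs c *: F (f (g c), f ('X * g c)).
    rewrite comb_nth ?size_mkseq ?size_bcols //; apply: eq_bigr => c _.
    by rewrite nth_mkseq // gE.
  rewrite !e csE; split=> //=.
  have -> : f ('X * p) = f ('X * \sum_(c < m) cs c *: g c).
    apply: phi_mulX => //; rewrite -/f csE /f raddf_sum; apply: eq_bigr => c _ /=.
    by rewrite linearZ.
  rewrite mulr_sumr /f raddf_sum; apply: eq_bigr => c _ /=.
  by rewrite -scalerAr linearZ.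
case: b wf nD comp le @m @f => // [m mu|m] /= m0 _ comp le.
  move/eqP: comp => ->; pose g c : {poly k} := ('X - lam%:P) ^+ (m - c.+1).
  exists (mkseq (fun c => phi N o m lam (g c)) m); first by rewrite size_mkseq.
  exists g => [c lt|p]; last first.
    exists (fun c => (p \Po ('X + lam%:P))`_(m - c.+1)); rewrite phi_powers.
    by rewrite (reindex_inj rev_ord_inj); apply: eq_bigr => i _.
  rewrite (nth_map 0%N) ?size_iota // nth_iota // add0n nth_mkseq //; congr (_, _).
  case: c lt => [|c] lt /=.
    rewrite addr0 -linearZ /=; apply/esym/eqP; rewrite -subr_eq0 -raddfB /=; apply/eqP/phi_dvd => //.
    rewrite /g subn1 -mul_polyC -mulrBl -exprS prednK //; exact: dvdpp.
  rewrite nth_mkseq; last exact: ltnW.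
  rewrite -linearZ -raddfD /=; congr phi; rewrite /g -(subnSK lt) exprS.
  by rewrite -mul_polyC; ring.
pose g c : {poly k} := 'X^(m - c.+1).
exists (mkseq (fun i => phi N o m lam 'X^(m - i)) m.+1); first by rewrite size_mkseq.
exists g => [c lt|p]; last first.
  have [r _ ->] := phi_monomials lam le p; exists (fun c => r`_(m - c.+1)).
  by rewrite (reindex_inj rev_ord_inj); apply: eq_bigr => i _.
rewrite (nth_map 0%N) ?size_iota // nth_iota // add0n !nth_mkseq //; last exact: ltnW.
by congr (_, phi _ _ _ _ _); rewrite /g -exprS subnSK.
Qed.

Lemma phi_supp N o m lam p (i : 'I_N) : ~~ (o <= i < o + m)%N -> phi N o m lam p 0 i = 0.
Proof. by move=> /negPf h; rewrite mxE h. Qed.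

Definition char_prod (bs : seq (KW_block k)) (es : seq k) : {poly k} :=
  \prod_(x <- zip bs es) ('X - x.2%:P) ^+ block_width x.1.

Lemma char_prod_coprime bs es (lam : k) m : lam \notin es ->
  coprimep (('X - lam%:P) ^+ m) (char_prod bs es).
Proof.
elim: bs es => [|b bs IH] [|e es]; rewrite /char_prod ?big_nil ?coprimep1 //=.
rewrite big_cons in_cons negb_or => /andP[le les]; rewrite coprimepMr -/(char_prod bs es) IH // andbT.
by apply: coprimep_expl; apply: coprimep_expr; rewrite coprimep_XsubC root_XsubC eq_sym.
Qed.

Lemma char_prod_size bs es : size bs = size es ->
  char_prod bs es \is monic /\ size (char_prod bs es) = (KW_width bs).+1.
Proof.
elim: bs es => [|b bs IH] [|e es] //=; rewrite /char_prod ?big_nil ?monic1 ?size_poly1 //.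
move=> [/IH[mo sz]]; rewrite big_cons -/(char_prod bs es).
have mo' : ('X - e%:P) ^+ block_width b \is monic by rewrite monic_exp // monicXsubC.
by rewrite monicMl // mo size_monicM // ?monic_neq0 // sz size_exp_XsubC addSn addnS.
Qed.

(** Chinese remainder theorem: with distinct eigenvalues the blocks, placed in consecutive
    coordinates, form the pencil (p, T p) on k[T] modulo the product of the (T - lambda)^m. *)
Lemma cyclic_data N o bs es : all (@block_wf k) bs -> ~~ has is_D bs -> uniq es ->
    all2 eigen_compat bs es -> (o + KW_width bs <= N)%N ->
  exists (L : seq (KW_block k * seq 'rV[k]_N)) (f : {poly k} -> 'rV[k]_N), [/\ blocks L = bs, wf_data L, linear f,
    forall p (i : 'I_N), ~~ (o <= i < o + KW_width bs)%N -> f p 0 i = 0 &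
    (forall p, f p = 0 -> char_prod bs es %| p) /\
    (forall p, exists2 cs : seq k, size cs = size (lcols L) &
       comb cs (lcols L) fst = f p /\ comb cs (lcols L) snd = f ('X * p))].
Proof.
elim: bs es o => [|b bs IH] [|e es] o //=.
  move=> _ _ _ _ _; exists [::], (fun=> 0); split=> //.
  - by move=> a p q; rewrite scaler0 addr0.
  - by move=> p i _; rewrite mxE.
  by split=> [p _|p]; [rewrite /char_prod /= big_nil dvd1p | exists [::] => //; rewrite /comb /= !big_nil].
move=> /andP[wb wbs]; rewrite negb_or => /andP[nD nDs] /andP[ne ue] /andP[cb cbs] le.
have le1 : (o + block_width b <= N)%N by apply: leq_trans le; rewrite leq_add2l leq_addr.
have [L [f [Lb wL flin fsupp [fdvd fcs]]]] := IH es (o + block_width b)%N wbs nDs ue cbs (leq_trans (eq_leq (esym (addnA _ _ _))) le).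
have [v sv vcs] := block_cyclic wb nD cb le1.
set g := phi N o (block_width b) e in vcs.
exists ((b, v) :: L), (fun p => g p + f p); split.
- by rewrite /= Lb.
- by rewrite /= wb sv eqxx.
- by move=> a p q; rewrite /g linearP flin scalerDr addrACA.
- move=> p i ni; rewrite mxE phi_supp ?fsupp ?addr0 //; apply: contra ni => /andP[h1 h2].
    by rewrite addnA h2 andbT (leq_trans _ h1) // leq_addr.
  by rewrite h1 (leq_trans h2) // leq_add2l leq_addr.
split=> p.
  move=> /rowP e0; rewrite /char_prod big_cons -/(char_prod bs es).
  rewrite Gauss_dvdp ?char_prod_coprime //; apply/andP; split.
    apply/(phi_dvd e le1)/rowP => i; rewrite [RHS]mxE.
    case hi: (o <= i < o + block_width b)%N; last by rewrite phi_supp ?hi.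
    have := e0 i; rewrite !mxE fsupp ?addr0 // negb_and -ltnNge.
    by case/andP: hi => _ ->.
  apply: fdvd; apply/rowP => i; rewrite [RHS]mxE.
  case hi: (o + block_width b <= i < o + block_width b + KW_width bs)%N; last by rewrite fsupp ?hi.
  have nh : ~~ (o <= i < o + block_width b)%N.
    by case/andP: hi => h _; rewrite negb_and -leqNgt h orbT.
  by have := e0 i; rewrite [LHS]mxE [RHS]mxE /g phi_supp // add0r.
have [cs1 s1 [e1 e1']] := vcs p; have [cs2 s2 [e2 e2']] := fcs p.
exists (cs1 ++ cs2); first by rewrite !size_cat s1 s2 size_bcols.
by rewrite /lcols /= -/(lcols L) !comb_cat ?size_bcols // e1 e1' e2 e2'.
Qed.

Lemma lcols_map n N bs (v : nat -> 'rV[k]_n) (D : 'M[k]_(n, N)) :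
  lcols (mk_data bs (fun i => v i *m D)) = [seq (x.1 *m D, x.2 *m D) | x <- lcols (mk_data bs v)].
Proof.
elim: bs v => //= b bs IH v; rewrite /lcols /= -/(lcols _) -/(lcols _) map_cat; congr (_ ++ _); last exact: IH.
rewrite (@bcols_ext _ _ b _ (fun i => v i *m D)) => [|i lt]; last by rewrite nth_mkseq.
rewrite [in RHS](@bcols_ext _ _ b _ v) => [|i lt]; last by rewrite nth_mkseq.
case: b => [m|m l|m]; rewrite /bcols -map_comp; apply: eq_map => c /=.
- by congr (_, _); case: ifP; rewrite ?mul0mx.
- by congr (_, _); rewrite mulmxDl -scalemxAl; congr (_ + _); case: ifP; rewrite ?mul0mx.
by [].
Qed.

(** The forms of L are independent, so there are points, the columns of D, at which they take the
    values prescribed by L'. *)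
Lemma data_points n N (L : seq (KW_block k * seq 'rV[k]_n)) (L' : seq (KW_block k * seq 'rV[k]_N)) :
    wf_data L -> wf_data L' -> blocks L = blocks L' -> free (lforms L) ->
  exists D : 'M[k]_(n, N), lcols L' = [seq (x.1 *m D, x.2 *m D) | x <- lcols L].
Proof.
move=> wL wL' eb fr; have [D LD] := row_free_inv (free_lmx fr).
have sz : size (lforms L') = size (lforms L).
  by rewrite -(mk_lforms wL) -(mk_lforms wL') !lforms_mk !size_mkseq eb.
pose E := D *m (\matrix_(i < size (lforms L)) (lforms L')`_i).
exists E; have -> : lcols L' = lcols (mk_data (blocks L') (nth 0 (lforms L'))) by rewrite mk_lforms.
have -> : lcols L = lcols (mk_data (blocks L) (nth 0 (lforms L))) by rewrite mk_lforms.
rewrite -lcols_map eb; congr lcols; apply: eq_mk_data => i; case: (ltnP i (size (lforms L))) => lt; last first.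
  by rewrite !nth_default ?sz // mul0mx.
have -> : (lforms L)`_i = row (Ordinal lt) (lmx (lforms L)) by apply/rowP => j; rewrite mxE mxE.
by rewrite /E mulmxA -row_mul LD row1 -rowE; apply/rowP => j; rewrite mxE mxE.
Qed.

(** Up to products found before, each minor is a product of two forms; they appear in the order X1
    X1, X1 X2, X1 X3, X2 X2, X2 X3, X3 X3. *)
Lemma hankel_minors n (X1 X2 X3 : {mpoly k[n]}) (c1 c2 c3 : k) :
  let T := mxs 2 4 [:: [:: 0; X1; X2; X3]; [:: X1; X2; X3; c1 *: X1 + c2 *: X2 + c3 *: X3]] in
  [/\ in_minors T (X1 ^+ 2), in_minors T (X2 ^+ 2) & in_minors T (X3 ^+ 2)].
Proof.
move=> T; have [I0 ID IM] := in_minors_ideal T.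
have hM i l : in_minors T (BR_middle T i l) by rewrite BR_middleE; apply: in_minors_form.
pose o (i : nat) (lt : (i < 4)%N) : 'I_4 := Ordinal lt.
have m01 := hM (o 0%N isT) (o 1%N isT); rewrite BR_middle_mxs mxE /= -!mul_mpolyC in m01.
have m02 := hM (o 0%N isT) (o 2%N isT); rewrite BR_middle_mxs mxE /= -!mul_mpolyC in m02.
have m03 := hM (o 0%N isT) (o 3%N isT); rewrite BR_middle_mxs mxE /= in m03.
have m12 := hM (o 1%N isT) (o 2%N isT); rewrite BR_middle_mxs mxE /= -!mul_mpolyC in m12.
have m13 := hM (o 1%N isT) (o 3%N isT); rewrite BR_middle_mxs mxE /= in m13.
have m23 := hM (o 2%N isT) (o 3%N isT); rewrite BR_middle_mxs mxE /= in m23.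
have h11 : in_minors T (X1 * X1).
  by rewrite (_ : _ * _ = -1 * (0 * X2 - X1 * X1)); [exact: (IM _ _ m23) | ring].
have h12 : in_minors T (X1 * X2).
  by rewrite (_ : _ * _ = 1 * - (0 * X3 - X2 * X1)); [exact: (IM _ _ m13) | ring].
pose l := c1%:MP * X1 + c2%:MP * X2 + c3%:MP * X3.
have h13 : in_minors T (X1 * X3).
  by rewrite (_ : _ * _ = -1 * (0 * l - X3 * X1)); [exact: (IM _ _ m12) | ring].
have h22 : in_minors T (X2 * X2).
  by rewrite (_ : _ * _ = X1 * X3 + -1 * (X1 * X3 - X2 * X2)); [exact: (ID _ _ h13 (IM _ _ m03)) | ring].
have h1l : in_minors T (X1 * l).
  rewrite (_ : _ * _ = c1%:MP * (X1 * X1) + (c2%:MP * (X1 * X2) + c3%:MP * (X1 * X3))); last by rewrite /l; ring.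
  by apply: (ID _ _ (IM _ _ h11) (ID _ _ (IM _ _ h12) (IM _ _ h13))).
have h23 : in_minors T (X2 * X3).
  by rewrite (_ : _ * _ = X1 * l + 1 * (- (X1 * l - X3 * X2))); [exact: (ID _ _ h1l (IM _ _ m02)) | ring].
have h2l : in_minors T (X2 * l).
  rewrite (_ : _ * _ = c1%:MP * (X1 * X2) + (c2%:MP * (X2 * X2) + c3%:MP * (X2 * X3))); last by rewrite /l; ring.
  by apply: (ID _ _ (IM _ _ h12) (ID _ _ (IM _ _ h22) (IM _ _ h23))).
have h33 : in_minors T (X3 * X3).
  by rewrite (_ : _ * _ = X2 * l + -1 * (X2 * l - X3 * X3)); [exact: (ID _ _ h2l (IM _ _ m01)) | ring].
by rewrite !expr2; split.
Qed.

Section Cyclic.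
Variables (n : nat) (A B : 'M[k]_(4, n)) (D : 'M[k]_(n, 4)) (f : {poly k} -> 'rV[k]_4).
Variables (Q : 'M[k]_4) (chi : {poly k}).
Hypothesis f_lin : linear f.
Hypotheses (fker : forall p, f p = 0 -> chi %| p) (chi_size : size chi = 5).
Hypothesis QA : forall j : 'I_4, row j (Q *m A *m D) = f 'X^j.
Hypothesis QB : forall j : 'I_4, row j (Q *m B *m D) = f 'X^(j.+1).

Let F : 'M[k]_4 := \matrix_(j < 4) f 'X^j.

Lemma cyclic_poly (c : 'rV[k]_4) : c *m F = f (\sum_(j < 4) c 0 j *: 'X^j).
Proof.
pose fl : {linear {poly k} -> 'rV[k]_4} := HB.pack f (GRing.isLinear.Build _ _ _ _ f f_lin).
rewrite -[f]/(fl : _ -> _) linear_sum mulmx_sum_row; apply: eq_bigr => j _.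
by rewrite linearZ rowK.
Qed.

Lemma cyclic_unit : F \in unitmx.
Proof.
rewrite -row_free_unit; apply: inj_row_free => c; rewrite cyclic_poly => /fker dv.
have p0 : \sum_(j < 4) c 0 j *: 'X^j = 0.
  apply/eqP; move: dv; apply: contraTT => nz; apply/negP => /(dvdp_leq nz).
  rewrite chi_size ltnNge => /negP; apply.
  have -> : \sum_(j < 4) c 0 j *: 'X^j = \poly_(j < 4) (if insub j is Some i then c 0 i else 0).
    by rewrite poly_def; apply: eq_bigr => j _; rewrite valK.
  by rewrite size_poly.
apply/rowP => j; rewrite [RHS]mxE -[RHS](coef0 _ j) -p0 coef_sum (bigD1 j) //= coefZ coefXn eqxx mulr1.
by rewrite big1 ?addr0 // => i ne; rewrite coefZ coefXn (_ : (_ == _) = false) ?mulr0 //; apply/negbTE; rewrite eq_sym.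
Qed.

Lemma cyclic_unitQ : Q \in unitmx.
Proof.
have : Q *m (A *m D *m invmx F) = 1%:M.
  rewrite !mulmxA (_ : Q *m A *m D = F) ?mulmxV ?cyclic_unit //.
  by apply/row_matrixP => j; rewrite QA rowK.
by case/mulmx1_unit.
Qed.

(* Modulo the forms vanishing on the last three coordinates with respect to F the
   matrix becomes [0 x1 x2 x3; x1 x2 x3 l]. *)
Lemma cyclic_small : small (pform (Q *m A) (Q *m B)).
Proof.
have uF := cyclic_unit; pose D1 := D *m invmx F.
pose T : 'M[k]_(4, 3) := \matrix_(i, j) (i == j.+1 :> nat)%:R.
pose D2 := D1 *m T.
have QA1 : Q *m A *m D1 = 1%:M.
  rewrite mulmxA (_ : Q *m A *m D = F) ?mulmxV //.
  by apply/row_matrixP => j; rewrite QA rowK.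
have QAr j : row j (Q *m A) *m D1 = delta_mx 0 j by rewrite -row_mul QA1 row1.
pose A0 := row_base (kermx D2); have fA0 : row_free A0 := row_base_free _.
have [Dk AD] := row_free_inv fA0.
pose K := kill_mx A0 Dk.
have A0D : A0 *m D2 = 0 by apply/eqP; rewrite -sub_kermx eq_row_base.
have AK : A0 *m K = 0 by rewrite /K /kill_mx mulmxBr mulmx1 mulmxA AD mul1mx subrr.
have killed (w : 'rV[k]_n) : w *m D2 = 0 -> w *m K = 0.
  move/eqP; rewrite -sub_kermx -(eq_row_base (kermx D2)) => /submxP[u ->].
  by rewrite -mulmxA AK mulmx0.
have sameK (w w' : 'rV[k]_n) : w *m D2 = w' *m D2 -> w *m K = w' *m K.
  by move=> e; apply/eqP; rewrite -subr_eq0 -mulmxBl; apply/eqP/killed; rewrite mulmxBl e subrr.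
pose x (j : 'I_4) := row j (Q *m A) *m K.
have aux r (X : 'M[k]_(n, r)) (Y : 'M[k]_(r, n)) (Z : 'M[k]_(n, 3)) (w : 'rV[k]_n) :
    Y *m Z = 0 -> w *m (X *m Y) *m Z = 0.
  by move=> e; rewrite -!mulmxA e !mulmx0.
have K2 (w : 'rV[k]_n) : w *m K = 0 -> w *m D2 = 0.
  rewrite /K /kill_mx mulmxBr mulmx1 => /eqP; rewrite subr_eq0 => /eqP ->.
  exact: aux A0D.
have x0 : x 0 = 0.
  apply: killed; rewrite /D2 mulmxA QAr; apply/rowP => j.
  by rewrite -rowE !mxE.
have fx : free [:: x 1; x (inord 2); x (inord 3)].
  apply/(@freeP _ _ _ (in_tuple _)) => c; rewrite !big_ord_recl big_ord0 /= addr0 => e.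
  have : (c 0 *: row 1 (Q *m A) + (c 1 *: row (inord 2) (Q *m A)
      + c (inord 2) *: row (inord 3) (Q *m A))) *m K = 0.
    rewrite -[RHS]e !mulmxDl -!scalemxAl; congr (c _ *: _ + (c _ *: _ + c _ *: _)); apply/val_inj => //=.
    by rewrite inordK.
  have xD i : row i (Q *m A) *m D2 = row i T by rewrite /D2 mulmxA QAr -rowE.
  move/K2; rewrite !mulmxDl -!scalemxAl !xD => /rowP e'.
  have c0 : c 0 = 0.
    by have := e' 0; rewrite !mxE /= !inordK //= mulr1 !mulr0 !addr0.
  have c1 : c 1 = 0.
    by have := e' 1; rewrite !mxE /= !inordK //= mulr1 !mulr0 addr0 add0r.
  have c2 : c (inord 2) = 0.
    by have := e' (inord 2); rewrite !mxE /= !inordK //= mulr1 !mulr0 !add0r.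
  move=> [[|[|[|//]]] lt]; [rewrite -[RHS]c0 | rewrite -[RHS]c1 | rewrite -[RHS]c2];
  by congr c; apply/val_inj => //=; rewrite inordK.
have xB (j : 'I_4) (lt : (j.+1 < 4)%N) : row j (Q *m B) *m K = x (Ordinal lt).
  apply: sameK; rewrite /D2 !mulmxA; congr (_ *m _ *m _).
  by rewrite -!row_mul QB QA.
pose c := row (inord 3) (Q *m B) *m D1.
have xBc : row (inord 3) (Q *m B) *m K = \sum_j c 0 j *: x j.
  transitivity (c *m (Q *m A) *m K).
    apply: sameK; have h (X : 'M[k]_(4, n)) (u : 'rV[k]_4) : X *m D1 = 1%:M -> u *m X *m D2 = u *m T.
      by move=> e; rewrite /D2 mulmxA -(mulmxA u) e mulmx1.
    by rewrite (h _ c QA1) /D2 mulmxA.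
  rewrite -mulmxA mulmx_sum_row; apply: eq_bigr => j _.
  by rewrite row_mul.
split.
  by move=> i j; rewrite mxE lform_homog.
exists _, A0, Dk, (x 1), (x (inord 2)), (x (inord 3)) => T0.
have -> : T0 = mxs 2 4 [:: [:: 0; lform (x 1); lform (x (inord 2)); lform (x (inord 3))];
    [:: lform (x 1); lform (x (inord 2)); lform (x (inord 3));
        c 0 1 *: lform (x 1) + c 0 (inord 2) *: lform (x (inord 2)) + c 0 (inord 3) *: lform (x (inord 3))]].
  apply/matrixP => i j; rewrite [RHS]mxE [LHS]mxE [pform _ _ _ _]mxE lsubst_lform -/K; case: i => [[|[|//]] ?] /=.
    case: j => [[|[|[|[|//]]]] lt] /=.
    + by rewrite -[RHS](raddf0 (@lform k n)) -x0; congr (lform (row _ _ *m _)); apply/val_inj.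
    + by congr (lform (row _ _ *m _)); apply/val_inj.
    + by congr (lform (row _ _ *m _)); apply/val_inj; rewrite /= inordK.
    by congr (lform (row _ _ *m _)); apply/val_inj; rewrite /= inordK.
  case: j => [[|[|[|[|//]]]] lt] /=.
  + by rewrite xB; congr (lform (x _)); apply/val_inj.
  + by rewrite xB; congr (lform (x _)); apply/val_inj; rewrite /= inordK.
  + by rewrite xB; congr (lform (x _)); apply/val_inj; rewrite /= inordK.
  have -> : Ordinal lt = inord 3 by apply/val_inj; rewrite /= inordK.
  rewrite xBc !big_ord_recl big_ord0 addr0 [x ord0]x0 scaler0 add0r addrA.
  have ljE (a1 a2 a3 : k) (u1 u2 u3 : 'rV[k]_n) : lform (a1 *: u1 + a2 *: u2 + a3 *: u3)
    = a1 *: lform u1 + a2 *: lform u2 + a3 *: lform u3 by rewrite !linearD !linearZ.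
  rewrite ljE.
  have j1 : lift ord0 ord0 = 1 :> 'I_4 by apply/val_inj.
  have j2 : lift ord0 (lift ord0 ord0) = inord 2 :> 'I_4 by apply/val_inj; rewrite /= inordK.
  have j3 : lift ord0 (lift ord0 (lift ord0 ord0)) = inord 3 :> 'I_4 by apply/val_inj; rewrite /= inordK.
  by rewrite j1 j2 j3.
have [m1 m2 m3] := hankel_minors (lform (x 1)) (lform (x (inord 2))) (lform (x (inord 3)))
  (c 0 1) (c 0 (inord 2)) (c 0 (inord 3)).
by split; [exact: AD | exact: fx | exact: m1 | exact: m2 | exact: m3].
Qed.

End Cyclic.

Lemma cyclic_data_small n (Theta : 'M[{mpoly k[n]}]_(2, 4)) L es :
    nf_data Theta L -> ~~ has is_D (blocks L) -> uniq es -> all2 eigen_compat (blocks L) es ->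
  small Theta /\ exists (D : 'M[k]_(n, 4)) (f : {poly k} -> 'rV[k]_4) (Q : 'M[k]_4),
    let A := mx1 (lcols L) in let B := mx2 (lcols L) in
    [/\ linear f, forall p, f p = 0 -> char_prod (blocks L) es %| p,
      forall j : 'I_4, row j (Q *m A *m D) = f 'X^j &
      forall j : 'I_4, row j (Q *m B *m D) = f 'X^(j.+1)].
Proof.
move=> [wf fr sz eqv] nD ue comp.
have wall : all (@block_wf k) (blocks L) by rewrite -(wf_mk (blocks L) (nth 0 (lforms L))) mk_lforms.
have width : KW_width (blocks L) = 4 by rewrite -size_lcols.
have [|L' [f [Lb wL' flin _ [fdvd fcs]]]] := @cyclic_data 4 0 _ _ wall nD ue comp; first by rewrite add0n width.
have [D DE] := data_points wf wL' (esym Lb) fr.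
have csP (j : 'I_4) : {cs : seq k | size cs = 4 /\
    (\sum_(c < 4) cs`_c *: ((nth (0, 0) (lcols L) c).1 *m D) = f 'X^j /\
     \sum_(c < 4) cs`_c *: ((nth (0, 0) (lcols L) c).2 *m D) = f 'X^(j.+1))}.
  apply: constructive_indefinite_description; have [cs scs [e1 e2]] := fcs 'X^j.
  have sz' : size (lcols L') = 4 by rewrite DE size_map.
  rewrite exprS; exists cs; split; first by rewrite scs.
  move: e1 e2; rewrite !comb_nth // sz' => <- <-.
  split; apply: eq_bigr => c _; congr (_ *: _);
  by rewrite DE (nth_map (0, 0)) ?sz.
pose Q : 'M[k]_4 := \matrix_(j, c) (sval (csP j))`_c.
have QA (j : 'I_4) : row j (Q *m mx1 (lcols L) *m D) = f 'X^j.
  have [_ [e _]] := proj2_sig (csP j); rewrite -[RHS]e -mulmxA row_mul mulmx_sum_row.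
  by apply: eq_bigr => c _; rewrite row_mul (proj1 (rowM _ _)) !mxE.
have QB (j : 'I_4) : row j (Q *m mx2 (lcols L) *m D) = f 'X^(j.+1).
  have [_ [_ e]] := proj2_sig (csP j); rewrite -[RHS]e -mulmxA row_mul mulmx_sum_row.
  by apply: eq_bigr => c _; rewrite row_mul (proj2 (rowM _ _)) !mxE.
have chi_size : size (char_prod (blocks L) es) = 5.
  have ses : size (blocks L) = size es by move: comp; rewrite all2E => /andP[/eqP].
  by have [_ ->] := char_prod_size ses; rewrite width.
split; last by exists D, f, Q.
apply: (small_equiv eqv); rewrite form_mxE.
have uQ := cyclic_unitQ flin fdvd chi_size QA.
apply: small_equiv (pform_col_equiv _ _ uQ) _.
exact: cyclic_small flin fdvd chi_size QA QB.
Qed.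

End CyclicData.

Lemma ratio_identities (F : fieldType) (a b : F) : a != 0 -> b != 0 ->
  [/\ b * b = a * (b ^+ 2 / a), b * (b ^+ 2 / a) = a * (b ^+ 3 / a ^+ 2),
      a ^+ 2 * (b ^+ 3 / a ^+ 2) = b ^+ 3 & forall c, b * (a / b * c) = a * c].
Proof. by move=> a0 b0; split=> [|||c]; field; rewrite ?a0 ?b0. Qed.

(** * Primes of height two for the Buchsbaum-Rim types *)

Section BRClass.
Variables (k : fieldType) (m : nat).
Local Notation R := {mpoly k[m.+3]}.
Local Notation V := 'rV[k]_m.+3.

Lemma small_invariants (Theta N : 'M[R]_(2, 4)) (P : R -> Prop) l :
    KW_equiv Theta N -> small N -> is_prime_ideal P -> ~ prime_height_ge P 3 ->
    (forall i, P (BR_middle N i l)) -> (exists i j, ~ P (BR_middle N i j)) ->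
  BR_type Theta /\ invariants Theta 3 2 BR_degrees.
Proof.
move=> eqv sN P_prime Ph Pl nP; have sT := small_equiv eqv sN.
have [Tl _] := sT; have [Nl _] := sN.
have BT := BR_type_of_exact Tl (small_BR_exact sT).
have [hB hi] := BR_has_Bour Nl (small_BR_exact sN) P_prime Ph Pl nP.
split=> //; split.
- exact: has_Bour_equiv eqv hB.
- exact: indeg_equiv eqv hi.
by exists 1%:M, (BR_maps Theta).
Qed.

Let i3 : 'I_4 := Ordinal (isT : (3 < 4)%N).

(** Column 3 of the middle map holds, up to sign, the minors of the first three columns. This column
    is the syzygy nu for which the Bourbaki ideal is caught in P. *)
Lemma drop_last_minors (P : R -> Prop) (c0 c1 c2 c3 : V * V) :
    is_prime_ideal P ->
    (forall x y, x \in [:: c0; c1; c2] -> y \in [:: c0; c1; c2] ->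
       P (lform x.1 * lform y.2 - lform y.1 * lform x.2)) ->
  forall i, P (BR_middle (form_mx [:: c0; c1; c2; c3]) i i3).
Proof.
move=> [[I0 ID IM] _ _] h i.
have PN f : P f -> P (- f) by rewrite -mulN1r; apply: IM.
rewrite /form_mx /= BR_middle_mxs mxE; case: (ord4P i) => -> /=.
- by apply: h; rewrite !inE eqxx ?orbT.
- by apply: PN; apply: h; rewrite !inE eqxx ?orbT.
- by apply: h; rewrite !inE eqxx ?orbT.
exact: I0.
Qed.

(** The second row of the first three columns is (l1, l2, 0), so their minors lie in (l1, l2),
    whereas the minor y l3 of the last two columns does not. *)
Lemma eigen_prime (a b c y l1 l2 l3 : V) : free [:: l3; l1; l2] -> free [:: y; l1; l2] ->
  let N := form_mx [:: (a, l1); (b, l2); (y, 0); (c, l3)] in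
  exists P l, [/\ is_prime_ideal P, ~ prime_height_ge P 3, forall i, P (BR_middle N i l)
    & exists i j, ~ P (BR_middle N i j)].
Proof.
move=> f3 fy N; have f12 : free [:: l1; l2] by move: fy; rewrite free_cons => /andP[].
have P_prime := inF_prime f12; have [[I0 ID IM] _ Pp] := P_prime.
exists (inF [:: l1; l2]), i3; split=> //.
- exact: inF2_height.
- apply: drop_last_minors => // x z.
  have hL d : d \in [:: (a, l1); (b, l2); (y, 0 : V)] -> inF [:: l1; l2] (lform d.2).
    rewrite !inE => /or3P[] /eqP -> /=; last by rewrite raddf0.
      by apply: (@inF_row _ _ [:: l1; l2] 0).
    by apply: (@inF_row _ _ [:: l1; l2] 1).
  move=> /hL hx /hL hz; apply: ID; first exact: IM.
  by rewrite -mulNr; apply: IM.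
exists 0, 1; rewrite /N /form_mx /= BR_middle_mxs mxE /= raddf0 mulr0 subr0.
by case/Pp => [/(inF_notin fy)|/(inF_notin f3)].
Qed.

Lemma D3_prime (x1 x2 x3 : V) : free [:: x3; x1; x2] ->
  let N := form_mx [:: (x1, 0); (x2, x1); (x3, x2); (0, x3)] in
  small N /\ exists P l, [/\ is_prime_ideal P, ~ prime_height_ge P 3, forall i, P (BR_middle N i l)
    & exists i j, ~ P (BR_middle N i j)].
Proof.
move=> f3 N; have f12 : free [:: x1; x2] by move: f3; rewrite free_cons => /andP[].
have P_prime := inF_prime f12; have [[I0 ID IM] _ Pp] := P_prime.
have f123 : free [:: x1; x2; x3] by have := @free_sub k _ [:: x3; x1; x2] [:: 1; 2; 0]%N isT isT f3.
split.
  split; first exact: form_mx_lin.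
  (* No form is killed: the ideal of minors of [D_3] already contains the three squares. *)
  exists 0%N, 0, 0, x1, x2, x3 => T.
  have D0 : (0 : 'M[k]_(0, m.+3)) *m (0 : 'M[k]_(m.+3, 0)) = 1%:M by apply/matrixP => -[].
  have -> : T = N.
    apply/matrixP => i j; rewrite [LHS]mxE; have [c] := kill_sub (0 : 'M[k]_(0, m.+3)) (0 : 'M[k]_(m.+3, 0)) (N i j).
    by rewrite big_ord0 => /eqP; rewrite subr_eq0 => /eqP.
  have [J0 JD JM] := in_minors_ideal N.
  have hM i l : in_minors N (BR_middle N i l) by rewrite BR_middleE; apply: in_minors_form.
  have NE : N = mxs 2 4 [:: [:: lform x1; lform x2; lform x3; 0]; [:: 0; lform x1; lform x2; lform x3]].
    by rewrite /N /form_mx /= raddf0.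
  pose o (i : nat) (lt : (i < 4)%N) : 'I_4 := Ordinal lt.
  have m01 := hM (o 0%N isT) (o 1%N isT); rewrite {2}NE BR_middle_mxs mxE /= in m01.
  have m03 := hM (o 0%N isT) (o 3%N isT); rewrite {2}NE BR_middle_mxs mxE /= in m03.
  have m12 := hM (o 1%N isT) (o 2%N isT); rewrite {2}NE BR_middle_mxs mxE /= in m12.
  have m23 := hM (o 2%N isT) (o 3%N isT); rewrite {2}NE BR_middle_mxs mxE /= in m23.
  split; [exact: D0 | exact: f123 | | | ].
  - rewrite (_ : _ ^+ 2 = 1 * (lform x1 * lform x1 - lform x2 * 0)); [exact: (JM _ _ m23) | ring].
  - rewrite (_ : _ ^+ 2 = 1 * (lform x2 * lform x2 - lform x3 * lform x1)
      + 1 * (lform x1 * lform x3 - 0 * 0)); [exact: (JD _ _ (JM _ _ m03) (JM _ _ m12)) | ring].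
  rewrite (_ : _ ^+ 2 = 1 * (lform x3 * lform x3 - 0 * lform x2)); [exact: (JM _ _ m01) | ring].
exists (inF [:: x1; x2]), i3; split=> //.
- exact: inF2_height.
- have h1 : inF [:: x1; x2] (lform x1) by apply: (@inF_row _ _ [:: x1; x2] 0).
  have h2 : inF [:: x1; x2] (lform x2) by apply: (@inF_row _ _ [:: x1; x2] 1).
  apply: drop_last_minors => // x z.
  have hL d : d \in [:: (x1, 0 : V); (x2, x1); (x3, x2)] -> inF [:: x1; x2] (lform d.2).
    by rewrite !inE => /or3P[] /eqP -> //=; rewrite raddf0.
  move=> /hL hx /hL hz; apply: ID; first exact: IM.
  by rewrite -mulNr; apply: IM.
exists 0, 1; rewrite /N /form_mx /= BR_middle_mxs mxE /= raddf0 mul0r subr0.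
by case/Pp => /(inF_notin f3).
Qed.

Section RationalPrime.
Local Notation F := {fraction R}.

Lemma spec_point (d0 d1 : V) (rest : seq V) (t0 t1 : F) : free (d0 :: d1 :: rest) ->
  exists W T, [/\ W \in unitmx, forall l : 'I_m.+1, T (rshift 2 l) = tofrac 'X_(rshift 2 l),
    spec_forms W T (lform d0) = t0, spec_forms W T (lform d1) = t1
    & (((size rest).+2 <= m.+3)%N *
       forall i, (i < size rest)%N -> spec_forms W T (lform rest`_i) = tofrac 'X_(inord i.+2))%type].
Proof.
move=> fr; have fl := free_lmx fr; have [W uW WE] := extend_row_free fl.
have le_n : ((size rest).+2 <= m.+3)%N.
  by have := rank_leq_col (lmx (d0 :: d1 :: rest)); rewrite (eqP fl).
pose T (l : 'I_m.+3) : F := if l == 0%N :> nat then t0 else if l == 1%N :> nat then t1 else tofrac 'X_l.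
have rW i : (i < (size rest).+2)%N -> row (inord i) W = (d0 :: d1 :: rest)`_i.
  move=> lt_i; have lt_n := leq_trans lt_i le_n.
  have -> : (d0 :: d1 :: rest)`_i = row (Ordinal lt_i) (lmx (d0 :: d1 :: rest)).
    by apply/rowP => j; rewrite mxE mxE.
  rewrite -WE; apply/rowP => j; rewrite [RHS]mxE [RHS]mxE (bigD1 (inord i)) //= big1 => [|l nl].
    by rewrite addr0 [LHS]mxE [pid_mx _ _ _]mxE /= inordK // eqxx lt_i mul1r.
  rewrite mxE; case: eqP => [e|_]; last by rewrite mul0r.
  by move/eqP: nl; case; apply/val_inj; rewrite /= inordK.
have sp i : (i < (size rest).+2)%N -> spec_forms W T (lform (d0 :: d1 :: rest)`_i) = T (inord i).
  by move=> lt; rewrite -rW // spec_formsE.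
exists W, T; split=> //.
- by rewrite -[d0]/((d0 :: d1 :: rest)`_0) sp // /T inordK.
- by rewrite -[d1]/((d0 :: d1 :: rest)`_1) sp // /T inordK.
split=> // i lt; rewrite -[rest`_i]/((d0 :: d1 :: rest)`_i.+2) sp // /T inordK //.
exact: leq_trans le_n.
Qed.

(* Columns 0, 1, 2 are proportional at the point, with ratio s = X_a / X_b, and the
   last column is not. *)
Lemma ratio_prime (c0 c1 c2 c3 : V * V) (W : 'M[k]_m.+3) T (a b j : 'I_m.+3) (g : R) :
    W \in unitmx -> (forall l : 'I_m.+1, T (rshift 2 l) = tofrac 'X_(rshift 2 l)) ->
    let rho w := spec_forms W T (lform w) in
    (forall x, x \in [:: c0; c1; c2] -> tofrac 'X_b * rho x.2 = tofrac 'X_a * rho x.1) ->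
    rho c0.1 != 0 -> j != a -> j != b -> rho c3.1 = tofrac 'X_j ->
    tofrac ('X_a ^+ 2) * rho c3.2 = tofrac g ->
    g.@[fun i => (i != j)%:R] != 0 ->
  let N := form_mx [:: c0; c1; c2; c3] in
  exists P l, [/\ is_prime_ideal P, ~ prime_height_ge P 3, forall i, P (BR_middle N i l)
    & exists i j, ~ P (BR_middle N i j)].
Proof.
move=> uW T_rat rho prop c00 ja jb c31 c32 g0 N.
have Xn0 (i : 'I_m.+3) : tofrac ('X_i : R) != 0 :> F.
  rewrite tofrac_eq0; apply/eqP => /(congr1 (mcoeff U_(i))).
  by rewrite mcoeffX eqxx mcoeff0 => /eqP; rewrite oner_eq0.
exists (fun f => spec_forms W T f = 0), i3; split.
- exact: spec_forms_prime.
- exact: spec_forms_height.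
- apply: (@drop_last_minors (fun f => spec_forms W T f = 0)); first exact: spec_forms_prime.
  move=> x y /prop px /prop py; rewrite rmorphB !rmorphM /= -/(rho _) -/(rho _) -/(rho _) -/(rho _).
  apply: (mulfI (Xn0 b)); rewrite mulr0 mulrBr.
  have -> : tofrac 'X_b * (rho x.1 * rho y.2) = rho x.1 * (tofrac 'X_b * rho y.2) by ring.
  have -> : tofrac 'X_b * (rho y.1 * rho x.2) = rho y.1 * (tofrac 'X_b * rho x.2) by ring.
  by rewrite px py; ring.
exists 1, (Ordinal (isT : (2 < 4)%N)); rewrite /N /form_mx /= BR_middle_mxs mxE /=.
rewrite rmorphB !rmorphM /= -/(rho _) -/(rho _) -/(rho _) -/(rho _) => e.
have c0in : c0 \in [:: c0; c1; c2] by rewrite !inE eqxx.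
have e1 : tofrac 'X_b * rho c3.2 = tofrac 'X_a * rho c3.1.
  apply: (mulfI c00); transitivity (tofrac 'X_b * (rho c0.1 * rho c3.2)); first by ring.
  have -> : rho c0.1 * rho c3.2 = rho c3.1 * rho c0.2 by apply/eqP; rewrite -subr_eq0 e.
  transitivity (rho c3.1 * (tofrac 'X_b * rho c0.2)); first by ring.
  by rewrite (prop _ c0in); ring.
have : tofrac (g * 'X_b) = tofrac ('X_a ^+ 3 * 'X_j) :> F.
  rewrite !rmorphM /= -c32 -c31 mulrAC -[LHS]mulrA e1 !rmorphXn /=; ring.
(* At the point with j-th coordinate 0 and all others 1 the right-hand side vanishes and the
   left-hand side does not. *)
move/eqP; rewrite tofrac_eq => /eqP/(congr1 (meval (fun i => (i != j)%:R))) => /eqP.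
rewrite !mevalM !mevalXU eqxx mulr0 [b == j]eq_sym jb mulr1.
by rewrite (negPf g0).
Qed.

Local Notation X i := (tofrac ('X_(inord i) : R) : F).

(** The forms d0 and d1 come first because only the first two values of a specialisation are free;
    these values make the columns c1 and c2 proportional to (z1, z0). Hence z0 and z1 become the
    variables 2 and 3, and the l-th form of [rest] the variable l + 4. *)
Lemma ratio_shape (z0 z1 d0 d1 : V) (rest : seq V) (t0 t1 : F) (c1 c2 : V * V) (q : V) i (g : R) :
    free (d0 :: d1 :: z0 :: z1 :: rest) -> (i < size rest)%N ->
    (forall rho : V -> F, rho z0 = X 2 -> rho z1 = X 3 -> rho d0 = t0 -> rho d1 = t1 ->
       (forall l, (l < size rest)%N -> rho rest`_l = X l.+4) ->
       [/\ X 3 * rho c1.2 = X 2 * rho c1.1, X 3 * rho c2.2 = X 2 * rho c2.1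
         & X 2 ^+ 2 * rho q = tofrac g]) ->
    g.@[fun l : 'I_m.+3 => (l != inord i.+4)%:R] != 0 ->
  let N := form_mx [:: (z1, z0); c1; c2; (rest`_i, q)] in
  exists P l, [/\ is_prime_ideal P, ~ prime_height_ge P 3, forall i, P (BR_middle N i l)
    & exists i j, ~ P (BR_middle N i j)].
Proof.
move=> fr lt_i h g0; have [W [T [uW T_rat e0 e1 [sz eX]]]] := spec_point t0 t1 fr.
rewrite /= in sz eX; have ez0 := eX 0%N isT; have ez1 := eX 1%N isT.
have eR l : (l < size rest)%N -> spec_forms W T (lform rest`_l) = X l.+4 by move=> lt; apply: (eX l.+2).
have [h1 h2 h3] := h (fun w => spec_forms W T (lform w)) ez0 ez1 e0 e1 eR.
have ne l : (l < 4)%N -> inord i.+4 != inord l :> 'I_m.+3.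
  move=> lt; apply/eqP => /(congr1 val); rewrite /= !inordK; last 2 first.
  - by apply: leq_trans sz; apply: (leq_trans lt); rewrite !ltnS.
  - by apply: leq_trans sz; rewrite !ltnS.
  by move=> e; move: lt; rewrite -e.
apply: (@ratio_prime (z1, z0) c1 c2 (rest`_i, q) W T (inord 2) (inord 3) (inord i.+4) g uW T_rat).
- by move=> x; rewrite !inE => /or3P[] /eqP -> //=; rewrite ez0 ez1 mulrC.
- rewrite /= ez1 tofrac_eq0; apply/eqP => /(congr1 (mcoeff U_(inord 3))).
  by rewrite mcoeffX eqxx mcoeff0 => /eqP; rewrite oner_eq0.
- exact: ne.
- exact: ne.
- exact: eR.
- by rewrite rmorphXn.
exact: g0.
Qed.

Lemma X_neq0 i : X i != 0.
Proof.
rewrite tofrac_eq0; apply/eqP => /(congr1 (mcoeff U_(inord i))).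
by rewrite mcoeffX eqxx mcoeff0 => /eqP; rewrite oner_eq0.
Qed.

Lemma eval_monomial (j : 'I_m.+3) (a b : 'I_m.+3) i l : a != j -> b != j ->
  ('X_a ^+ i * 'X_b ^+ l : R).@[fun l : 'I_m.+3 => (l != j)%:R] != 0.
Proof. by move=> aj bj; rewrite rmorphM !rmorphXn /= !mevalXU aj bj !expr1n mulr1 oner_neq0. Qed.

Lemma inord_neq i j : (i < m.+3)%N -> (j < m.+3)%N -> i != j -> inord i != inord j :> 'I_m.+3.
Proof. by move=> lt1 lt2; apply: contra_neq => /(congr1 val); rewrite /= !inordK. Qed.

Lemma free_size_le (s : seq V) : free s -> (size s <= m.+3)%N.
Proof. by move=> fr; have := rank_leq_col (lmx s); rewrite (eqP (free_lmx fr)). Qed.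

Lemma free_pick (s : seq V) : free s -> forall idx, uniq idx -> all (fun i => i < size s)%N idx ->
  free [seq s`_i | i <- idx].
Proof. by move=> fr idx u_idx lt; apply: free_sub. Qed.

Arguments free_pick {s} _ idx _ _.

Definition minor_prime (N : 'M[R]_(2, 4)) := exists P l,
  [/\ is_prime_ideal P, ~ prime_height_ge P 3, forall i, P (BR_middle N i l)
    & exists i j, ~ P (BR_middle N i j)].

(** z0, z1, z2, z3 are sent to a geometric progression, which makes the first three columns
    proportional, while z4 stays a variable. In the lists of several blocks below, the columns among
    the first three share one common ratio in the same way. *)
Lemma B4_prime z0 z1 z2 z3 z4 : free [:: z0; z1; z2; z3; z4] ->
  minor_prime (form_mx [:: (z1, z0); (z2, z1); (z3, z2); (z4, z3)]).
Proof.
move=> fr; have sz := free_size_le fr.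
have fr' := free_pick fr ([:: 2; 3; 0; 1; 4]%N) isT isT.
apply: (@ratio_shape z0 z1 z2 z3 [:: z4] (X 3 ^+ 2 / X 2) (X 3 ^+ 3 / X 2 ^+ 2) (z2, z1) (z3, z2) z3
  0%N ('X_(inord 3) ^+ 3 * 'X_(inord 3) ^+ 0) fr' isT); last first.
  by apply: eval_monomial; apply: inord_neq => //; apply: leq_trans sz.
move=> rho e0 e1 e2 e3 eR; rewrite /= !(e0, e1, e2, e3) expr0 mulr1 rmorphXn /=.
by have [h1 h2 h3 h4] := ratio_identities (X_neq0 2) (X_neq0 3).
Qed.

Lemma B31_prime z0 z1 z2 z3 u0 u1 : free [:: z0; z1; z2; z3; u0; u1] ->
  minor_prime (form_mx [:: (z1, z0); (z2, z1); (z3, z2); (u1, u0)]).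
Proof.
move=> fr; have sz := free_size_le fr.
have fr' := free_pick fr ([:: 2; 3; 0; 1; 5; 4]%N) isT isT.
apply: (@ratio_shape z0 z1 z2 z3 [:: u1; u0] (X 3 ^+ 2 / X 2) (X 3 ^+ 3 / X 2 ^+ 2) (z2, z1) (z3, z2)
  u0 0%N ('X_(inord 2) ^+ 2 * 'X_(inord 5) ^+ 1) fr' isT); last first.
  by apply: eval_monomial; apply: inord_neq => //; apply: leq_trans sz.
move=> rho e0 e1 e2 e3 eR; rewrite /= !(e0, e1, e2, e3) (eR 1%N isT : rho u0 = _) expr1 rmorphM rmorphXn /=.
by have [h1 h2 h3 h4] := ratio_identities (X_neq0 2) (X_neq0 3).
Qed.

Lemma B22_prime z0 z1 z2 u0 u1 u2 : free [:: z0; z1; z2; u0; u1; u2] ->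
  minor_prime (form_mx [:: (z1, z0); (z2, z1); (u1, u0); (u2, u1)]).
Proof.
move=> fr; have sz := free_size_le fr.
have fr' := free_pick fr ([:: 2; 3; 0; 1; 4; 5]%N) isT isT.
apply: (@ratio_shape z0 z1 z2 u0 [:: u1; u2] (X 3 ^+ 2 / X 2) (X 2 / X 3 * X 4) (z2, z1) (u1, u0)
  u1 1%N ('X_(inord 2) ^+ 2 * 'X_(inord 4) ^+ 1) fr' isT); last first.
  by apply: eval_monomial; apply: inord_neq => //; apply: leq_trans sz.
move=> rho e0 e1 e2 e3 eR; rewrite /= !(e0, e1, e2, e3) (eR 0%N isT : rho u1 = _) expr1 rmorphM rmorphXn /=.
by have [h1 h2 h3 h4] := ratio_identities (X_neq0 2) (X_neq0 3); split=> //; apply: h4.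
Qed.

Lemma B211_prime z0 z1 z2 u0 u1 v0 v1 : free [:: z0; z1; z2; u0; u1; v0; v1] ->
  minor_prime (form_mx [:: (z1, z0); (z2, z1); (u1, u0); (v1, v0)]).
Proof.
move=> fr; have sz := free_size_le fr.
have fr' := free_pick fr ([:: 2; 3; 0; 1; 4; 6; 5]%N) isT isT.
apply: (@ratio_shape z0 z1 z2 u0 [:: u1; v1; v0] (X 3 ^+ 2 / X 2) (X 2 / X 3 * X 4) (z2, z1) (u1, u0)
  v0 1%N ('X_(inord 2) ^+ 2 * 'X_(inord 6) ^+ 1) fr' isT); last first.
  by apply: eval_monomial; apply: inord_neq => //; apply: leq_trans sz.
move=> rho e0 e1 e2 e3 eR; rewrite /= !(e0, e1, e2, e3) (eR 0%N isT : rho u1 = _) (eR 2%N isT : rho v0 = _).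
rewrite expr1 rmorphM rmorphXn /=.
by have [h1 h2 h3 h4] := ratio_identities (X_neq0 2) (X_neq0 3); split=> //; apply: h4.
Qed.

Lemma B1111_prime z0 z1 u0 u1 v0 v1 w0 w1 : free [:: z0; z1; u0; u1; v0; v1; w0; w1] ->
  minor_prime (form_mx [:: (z1, z0); (u1, u0); (v1, v0); (w1, w0)]).
Proof.
move=> fr; have sz := free_size_le fr.
have fr' := free_pick fr ([:: 2; 4; 0; 1; 3; 5; 7; 6]%N) isT isT.
apply: (@ratio_shape z0 z1 u0 v0 [:: u1; v1; w1; w0] (X 2 / X 3 * X 4) (X 2 / X 3 * X 5) (u1, u0) (v1, v0)
  w0 2%N ('X_(inord 2) ^+ 2 * 'X_(inord 7) ^+ 1) fr' isT); last first.
  by apply: eval_monomial; apply: inord_neq => //; apply: leq_trans sz.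
move=> rho e0 e1 e2 e3 eR; rewrite /= !(e0, e1, e2, e3) (eR 0%N isT : rho u1 = _)
  (eR 1%N isT : rho v1 = _) (eR 3%N isT : rho w0 = _).
rewrite expr1 rmorphM rmorphXn /=.
by have [h1 h2 h3 h4] := ratio_identities (X_neq0 2) (X_neq0 3); split=> //; apply: h4.
Qed.

End RationalPrime.
End BRClass.

Arguments free_pick {k m s} _ idx _ _.

Ltac perm_lists := apply/seq.permP => ? /=; lia.

Lemma perm_eq4 (T : eqType) (a b c d : T) :
  [/\ perm_eq [:: a; b; c; d] [:: a; b; d; c], perm_eq [:: a; b; c; d] [:: b; c; d; a]
    & perm_eq [:: a; b; c; d] [:: a; c; d; b]].
Proof. by split; perm_lists. Qed.

Section DistinctEigenvalues.
Variables (k : fieldType) (m : nat).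
Local Notation R := {mpoly k[m.+3]}.
Local Notation V := 'rV[k]_m.+3.

Lemma span2 (y a b : V) : y \in <<[:: a; b]>>%VS -> exists c d, y = c *: a + d *: b.
Proof.
rewrite span_cons => /memv_addP[u /vlineP[c ->]] [w]; rewrite span_seq1 => /vlineP[d ->] ->.
by exists c, d.
Qed.

(** The three planes spanned by two of the forms have only 0 in common. *)
Lemma choose_pair (l0 l1 l2 y : V) : free [:: l0; l1; l2] -> y != 0 ->
  [\/ free [:: y; l0; l1], free [:: y; l1; l2] | free [:: y; l0; l2]].
Proof.
move=> fr y0; have f01 := @free_sub k _ [:: l0; l1; l2] [:: 0; 1]%N isT isT fr.
have f12 := @free_sub k _ [:: l0; l1; l2] [:: 1; 2]%N isT isT fr.
have f02 := @free_sub k _ [:: l0; l1; l2] [:: 0; 2]%N isT isT fr.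
rewrite /= in f01 f12 f02.
have fc s : free s -> free (y :: s) = (y \notin <<s>>%VS) by rewrite free_cons => ->; rewrite andbT.
rewrite !fc //.
case s01: (y \in _); last by constructor 1.
case s12: (y \in _); last by constructor 2.
case s02: (y \in _); last by constructor 3.
have [a [b e1]] := span2 s01; have [c [d e2]] := span2 s12; have [e [f e3]] := span2 s02.
have [p pE] := free_points [:: 1; 0; 0] fr; have [q qE] := free_points [:: 0; 1; 0] fr.
have p0 : fv l0 p = 1 := pE 0%N isT; have p1 : fv l1 p = 0 := pE 1%N isT.
have p2 : fv l2 p = 0 := pE 2%N isT; have q0 : fv l0 q = 0 := qE 0%N isT.
have q1 : fv l1 q = 1 := qE 1%N isT; have q2 : fv l2 q = 0 := qE 2%N isT.
have a0 : a = 0.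
  transitivity (fv y p); first by rewrite e1 !fvE p0 p1 mulr1 mulr0 addr0.
  by rewrite e2 !fvE p1 p2 !mulr0 addr0.
have b0 : b = 0.
  transitivity (fv y q); first by rewrite e1 !fvE q0 q1 mulr1 mulr0 add0r.
  by rewrite e3 !fvE q0 q2 !mulr0 addr0.
by case/eqP: y0; rewrite e1 a0 b0 !scale0r addr0.
Qed.

(** Subtracting lam times the first row turns the first column into (y, 0). Take the cyclic vectors
    1, T, T^2 for the other columns: their second entries specialise to (T - lam) T^j, of degree
    below 4, and are independent. Two of them, chosen so that y is not in their span, generate the
    prime. *)
Lemma eigen_invariants (Theta : 'M[R]_(2, 4)) L a lam bs es : nf_data Theta L ->
    blocks L = KW_J a lam :: bs -> ~~ has (@is_D k) bs -> uniq (lam :: es) ->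
    all2 (@eigen_compat k) bs es ->
  BR_type Theta /\ invariants Theta 3 2 BR_degrees.
Proof.
move=> dL bL nD ue comp; have [wf fr sz eqv] := dL.
have [|||sT [D [f [Q [flin fdvd QA QB]]]]] := @cyclic_data_small _ _ _ L (lam :: es) dL; rewrite ?bL //=.
  by rewrite eqxx.
set A := mx1 (lcols L) in QA QB *; set B := mx2 (lcols L) in QB *.
have [y [y0 yE]] : exists y : V, y != 0 /\ nth (0, 0) (lcols L) 0 = (y, lam *: y).
  case: L dL bL wf fr {sz eqv sT D f Q flin fdvd QA QB A B} => //= -[b v] L _ [-> _] /= /andP[/andP[a0 /eqP sv] _].
  rewrite /lforms /= => /catl_free fv; case: v sv fv => [|y v] sv fv; first by rewrite -sv in a0.
  exists y; split.
    by move: fv; rewrite free_cons => /andP[+ _]; apply: contraNneq => ->; apply: mem0v.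
  by rewrite /lcols /= nth_cat size_map size_iota a0; case: (a) a0 => //= a' _; rewrite addr0.
have chi_size : size (char_prod (blocks L) (lam :: es)) = 5.
  have ses : size (blocks L) = size (lam :: es).
    by rewrite bL /=; move: comp; rewrite all2E => /andP[/eqP ->].
  by have [_ ->] := char_prod_size ses; rewrite -size_lcols sz.
pose C := B - lam *: A.
pose Q' : 'M[k]_4 := \matrix_(j, c) if (j < 3)%N then Q j c else (c == 0)%:R.
have rQ (j : 'I_4) : (j < 3)%N -> row j Q' = row j Q by move=> lt; apply/rowP => c; rewrite !mxE lt.
have rQ3 (j : 'I_4) : j = 3%N :> nat -> row j Q' = delta_mx 0 0.
  by move=> j3; apply/rowP => c; rewrite !mxE j3.
have A0 : row 0 A = y by rewrite (proj1 (rowM _ _)) yE.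
have C0 : row 0 C = 0.
  by rewrite /C raddfB /= (proj2 (rowM _ _)) yE /=; apply/rowP => c;
     have /rowP/(_ c) := A0; rewrite !mxE => ->; rewrite subrr.
pose l (j : 'I_4) := row j (Q' *m C).
have lD (j : 'I_4) : (j < 3)%N -> l j *m D = f (('X - lam%:P) * 'X^j).
  move=> lt; rewrite /l row_mul rQ // -row_mul /C mulmxBr -scalemxAr raddfB /= mulmxBl.
  have -> : row j (lam *: (Q *m A)) = lam *: row j (Q *m A) by apply/rowP => c; rewrite !mxE.
  rewrite -scalemxAl -!row_mul QB QA mulrBl -exprS mul_polyC.
  by rewrite addrC -scaleNr -flin scaleNr addrC.
have comb0 (c : 'I_3 -> k) : (\sum_(j < 3) c j *: l (widen_ord (isT : 3 <= 4)%N j)) *m D = 0 ->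
    forall j, c j = 0.
  rewrite mulmx_suml => e.
  pose p := \sum_(j < 3) c j *: 'X^j : {poly k}.
  have fp : f (('X - lam%:P) * p) = 0.
    pose fl : {linear {poly k} -> 'rV[k]_4} := HB.pack f (GRing.isLinear.Build _ _ _ _ f flin).
    rewrite -[RHS]e -[f]/(fl : _ -> _) /p mulr_sumr linear_sum; apply: eq_bigr => j _ /=.
    rewrite -scalemxAl lD; last exact: (ltn_ord j).
    have -> : ('X - lam%:P) * (c j *: 'X^j) = c j *: (('X - lam%:P) * 'X^j) by rewrite -!mul_polyC mulrCA.
    by rewrite -[LHS]/(fl _) linearZ.
  have sp : (size p <= 3)%N.
    by apply: (leq_trans (size_sum _ _ _)); apply/bigmax_leqP => j _;
       apply: (leq_trans (size_scale_leq _ _)); rewrite size_polyXn.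
  have p0 : p = 0.
    apply/eqP; move: (fdvd _ fp); apply: contraTT => nz; apply/negP.
    have nz' : ('X - lam%:P) * p != 0 by rewrite mulf_neq0 // polyXsubC_eq0.
    move/(dvdp_leq nz'); rewrite chi_size size_mul ?polyXsubC_eq0 // size_XsubC /=.
    by move=> h; have := leq_trans h (sp : (1 + size p <= 4)%N).
  move=> j; rewrite -[RHS](coef0 _ j) -p0 coef_sum (bigD1 j) //= coefZ coefXn eqxx mulr1.
  by rewrite big1 ?addr0 // => i ne; rewrite coefZ coefXn (_ : (_ == _) = false) ?mulr0 //; apply/negbTE; rewrite eq_sym.
have l3 : l (inord 3) = 0.
  by rewrite /l row_mul rQ3 ?inordK // -rowE.
have uQ : Q' \in unitmx.
  rewrite -row_free_unit; apply: inj_row_free => c e.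
  have e' : \sum_j c 0 j *: l j = 0.
    by rewrite -mulmx_sum_row mulmxA e mul0mx.
  have c0 j : c 0 (widen_ord (isT : 3 <= 4)%N j) = 0.
    apply: (comb0 (fun j => c 0 (widen_ord (isT : 3 <= 4)%N j))).
    move: e'; rewrite big_ord_recr /= (_ : ord_max = inord 3); last by apply/val_inj; rewrite /= inordK.
    rewrite l3 scaler0 addr0 => e2; transitivity ((0 : V) *m D); last exact: mul0mx.
    congr (_ *m D); rewrite -[RHS]e2; apply: eq_bigr => i _.
    by congr (c 0 _ *: l _); apply/val_inj.
  have c0' (i : 'I_4) : (i < 3)%N -> c 0 i = 0.
    by move=> lt; rewrite -[RHS](c0 (Ordinal lt)); congr (c 0 _); apply/val_inj.
  move: e; rewrite mulmx_sum_row big_ord_recr /= big1 ?add0r => [|j _]; last first.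
    by rewrite (c0' (widen_ord _ j) (ltn_ord j)) scale0r.
  rewrite rQ3 // => /rowP/(_ 0); rewrite !mxE eqxx mulr1 => cm.
  apply/rowP => j; rewrite [RHS]mxE; case: (ltnP j 3) => lt.
    exact: c0'.
  by rewrite -[RHS]cm; congr (c 0 _); apply/val_inj/eqP; rewrite eqn_leq lt andbT -ltnS ltn_ord.
pose o (i : nat) (lt : (i < 4)%N) : 'I_4 := Ordinal lt.
pose o0 := o 0%N isT; pose o1 := o 1%N isT; pose o2 := o 2%N isT; pose o3 := o 3%N isT.
have fl : free [:: l o0; l o1; l o2].
  apply/(@freeP _ _ _ (in_tuple _)) => c; rewrite !big_ord_recl big_ord0 /= addr0 => e.
  apply: comb0; rewrite !big_ord_recl big_ord0 addr0; transitivity ((0 : V) *m D); last exact: mul0mx.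
  congr (_ *m D); rewrite -[RHS]e.
  by congr (c _ *: l _ + (c _ *: l _ + c _ *: l _)); apply/val_inj.
have eqN : KW_equiv Theta (form_mx [:: (row o0 (Q' *m A), l o0); (row o1 (Q' *m A), l o1);
    (row o2 (Q' *m A), l o2); (y, 0)]).
  apply: KW_equiv_trans eqv _; rewrite form_mxE -/A -/B.
  apply: KW_equiv_trans (pform_row_equiv _ _ lam) _; rewrite -/C.
  apply: KW_equiv_trans (pform_col_equiv _ _ uQ) _; rewrite form_mxE.
  set X := [:: _; _; _; _].
  have e1 : mx1 X = Q' *m A.
    apply/row_matrixP => j; rewrite (proj1 (rowM _ _)); case: (ord4P j) => -> /=;
      try by congr (row _ _); apply/val_inj.
    by rewrite row_mul rQ3 // -rowE A0.
  have e2 : mx2 X = Q' *m C.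
    apply/row_matrixP => j; rewrite (proj2 (rowM _ _)); case: (ord4P j) => -> /=;
      try by rewrite /l; congr (row _ _); apply/val_inj.
    by rewrite -[LHS]l3; congr (row _ _); apply/val_inj; rewrite /= inordK.
  by rewrite e1 e2; exact: KW_equiv_refl.
have fin (N : seq (V * V)) : perm_eq [:: (row o0 (Q' *m A), l o0); (row o1 (Q' *m A), l o1);
    (row o2 (Q' *m A), l o2); (y, 0)] N -> minor_prime (form_mx N) ->
    BR_type Theta /\ invariants Theta 3 2 BR_degrees.
  move=> pN [P [i [P1 P2 P3 P4]]].
  have eqN' : KW_equiv Theta (form_mx N).
    by apply: KW_equiv_trans eqN _; apply: form_mx_perm pN.
  by apply: (small_invariants eqN' _ P1 P2 P3 P4); apply: small_equiv (KW_equiv_sym eqN') sT.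
case: (choose_pair fl y0) => fy.
- apply: (fin [:: (row o0 (Q' *m A), l o0); (row o1 (Q' *m A), l o1); (y, 0); (row o2 (Q' *m A), l o2)]).
    by have [] := perm_eq4 (row o0 (Q' *m A), l o0) (row o1 (Q' *m A), l o1) (row o2 (Q' *m A), l o2) (y, 0).
  exact: (eigen_prime _ _ _ (free_pick fl [:: 2; 0; 1]%N isT isT) fy).
- apply: (fin [:: (row o1 (Q' *m A), l o1); (row o2 (Q' *m A), l o2); (y, 0); (row o0 (Q' *m A), l o0)]).
    by have [] := perm_eq4 (row o0 (Q' *m A), l o0) (row o1 (Q' *m A), l o1) (row o2 (Q' *m A), l o2) (y, 0).
  exact: (eigen_prime _ _ _ (free_pick fl [:: 0; 1; 2]%N isT isT) fy).
apply: (fin [:: (row o0 (Q' *m A), l o0); (row o2 (Q' *m A), l o2); (y, 0); (row o1 (Q' *m A), l o1)]).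
  by have [] := perm_eq4 (row o0 (Q' *m A), l o0) (row o1 (Q' *m A), l o1) (row o2 (Q' *m A), l o2) (y, 0).
exact: (eigen_prime _ _ _ (free_pick fl [:: 1; 0; 2]%N isT isT) fy).
Qed.

End DistinctEigenvalues.

(** * Classification of the normal forms *)

Section RankTwo.
Variables (k : fieldType) (n : nat).
Local Notation R := {mpoly k[n]}.

Definition row_independent (N : 'M[R]_(2, 4)) := forall r0 r1 : R,
  (forall j, r0 * N 0 j + r1 * N 1 j = 0) -> r0 = 0 /\ r1 = 0.

Lemma admissible_rows (Theta N : 'M[R]_(2, 4)) : admissible Theta -> KW_equiv Theta N ->
  row_independent N.
Proof.
move=> [_ rT _] [P [Q [_ _ E]]] r0 r1 e.
have fN : row_free (map_mx (@tofrac R) N).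
  rewrite /row_free eqn_leq rank_leq_row -{1}rT E !map_mxM.
  exact: leq_trans (mxrankM_maxl _ _) (mxrankM_maxr _ _).
pose r : 'rV[R]_2 := \row_i (if i == 0 then r0 else r1).
have rN : r *m N = 0.
  by apply/rowP => j; rewrite !mxE !big_ord_recl big_ord0 !mxE /= addr0 -[RHS](e j); congr (_ + _ * N _ _); apply/val_inj.
have r_0 : map_mx (@tofrac R) r = 0.
  by apply: (row_free_inj fN); rewrite -map_mxM rN map_mx0 mul0mx.
have r0E i : r 0 i = 0.
  by apply/eqP; rewrite -(tofrac_eq0 (r 0 i)); have /rowP/(_ i) := r_0; rewrite !mxE => ->.
by split; [have := r0E 0 | have := r0E 1]; rewrite mxE.
Qed.

Lemma row_independent_det (a b c d : 'rV[k]_n) :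
    row_independent (form_mx [:: (0, 0); (0, 0); (a, c); (b, d)]) ->
  lform a * lform d - lform b * lform c != 0 :> R.
Proof.
move=> ind; apply/eqP => e.
have aux (r0 r1 : R) : r0 * lform a + r1 * lform c = 0 -> r0 * lform b + r1 * lform d = 0 ->
    r0 = 0 /\ r1 = 0.
  move=> e1 e2; apply: ind => -[[|[|[|[|//]]]] ?]; rewrite !mxE /= ?raddf0 ?mulr0 ?addr0 //.
have [c0 a0] : lform c = 0 :> R /\ - lform a = 0 :> R.
  by apply: aux; [ring | rewrite -oppr0 -e; ring].
have {}a0 : lform a = 0 :> R by rewrite -[lform a]opprK a0 oppr0.
have [d0 b0] : lform d = 0 :> R /\ - lform b = 0 :> R.
  by apply: aux; [rewrite a0 c0; ring | ring].
have {}b0 : lform b = 0 :> R by rewrite -[lform b]opprK b0 oppr0.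
have [/eqP] : 1 = 0 :> R /\ 0 = 0 :> R by apply: aux; rewrite ?a0 ?b0 ?c0 ?d0; ring.
by rewrite oner_eq0.
Qed.

Lemma row_independent_last (a0 a1 a2 a3 l : 'rV[k]_n) :
  row_independent (form_mx [:: (a0, 0); (a1, 0); (a2, 0); (a3, l)]) -> l != 0.
Proof.
move=> ind; apply/eqP => l0; have [_ /eqP] : 0 = 0 :> R /\ 1 = 0 :> R.
  by apply: ind => -[[|[|[|[|//]]]] ?]; rewrite !mxE /= ?l0 ?raddf0 mulr0 mul0r add0r.
by rewrite oner_eq0.
Qed.

Lemma row_equiv (Theta : 'M[R]_(2, 4)) c lam N : KW_equiv Theta (form_mx c) -> size c = 4 ->
  [seq (x.1, x.2 - lam *: x.1) | x <- c] = N -> KW_equiv Theta (form_mx N).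
Proof. by move=> e s <-; apply: KW_equiv_trans e (form_mx_row _ s). Qed.

Lemma perm_equiv (Theta : 'M[R]_(2, 4)) c N : KW_equiv Theta (form_mx c) -> size c = 4 ->
  perm_eq c N -> KW_equiv Theta (form_mx N).
Proof. by move=> e s p; apply: KW_equiv_trans e (form_mx_perm s p). Qed.

Lemma add_col_equiv (Theta : 'M[R]_(2, 4)) a0 b0 a1 b1 a2 b2 c3 mu nu :
    KW_equiv Theta (form_mx [:: (a0, b0); (a1, b1); (a2, b2); c3]) ->
  KW_equiv Theta (form_mx [:: (a0 + mu *: a1 + nu *: a2, b0 + mu *: b1 + nu *: b2);
    (a1, b1); (a2, b2); c3]).
Proof.
move=> e; apply: KW_equiv_trans e _.
pose Q : 'M[k]_4 := \matrix_(i, j) (if (i == 0%N :> nat) && (j == 1%N :> nat) then mu else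
   if (i == 0%N :> nat) && (j == 2%N :> nat) then nu else (i == j)%:R).
have uQ : Q \in unitmx.
  have trQ : is_trig_mx Q^T.
    apply/is_trig_mxP => i j lt; rewrite !mxE.
    have -> : (j == i) = false by apply/negbTE; rewrite -val_eqE /= neq_ltn lt orbT.
    by case: (j : nat) lt => // -[|j'].
  rewrite unitmxE -det_tr det_trig // !big_ord_recl big_ord0 !mxE /=.
  by rewrite !mulr1 unitr1.
rewrite form_mxE; apply: KW_equiv_trans (pform_col_equiv _ _ uQ) _.
rewrite form_mxE.
have QE (X : 'M[k]_(4, n)) (i : 'I_4) : row i (Q *m X) =
    if i == 0%N :> nat then row 0 X + mu *: row 1 X + nu *: row (inord 2) X else row i X.
  rewrite row_mul mulmx_sum_row; case: eqP => i0.
    rewrite !big_ord_recl big_ord0 !mxE /= i0 /= addr0.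
    have -> : (i == ord0) = true by apply/eqP/val_inj.
    have -> : (i == lift ord0 (lift ord0 (lift ord0 ord0))) = false by apply/negbTE; rewrite -val_eqE /= i0.
    rewrite scale1r scale0r addr0 -addrA; congr (row _ X + (_ *: row _ X + _ *: row _ X)); apply/val_inj => //=.
    by rewrite inordK.
  rewrite (bigD1 i) //= big1 ?addr0 => [|j ne]; first by rewrite !mxE (negbTE (introN eqP i0)) /= eqxx scale1r.
  by rewrite !mxE (negbTE (introN eqP i0)) /= eq_sym (negbTE ne) scale0r.
set X := pform _ _; set Y := pform _ _; suff -> : X = Y by apply: KW_equiv_refl.
rewrite /X /Y; congr pform; apply/row_matrixP => i; rewrite QE ?(proj1 (rowM _ _)) ?(proj2 (rowM _ _)) inordK //=;
  by case: i => [[|[|[|[|//]]]] ?].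
Qed.

End RankTwo.

Lemma perm_1423 (T : eqType) (a b c d : T) : perm_eq [:: a; b; c; d] [:: a; d; b; c].
Proof. perm_lists. Qed.

Lemma perm_1324 (T : eqType) (a b c d : T) : perm_eq [:: a; b; c; d] [:: a; c; b; d].
Proof. perm_lists. Qed.

Lemma perm_1243 (T : eqType) (a b c d : T) : perm_eq [:: a; b; c; d] [:: a; b; d; c].
Proof. perm_lists. Qed.

Section Classification.
Variable k : closedFieldType.

Definition kind n (Theta : 'M[{mpoly k[n]}]_(2, 4)) :=
  [\/ is_free Theta, nearly_free Theta, BR_type Theta /\ has_Bour Theta 3
    | KW_normal_form Theta [:: KW_D 2; KW_B 1]].

Definition solved n (Theta : 'M[{mpoly k[n]}]_(2, 4)) b e h := invariants Theta b e h /\ kind Theta.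

Lemma free_solved n (Theta N : 'M[{mpoly k[n]}]_(2, 4)) b e h : KW_equiv Theta N ->
  is_free N /\ invariants N b e h -> solved Theta b e h.
Proof.
move=> eqv [fr inv]; split; first exact: invariants_equiv eqv inv.
by constructor 1; apply: is_free_equiv eqv fr.
Qed.

Lemma nearly_solved n (Theta N : 'M[{mpoly k[n]}]_(2, 4)) e h : KW_equiv Theta N ->
  ~ is_free N /\ invariants N 1 e h -> solved Theta 1 e h.
Proof.
move=> eqv [nfr inv]; have inv' := invariants_equiv eqv inv; split=> //.
constructor 2; split; last by case: inv'.
by move=> fr; apply: nfr; apply: is_free_equiv (KW_equiv_sym eqv) fr.
Qed.

Lemma BR_solved n (Theta : 'M[{mpoly k[n]}]_(2, 4)) :
  BR_type Theta /\ invariants Theta 3 2 BR_degrees -> solved Theta 3 2 BR_degrees.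
Proof. by move=> [br inv]; split=> //; constructor 3; split=> //; case: inv. Qed.

(** The values b, e, h come before the ring and the matrix, so they depend on the normal form alone.
    The number of variables is written m + 3 because it is at least three. *)
Definition good (bs : seq (KW_block k)) := exists b e h, forall m (Theta : 'M[{mpoly k[m.+3]}]_(2, 4)),
  admissible Theta -> KW_normal_form Theta bs -> solved Theta b e h.

Lemma good_perm bs bs' : Permutation bs bs' -> good bs' -> good bs.
Proof.
move=> p [b [e [h H]]]; exists b, e, h => m Theta adm nf.
by apply: H adm _; apply: normal_form_perm nf.
Qed.

Lemma nf_dataP n (Theta : 'M[{mpoly k[n]}]_(2, 4)) bs : KW_normal_form Theta bs ->
  exists v : nat -> 'rV[k]_n, nf_data Theta (mk_data bs v) /\
    free (mkseq v (KW_nvars bs)) /\ KW_equiv Theta (form_mx (lcols (mk_data bs v))).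
Proof.
move=> /normal_form_data[L <- dL]; have [wf fr _ eqv] := dL.
exists (nth 0 (lforms L)); rewrite mk_lforms //; split=> //.
by rewrite -(lforms_mk (blocks L) (nth 0 (lforms L))) mk_lforms.
Qed.

Lemma goodI bs b e h : (forall m (Theta : 'M[{mpoly k[m.+3]}]_(2, 4)) v,
    (forall N, KW_equiv Theta N -> row_independent N) -> nf_data Theta (mk_data bs v) ->
    free (mkseq v (KW_nvars bs)) -> KW_equiv Theta (form_mx (lcols (mk_data bs v))) ->
    solved Theta b e h) -> good bs.
Proof.
move=> H; exists b, e, h => m Theta adm /nf_dataP[v [d [fr eqv]]].
by apply: (H m Theta v) => // N; apply: admissible_rows.
Qed.

Lemma good_D0D0 r : good [:: KW_D 0, KW_D 0 & r].
Proof.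
apply: goodI => m Theta v ind [_ _ sz _] _ eqv.
have [a [c [b [d E]]]] : exists a c b d, lcols (mk_data (KW_D 0 :: KW_D 0 :: r) v) = [:: (0, 0); (0, 0); (a, c); (b, d)].
  move: sz; rewrite /lcols /=; case: flatten => [|[a c] [|[b d] []]] //= _.
  by exists a, c, b, d.
rewrite E in eqv; apply: free_solved (eqv) _; apply: zero2_invariants.
exact: row_independent_det (ind _ eqv).
Qed.

Ltac cols := rewrite /lcols /= /addn /=.
Ltac vec := apply/rowP => ?; rewrite !mxE; ring.
Ltac cols_eq := cols; do ! (congr cons); congr pair; vec.

Lemma good_D3 : good [:: KW_D 3].
Proof.
apply: goodI => m Theta v ind _ fr; cols => eqv.
have [sN [P [l [P1 P2 P3 P4]]]] := D3_prime (free_pick fr [:: 2; 0; 1]%N isT isT).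
exact/BR_solved/(small_invariants eqv sN P1 P2 P3 P4).
Qed.

Lemma good_D2B1 : good [:: KW_D 2; KW_B 1].
Proof.
apply: goodI => m Theta v ind d fr; cols => eqv.
split; last by constructor 4; apply/normal_form_data; exists (mk_data [:: KW_D 2; KW_B 1] v); rewrite ?blocks_mk.
apply: invariants_equiv eqv _; apply: exc_invariants.
exact: (free_pick fr [:: 2; 3; 0; 1]%N isT isT).
Qed.

Ltac open_cols fr eqv := move: fr eqv; rewrite /lcols /mkseq /= /addn /=.

Lemma good_D2J1 lam : good [:: KW_D 2; KW_J 1 lam].
Proof.
apply: goodI => m Theta v ind d fr eqv; open_cols fr eqv.
move: (v 0%N) (v 1%N) (v 2) => x1 x2 y fr eqv.
(* After the row operation, adding lam times the second and lam^2 times the third column cancels the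
   second entry of the first column. *)
have /= e1 := add_col_equiv lam (lam ^+ 2) (row_equiv (lam := lam) eqv (erefl 4%N) erefl).
have e2 : KW_equiv Theta (form_mx [:: (x1 + lam *: x2, 0); (y, 0); (x2, x1 - lam *: x2); (0, x2)]).
  apply: (perm_equiv (c := [:: (x1 + lam *: x2, 0); (x2, x1 - lam *: x2); (0, x2); (y, 0)]) _ (erefl 4%N) (perm_1423 _ _ _ _)).
  move: e1; congr (KW_equiv _ (form_mx _)); cols_eq.
have fy : free [:: x1 + lam *: x2; y].
  have [q qE] := free_points [:: 0; 0; 1] fr; have [q' qE'] := free_points [:: 1; 0; 0] fr.
  apply: (free2 (p1 := q') (p2 := q)); rewrite !fvE.
  rewrite (qE 0%N isT) (qE 1%N isT) (qE 2 isT) (qE' 0%N isT) (qE' 1%N isT) (qE' 2 isT) /=.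
  by rewrite !(mulr0, addr0, mulr1, mul0r, subr0) oner_eq0.
have fl : free [:: x1 - lam *: x2; x2].
  have [q qE] := free_points [:: 1; 0; 1] fr; have [q' qE'] := free_points [:: lam; 1; 0] fr.
  apply: (free2 (p1 := q) (p2 := q')); rewrite !fvE.
  rewrite (qE 0%N isT) (qE 1%N isT) (qE' 0%N isT) (qE' 1%N isT) /=.
  by rewrite !(mulr0, addr0, mulr1, mul0r, subr0) oner_eq0.
have [p pE] := free_points [:: - lam; 1; 0] fr.
have p0 := pE 0%N isT; have p1 := pE 1%N isT; have p2 := pE 2 isT; rewrite /= in p0 p1 p2.
apply: nearly_solved e2 _.
apply: (split_nearly_free fy fl (p := p)); rewrite ?fvE ?p0 ?p1 ?p2 //; first by ring.
by rewrite mulr1 mul0r subr0 oner_eq0.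
Qed.

Lemma split_solved m (Theta : 'M[{mpoly k[m.+3]}]_(2, 4)) y1 y2 a b l1 l2 p q1 q2 :
    KW_equiv Theta (form_mx [:: (y1, 0); (y2, 0); (a, l1); (b, l2)]) -> free [:: y1; y2] ->
    fv l1 q1 * fv l2 q2 - fv l2 q1 * fv l1 q2 != 0 -> fv y1 p = 0 -> fv y2 p = 0 ->
    fv a p * fv l2 p - fv b p * fv l1 p != 0 ->
  solved Theta 1 1 (mk_htype [:: 0; 0; 0; 0]%Z [:: 1; 2; 2]%Z [:: 3]%Z [::]).
Proof.
move=> eqv fy nz e1 e2 nz2; apply: nearly_solved eqv _.
by apply: (split_nearly_free fy (free2 nz) (p := p)).
Qed.

Lemma koszul_solved m (Theta : 'M[{mpoly k[m.+3]}]_(2, 4)) y1 y2 y3 a l :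
    KW_equiv Theta (form_mx [:: (y1, 0); (y2, 0); (y3, 0); (a, l)]) -> free [:: y3; y1; y2] ->
    l != 0 ->
  solved Theta 1 1 (mk_htype [:: 0; 0; 0; 0]%Z [:: 1; 1; 1]%Z [:: 2]%Z [::]).
Proof. by move=> eqv fy nz; apply: nearly_solved eqv _; apply: koszul_nearly_free. Qed.

Lemma scalar_solved m (Theta : 'M[{mpoly k[m.+3]}]_(2, 4)) x a b c d p :
    KW_equiv Theta (form_mx [:: (x, 0); (0, x); (a, c); (b, d)]) -> free [:: x] -> fv x p = 0 ->
    fv a p * fv d p - fv b p * fv c p != 0 ->
  solved Theta 0 1 (mk_htype [:: 0; 0; 0; 0]%Z [:: 1; 1]%Z [::] [::]).
Proof. by move=> eqv fx e nz; apply: free_solved eqv _; apply: (scalar_invariants fx e nz). Qed.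

Ltac row_op lam eqv := apply: (row_equiv (lam := lam) eqv (erefl 4%N)); cols_eq.
Ltac fv3 E := rewrite ?fvE ?(E 0%N isT, E 1%N isT, E 2 isT) /=.
Ltac fv4 E := rewrite ?fvE ?(E 0%N isT, E 1%N isT, E 2 isT, E 3 isT) /=.
Ltac fv5 E := rewrite ?fvE ?(E 0%N isT, E 1%N isT, E 2 isT, E 3 isT, E 4 isT) /=.
Ltac fv6 E := rewrite ?fvE ?(E 0%N isT, E 1%N isT, E 2 isT, E 3 isT, E 4 isT, E 5 isT) /=.
Ltac nz H := let e := fresh in apply: contraNneq (H) => e; apply/eqP; apply: etrans e; ring.

(** Subtracting lam times the first row gives each first column of a block with eigenvalue lam the
    second entry 0. Three such columns lead to the Koszul case, two to the split case, where q is
    tested at a common zero of the two forms. *)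
Lemma good_J1J1J2 lam mu : good [:: KW_J 1 lam; KW_J 1 lam; KW_J 2 mu].
Proof.
have [->|ne] := eqVneq mu lam.
  apply: goodI => m Theta v ind d fr eqv; open_cols fr eqv.
  move: (v 0%N) (v 1%N) (v 2) (v 3) => y w u1 u2 fr eqv.
  have e1 : KW_equiv Theta (form_mx [:: (y, 0); (w, 0); (u1, 0); (u2, u1)]) by row_op lam eqv.
  apply: (koszul_solved e1 (free_pick fr [:: 2; 0; 1]%N isT isT)).
  by have := free_pick fr [:: 2]%N isT isT; rewrite seq1_free.
apply: goodI => m Theta v ind d fr eqv; open_cols fr eqv.
move: (v 0%N) (v 1%N) (v 2) (v 3) => y w u1 u2 fr eqv.
have e1 : KW_equiv Theta (form_mx [:: (y, 0); (w, 0); (u1, (mu - lam) *: u1);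
  (u2, u1 + (mu - lam) *: u2)]) by row_op lam eqv.
rewrite -subr_eq0 in ne.
have [p pE] := free_points [:: 0; 0; 1; 0] fr; have [q qE] := free_points [:: 0; 0; 0; 1] fr.
apply: (split_solved (p := p) (q1 := p) (q2 := q) e1 (free_pick fr [:: 0; 1]%N isT isT)).
- fv4 pE; fv4 qE; nz (mulf_neq0 ne ne).
- exact: (pE 0%N isT).
- exact: (pE 1%N isT).
fv4 pE; nz (oner_neq0 k).
Qed.

Lemma good_J1J1B2 lam : good [:: KW_J 1 lam; KW_J 1 lam; KW_B 2].
Proof.
apply: goodI => m Theta v ind d fr eqv; open_cols fr eqv.
move: (v 0%N) (v 1%N) (v 2) (v 3) (v 4) => y w z0 z1 z2 fr eqv.
have e1 : KW_equiv Theta (form_mx [:: (y, 0); (w, 0); (z1, z0 - lam *: z1);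
  (z2, z1 - lam *: z2)]) by row_op lam eqv.
have [p pE] := free_points [:: 0; 0; 0; 1; 0] fr; have [q qE] := free_points [:: 0; 0; 1; 0; 0] fr.
apply: (split_solved (p := p) (q1 := q) (q2 := p) e1 (free_pick fr [:: 0; 1]%N isT isT)).
- fv5 pE; fv5 qE; nz (oner_neq0 k).
- exact: (pE 0%N isT).
- exact: (pE 1%N isT).
fv5 pE; nz (oner_neq0 k).
Qed.

Lemma good_J1J1J1J1 lam nu : good [:: KW_J 1 lam; KW_J 1 lam; KW_J 1 lam; KW_J 1 nu].
Proof.
apply: goodI => m Theta v ind d fr eqv; open_cols fr eqv.
move: (v 0%N) (v 1%N) (v 2) (v 3) => y w u t fr eqv.
have e1 : KW_equiv Theta (form_mx [:: (y, 0); (w, 0); (u, 0); (t, (nu - lam) *: t)]) by row_op lam eqv.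
apply: (koszul_solved (e1) (free_pick fr [:: 2; 0; 1]%N isT isT)).
exact: row_independent_last (ind _ e1).
Qed.

Lemma good_J1J1JJ lam mu nu : good [:: KW_J 1 lam; KW_J 1 lam; KW_J 1 mu; KW_J 1 nu].
Proof.
have [->|nem] := eqVneq mu lam; first exact: good_J1J1J1J1.
have [->|nen] := eqVneq nu lam.
  apply: good_perm (good_J1J1J1J1 lam mu).
  by do 2! apply: perm_skip; apply: perm_swap.
rewrite -subr_eq0 in nem; rewrite -subr_eq0 in nen.
(* With two pairs of equal eigenvalues q vanishes, and the matrix is free. *)
have [e_mn|ne] := eqVneq nu mu.
  apply: goodI => m Theta v ind d fr eqv; open_cols fr eqv.
  move: (v 0%N) (v 1%N) (v 2) (v 3) => y w u t fr eqv.
  have e1 : KW_equiv Theta (form_mx [:: (y, 0); (w, 0); (u, (mu - lam) *: u);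
    (t, (mu - lam) *: t)]) by rewrite e_mn in eqv; row_op lam eqv.
  have [p pE] := free_points [:: 0; 0; 1; 0] fr; have [q qE] := free_points [:: 0; 0; 0; 1] fr.
  apply: free_solved e1 (split_free (al := 0) (be := 0) (free_pick fr [:: 0; 1]%N isT isT) _ _).
    by apply: (free2 (p1 := p) (p2 := q)); fv4 pE; fv4 qE; nz (mulf_neq0 nem nem).
  rewrite !raddf0 !linearZ /= -!mul_mpolyC; ring.
apply: goodI => m Theta v ind d fr eqv; open_cols fr eqv.
move: (v 0%N) (v 1%N) (v 2) (v 3) => y w u t fr eqv.
have e1 : KW_equiv Theta (form_mx [:: (y, 0); (w, 0); (u, (mu - lam) *: u);
  (t, (nu - lam) *: t)]) by row_op lam eqv.
have [p pE] := free_points [:: 0; 0; 1; 0] fr; have [q qE] := free_points [:: 0; 0; 0; 1] fr.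
have [r rE] := free_points [:: 0; 0; 1; 1] fr.
apply: (split_solved (p := r) (q1 := p) (q2 := q) e1 (free_pick fr [:: 0; 1]%N isT isT)).
- fv4 pE; fv4 qE; nz (mulf_neq0 nem nen).
- exact: (rE 0%N isT).
- exact: (rE 1%N isT).
rewrite -subr_eq0 in ne; fv4 rE; nz ne.
Qed.

Lemma good_J1J1J1B1 lam mu : good [:: KW_J 1 lam; KW_J 1 lam; KW_J 1 mu; KW_B 1].
Proof.
have [->|ne] := eqVneq mu lam.
  apply: goodI => m Theta v ind d fr eqv; open_cols fr eqv.
  move: (v 0%N) (v 1%N) (v 2) (v 3) (v 4) => y w u z0 z1 fr eqv.
  have e1 : KW_equiv Theta (form_mx [:: (y, 0); (w, 0); (u, 0); (z1, z0 - lam *: z1)]) by row_op lam eqv.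
  apply: (koszul_solved (e1) (free_pick fr [:: 2; 0; 1]%N isT isT)).
  exact: row_independent_last (ind _ e1).
rewrite -subr_eq0 in ne; apply: goodI => m Theta v ind d fr eqv; open_cols fr eqv.
move: (v 0%N) (v 1%N) (v 2) (v 3) (v 4) => y w u z0 z1 fr eqv.
have e1 : KW_equiv Theta (form_mx [:: (y, 0); (w, 0); (u, (mu - lam) *: u);
  (z1, z0 - lam *: z1)]) by row_op lam eqv.
have [p pE] := free_points [:: 0; 0; 1; 0; 0] fr; have [q qE] := free_points [:: 0; 0; 0; 1; 0] fr.
have [r rE] := free_points [:: 0; 0; 1; 1; 0] fr.
apply: (split_solved (p := r) (q1 := p) (q2 := q) e1 (free_pick fr [:: 0; 1]%N isT isT)).
- fv5 pE; fv5 qE; nz ne.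
- exact: (rE 0%N isT).
- exact: (rE 1%N isT).
fv5 rE; nz (oner_neq0 k).
Qed.

Lemma good_J1J1B1B1 lam : good [:: KW_J 1 lam; KW_J 1 lam; KW_B 1; KW_B 1].
Proof.
apply: goodI => m Theta v ind d fr eqv; open_cols fr eqv.
move: (v 0%N) (v 1%N) (v 2) (v 3) (v 4) (v 5) => y w z0 z1 w0 w1 fr eqv.
have e1 : KW_equiv Theta (form_mx [:: (y, 0); (w, 0); (z1, z0 - lam *: z1);
  (w1, w0 - lam *: w1)]) by row_op lam eqv.
have [p pE] := free_points [:: 0; 0; 1; 0; 0; 0] fr.
have [q qE] := free_points [:: 0; 0; 0; 0; 1; 0] fr.
have [r rE] := free_points [:: 0; 0; 0; 1; 1; 0] fr.
apply: (split_solved (p := r) (q1 := p) (q2 := q) e1 (free_pick fr [:: 0; 1]%N isT isT)).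
- fv6 pE; fv6 qE; nz (oner_neq0 k).
- exact: (rE 0%N isT).
- exact: (rE 1%N isT).
fv6 rE; nz (oner_neq0 k).
Qed.

Lemma good_J1J2J1 lam mu : good [:: KW_J 1 lam; KW_J 2 lam; KW_J 1 mu].
Proof.
have [->|ne] := eqVneq mu lam.
  apply: goodI => m Theta v ind d fr eqv; open_cols fr eqv.
  move: (v 0%N) (v 1%N) (v 2) (v 3) => y u1 u2 t fr eqv.
  have e1 : KW_equiv Theta (form_mx [:: (y, 0); (u1, 0); (u2, u1); (t, 0)]) by row_op lam eqv.
  have e2 := perm_equiv e1 (erefl 4%N) (perm_1243 _ _ _ _).
  apply: (koszul_solved (e2) (free_pick fr [:: 3; 0; 1]%N isT isT)).
  exact: row_independent_last (ind _ e2).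
rewrite -subr_eq0 in ne; apply: goodI => m Theta v ind d fr eqv; open_cols fr eqv.
move: (v 0%N) (v 1%N) (v 2) (v 3) => y u1 u2 t fr eqv.
have e1 : KW_equiv Theta (form_mx [:: (y, 0); (u1, 0); (u2, u1); (t, (mu - lam) *: t)]) by row_op lam eqv.
have [p pE] := free_points [:: 0; 1; 0; 0] fr; have [q qE] := free_points [:: 0; 0; 0; 1] fr.
have [r rE] := free_points [:: 0; 0; 1; 1] fr.
apply: (split_solved (p := r) (q1 := p) (q2 := q) e1 (free_pick fr [:: 0; 1]%N isT isT)).
- fv4 pE; fv4 qE; nz ne.
- exact: (rE 0%N isT).
- exact: (rE 1%N isT).
fv4 rE; nz ne.
Qed.

Lemma good_J1J2B1 lam : good [:: KW_J 1 lam; KW_J 2 lam; KW_B 1].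
Proof.
apply: goodI => m Theta v ind d fr eqv; open_cols fr eqv.
move: (v 0%N) (v 1%N) (v 2) (v 3) (v 4) => y u1 u2 z0 z1 fr eqv.
have e1 : KW_equiv Theta (form_mx [:: (y, 0); (u1, 0); (u2, u1); (z1, z0 - lam *: z1)]) by row_op lam eqv.
have [p pE] := free_points [:: 0; 1; 0; 0; 0] fr; have [q qE] := free_points [:: 0; 0; 0; 1; 0] fr.
have [r rE] := free_points [:: 0; 0; 1; 1; 0] fr.
apply: (split_solved (p := r) (q1 := p) (q2 := q) e1 (free_pick fr [:: 0; 1]%N isT isT)).
- fv5 pE; fv5 qE; nz (oner_neq0 k).
- exact: (rE 0%N isT).
- exact: (rE 1%N isT).
fv5 rE; nz (oner_neq0 k).
Qed.

Lemma good_J1J3 lam : good [:: KW_J 1 lam; KW_J 3 lam].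
Proof.
apply: goodI => m Theta v ind d fr eqv; open_cols fr eqv.
move: (v 0%N) (v 1%N) (v 2) (v 3) => y u1 u2 u3 fr eqv.
have e1 : KW_equiv Theta (form_mx [:: (y, 0); (u1, 0); (u2, u1); (u3, u2)]) by row_op lam eqv.
have [p pE] := free_points [:: 0; 1; 0; 0] fr; have [q qE] := free_points [:: 0; 0; 1; 0] fr.
apply: (split_solved (p := q) (q1 := p) (q2 := q) e1 (free_pick fr [:: 0; 1]%N isT isT)).
- fv4 pE; fv4 qE; nz (oner_neq0 k).
- exact: (qE 0%N isT).
- exact: (qE 1%N isT).
fv4 qE; nz (oner_neq0 k).
Qed.

Lemma good_J2J2 lam : good [:: KW_J 2 lam; KW_J 2 lam].
Proof.
apply: goodI => m Theta v ind d fr eqv; open_cols fr eqv.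
move: (v 0%N) (v 1%N) (v 2) (v 3) => y1 y2 u1 u2 fr eqv.
have e1 : KW_equiv Theta (form_mx [:: (y1, 0); (y2, y1); (u1, 0); (u2, u1)]) by row_op lam eqv.
have e2 := perm_equiv e1 (erefl 4%N) (perm_1324 _ _ _ _).
apply: free_solved e2 (split_free (al := - u2) (be := y2) (free_pick fr [:: 0; 2]%N isT isT)
  (free_pick fr [:: 0; 2]%N isT isT) _).
rewrite raddfN /=; ring.
Qed.

Lemma good_D1D1 : good [:: KW_D 1; KW_D 1].
Proof.
apply: goodI => m Theta v ind d fr eqv; open_cols fr eqv.
move: (v 0%N) (v 1%N) => x y fr eqv; have [p pE] := free_points [:: 0; 1] fr.
apply: (scalar_solved (p := p) eqv (free_pick fr [:: 0]%N isT isT) (pE 0%N isT)).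
rewrite ?fvE (pE 1%N isT) /=; nz (oner_neq0 k).
Qed.

Lemma good_D1J2 lam : good [:: KW_D 1; KW_J 2 lam].
Proof.
apply: goodI => m Theta v ind d fr eqv; open_cols fr eqv.
move: (v 0%N) (v 1%N) (v 2) => x y1 y2 fr eqv; have [p pE] := free_points [:: 0; 1; 0] fr.
apply: (scalar_solved (p := p) eqv (free_pick fr [:: 0]%N isT isT) (pE 0%N isT)).
fv3 pE; nz (oner_neq0 k).
Qed.

Lemma good_D1B2 : good [:: KW_D 1; KW_B 2].
Proof.
apply: goodI => m Theta v ind d fr eqv; open_cols fr eqv.
move: (v 0%N) (v 1%N) (v 2) (v 3) => x z0 z1 z2 fr eqv; have [p pE] := free_points [:: 0; 0; 1; 0] fr.
apply: (scalar_solved (p := p) eqv (free_pick fr [:: 0]%N isT isT) (pE 0%N isT)).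
fv4 pE; nz (oner_neq0 k).
Qed.

Lemma good_D1J1B1 lam : good [:: KW_D 1; KW_J 1 lam; KW_B 1].
Proof.
apply: goodI => m Theta v ind d fr eqv; open_cols fr eqv.
move: (v 0%N) (v 1%N) (v 2) (v 3) => x y z0 z1 fr eqv; have [p pE] := free_points [:: 0; 1; 1; 0] fr.
apply: (scalar_solved (p := p) eqv (free_pick fr [:: 0]%N isT isT) (pE 0%N isT)).
fv4 pE; nz (oner_neq0 k).
Qed.

Lemma good_D1B1B1 : good [:: KW_D 1; KW_B 1; KW_B 1].
Proof.
apply: goodI => m Theta v ind d fr eqv; open_cols fr eqv.
move: (v 0%N) (v 1%N) (v 2) (v 3) (v 4) => x z0 z1 w0 w1 fr eqv.
have [p pE] := free_points [:: 0; 0; 1; 1; 0] fr.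
apply: (scalar_solved (p := p) eqv (free_pick fr [:: 0]%N isT isT) (pE 0%N isT)).
fv5 pE; nz (oner_neq0 k).
Qed.

Lemma good_D1J1J1 lam mu : good [:: KW_D 1; KW_J 1 lam; KW_J 1 mu].
Proof.
have [->|ne] := eqVneq mu lam.
  apply: goodI => m Theta v ind d fr eqv; open_cols fr eqv.
  move: (v 0%N) (v 1%N) (v 2) => x y u fr eqv.
  have e1 := add_col_equiv lam 0 (row_equiv (lam := lam) eqv (erefl 4%N) erefl).
  have e2 : KW_equiv Theta (form_mx [:: (x, 0); (0, x); (y, 0); (u, 0)]).
    move: e1; congr (KW_equiv _ (form_mx _)); cols_eq.
  have [_ _ pm] := perm_eq4 (x, 0 : 'rV[k]_m.+3) (0 : 'rV[k]_m.+3, x) (y, 0 : 'rV[k]_m.+3) (u, 0 : 'rV[k]_m.+3).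
  have e3 := perm_equiv e2 (erefl 4%N) pm.
  apply: (koszul_solved (e3) (free_pick fr [:: 2; 0; 1]%N isT isT)).
  exact: row_independent_last (ind _ e3).
rewrite -subr_eq0 in ne; apply: goodI => m Theta v ind d fr eqv; open_cols fr eqv.
move: (v 0%N) (v 1%N) (v 2) => x y u fr eqv; have [p pE] := free_points [:: 0; 1; 1] fr.
apply: (scalar_solved (p := p) eqv (free_pick fr [:: 0]%N isT isT) (pE 0%N isT)).
fv3 pE; nz ne.
Qed.

Lemma zero_split_solved n (Theta : 'M[{mpoly k[n]}]_(2, 4)) y1 y2 a l :
    KW_equiv Theta (form_mx [:: (0, 0); (y1, 0); (y2, 0); (a, l)]) -> free [:: y1; y2] -> l != 0 ->
  solved Theta 0 0 (mk_htype [:: 0; 0; 0]%Z [:: 1%:Z] [::] [::]).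
Proof.
move=> eqv fy l0; apply: free_solved eqv _.
have L0 : lform l != 0 :> {mpoly k[n]} by apply: contra_neq l0 => e; apply: lform_inj; rewrite raddf0.
apply: (@zero1_invariants _ _ _ _ _ (lform y2) (- lform y1) 0); rewrite ?rpredN ?lform_homog ?rpred0 //.
- by rewrite (lform_neq0 (free_swap2 fy)).
- by apply/syz_form_mx; rewrite /= !raddf0; split; ring.
move=> v1 v2 v3 /syz_form_mx /=; rewrite !raddf0 !mul0r !add0r => -[e1 /eqP].
rewrite mulf_eq0 (negbTE L0) /= => /eqP v30; move: e1; rewrite v30 mulr0 addr0.
by case/(koszul2 fy) => s [-> ->]; exists s; rewrite mulr0 mulrN mulNr.
Qed.

Lemma zero_scalar_solved n (Theta : 'M[{mpoly k[n]}]_(2, 4)) x a b :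
    KW_equiv Theta (form_mx [:: (0, 0); (x, 0); (0, x); (a, b)]) -> free [:: x; a] ->
  solved Theta 0 0 (mk_htype [:: 0; 0; 0]%Z [:: 1%:Z] [::] [::]).
Proof.
move=> eqv fx; apply: free_solved eqv _; have X0 := lform_neq0 fx.
apply: (@zero1_invariants _ _ _ _ _ (- lform a) (- lform b) (lform x)); rewrite ?rpredN ?lform_homog //.
- by rewrite X0 !orbT.
- by apply/syz_form_mx; rewrite /= !raddf0; split; ring.
move=> v1 v2 v3 /syz_form_mx /=; rewrite !raddf0 !mul0r !add0r !addr0 => -[e1 e2].
have [s [e3 e4]] := koszul2 fx e1; exists (- s); split.
- by rewrite e3 mulrNN.
- apply: (mulfI X0); apply: etrans (_ : - (lform b * v3) = _).
    by apply: (addIr (lform b * v3)); rewrite e2 addNr.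
  by rewrite e4; ring.
by rewrite e4.
Qed.

Lemma good_D0D1 b : block_wf b -> ~~ is_D b -> block_width b = 1%N -> good [:: KW_D 0; KW_D 1; b].
Proof.
case: b => [//|j lam|j] _ _ /= -> {j}.
  apply: goodI => m Theta v ind d fr eqv; open_cols fr eqv.
  by move=> fr eqv; apply: zero_scalar_solved eqv fr.
apply: goodI => m Theta v ind d fr eqv; open_cols fr eqv.
by move=> fr eqv; exact: zero_scalar_solved eqv (free_pick fr [:: 0; 2]%N isT isT).
Qed.

Lemma good_D0J1J1 b lam : block_wf b -> ~~ is_D b -> block_width b = 1%N ->
  good [:: KW_D 0; KW_J 1 lam; KW_J 1 lam; b].
Proof.
case: b => [//|j mu|j] _ _ /= -> {j}.
  apply: goodI => m Theta v ind d fr eqv; open_cols fr eqv.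
  move: (v 0%N) (v 1%N) (v 2) => y w u fr eqv.
  have e1 : KW_equiv Theta (form_mx [:: (0, 0); (y, 0); (w, 0); (u, (mu - lam) *: u)]) by row_op lam eqv.
  by apply: (zero_split_solved (e1) (free_pick fr [:: 0; 1]%N isT isT)); apply: row_independent_last (ind _ e1).
apply: goodI => m Theta v ind d fr eqv; open_cols fr eqv.
move: (v 0%N) (v 1%N) (v 2) (v 3) => y w z0 z1 fr eqv.
have e1 : KW_equiv Theta (form_mx [:: (0, 0); (y, 0); (w, 0); (z1, z0 - lam *: z1)]) by row_op lam eqv.
by apply: (zero_split_solved (e1) (free_pick fr [:: 0; 1]%N isT isT)); apply: row_independent_last (ind _ e1).
Qed.

Lemma good_D0J1J2 lam : good [:: KW_D 0; KW_J 1 lam; KW_J 2 lam].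
Proof.
apply: goodI => m Theta v ind d fr eqv; open_cols fr eqv.
move: (v 0%N) (v 1%N) (v 2) => y u1 u2 fr eqv.
have e1 : KW_equiv Theta (form_mx [:: (0, 0); (y, 0); (u1, 0); (u2, u1)]) by row_op lam eqv.
by apply: (zero_split_solved (e1) (free_pick fr [:: 0; 1]%N isT isT)); apply: row_independent_last (ind _ e1).
Qed.

Lemma good_D0D2 : good [:: KW_D 0; KW_D 2].
Proof.
apply: goodI => m Theta v ind d fr eqv; open_cols fr eqv.
move: (v 0%N) (v 1%N) => x1 x2 fr eqv; apply: free_solved eqv _.
have X1 := lform_neq0 fr; have X2 := lform_neq0 (free_swap2 fr).
apply: (@zero1_invariants _ _ _ _ _ (lform x2 * lform x2) (- (lform x1 * lform x2)) (lform x1 * lform x1) 2);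
  rewrite ?rpredN ?lform2_homog //.
- by rewrite mulf_neq0.
- by apply/syz_form_mx; rewrite /= !raddf0; split; ring.
move=> v1 v2 v3 /syz_form_mx /=; rewrite !raddf0 !mul0r !add0r !addr0 => -[e1 e2].
have [s [e3 e4]] := koszul2 fr e1; have [t [e5 e6]] := koszul2 fr e2.
have [r [e7 e8]] : exists r, s = r * lform x2 /\ t = - r * lform x1.
  by apply: (koszul2 fr); apply: etrans (_ : t * lform x2 - v2 = _); [rewrite e4 | rewrite -e5]; ring.
exists r; rewrite e3 e6 e4 e7 e8; split; ring.
Qed.

End Classification.

Lemma proportional3 (A : idomainType) (g v : 'I_3 -> A) : ufd A ->
    (forall p, prime_elt p -> exists i, ~ rdvd p (g i)) -> (exists i, g i != 0) ->
    (forall i j, v i * g j = v j * g i) ->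
  exists t, forall i, v i = t * g i.
Proof.
move=> ufdA prim [i gi] prop.
have [|t vi] := @rdvd_family A _ (g i) (v i) g ufdA gi prim.
  by move=> j; exists (v j); rewrite prop.
exists t => j; apply: (mulIf gi); rewrite -prop vi; ring.
Qed.

Lemma lform_comb3 (k : fieldType) n (s1 s2 s3 : k) (a b c : 'rV[k]_n) :
  lform (s1 *: a + s2 *: b + s3 *: c) = s1%:MP * lform a + s2%:MP * lform b + s3%:MP * lform c.
Proof. by rewrite !linearD !linearZ /= !mul_mpolyC. Qed.

Section ZeroCyclic.
Variable k : closedFieldType.

Lemma lsubst_coef0 n (E : 'M[k]_n) (p : {mpoly k[n]}) : (lsubst E p)@_0%MM = p@_0%MM.
Proof.
have ev (q : {mpoly k[n]}) : q@_0%MM = q.@[fun=> 0].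
  rewrite {2}[q]mpolyE raddf_sum /=.
  have [in0|out] := boolP (0%MM \in msupp q); last first.
    rewrite (memN_msupp_eq0 out) big_seq big1 // => m m_in.
    rewrite mevalZ mevalX; have [i mi] : exists i, m i != 0%N.
      apply/existsP; apply: contraNT out; rewrite negb_exists => /forallP m0.
      suff -> : 0%MM = m by [].
      by apply/mnmP => i; rewrite mnmE; apply/esym/eqP; rewrite -[_ == _]negbK m0.
    by rewrite (bigD1 i) //= expr0n (negbTE mi) mul0r mulr0.
  rewrite (bigD1_seq 0%MM) ?msupp_uniq //= big1 ?addr0 => [|m m0].
    by rewrite mevalZ mevalX big1 ?mulr1 // => i _; rewrite mnmE expr0.
  rewrite mevalZ mevalX; have [i mi] : exists i, m i != 0%N.
    apply/existsP; apply: contraNT m0; rewrite negb_exists => /forallP m0.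
    by apply/eqP/mnmP => i; rewrite mnmE; apply/eqP; rewrite -[_ == _]negbK m0.
  by rewrite (bigD1 i) //= expr0n (negbTE mi) mul0r mulr0.
rewrite !ev /lsubst comp_mpoly_meval; apply: meval_eq => i.
by rewrite tnth_mktuple -ev; apply: homog_coef0 (lform_homog _).
Qed.

(** Since p(0) is nonzero, the lowest component of the form comes from that of q. So q has no
    component of degree below d, and p is constant for reasons of degree. *)
Lemma homog_factor_unit n d (p q : {mpoly k[n]}) : q * p \is d.-homog -> q * p != 0 -> p@_0%MM != 0 ->
  p \is a GRing.unit.
Proof.
move=> h nz p0; have [q_0 p_0] : q != 0 /\ p != 0 by move: nz; rewrite mulf_eq0 negb_or => /andP.
have hc_p0 : pihomog (@mdeg n) 0 p = (p@_0%MM)%:MP.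
  rewrite (homog0_const (pihomogP (@mdeg n) 0 p)); congr (_%:MP).
  have := congr1 (mcoeff 0%MM) (pihomog_sum (leqnSn (msize p))).
  rewrite [in X in _ = X -> _]raddf_sum big_ord_recl big1 ?addr0 => [-> //|i _].
  exact: homog_coef0 (pihomogP _ _ _).
have low l : (l < d)%N -> pihomog (@mdeg n) l q = 0.
  elim/ltn_ind: l => l IH lt; have : pihomog (@mdeg n) l (q * p) = 0.
    by apply: (pihomog_out _ h); rewrite neq_ltn lt.
  rewrite {1}(pihomog_sum (leqnSn (msize p))) mulr_sumr.
  rewrite (big_morph _ (pihomogD l) (raddf0 (pihomog (@mdeg n) l))) big_ord_recl big1 ?addr0 => [|i _]; last first.
    have hi := pihomogP (@mdeg n) (lift ord0 i) p.
    have [li|il] := ltnP l (lift ord0 i); first by rewrite (pihomogM_lt _ hi li).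
    rewrite -{1}(subnK il) (pihomogM _ _ hi) IH ?mul0r //; last exact: leq_ltn_trans (leq_subr _ _) lt.
    by rewrite ltn_subrL (leq_trans _ il).
  rewrite -{1}[l]addn0 (pihomogM _ _ (pihomogP _ _ _)) hc_p0 => /eqP.
  by rewrite mulf_eq0 mpolyC_eq0 (negbTE p0) orbF => /eqP.
have sq : (d < msize q)%N.
  rewrite ltnNge; apply: contra q_0 => le; rewrite (pihomog_sum le).
  by rewrite big1 // => i _; apply: low.
have sp : (msize p <= 1)%N.
  have := dhomog_msize_le h; rewrite msizeM // => le.
  move: (msize p) (msize q) sq le => a b; lia.
rewrite (pihomog_sum sp) big_ord_recl big_ord0 addr0 hc_p0.
by apply: (rmorph_unit (@mpolyC n k)); rewrite unitfE.
Qed.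

(** The syzygies of the three nonzero columns are the multiples of the vector of signed minors, once
    these have no common prime factor p. A specialisation to two variables x, y sends combinations
    of the minors to - x^2 and x z - y^2, so the image of p is a nonzero constant; as p divides a
    form, it is a unit itself. *)
Lemma good_D0_cyclic r es : all (@block_wf k) r -> ~~ has (@is_D k) r -> KW_width r = 3 ->
    uniq es -> all2 (@eigen_compat k) r es -> good (KW_D 0 :: r).
Proof.
move=> wfr nD wr ue comp; apply: goodI => m Theta v ind d fr.
pose L := mk_data r v.
have [L' [f [bL' wL' flin _ [fdvd fcomb]]]] := @cyclic_data k 3 0 r es wfr nD ue comp (eq_leq wr).
have wL : wf_data L by rewrite wf_mk.
have fL : free (lforms L) by rewrite lforms_mk.
have [D DE] := data_points wL wL' (etrans (blocks_mk _ _) (esym bL')) fL.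
have -> : lcols (mk_data (KW_D 0 :: r) v) = (0, 0) :: lcols L by [].
have := size_lcols L; rewrite blocks_mk wr.
case: (lcols L) DE => [|c1 [|c2 [|c3 []]]] //= DE _ eqv.
have combE j : exists a1 a2 a3, (a1 *: c1.1 + a2 *: c2.1 + a3 *: c3.1) *m D = f 'X^j /\
    (a1 *: c1.2 + a2 *: c2.2 + a3 *: c3.2) *m D = f ('X * 'X^j).
  have [cs scs [<- <-]] := fcomb 'X^j; rewrite DE /= in scs *.
  exists cs`_0, cs`_1, cs`_2; rewrite !comb_nth // !big_ord_recl !big_ord0 /= !addr0.
  by rewrite !mulmxDl -!scalemxAl !addrA.
pose F : 'M[k]_3 := \matrix_(j < 3) f 'X^j.
pose fl : {linear {poly k} -> 'rV[k]_3} := HB.pack f (GRing.isLinear.Build _ _ _ _ f flin).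
have uF : F \in unitmx.
  rewrite -row_free_unit; apply: inj_row_free => c e.
  pose p : {poly k} := \sum_(j < 3) c 0 j *: 'X^j.
  have fp : f p = 0.
    rewrite -e mulmx_sum_row -[f]/(fl : _ -> _) /p linear_sum; apply: eq_bigr => j _ /=.
    by rewrite rowK -[LHS]/(fl _) linearZ.
  have sp : (size p <= 3)%N.
    by apply: (leq_trans (size_sum _ _ _)); apply/bigmax_leqP => j _;
       apply: (leq_trans (size_scale_leq _ _)); rewrite size_polyXn.
  have ses : size r = size es by move: comp; rewrite all2E => /andP[/eqP].
  have p0 : p = 0.
    apply/eqP; move: (fdvd _ fp); apply: contraTT => nz; apply/negP.
    move/(dvdp_leq nz); have [_ ->] := char_prod_size ses; rewrite wr => h.
    by have := leq_trans h sp.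
  apply/rowP => j; rewrite mxE -[RHS](coef0 _ j) -p0 coef_sum (bigD1 j) //= coefZ coefXn eqxx mulr1.
  by rewrite big1 ?addr0 // => i ne; rewrite coefZ coefXn (_ : (_ == _) = false) ?mulr0 //; apply/negbTE; rewrite eq_sym.
pose x : 'rV[k]_m.+3 := delta_mx 0 0; pose y : 'rV[k]_m.+3 := delta_mx 0 1.
pose S : 'M[k]_(3, m.+3) := \matrix_j (if j == 1%N :> nat then x else if j == 2%N :> nat then y else 0).
pose E := D *m invmx F *m S.
have SE (j : 'I_3) w : w *m D = f 'X^j -> w *m E = row j S.
  move=> e; rewrite /E !mulmxA e; have -> : f 'X^j = row j F by rewrite rowK.
  by rewrite -row_mul mulmxV // row1 -rowE.
have [a1 [a2 [a3 [ea ea']]]] := combE 0%N; have [b1 [b2 [b3 [eb eb']]]] := combE 1%N.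
have [d1 [d2 [d3 [ed ed']]]] := combE 2.
rewrite mulr1 in ea'; rewrite -exprS in eb'.
have fxy : free [:: x; y].
  apply: (free2 (p1 := delta_mx 0 0) (p2 := delta_mx 1 0)).
  by rewrite /fv /x /y !mul_delta_mx !mul_delta_mx_0 // !mxE /= mulr1 mulr0 subr0 oner_eq0.
have X0 := lform_neq0 fxy.
pose mn (c c' : 'rV[k]_m.+3 * 'rV[k]_m.+3) : {mpoly k[m.+3]} := lform c.1 * lform c'.2 - lform c'.1 * lform c.2.
pose g1 := mn c2 c3; pose g2 := - mn c1 c3; pose g3 := mn c1 c2.
pose lc s1 s2 s3 : 'rV[k]_m.+3 * 'rV[k]_m.+3 :=
  (s1 *: c1.1 + s2 *: c2.1 + s3 *: c3.1, s1 *: c1.2 + s2 *: c2.2 + s3 *: c3.2).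
have mnE s1 s2 s3 t1 t2 t3 : mn (lc s1 s2 s3) (lc t1 t2 t3) = (s2 * t3 - s3 * t2)%:MP * g1
    - (s1 * t3 - s3 * t1)%:MP * g2 + (s1 * t2 - s2 * t1)%:MP * g3.
  rewrite /mn /lc /g1 /g2 /g3 /mn /= !lform_comb3 !mpolyCB !mpolyCM; ring.
have SE2 w : w *m D = f 'X^2 -> w *m E = y.
  by move=> e; rewrite (SE (inord 2)) ?inordK // rowK inordK.
have SE1 w : w *m D = f 'X -> w *m E = x by move=> e; rewrite (SE 1) ?rowK.
have SE0 w : w *m D = f 'X^0 -> w *m E = 0 by move=> e; rewrite (SE 0) ?rowK.
have sub_ab : lsubst E (mn (lc a1 a2 a3) (lc b1 b2 b3)) = - (lform x * lform x).
  rewrite /mn /lc rmorphB !rmorphM /= !lsubst_lform.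
  by rewrite (SE0 _ ea) (SE1 _ ea') (SE1 _ eb) (SE2 _ eb') raddf0; ring.
have [z sub_bd] : exists z, lsubst E (mn (lc b1 b2 b3) (lc d1 d2 d3)) = lform x * z - lform y * lform y.
  rewrite /mn /lc rmorphB !rmorphM /= !lsubst_lform.
  by rewrite (SE1 _ eb) (SE2 _ ed) (SE2 _ eb'); eexists.
have g_neq0 : [|| g1 != 0, g2 != 0 | g3 != 0].
  apply/contraT; rewrite !negb_or !negbK => /and3P[/eqP h1 /eqP h2 /eqP h3].
  move: sub_ab; rewrite mnE h1 h2 h3 !mulr0 subr0 addr0 rmorph0 => /eqP.
  by rewrite eq_sym oppr_eq0 mulf_eq0 (negbTE X0).
have prim p : prime_elt p -> rdvd p g1 -> rdvd p g2 -> rdvd p g3 -> False.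
  move=> pp h1 h2 h3; have [p0 nu pP] := pp.
  have dv s1 s2 s3 t1 t2 t3 : rdvd (lsubst E p) (lsubst E (mn (lc s1 s2 s3) (lc t1 t2 t3))).
    have [q qE] : rdvd p (mn (lc s1 s2 s3) (lc t1 t2 t3)).
      by rewrite mnE; apply: rdvdD; [apply: rdvdB|]; apply: rdvd_mull.
    by exists (lsubst E q); rewrite qE rmorphM.
  have dx : rdvd (lsubst E p) (lform x * lform x).
    by have := rdvdN (dv a1 a2 a3 b1 b2 b3); rewrite sub_ab opprK.
  have dy : rdvd (lsubst E p) (lform x * z - lform y * lform y) by rewrite -sub_bd; apply: dv.
  have sp0 : lsubst E p != 0.
    by apply: contraTneq X0 => e; case: dx => q /eqP; rewrite e mulr0 mulf_eq0 orbb negbK.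
  have [s sE] := mpoly_ufd sp0.
  have uni : lsubst E p \is a GRing.unit.
    apply: contraT => nun; have [q qp qd] := factored_nonunit sE nun; have [_ _ qP] := qp.
    have qx : rdvd q (lform x) by case: (qP _ _ (rdvd_trans qd dx)).
    have qy : rdvd q (lform y * lform y).
      have -> : lform y * lform y = lform x * z - (lform x * z - lform y * lform y) :> {mpoly k[m.+3]} by ring.
      by apply: rdvdB; [apply: rdvd_mulr | apply: rdvd_trans qd dy].
    by case: (coprime_forms fxy qp qx); case: (qP _ _ qy).
  have [g [g0 hg [q gq]]] : exists g : {mpoly k[m.+3]}, [/\ g != 0, g \is 2.-homog & rdvd p g].
    have h2h c c' : mn c c' \is 2.-homog by rewrite rpredB ?lform2_homog.
    by case/or3P: g_neq0 => g0; [exists g1 | exists g2 | exists g3]; split; rewrite ?rpredN ?h2h.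
  have [c c0 cE] := unit_mpolyP uni.
  case/negP: nu; rewrite gq in g0 hg; apply: homog_factor_unit hg g0 _.
  by rewrite -(lsubst_coef0 E) cE mcoeffC eqxx mulr1.
apply: free_solved eqv _.
have hg1 : g1 \is 2.-homog by rewrite rpredB ?lform2_homog.
have hg2 : g2 \is 2.-homog by rewrite rpredN rpredB ?lform2_homog.
have hg3 : g3 \is 2.-homog by rewrite rpredB ?lform2_homog.
clear mnE sub_ab sub_bd SE SE0 SE1 SE2.
apply: (@zero1_invariants _ _ _ _ _ g1 g2 g3 2) => //.
  by apply/syz_form_mx; rewrite /g1 /g2 /g3 /mn /= !raddf0; split; ring.
move=> v1 v2 v3 /syz_form_mx /=; rewrite !raddf0 !mul0r !add0r => -[e1 e2].
pose g (i : 'I_3) := [:: g1; g2; g3]`_i; pose w (i : 'I_3) := [:: v1; v2; v3]`_i.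
have [|||t tE] := @proportional3 _ g w (@mpoly_ufd k m.+3).
- move=> p pp; apply: NNPP => h; apply: (prim p pp); apply: NNPP => h'; apply: h.
  + by exists 0. 
  + by exists 1.
  by exists (inord 2); rewrite /g inordK.
- by case/or3P: g_neq0 => nz; [exists 0 | exists 1 | exists (inord 2); rewrite /g inordK].
- have e12 : v1 * g2 = v2 * g1.
    apply/eqP; rewrite -subr_eq0; apply/eqP.
    transitivity (lform c3.1 * (lform c1.2 * v1 + lform c2.2 * v2 + lform c3.2 * v3) - lform c3.2 * (lform c1.1 * v1 + lform c2.1 * v2 + lform c3.1 * v3)).
      by rewrite /g1 /g2 /mn /=; ring.
    by rewrite e1 e2 !mulr0 subr0.
  have e13 : v1 * g3 = v3 * g1.
    apply/eqP; rewrite -subr_eq0; apply/eqP.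
    transitivity (lform c2.2 * (lform c1.1 * v1 + lform c2.1 * v2 + lform c3.1 * v3) - lform c2.1 * (lform c1.2 * v1 + lform c2.2 * v2 + lform c3.2 * v3)).
      by rewrite /g1 /g3 /mn /=; ring.
    by rewrite e1 e2 !mulr0 subr0.
  have e23 : v2 * g3 = v3 * g2.
    apply/eqP; rewrite -subr_eq0; apply/eqP.
    transitivity (lform c1.1 * (lform c1.2 * v1 + lform c2.2 * v2 + lform c3.2 * v3) - lform c1.2 * (lform c1.1 * v1 + lform c2.1 * v2 + lform c3.1 * v3)).
      by rewrite /g2 /g3 /mn /=; ring.
    by rewrite e1 e2 !mulr0 subr0.
  by move=> [[|[|[|//]]] ?] [[|[|[|//]]] ?]; rewrite /g /w /= ?e12 ?e13 ?e23.
exists t; split; [exact: (tE 0) | exact: (tE 1) |].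
by have := tE (inord 2); rewrite /g /w inordK.
Qed.

End ZeroCyclic.

(** * All lists of blocks of total width four *)

Section BlockLists.
Variable k : closedFieldType.
Local Notation blk := (KW_block k).

Lemma extract (P : pred blk) bs : has P bs -> exists b r, P b /\ Permutation bs (b :: r).
Proof.
elim: bs => //= b r IH /orP[Pb|/IH[b' [r' [Pb' p]]]]; first by exists b, r; split=> //; apply: Permutation_refl.
exists b', (b :: r'); split=> //; apply: perm_trans (perm_skip b p) _; exact: perm_swap.
Qed.

Lemma perm_blocks (P : pred blk) bs bs' : Permutation bs bs' ->
  has P bs = has P bs' /\ KW_width bs = KW_width bs'.
Proof.
elim=> [|b r r' _ [IH1 IH2]|b b' r|r r' r'' _ [-> ->] _ [-> ->]] //=.
- by rewrite IH1 IH2.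
- by rewrite orbCA addnCA.
Qed.

Lemma perm_wf bs bs' : Permutation bs bs' -> all (@block_wf k) bs = all (@block_wf k) bs'.
Proof.
move=> p; have e := (perm_blocks (predC (@block_wf k)) p).1.
by apply: negb_inj; rewrite -!has_predC.
Qed.

Lemma width_pos (b : blk) : block_wf b -> (0 < block_width b)%N.
Proof. by case: b. Qed.

Lemma width0 r : all (@block_wf k) r -> KW_width r = 0%N -> r = [::].
Proof. by case: r => //= b r /andP[/width_pos]; lia. Qed.

Lemma width1 r : all (@block_wf k) r -> KW_width r = 1%N ->
  exists b, [/\ r = [:: b], block_wf b & block_width b = 1%N].
Proof.
case: r => //= b r /andP[wb wr] e; have pb := width_pos wb.
by exists b; split=> //; [rewrite (width0 wr) //|]; lia.
Qed.

Lemma width2 r : all (@block_wf k) r -> KW_width r = 2 ->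
  (exists b, [/\ r = [:: b], block_wf b & block_width b = 2]) \/
  (exists b c, [/\ r = [:: b; c], block_wf b /\ block_wf c, block_width b = 1%N & block_width c = 1%N]).
Proof.
case: r => //= b r /andP[wb wr] e; have pb := width_pos wb.
have [e1|e1] : KW_width r = 0%N \/ KW_width r = 1%N by lia.
  by left; exists b; split=> //; [rewrite (width0 wr e1) | lia].
by have [c [-> wc ec]] := width1 wr e1; right; exists b, c; split=> //; lia.
Qed.

Definition repeated (bs : seq blk) := exists lam a b r, Permutation bs [:: KW_J a lam, KW_J b lam & r].

Lemma fresh_eigenvalue (s : seq k) : exists x, x \notin s.
Proof.
have [|x nr] := closed_nonrootP (\prod_(a <- s) ('X - a%:P)) _.
  by rewrite monic_neq0 // monic_prod_XsubC.
by exists x; rewrite -root_prod_XsubC.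
Qed.

Definition eigenvalue_of (b : blk) : k := if b is KW_J _ lam then lam else 0.

(** Blocks J dictate their eigenvalue and blocks B need a new one, which exists because k is
    infinite. The list [av] of values to avoid makes the induction on the blocks go through. *)
Lemma eigen_dichotomy bs : ~~ has (@is_D k) bs -> repeated bs \/
  forall av : seq k, (forall j mu, List.In (KW_J j mu) bs -> mu \notin av) ->
    exists es : seq k, [/\ uniq es, all2 (@eigen_compat k) bs es & forall x, x \in es -> x \notin av].
Proof.
elim: bs => [|b r IH] /=; first by right=> av _; exists [::].
rewrite negb_or => /andP[nb /IH [[lam [a [c [r' p]]]]|{}IH]].
  left; exists lam, a, c, (b :: r').
  apply: perm_trans (perm_skip b p) _; apply: perm_trans (perm_swap _ _ _) _.
  by apply: perm_skip; apply: perm_swap.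
case: b nb => // j.
  move=> mu _; have [[j' in_r]|nin] := classic (exists j', List.In (KW_J j' mu) r).
    left; have [r1 [r2 ->]] := List.in_split _ _ in_r; exists mu, j, j', (r1 ++ r2)%list.
    by apply: perm_skip; apply: Permutation_sym; apply: Permutation_middle.
  right=> av H; have [|es [u c na]] := IH (mu :: av).
    move=> j' mu' in_r; rewrite inE negb_or (H j') ?andbT; last by right.
    by apply/eqP => e; apply: nin; exists j'; rewrite -e.
  exists (mu :: es); split=> /=; rewrite ?eqxx //.
    by rewrite u andbT; apply/negP => /na; rewrite inE eqxx.
  move=> x; rewrite inE => /orP[/eqP ->|/na]; first by apply: (H j); left.
  by rewrite inE negb_or => /andP[].
move=> _; right=> av H; have [x] := fresh_eigenvalue (av ++ map eigenvalue_of r).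
rewrite mem_cat negb_or => /andP[xav xr].
have [|es [u c na]] := IH (x :: av).
  move=> j' mu in_r; rewrite inE negb_or (H j') ?andbT; last by right.
  apply: contraNneq xr => <-.
  elim: (r) in_r => //= b r' IHr [->|/IHr]; rewrite inE ?eqxx // => ->.
  by rewrite orbT.
exists (x :: es); split=> //=.
  by rewrite u andbT; apply/negP => /na; rewrite inE eqxx.
move=> y; rewrite inE => /orP[/eqP -> //|/na].
by rewrite inE negb_or => /andP[].
Qed.

Lemma distinct_eigenvalues bs : ~~ has (@is_D k) bs -> repeated bs \/
  exists es : seq k, uniq es /\ all2 (@eigen_compat k) bs es.
Proof.
move=> /eigen_dichotomy [|H]; first by left.
by right; have [//|es [u c _]] := H [::]; exists es.
Qed.

Definition is_J (b : blk) := if b is KW_J _ _ then true else false.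
Definition is_D0 (b : blk) := if b is KW_D 0 then true else false.

Lemma extract_J bs : has is_J bs -> exists a lam r, Permutation bs (KW_J a lam :: r).
Proof. by move=> /extract[b [r [Pb p]]]; case: b Pb p => // a lam _ p; exists a, lam, r. Qed.

Lemma extract_D bs : has (@is_D k) bs -> exists d r, Permutation bs (KW_D d :: r).
Proof. by move=> /extract[b [r [Pb p]]]; case: b Pb p => // d _ p; exists d, r. Qed.

Lemma extract_D0 bs : has is_D0 bs -> exists r, Permutation bs (KW_D 0 :: r).
Proof. by move=> /extract[b [r [Pb p]]]; case: b Pb p => // -[] // _ p; exists r. Qed.

Lemma no_J_repeated bs : ~~ has is_J bs -> ~ repeated bs.
Proof. by move=> nJ [lam [a [b [r p]]]]; move: nJ; rewrite (perm_blocks _ p).1. Qed.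

Lemma good_B bs :
    ~~ has (@is_D k) bs -> ~~ has is_J bs ->
    (forall m (v : nat -> 'rV[k]_m.+3), free (mkseq v (KW_nvars bs)) ->
       minor_prime (form_mx (lcols (mk_data bs v)))) ->
  good bs.
Proof.
move=> nD nJ H; apply: goodI => m Theta v ind d fr eqv.
have [/(no_J_repeated nJ) []|[es [u c]]] := distinct_eigenvalues nD.
have [|||sT _] := @cyclic_data_small _ _ _ _ es d; rewrite ?blocks_mk //.
have [P [l [P1 P2 P3 P4]]] := H m v fr.
apply/BR_solved/(small_invariants eqv _ P1 P2 P3 P4).
exact: small_equiv (KW_equiv_sym eqv) sT.
Qed.

Ltac pr H := apply: good_B => // m v; rewrite /lcols /mkseq /= /addn /=; exact: H.

Lemma good_B4 : good [:: @KW_B k 4]. Proof. pr B4_prime. Qed.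
Lemma good_B31 : good [:: @KW_B k 3; KW_B 1]. Proof. pr B31_prime. Qed.
Lemma good_B22 : good [:: @KW_B k 2; KW_B 2]. Proof. pr B22_prime. Qed.
Lemma good_B211 : good [:: @KW_B k 2; KW_B 1; KW_B 1]. Proof. pr B211_prime. Qed.
Lemma good_B1111 : good [:: @KW_B k 1; KW_B 1; KW_B 1; KW_B 1]. Proof. pr B1111_prime. Qed.

Lemma good_all_B bs : all (@block_wf k) bs -> KW_width bs = 4 -> ~~ has (@is_D k) bs ->
  ~~ has is_J bs -> good bs.
Proof.
case: bs => [|[] // a [|[] // b [|[] // c [|[] // d [|e r]]]]] //=; rewrite ?andbT ?addn0.
- by move=> _ -> _ _; apply: good_B4.
- case/andP=> a0 b0 e _ _; have [[-> ->]|[[-> ->]|[-> ->]]] :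
    (a = 1 /\ b = 3 \/ a = 2 /\ b = 2 \/ a = 3 /\ b = 1)%N by lia.
  + exact: good_perm (perm_swap _ _ _) good_B31.
  + exact: good_B22.
  exact: good_B31.
- case/and3P=> a0 b0 c0 e _ _; have [[-> [-> ->]]|[[-> [-> ->]]|[-> [-> ->]]]] :
    (a = 1 /\ b = 1 /\ c = 2 \/ a = 1 /\ b = 2 /\ c = 1 \/ a = 2 /\ b = 1 /\ c = 1)%N by lia.
  + apply: good_perm good_B211; apply: perm_trans (perm_skip _ (perm_swap _ _ _)) _; exact: perm_swap.
  + exact: good_perm (perm_swap _ _ _) good_B211.
  exact: good_B211.
- case/and4P=> a0 b0 c0 d0 e _ _; have [-> [-> [-> ->]]] : (a = 1 /\ b = 1 /\ c = 1 /\ d = 1)%N by lia.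
  exact: good_B1111.
case/and5P=> a0 b0 c0 d0 /andP[/width_pos we _] e1; lia.
Qed.

Lemma good_distinct_J a lam r es : ~~ has (@is_D k) r -> uniq es ->
  all2 (@eigen_compat k) (KW_J a lam :: r) es -> good (KW_J a lam :: r).
Proof.
case: es => [|x es] //= nD u /andP[/eqP e c]; apply: goodI => m Theta v ind d fr eqv.
apply: BR_solved; apply: (eigen_invariants d (blocks_mk _ _) nD _ c).
by rewrite e.
Qed.

Lemma good_no_D bs : all (@block_wf k) bs -> KW_width bs = 4 -> ~~ has (@is_D k) bs -> good bs.
Proof.
move=> wf w nD; have [[lam [a [b [r p]]]]|nrep] := classic (repeated bs); last first.
  have [hJ|] := boolP (has is_J bs); last exact: good_all_B.
  have [a [lam [r p]]] := extract_J hJ; apply: good_perm (p) _.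
  have nD' : ~~ has (@is_D k) (KW_J a lam :: r) by rewrite -(perm_blocks _ p).1.
  have [[mu [a1 [b1 [r1 p1]]]]|[es [u c]]] := distinct_eigenvalues nD'.
    by case: nrep; exists mu, a1, b1, r1; apply: perm_trans p p1.
  exact: good_distinct_J u c.
apply: good_perm (p) _; rewrite (perm_wf p) in wf; rewrite (perm_blocks (@is_D k) p).1 in nD.
rewrite (perm_blocks is_J p).2 in w; move: wf w nD => /= /and3P[a0 b0 wr] w nD {p bs}.
wlog le : a b a0 b0 w / (a <= b)%N.
  move=> H; have [/H|/ltnW] := leqP a b; first exact.
  by move=> le; apply: good_perm (perm_swap _ _ _) _; apply: H => //; rewrite addnCA.
have [[ea eb er]|[[ea eb er]|[[ea eb er]|[ea eb er]]]] : [/\ a = 1, b = 1 & KW_width r = 2]%N \/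
  [/\ a = 1, b = 2 & KW_width r = 1]%N \/ [/\ a = 1, b = 3 & KW_width r = 0]%N \/
  [/\ a = 2, b = 2 & KW_width r = 0]%N.
- move: (KW_width r) w => x w; have : (a <= 2)%N by lia.
  case: a a0 le w => [|[|[|]]] // _ le w _.
    case: b b0 le w => [|[|[|[|b]]]] // _ _ w; [left | right; left | right; right; left]; split; lia.
  by do 3! right; split; lia.
- rewrite ea eb; have [[c [rE wc c2]]|[c [d [rE [wc wd] c1 d1]]]] := width2 wr er; rewrite rE in nD *.
    case: c nD c2 {wc rE} => //= [j mu _ ->|j _ ->]; [exact: good_J1J1J2 | exact: good_J1J1B2].
  move: nD c1 d1 {wc wd rE}; case: c => [//|j mu|j]; case: d => [j'|j' mu'|j'] //= _ -> ->.
  + exact: good_J1J1JJ.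
  + exact: good_J1J1J1B1.
  + apply: good_perm (good_J1J1J1B1 lam mu'); do 2! apply: perm_skip; exact: perm_swap.
  exact: good_J1J1B1B1.
- rewrite ea eb; have [c [rE wc c1]] := width1 wr er; rewrite rE in nD *.
  by case: c nD c1 {wc rE} => //= [j mu _ ->|j _ ->]; [exact: good_J1J2J1 | exact: good_J1J2B1].
- by rewrite ea eb (width0 wr er); apply: good_J1J3.
by rewrite ea eb (width0 wr er); apply: good_J2J2.
Qed.

Lemma good_D bs d r : Permutation bs (KW_D d :: r) -> (0 < d)%N -> all (@block_wf k) bs ->
  KW_width bs = 4 -> ~~ has is_D0 bs -> good bs.
Proof.
move=> p d0 wf w nD; apply: good_perm (p) _; rewrite (perm_wf p) in wf.
rewrite (perm_blocks is_D0 p).2 in w; rewrite (perm_blocks is_D0 p).1 in nD; move: wf w nD => /= wr w nD {p bs}.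
have {}nD : ~~ has is_D0 r by move: nD; rewrite negb_or => /andP[].
have [[ed er]|[[ed er]|[ed er]]] : (d = 1 /\ KW_width r = 2 \/ d = 2 /\ KW_width r = 1 \/ d = 3 /\ KW_width r = 0)%N.
- by move: (KW_width r) w => x; lia.
- rewrite ed; have [[c [rE wc c2]]|[c [e [rE [wc we] c1 e1]]]] := width2 wr er; rewrite rE in nD *.
    case: c nD c2 {wc rE} => //= [j _ [->]|j mu _ ->|j _ ->]; [exact: good_D1D1 | exact: good_D1J2 | exact: good_D1B2].
  case: c e nD c1 e1 {wc we rE} => [[|j] //|j mu|j] [[|j'] //|j' mu'|j'] /= _ -> -> //.
  + exact: good_D1J1J1.
  + exact: good_D1J1B1.
  + apply: good_perm (good_D1J1B1 mu'); apply: perm_skip; exact: perm_swap.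
  exact: good_D1B1B1.
- rewrite ed; have [c [rE wc c1]] := width1 wr er; rewrite rE in nD *.
  case: c nD c1 {wc rE} => [[|j] //|j mu|j] /= _ -> //; [exact: good_D2J1 | exact: good_D2B1].
by rewrite ed (width0 wr er); apply: good_D3.
Qed.

Lemma good_D0 bs r : Permutation bs (KW_D 0 :: r) -> all (@block_wf k) bs -> KW_width bs = 4 -> good bs.
Proof.
move=> p wf w; apply: good_perm (p) _; rewrite (perm_wf p) in wf.
rewrite (perm_blocks is_D0 p).2 in w; move: wf w => /= wr [w] {p bs}.
have [h0|n0] := boolP (has is_D0 r).
  have [r' p] := extract_D0 h0; apply: good_perm (perm_skip _ p) _; exact: good_D0D0.
have [hD|nD] := boolP (has (@is_D k) r).
  have [d [r' p]] := extract_D hD; apply: good_perm (perm_skip _ p) _.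
  rewrite (perm_wf p) in wr; rewrite (perm_blocks is_D0 p).2 in w; rewrite (perm_blocks is_D0 p).1 in n0.
  move: wr w n0 => /= wr w n0.
  have [[ed er]|[ed er]] : (d = 1 /\ KW_width r' = 1 \/ d = 2 /\ KW_width r' = 0)%N.
  - by case: d n0 w {p} => // d _; move: (KW_width r') => x; lia.
  - rewrite ed; have [c [rE wc c1]] := width1 wr er; rewrite rE in n0 *.
    apply: good_D0D1 => //; move: n0 c1; rewrite /= orbF negb_or => /andP[_].
    by case: c {wc rE} => // -[].
  by rewrite ed (width0 wr er); apply: good_D0D2.
have [[lam [a [b [r' p]]]]|[es [u c]]] := distinct_eigenvalues nD; last exact: good_D0_cyclic u c.
apply: good_perm (perm_skip _ p) _; rewrite (perm_wf p) in wr; rewrite (perm_blocks (@is_D k) p).1 in nD.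
rewrite (perm_blocks is_J p).2 in w; move: wr w nD => /= /and3P[a0 b0 wr] w nD.
have [[ea eb er]|[[ea eb er]|[ea eb er]]] : [/\ a = 1, b = 1 & KW_width r' = 1]%N \/
  [/\ a = 1, b = 2 & KW_width r' = 0]%N \/ [/\ a = 2, b = 1 & KW_width r' = 0]%N.
- move: (KW_width r') w => x w; have : (a <= 2)%N by lia.
  case: a a0 w {p} => [|[|[|]]] // _ w _; last by right; right; split; lia.
  by have : (b <= 2)%N by [lia]; case: b b0 w => [|[|[|]]] // _ w _; [left | right; left]; split; lia.
- rewrite ea eb; have [c [rE wc c1]] := width1 wr er; rewrite rE in nD *; apply: good_D0J1J1 => //.
  by move: nD; rewrite /= orbF.
- by rewrite ea eb (width0 wr er); apply: good_D0J1J2.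
rewrite ea eb (width0 wr er); apply: good_perm (perm_skip _ (perm_swap _ _ _)) _; exact: good_D0J1J2.
Qed.

Lemma good_all bs : all (@block_wf k) bs -> KW_width bs = 4 -> good bs.
Proof.
move=> wf w; have [h0|n0] := boolP (has is_D0 bs).
  by have [r p] := extract_D0 h0; apply: good_D0 p wf w.
have [hD|nD] := boolP (has (@is_D k) bs); last exact: good_no_D.
have [d [r p]] := extract_D hD; apply: good_D (p) _ wf w (n0).
by move: n0; rewrite (perm_blocks _ p).1 /= negb_or => /andP[]; case: d {p}.
Qed.

End BlockLists.

(** * Existence of the Kronecker-Weierstrass normal form *)

Section FreeMaps.
Variables (k : fieldType) (U V : vectType k).
Implicit Types (f : 'Hom(U, V)) (s t : seq U) (K W : {vspace U}).

Lemma free_map f s : free s -> (forall x, x \in <<s>>%VS -> f x = 0 -> x = 0) -> free (map f s).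
Proof.
move=> fs inj; have : basis_of <<s>> s by rewrite /basis_of eqxx fs.
have /limg_basis_of h : (<<s>> :&: lker f = 0)%VS.
  apply/eqP; rewrite -subv0; apply/subvP => x; rewrite memv_cap memv_ker => /andP[xs /eqP fx].
  by rewrite memv0; apply/eqP; apply: inj.
by move=> /h /basis_free.
Qed.

Lemma free_map_dim f s : free (map f s) -> \dim <<s>> = size s /\ (<<s>> :&: lker f = 0)%VS.
Proof.
rewrite /free size_map -limg_span => /eqP e; have := limg_ker_dim f <<s>>; rewrite e => e2.
have := dim_span s; rewrite -{1}e2 => le.
have d0 : \dim (<<s>> :&: lker f) = 0%N by apply/eqP; rewrite -leqn0 -(leq_add2r (size s)).
by rewrite -e2 d0; split=> //; apply/eqP; rewrite -dimv_eq0 d0.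
Qed.

Lemma free_of_map f s : free (map f s) -> free s.
Proof. by move=> /free_map_dim[e _]; apply/eqP. Qed.

Lemma free_map_inj f s x : free (map f s) -> x \in <<s>>%VS -> f x = 0 -> x = 0.
Proof.
move=> /free_map_dim[_ e] xs fx; apply/eqP; rewrite -memv0 -e memv_cap xs memv_ker fx eqxx //.
Qed.

Lemma free_cat_map f s t : free (map f s) -> (forall x, x \in t -> f x = 0) -> free t -> free (s ++ t).
Proof.
move=> fs ft frt; rewrite cat_free (free_of_map fs) frt /=; apply/directv_addP.
apply/eqP; rewrite -subv0; apply/subvP => x; rewrite memv_cap => /andP[xs xt].
rewrite memv0; apply/eqP; apply: (free_map_inj fs xs).
have /subvP/(_ x xt) : (<<t>> <= lker f)%VS by apply/span_subvP => y /ft e; rewrite memv_ker e.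
by rewrite memv_ker => /eqP.
Qed.

Lemma complete_free s K : free s -> (<<s>> <= K)%VS ->
  exists t, free (s ++ t) /\ (<<s ++ t>> = K)%VS.
Proof.
move=> fs sK; exists (vbasis (K :\: <<s>>)); rewrite span_cat (span_basis (vbasisP _)); split.
  rewrite cat_free fs (basis_free (vbasisP _)) /=; apply/directv_addP.
  by rewrite (span_basis (vbasisP _)) capvC capv_diff.
by rewrite addvC addv_diff; apply/eqP; rewrite eqEsubv addvSl subv_add subvv sK.
Qed.

Lemma section_on f K : exists s : V -> U,
  (forall v, s v \in K) /\ (forall v, v \in (f @: K)%VS -> f (s v) = v).
Proof.
exists (fun v => projv K ((f \o projv K)^-1%VF v)); split=> v; first exact: memv_proj.
move=> vK; have := @limg_lfunVK _ _ _ (f \o projv K)%VF v; rewrite comp_lfunE => -> //.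
by rewrite limg_comp limg_proj.
Qed.

End FreeMaps.

Section Modulo.
Variables (k : fieldType) (U : vectType k).
Implicit Types (s t : seq U) (K W : {vspace U}).

(** An endomorphism with kernel K stands for the quotient map, so inductions on quotients stay in
    the same space. *)
Definition modulo K : 'End(U) := (\1 - projv K)%VF.

Lemma moduloP K x : (modulo K x == 0) = (x \in K).
Proof.
rewrite /modulo add_lfunE opp_lfunE id_lfunE subr_eq0; apply/eqP/idP => [->|/projv_id ->] //.
exact: memv_proj.
Qed.

Lemma modulo_eq0 K x : x \in K -> modulo K x = 0. Proof. by rewrite -moduloP => /eqP. Qed.

Lemma modulo_eq K x y : x - y \in K -> modulo K x = modulo K y.
Proof. by rewrite -moduloP linearB subr_eq0 => /eqP. Qed.

Lemma modulo_sub K x y : modulo K x = modulo K y -> x - y \in K.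
Proof. by move=> e; rewrite -moduloP linearB /= e subrr. Qed.

Lemma free_congruent K s s' t : free s -> (<<s>> :&: K = 0)%VS -> map (modulo K) s' = map (modulo K) s ->
  free t -> (<<t>> <= K)%VS -> free (s' ++ t).
Proof.
move=> fs d e ft tK; apply: (free_cat_map (f := modulo K)) => //.
  rewrite e; apply: free_map => // x xs /eqP; rewrite moduloP => xK.
  by apply/eqP; rewrite -memv0 -d memv_cap xs.
by move=> x xt; apply: modulo_eq0; apply: (subvP tK); apply: memv_span.
Qed.

Lemma span_congruent K s s' : map (modulo K) s' = map (modulo K) s -> (<<s'>> + K = <<s>> + K)%VS.
Proof.
have aux s1 s2 : map (modulo K) s1 = map (modulo K) s2 -> (<<s1>> + K <= <<s2>> + K)%VS.
  move=> e; rewrite subv_add addvSr andbT; apply/span_subvP => x xs.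
  have : modulo K x \in map (modulo K) s2 by rewrite -e map_f.
  case/mapP => y ys /modulo_sub d; rewrite -[x](subrK y) addrC.
  by apply: memv_add => //; apply: memv_span.
by move=> e; apply/eqP; rewrite eqEsubv !aux.
Qed.

End Modulo.

Section Entries.
Variables (k : closedFieldType) (n : nat) (U : vectType k).
Local Notation V := 'rV[k]_n.
Local Notation entry := (KW_block k * seq U * seq V)%type.
Implicit Types (al be : 'Hom(U, V)) (us : seq U) (vs : seq V) (L : seq entry).

(** An entry lists a block, the vectors of U that index its columns and the forms that are its
    variables; [al] and [be] give the first and the second row. *)
Definition adapted al be (e : entry) :=
  [&& block_wf e.1.1, size e.2 == block_nvars e.1.1
    & [seq (al u, be u) | u <- e.1.2] == bcols e.1.1 (nth 0 e.2)].

Definition vects L := flatten [seq e.1.2 | e <- L].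
Definition forms L := flatten [seq e.2 | e <- L].

Definition decomposed al be (W : {vspace U}) (P : pred (KW_block k)) := exists L,
  [/\ all (adapted al be) L, all (fun e => P e.1.1) L, free (vects L), (<<vects L>> = W)%VS & free (forms L)].

Lemma map_iota_eq (T : eqType) (x0 : T) (f : U -> T) (g : nat -> T) us w :
  [seq f u | u <- us] == [seq g c | c <- iota 0 w] <->
  size us = w /\ forall c, (c < w)%N -> f us`_c = g c.
Proof.
split=> [/eqP e|[su e]].
  have su : size us = w by have := congr1 size e; rewrite !size_map size_iota.
  split=> // c lt; have := congr1 (nth x0 ^~ c) e.
  by rewrite (nth_map 0) ?su // (nth_map 0%N) ?size_iota // nth_iota.
apply/eqP/(@eq_from_nth _ x0) => [|c]; rewrite !size_map ?size_iota // su => lt.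
by rewrite (nth_map 0) ?su // (nth_map 0%N) ?size_iota // nth_iota // e.
Qed.

Lemma adaptedD al be m us vs : adapted al be (KW_D m, us, vs) <-> [/\ size vs = m, size us = m.+1 &
  forall c, (c < m.+1)%N -> al us`_c = (if (c < m)%N then vs`_c else 0) /\
                         be us`_c = (if (0 < c)%N then vs`_c.-1 else 0)].
Proof.
rewrite /adapted /fst /snd /bcols /block_nvars /block_wf; split.
  case/and3P=> _ /eqP sv /(map_iota_eq (0, 0))[su e]; split=> // c lt.
  by have [-> ->] := e c lt.
case=> sv su e; rewrite sv eqxx !andTb; apply/(map_iota_eq (0, 0)); split=> // c lt.
by have [-> ->] := e c lt.
Qed.

Lemma adaptedJ al be m lam us vs : adapted al be (KW_J m lam, us, vs) <-> [/\ (0 < m)%N, size vs = m, size us = m &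
  forall c, (c < m)%N -> al us`_c = vs`_c /\
                         be us`_c = lam *: vs`_c + (if (0 < c)%N then vs`_c.-1 else 0)].
Proof.
rewrite /adapted /fst /snd /bcols /block_nvars /block_wf; split.
  case/and3P=> m0 /eqP sv /(map_iota_eq (0, 0))[su e]; split=> // c lt.
  by have [-> ->] := e c lt.
case=> m0 sv su e; rewrite m0 sv eqxx /=; apply/(map_iota_eq (0, 0)); split=> // c lt.
by have [-> ->] := e c lt.
Qed.

Lemma adaptedB al be m us vs : adapted al be (KW_B m, us, vs) <-> [/\ (0 < m)%N, size vs = m.+1, size us = m &
  forall c, (c < m)%N -> al us`_c = vs`_c.+1 /\ be us`_c = vs`_c].
Proof.
rewrite /adapted /fst /snd /bcols /block_nvars /block_wf; split.
  case/and3P=> m0 /eqP sv /(map_iota_eq (0, 0))[su e]; split=> // c lt.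
  by have [-> ->] := e c lt.
case=> m0 sv su e; rewrite m0 sv eqxx /=; apply/(map_iota_eq (0, 0)); split=> // c lt.
by have [-> ->] := e c lt.
Qed.

Lemma vects_cat L L' : vects (L ++ L') = vects L ++ vects L'.
Proof. by rewrite /vects map_cat flatten_cat. Qed.

Lemma forms_cat L L' : forms (L ++ L') = forms L ++ forms L'.
Proof. by rewrite /forms map_cat flatten_cat. Qed.

End Entries.

Lemma map_congruent (k : fieldType) (U : vectType k) (K : {vspace U}) (us : seq U) c :
  (forall i, c i - us`_i \in K) -> map (modulo K) (mkseq c (size us)) = map (modulo K) us.
Proof.
move=> cK; rewrite -[in RHS](mkseq_nth 0 us) /mkseq -!map_comp; apply: eq_map => i /=.
exact: modulo_eq.
Qed.

Lemma nth_map0 (k : fieldType) (U V : vectType k) (f : 'Hom(U, V)) (s : seq U) i :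
  [seq f x | x <- s]`_i = f s`_i.
Proof.
have [lt|ge] := ltnP i (size s); first by rewrite (nth_map 0).
by rewrite !nth_default ?size_map // linear0.
Qed.

(** * Pencils with injective first map: Jordan chains *)

Section Jordan.
Variables (k : closedFieldType) (n : nat) (U : vectType k).
Local Notation V := 'rV[k]_n.
Local Notation entry := (KW_block k * seq U * seq V)%type.
Implicit Types (al be : 'Hom(U, V)) (us : seq U) (vs : seq V) (L : seq entry) (W : {vspace U}).

Definition injective_on al W := forall x, x \in W -> al x = 0 -> x = 0.

Lemma eigenvector_exists al be W : W != 0%VS -> injective_on al W -> (be @: W <= al @: W)%VS ->
  exists lam w, [/\ w \in W, w != 0 & be w = lam *: al w].
Proof.
move=> W0 inj sub; pose us := vbasis W; pose d := \dim W.
have d0 : (0 < d)%N by rewrite lt0n dimv_eq0.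
have bW := vbasisP W.
have bA : basis_of (al @: W) (map al us).
  apply: limg_basis_of bW; apply/eqP; rewrite -subv0; apply/subvP => x; rewrite memv_cap memv_ker memv0.
  by case/andP=> xW /eqP e; apply/eqP; apply: inj.
pose M : 'M[k]_d := \matrix_(i, j) coord (map_tuple al us) j (be us`_i).
have uW (i : 'I_d) : us`_i \in W by apply: vbasis_mem; rewrite mem_nth // size_tuple.
have Mus (i : 'I_d) : be us`_i = \sum_j M i j *: al us`_j.
  rewrite {1}(coord_basis bA (v := be us`_i)); last by apply: (subvP sub); apply: memv_img.
  by apply: eq_bigr => j _; rewrite mxE (nth_map 0) // size_tuple.
have [lam rt] : exists lam, root (char_poly M) lam.
  by apply/closed_rootP; rewrite size_char_poly eqSS -lt0n.
rewrite -eigenvalue_root_char in rt; have [v vM v0] := eigenvalueP rt.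
exists lam, (\sum_i v 0 i *: us`_i); split.
- by apply: memv_suml => i _; apply: memvZ.
- apply: contraNneq v0 => e; apply/eqP/rowP => i; rewrite mxE.
  have /freeP h := basis_free bW; exact: (h (fun i => v 0 i) e i).
rewrite !linear_sum /=.
transitivity (\sum_j (v *m M) 0 j *: al us`_j).
  under eq_bigr => i _ do rewrite linearZ /= Mus scaler_sumr.
  rewrite exchange_big; apply: eq_bigr => j _ /=; rewrite mxE scaler_suml.
  by apply: eq_bigr => i _; rewrite scalerA.
by apply: eq_bigr => j _; rewrite vM mxE linearZ /= scalerA.
Qed.

Section Step.
Variables (al be : 'Hom(U, V)) (W : {vspace U}) (lam : k).
Let g := (be - lam *: al)%VF.
Let K := (W :&: lker g)%VS.
Let pi := modulo (al @: K).

Variable s : V -> U.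
Hypotheses (sK : forall v, s v \in K) (sE : forall v, v \in (al @: K)%VS -> al (s v) = v).

Lemma gE x : g x = be x - lam *: al x.
Proof. by rewrite /g add_lfunE opp_lfunE scale_lfunE. Qed.

Lemma beK x : x \in K -> be x = lam *: al x.
Proof. by rewrite memv_cap memv_ker gE subr_eq0 => /andP[_ /eqP]. Qed.

(** The chain relations hold modulo [al K]. On K the map be - mu al equals (lam - mu) al, so the
    defect is removed by subtracting an element of K, one vector at a time. *)
Lemma lift_other m mu us vs : mu != lam -> adapted (pi \o al)%VF (pi \o be)%VF (KW_J m mu, us, vs) ->
  exists us', [/\ map (modulo K) us' = map (modulo K) us & adapted al be (KW_J m mu, us', map al us')].
Proof.
move=> ne /adaptedJ[m0 sv su e]; have ne' : lam - mu != 0 by rewrite subr_eq0 eq_sym.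
pose F i (p : V) := us`_i - (lam - mu)^-1 *: s (be us`_i - mu *: al us`_i - p).
pose c := nat_rect (fun=> U) (F 0%N 0) (fun i x => F i.+1 (al x)).
have cK i : c i - us`_i \in K.
  by case: i => [|i]; rewrite /= /F addrC addKr rpredN memvZ.
pose prev i := if (0 < i)%N then al (c i.-1) else 0.
have cF i : c i = F i (prev i) by case: i.
have cE i : (i < m)%N -> be (c i) = mu *: al (c i) + prev i.
  move=> lt; have [e1 e2] := e i lt; rewrite !comp_lfunE in e1 e2.
  have zK : be us`_i - mu *: al us`_i - prev i \in (al @: K)%VS.
    rewrite -moduloP -/pi !linearB linearZ /= e1 e2 [mu *: _ + _]addrC addrK /prev.
    case: ifP => i0; last by rewrite linear0 subrr.
    have [e3 _] := e i.-1 (leq_ltn_trans (leq_pred i) lt); rewrite comp_lfunE in e3.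
    rewrite -e3 -linearB -linearB /= moduloP -opprB linearN rpredN.
    exact: memv_img.
  have := cF i; rewrite /F; move: zK; set z := be us`_i - _ - _ => zK ->.
  have bz : be us`_i = z + mu *: al us`_i + prev i by rewrite /z addrAC subrK subrK.
  rewrite !linearB !linearZ /= (beK (sK _)) (sE zK) bz !scalerBr !scalerA.
  apply/rowP => j; rewrite !mxE.
  move: (be us`_i 0 j) (al us`_i 0 j) (prev i 0 j) => a b d; field; exact: ne'.
exists (mkseq c m); split.
  by rewrite -su map_congruent.
apply/adaptedJ; rewrite size_map size_mkseq; split=> // i lt.
rewrite !nth_map0 nth_mkseq // cE //; split=> //; congr (_ + _).
rewrite /prev; case: ifP => // i0; have lt' := leq_ltn_trans (leq_pred i) lt.
by rewrite nth_mkseq.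
Qed.

(** On K the map g = be - lam al is zero, so g cannot be corrected. Instead each u_i is moved within
    K until al u_i = g u_(i+1), and g u_0, an element of al K, gives a new first vector x in K. *)
Lemma lift_same m us vs : adapted (pi \o al)%VF (pi \o be)%VF (KW_J m lam, us, vs) ->
  exists us' x, [/\ map (modulo K) us' = map (modulo K) us, x \in K, al x = g us`_0
    & adapted al be (KW_J m.+1 lam, x :: us', map al (x :: us'))].
Proof.
move=> /adaptedJ[m0 sv su e].
have prevK i : (i < m)%N -> g us`_i - (if (0 < i)%N then al us`_i.-1 else 0) \in (al @: K)%VS.
  move=> lt; have [e1 e2] := e i lt; rewrite !comp_lfunE in e1 e2.
  rewrite -moduloP -/pi linearB gE linearB linearZ /= e1 e2 [lam *: _ + _]addrC addrK.
  case: ifP => i0; last by rewrite linear0 subrr.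
  have [e3 _] := e i.-1 (leq_ltn_trans (leq_pred i) lt); rewrite comp_lfunE in e3.
  by rewrite e3 subrr.
pose c i := if (i.+1 < m)%N then us`_i + s (g us`_i.+1 - al us`_i) else us`_i.
have cK i : c i - us`_i \in K.
  by rewrite /c; case: ifP => _; [rewrite addrC addKr | rewrite subrr mem0v].
have gK x : x \in K -> g x = 0 by rewrite memv_cap memv_ker => /andP[_ /eqP].
have gc i : g (c i) = g us`_i by have := gK _ (cK i); rewrite linearB => /eqP; rewrite subr_eq0 => /eqP.
have alc i : (i.+1 < m)%N -> al (c i) = g us`_i.+1.
  by move=> lt; rewrite /c lt linearD /= sE ?subrKC //; apply: (prevK i.+1).
exists (mkseq c m), (s (g us`_0)); split=> //.
- by rewrite -su map_congruent.
- by rewrite sE //; have := prevK 0%N m0; rewrite subr0.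
have beE x : be x = lam *: al x + g x by rewrite gE addrC subrK.
apply/adaptedJ; rewrite size_map /= size_mkseq; split=> // -[|i] lt.
  by rewrite /= addr0 beK.
have lt' : (i < m)%N by [].
rewrite /= !nth_map0 nth_mkseq // beE gc; split=> //; congr (_ + _).
case: i lt lt' => [|i] lt lt' /=; first by rewrite sE //; have := prevK 0%N m0; rewrite subr0.
by rewrite nth_map0 nth_mkseq 1?ltnW // alc.
Qed.

(** [ks] are the new first vectors and [hs] the former ones of the prolonged chains. The relation
    between al ks and g hs will show that [ks] is free, because g is injective on the complement of
    K. *)
Lemma jordan_lift_list L' : all (adapted (pi \o al)%VF (pi \o be)%VF) L' -> all (fun e => is_J e.1.1) L' ->
  exists L us' ks hs rs, [/\ all (adapted al be) L /\ all (fun e => is_J e.1.1) L,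
    perm_eq (vects L) (us' ++ ks) /\ forms L = map al (vects L),
    map (modulo K) us' = map (modulo K) (vects L'), perm_eq (vects L') (hs ++ rs)
    & {subset ks <= K} /\ map al ks = map g hs].
Proof.
elim: L' => [|[[b us] vs] L' IH] /=; first by exists [::], [::], [::], [::], [::].
case: b => [//|m mu|//] /andP[ad all_ad] /= allJ.
have [L [us' [ks [hs [rs [[h1 h2] [h3 h4] h5 h6 [h7 h8]]]]]]] := IH all_ad allJ.
have [e|ne] := eqVneq mu lam.
  rewrite e in ad; have [us1 [x [e1 xK e2 ad1]]] := lift_same ad.
  have [m0 _ su _] := (proj1 (adaptedJ _ _ _ _ _ _)) ad.
  case: us su ad e1 e2 => [|h us] su ad e1 e2; first by rewrite -su in m0.
  exists ((KW_J m.+1 lam, x :: us1, map al (x :: us1)) :: L), (us1 ++ us'), (x :: ks), (h :: hs), (us ++ rs).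
  split.
  - by rewrite /= ad1 h1 h2.
  - split; last by rewrite /forms /vects /= map_cat -h4.
    rewrite /vects /= -cat_cons -catA /=.
    apply: (seq.perm_trans (y := (x :: us1) ++ (us' ++ ks))); first by rewrite /= perm_cons perm_cat2l.
    rewrite (catA us1 us' (x :: ks)) /= catA -[x :: _]/([:: x] ++ ((us1 ++ us') ++ ks)).
    exact/permPl/perm_catCA.
  - by rewrite -[vects (_ :: L')]/((h :: us) ++ vects L') !map_cat h5 e1.
  - rewrite /vects /= perm_cons.
    apply: (seq.perm_trans (y := us ++ (hs ++ rs))); first by rewrite perm_cat2l.
    by rewrite perm_catCA.
  split; first by move=> y; rewrite inE => /orP[/eqP ->|/h7].
  by rewrite /= e2 h8.
have [us1 [e1 ad1]] := lift_other ne ad.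
exists ((KW_J m mu, us1, map al us1) :: L), (us1 ++ us'), ks, hs, (us ++ rs); split=> //.
- by rewrite /= ad1 h1 h2.
- split; last by rewrite /forms /vects /= map_cat -h4.
  by rewrite /vects /= -catA perm_cat2l.
- by rewrite -[vects (_ :: L')]/(us ++ vects L') !map_cat h5 e1.
rewrite /vects /=; apply: (seq.perm_trans (y := us ++ (hs ++ rs))); first by rewrite perm_cat2l.
by rewrite perm_catCA.
Qed.

End Step.

(** Induction on the dimension of W. An eigenvector makes K nonzero; the pencil modulo al K is
    decomposed on a complement of K, its chains are lifted, and the new first vectors are completed
    to a basis of K by blocks [J_1(lam)]. *)
Lemma jordan_form al be W : injective_on al W -> (be @: W <= al @: W)%VS -> decomposed al be W (@is_J k).
Proof.
have [d] := ubnP (\dim W); elim: d al be W => // d IH al be W lt inj sub.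
have [->|W0] := eqVneq W 0%VS.
  by exists [::]; split=> //; [exact: nil_free | exact: span_nil | exact: nil_free].
have [lam [w [wW w0 be_w]]] := eigenvector_exists W0 inj sub.
pose g := (be - lam *: al)%VF; pose K := (W :&: lker g)%VS; pose W' := (W :\: K)%VS.
pose pi := modulo (al @: K).
have KW : (K <= W)%VS by apply: capvSl.
have wK : w \in K by rewrite memv_cap wW memv_ker gE be_w subrr eqxx.
have W'W : (W' <= W)%VS by apply: diffvSl.
have W'K : (W' :&: K = 0)%VS by apply: capv_diff.
have sumW : (W' + K = W)%VS by rewrite addv_diff; apply/eqP; rewrite eqEsubv addvSl subv_add subvv KW.
have dimlt : (\dim W' < d)%N.
  have := dimv_cap_compl W K; rewrite (capv_idPr KW) -/W' => e.
  have K0 : (0 < \dim K)%N by rewrite lt0n dimv_eq0; apply: contraNneq w0 => e0; rewrite e0 memv0 in wK.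
  by apply: leq_trans (_ : \dim W <= d)%N; [rewrite -e -add1n leq_add2r | rewrite -ltnS].
have inj' : injective_on (pi \o al)%VF W'.
  move=> x xW' /eqP; rewrite comp_lfunE moduloP => /memv_imgP[y yK e].
  have : x - y = 0.
    apply: inj; last by rewrite linearB /= e subrr.
    by apply: rpredB; [exact: (subvP W'W) | exact: (subvP KW)].
  by move/eqP; rewrite subr_eq0 => /eqP xy; apply/eqP; rewrite -memv0 -W'K memv_cap xW' xy.
have sub' : ((pi \o be) @: W' <= (pi \o al) @: W')%VS.
  apply/subvP => _ /memv_imgP[x xW' ->]; rewrite comp_lfunE.
  have /(subvP sub)/memv_imgP[y yW ->] : be x \in (be @: W)%VS by apply: memv_img; apply: (subvP W'W).
  move: yW; rewrite -sumW => /memv_addP[y1 y1W [y2 y2K ->]].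
  have -> : pi (al (y1 + y2)) = (pi \o al)%VF y1.
    by rewrite comp_lfunE linearD linearD /= (modulo_eq0 (x := al y2)) ?addr0 //; apply: memv_img.
  exact: memv_img.
have [L' [ad' J' fr' sp' _]] := IH _ _ W' dimlt inj' sub'.
have [s [sK sE]] := section_on al K.
have [L [us' [ks [hs [rs [[h1 h2] [h3 h4] h5 h6 [h7 h8]]]]]]] := jordan_lift_list sK sE ad' J'.
have fh : free hs by move: fr'; rewrite (perm_free h6) => /catl_free.
have hsW : (<<hs>> <= W')%VS.
  rewrite -sp' -[X in (_ <= X)%VS]/<<vects L'>>%VS; apply: sub_span => x xh; by rewrite (perm_mem h6) mem_cat xh.
have fks : free ks.
  apply: (free_of_map (f := al)); rewrite h8; apply: free_map => // x xh gx.
  have xW' := subvP hsW _ xh; apply/eqP; rewrite -memv0 -W'K memv_cap xW' memv_cap memv_ker gx eqxx andbT.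
  exact: (subvP W'W).
have [t [ft st]] : exists t, free (ks ++ t) /\ <<ks ++ t>>%VS = K.
  by apply: complete_free => //; apply/span_subvP.
pose E := [seq (KW_J 1 lam, [:: x], [:: al x]) | x <- t].
have vE : vects E = t by rewrite /E /vects -map_comp /=; elim: (t) => //= x t' ->.
have fE : forms E = map al t by rewrite /E /forms -map_comp /=; elim: (t) => //= x t' ->.
have pm : perm_eq (vects (L ++ E)) (us' ++ (ks ++ t)).
  by rewrite vects_cat vE catA perm_cat2r.
have span_all : <<vects (L ++ E)>>%VS = W.
  rewrite (eq_span (perm_mem pm)) span_cat st (span_congruent h5) sp'; exact: sumW.
have free_all : free (vects (L ++ E)).
  rewrite (perm_free pm); apply: (free_congruent fr' _ h5 ft); last by rewrite st.
  by rewrite sp'.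
exists (L ++ E); split=> //.
- rewrite all_cat h1 /= all_map; apply/allP => x xt; apply/adaptedJ; split=> // -[|//] _ /=.
  split=> //; rewrite addr0; have : x \in K by rewrite -st memv_span // mem_cat xt orbT.
  by move/beK.
- by rewrite all_cat h2 /= all_map; apply/allP.
rewrite forms_cat h4 fE -{1}vE -map_cat -vects_cat; apply: free_map => // x.
by rewrite span_all; apply: inj.
Qed.

End Jordan.

Definition is_B (k : Type) (b : KW_block k) := if b is KW_B _ then true else false.

Section SurjectivePencils.
Variables (k : closedFieldType) (n : nat) (U : vectType k).
Local Notation V := 'rV[k]_n.
Local Notation entry := (KW_block k * seq U * seq V)%type.
Implicit Types (al be : 'Hom(U, V)) (us : seq U) (vs : seq V) (L : seq entry) (W : {vspace U}).

Lemma decomposed_weaken al be W (P Q : pred (KW_block k)) : (forall b, P b -> Q b) ->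
  decomposed al be W P -> decomposed al be W Q.
Proof.
move=> PQ [L [h1 h2 h3 h4 h5]]; exists L; split=> //.
by elim: (L) h2 => //= e L' IH /andP[/PQ -> /IH].
Qed.

Section Step.
Variables (al be : 'Hom(U, V)) (W : {vspace U}).
Let K := (W :&: lker al)%VS.
Let pi := modulo (be @: K).

Variable s : V -> U.
Hypotheses (sK : forall v, s v \in K) (sE : forall v, v \in (be @: K)%VS -> be (s v) = v).

Let alK x : x \in K -> al x = 0. Proof. by rewrite memv_cap memv_ker => /andP[_ /eqP]. Qed.

(** Serves the blocks J with eigenvalue lam and, with lam = 0, the blocks D. The correction lies in
    K, where [al] vanishes, so the values of [al] are kept and only those of [be] change. *)
Lemma lift_chain (lam : k) m us : size us = m ->
    (forall i, (i < m)%N -> pi (be us`_i) = lam *: pi (al us`_i) + (if (0 < i)%N then pi (al us`_i.-1) else 0)) ->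
  exists us', [/\ map (modulo K) us' = map (modulo K) us, map al us' = map al us &
    forall i, (i < m)%N -> be us'`_i = lam *: al us'`_i + (if (0 < i)%N then al us'`_i.-1 else 0)].
Proof.
move=> su e; pose c i := us`_i - s (be us`_i - lam *: al us`_i - (if (0 < i)%N then al us`_i.-1 else 0)).
have cK i : c i - us`_i \in K by rewrite /c addrC addKr rpredN.
have alc i : al (c i) = al us`_i by rewrite /c linearB /= (alK (sK _)) subr0.
exists (mkseq c (size us)); split.
- exact: map_congruent.
- by rewrite -[in RHS](mkseq_nth 0 us) /mkseq -!map_comp; apply: eq_map => i /=; exact: alc.
move=> i lt; rewrite su; have lt' := leq_ltn_trans (leq_pred i) lt; rewrite !nth_mkseq // !alc.
rewrite {1}/c linearB /= sE; last first.
  rewrite -moduloP -/pi !linearB linearZ /= e // [lam *: _ + _]addrC addrK.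
  by case: (0 < i)%N; [rewrite subrr | rewrite linear0 subr0].
by move: (be _) (lam *: _) (if _ then _ else _) => x y z; rewrite -addrA -opprD subKr.
Qed.

Lemma lift_J m mu us vs : adapted (pi \o al)%VF (pi \o be)%VF (KW_J m mu, us, vs) ->
  exists us', [/\ map (modulo K) us' = map (modulo K) us, map al us' = map al us
    & adapted al be (KW_J m mu, us', map al us')].
Proof.
move=> /adaptedJ[m0 sv su e]; have [|us' [e1 e2 e3]] := lift_chain (lam := mu) su.
  move=> i lt; have [e1 e2] := e i lt; rewrite !comp_lfunE in e1 e2; rewrite e2 e1.
  by case: ifP => // i0; have [<- _] := e i.-1 (leq_ltn_trans (leq_pred i) lt); rewrite comp_lfunE.
have su' : size us' = m by have := congr1 size e2; rewrite !size_map su.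
exists us'; split=> //; apply/adaptedJ; rewrite size_map; split=> // i lt.
by rewrite !nth_map0 e3.
Qed.

Lemma lift_D m us vs : adapted (pi \o al)%VF (pi \o be)%VF (KW_D m, us, vs) ->
  exists us' x, [/\ map (modulo K) us' = map (modulo K) us, map al us' = map al us,
    x \in K, be x = al us`_m & adapted al be (KW_D m.+1, rcons us' x, map al us')].
Proof.
move=> /adaptedD[sv su e]; have [|us' [e1 e2 e3]] := lift_chain (lam := 0) su.
  move=> i lt; have [e1 e2] := e i lt; rewrite !comp_lfunE in e1 e2; rewrite e2 scale0r add0r.
  case: ifP => // i0; have [+ _] := e i.-1 (leq_ltn_trans (leq_pred i) lt); rewrite comp_lfunE => ->.
  by case: (i) i0 lt => // i' _; rewrite ltnS => ->.
have su' : size us' = m.+1 by have := congr1 size e2; rewrite !size_map su.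
have xE : be (s (al us`_m)) = al us`_m.
  by apply: sE; rewrite -moduloP -/pi; have [+ _] := e m (leqnn _); rewrite comp_lfunE ltnn => ->.
exists us', (s (al us`_m)); split=> //; apply/adaptedD; rewrite size_map size_rcons su'; split=> // i.
rewrite ltnS leq_eqVlt => /orP[/eqP ->|lt]; last first.
  rewrite lt !nth_rcons su' lt !nth_map0 e3 // scale0r add0r; split=> //.
rewrite ltnn nth_rcons su' ltnn eqxx alK // nth_map0; split=> //=.
by rewrite xE -!nth_map0 e2.
Qed.

Lemma chain_lift_list L' : all (adapted (pi \o al)%VF (pi \o be)%VF) L' -> all (fun e => ~~ is_B e.1.1) L' ->
  exists L us' ks hs rs, [/\ all (adapted al be) L /\ all (fun e => ~~ is_B e.1.1) L,
    perm_eq (vects L) (us' ++ ks) /\ forms L = map al (vects L'),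
    map (modulo K) us' = map (modulo K) (vects L'),
    [/\ perm_eq (vects L') (hs ++ rs), {in hs, forall x, (pi \o al)%VF x = 0} &
      map (pi \o al)%VF rs = forms L']
    & {subset ks <= K} /\ map be ks = map al hs].
Proof.
elim: L' => [|[[b us] vs] L' IH] /=; first by exists [::], [::], [::], [::], [::].
case: b => [m|m mu|//] /andP[ad all_ad] /= noB;
  have [L [us' [ks [hs [rs [[h1 h2] [h3 h4] h5 [h6 h6' h6''] [h7 h8]]]]]]] := IH all_ad noB.
  have [us1 [x [e1 e2 xK ex ad1]]] := lift_D ad.
  have [sv su e] := (proj1 (adaptedD _ _ _ _ _)) ad.
  have [us2 [y usE]] : exists us2 y, us = rcons us2 y.
    by case/lastP: (us) su => // us2 y _; exists us2, y.
  have su2 : size us2 = m by move: su; rewrite usE size_rcons => -[].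
  have yE : y = us`_m by rewrite usE nth_rcons su2 ltnn eqxx.
  exists ((KW_D m.+1, rcons us1 x, map al us1) :: L), (us1 ++ us'), (x :: ks), (y :: hs), (us2 ++ rs).
  split.
  - by rewrite /= ad1 h1 h2.
  - split; last by rewrite -[vects (_ :: L')]/(us ++ vects L') map_cat -h4 -e2.
    rewrite -[vects (_ :: L)]/(rcons us1 x ++ vects L).
    apply: (seq.perm_trans (y := rcons us1 x ++ (us' ++ ks))); first by rewrite perm_cat2l.
    by rewrite -cats1 -!catA perm_cat2l perm_catCA.
  - by rewrite -[vects (_ :: L')]/(us ++ vects L') !map_cat h5 e1.
  - split.
    + rewrite -[vects (_ :: L')]/(us ++ vects L') usE -cats1 -catA /=.
      apply: (seq.perm_trans (y := us2 ++ (y :: (hs ++ rs)))); first by rewrite perm_cat2l perm_cons.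
      by rewrite -[y :: hs ++ rs]/((y :: hs) ++ rs) -[y :: hs ++ (us2 ++ rs)]/((y :: hs) ++ (us2 ++ rs)) perm_catCA.
    + move=> z; rewrite inE => /orP[/eqP ->|/h6' //].
      by rewrite yE; have [-> _] := e m (leqnn _); rewrite ltnn.
    rewrite map_cat h6''; congr (_ ++ _); apply: (@eq_from_nth _ 0).
      by rewrite size_map su2 sv.
    move=> i; rewrite size_map su2 => lt; rewrite nth_map0 /= -[RHS](_ : (if (i < m)%N then vs`_i else 0) = _); last by rewrite lt.
    by have [<- _] := e i (ltnW lt); rewrite usE nth_rcons su2 lt.
  split; first by move=> z; rewrite inE => /orP[/eqP ->|/h7].
  by rewrite /= ex h8 yE.
have [us1 [e1 e2 ad1]] := lift_J ad.
have [m0 sv su e] := (proj1 (adaptedJ _ _ _ _ _ _)) ad.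
exists ((KW_J m mu, us1, map al us1) :: L), (us1 ++ us'), ks, hs, (us ++ rs); split=> //.
- by rewrite /= ad1 h1 h2.
- split; last by rewrite -[vects (_ :: L')]/(us ++ vects L') map_cat -h4 -e2.
  by rewrite -[vects (_ :: L)]/(us1 ++ vects L) -catA perm_cat2l.
- by rewrite -[vects (_ :: L')]/(us ++ vects L') !map_cat h5 e1.
split=> //.
  rewrite -[vects (_ :: L')]/(us ++ vects L').
  apply: (seq.perm_trans (y := us ++ (hs ++ rs))); first by rewrite perm_cat2l.
  by rewrite perm_catCA.
rewrite map_cat h6''; congr (_ ++ _); apply: (@eq_from_nth _ 0); first by rewrite size_map su sv.
by move=> i; rewrite size_map su => lt; rewrite nth_map0; have [-> _] := e i lt.
Qed.

End Step.

(** Induction on the dimension of W, with K the kernel of al in W. The pencil modulo be K is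
    decomposed on a complement of K; lifting turns each [D_m] into [D_(m+1)], and the common kernel
    of al and be yields the blocks [D_0]. If K = 0, a Jordan form remains. *)
Lemma surjective_form al be W : (be @: W <= al @: W)%VS ->
  decomposed al be W (fun b => ~~ is_B b).
Proof.
have [d] := ubnP (\dim W); elim: d al be W => // d IH al be W lt sub.
pose K := (W :&: lker al)%VS; have [K0|K0] := eqVneq K 0%VS.
  apply: (decomposed_weaken (P := @is_J k)); first by case.
  apply: jordan_form => // x xW ax; apply/eqP; rewrite -memv0 -K0 memv_cap xW memv_ker ax eqxx //.
pose W' := (W :\: K)%VS; pose pi := modulo (be @: K).
have KW : (K <= W)%VS by apply: capvSl.
have W'W : (W' <= W)%VS by apply: diffvSl.
have W'K : (W' :&: K = 0)%VS by apply: capv_diff.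
have sumW : (W' + K = W)%VS by rewrite addv_diff; apply/eqP; rewrite eqEsubv addvSl subv_add subvv KW.
have alK x : x \in K -> al x = 0 by rewrite memv_cap memv_ker => /andP[_ /eqP].
have inj x : x \in W' -> al x = 0 -> x = 0.
  move=> xW' ax; apply/eqP; rewrite -memv0 -W'K memv_cap xW' memv_cap memv_ker ax eqxx andbT.
  exact: (subvP W'W).
have dimlt : (\dim W' < d)%N.
  have := dimv_cap_compl W K; rewrite (capv_idPr KW) -/W' => e.
  have K0' : (0 < \dim K)%N by rewrite lt0n dimv_eq0.
  by apply: leq_trans (_ : \dim W <= d)%N; [rewrite -e -add1n leq_add2r | rewrite -ltnS].
have alW' v : v \in (be @: W)%VS -> exists2 u, u \in W' & v = al u.
  move=> /(subvP sub)/memv_imgP[y]; rewrite -sumW => /memv_addP[y1 y1W [y2 y2K ->]] ->.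
  by exists y1 => //; rewrite linearD /= (alK y2) ?addr0.
have sub' : ((pi \o be) @: W' <= (pi \o al) @: W')%VS.
  apply/subvP => _ /memv_imgP[x xW' ->]; rewrite comp_lfunE.
  have [|u uW' ->] := alW' (be x); first by apply: memv_img; apply: (subvP W'W).
  by rewrite -comp_lfunE; apply: memv_img.
have [L' [ad' J' fr' sp' ff']] := IH _ _ W' dimlt sub'.
have [s [sK sE]] := section_on be K.
have [L [us' [ks [hs [rs [[h1 h2] [h3 h4] h5 [h6 h6' h6''] [h7 h8]]]]]]] := chain_lift_list sK sE ad' J'.
have fh : free hs by move: fr'; rewrite (perm_free h6) => /catl_free.
have hsW : (<<hs>> <= W')%VS.
  by rewrite -sp'; apply: sub_span => x xh; rewrite (perm_mem h6) mem_cat xh.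
have fbk : free (map be ks).
  by rewrite h8; apply: free_map => // x xh; apply: inj; apply: (subvP hsW).
(* An element of be K is al u with u in the complement W', and al u dies modulo be K; hence u is a
   combination of the last vectors [hs] of the blocks D. *)
have beK : (be @: K <= <<map be ks>>)%VS.
  apply/subvP => v vK; have [|u uW' vE] := alW' v; first exact: (subvP (limgS be KW)).
  have pu : (pi \o al)%VF u = 0 by rewrite comp_lfunE -vE; apply: modulo_eq0.
  move: uW'; rewrite -sp' (eq_span (perm_mem h6)) span_cat => /memv_addP[a ah [b br uE]].
  have pa : (pi \o al)%VF a = 0.
    have /subvP/(_ a ah) : (<<hs>> <= lker (pi \o al))%VS.
      by apply/span_subvP => x /h6' e; rewrite memv_ker e.
    by rewrite memv_ker => /eqP.
  have b0 : b = 0.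
    apply: (free_map_inj (f := (pi \o al)%VF) (s := rs)) => //; first by rewrite h6''.
    by move: pu; rewrite uE linearD /= pa add0r.
  rewrite vE uE b0 addr0 h8 -limg_span; exact: memv_img.
pose t := vbasis (K :&: lker be); have tK x : x \in t -> x \in K /\ be x = 0.
  by move=> /vbasis_mem; rewrite memv_cap memv_ker => /andP[-> /eqP].
have ft : free (ks ++ t).
  by apply: (free_cat_map (f := be)) => //; [move=> x /tK[] | exact: basis_free (vbasisP _)].
have st : <<ks ++ t>>%VS = K.
  apply/eqP; rewrite eqEsubv; apply/andP; split.
    by apply/span_subvP => x; rewrite mem_cat => /orP[/h7|/tK[]].
  apply/subvP => x xK; have /(subvP beK) : be x \in (be @: K)%VS by apply: memv_img.
  rewrite -limg_span => /memv_imgP[y yk e]; rewrite span_cat -[x](subrK y) addrC; apply: memv_add => //.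
  rewrite (span_basis (vbasisP _)) memv_cap memv_ker linearB /= e subrr eqxx andbT.
  apply: rpredB => //; have /subvP : (<<ks>> <= K)%VS by [apply/span_subvP]; exact.
pose E := [seq (@KW_D k 0, [:: x], [::] : seq V) | x <- (t : seq U)].
have vE : vects E = t by rewrite /E /vects -map_comp /=; elim: (t : seq U) => //= x t' ->.
have fE : forms E = [::] by rewrite /E /forms -map_comp /=; elim: (t : seq U) => //= x t' ->.
have pm : perm_eq (vects (L ++ E)) (us' ++ (ks ++ t)).
  by rewrite vects_cat vE catA perm_cat2r.
exists (L ++ E); split=> //.
- rewrite all_cat h1 /= all_map; apply/allP => x /tK[xK bx]; apply/adaptedD; split=> // -[|//] _ /=.
  by rewrite bx alK.
- by rewrite all_cat h2 /= all_map; apply/allP.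
- rewrite (perm_free pm); apply: (free_congruent fr' _ h5 ft); last by rewrite st.
  by rewrite sp'.
- by rewrite (eq_span (perm_mem pm)) span_cat st (span_congruent h5) sp'.
rewrite forms_cat h4 fE cats0; apply: free_map => // x; rewrite sp'; exact: inj.
Qed.

End SurjectivePencils.

Section GeneralPencils.
Variables (k : closedFieldType) (n : nat) (U : vectType k).
Local Notation V := 'rV[k]_n.
Local Notation entry := (KW_block k * seq U * seq V)%type.
Implicit Types (al be : 'Hom(U, V)) (us : seq U) (vs : seq V) (L : seq entry) (W : {vspace U}).

(** A block B inside U1 has its first form z_0 = be u_0 in al W, and a vector t z_0 with al (t z_0)
    = z_0 prolongs it by one column; the other blocks are kept. [S] collects these z_0 and [rs] the
    remaining forms, which span al U1. *)
Lemma extend_list al be W (t : V -> U) L1 :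
    (forall v, v \in (al @: W)%VS -> al (t v) = v) ->
    let U1 := (W :&: be @^-1: (al @: W))%VS in
    all (adapted al be) L1 -> {subset vects L1 <= U1} ->
  exists L S rs, [/\ all (adapted al be) L, perm_eq (vects L) (vects L1 ++ map t S),
    perm_eq (forms L) (forms L1 ++ map be (map t S)), perm_eq (forms L1) (S ++ rs)
    & [/\ {subset rs <= (al @: U1)%VS}, {subset S <= (al @: W)%VS} &
          forall u, u \in vects L1 -> al u \in <<rs>>%VS]].
Proof.
move=> tE U1; elim: L1 => [|[[b us] vs] L1 IH] /=; first by exists [::], [::], [::].
move=> /andP[ad all_ad]; rewrite -[vects (_ :: L1)]/(us ++ vects L1) => sub.
have subs : {subset us <= U1} by move=> x xu; apply: sub; rewrite mem_cat xu.
have [|L [S [rs [h1 h2 h3 h4 [h5 h6 h7]]]]] := IH all_ad.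
  by move=> x xu; apply: sub; rewrite mem_cat xu orbT.
have span_rs (rs1 : seq V) : (forall u, u \in us -> al u \in <<rs1>>%VS) ->
    forall u, u \in us ++ vects L1 -> al u \in <<rs1 ++ rs>>%VS.
  move=> h u; rewrite mem_cat span_cat => /orP[/h|/h7] hu.
    exact: (subvP (addvSl _ _)).
  exact: (subvP (addvSr _ _)).
have keep : {subset vs <= (al @: U1)%VS} -> (forall u, u \in us -> al u \in <<vs>>%VS) ->
  exists L S rs, [/\ all (adapted al be) L, perm_eq (vects L) ((us ++ vects L1) ++ map t S),
    perm_eq (forms L) ((vs ++ forms L1) ++ map be (map t S)), perm_eq (vs ++ forms L1) (S ++ rs)
    & [/\ {subset rs <= (al @: U1)%VS}, {subset S <= (al @: W)%VS} &
          forall u, u \in us ++ vects L1 -> al u \in <<rs>>%VS]].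
  move=> g1 g2; exists ((b, us, vs) :: L), S, (vs ++ rs); split.
  - by rewrite /= ad.
  - by rewrite -[vects (_ :: L)]/(us ++ vects L) -catA perm_cat2l.
  - by rewrite -[forms (_ :: L)]/(vs ++ forms L) -catA perm_cat2l.
  - by apply: (seq.perm_trans (y := vs ++ (S ++ rs))); [rewrite perm_cat2l | rewrite perm_catCA].
  by split=> //; [move=> x; rewrite mem_cat => /orP[/g1|/h5] | apply: span_rs].
have nthP (s : seq V) (P : V -> Prop) : (forall i, (i < size s)%N -> P s`_i) -> forall x, x \in s -> P x.
  by move=> h x xs; rewrite -(nth_index 0 xs); apply: h; rewrite index_mem.
have nthU (s : seq U) (P : U -> Prop) : (forall i, (i < size s)%N -> P s`_i) -> forall x, x \in s -> P x.
  by move=> h x xs; rewrite -(nth_index 0 xs); apply: h; rewrite index_mem.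
rewrite -[forms (_ :: L1)]/(vs ++ forms L1).
case: b ad keep => [m|m mu|m] ad keep.
- have [sv su e] := (proj1 (adaptedD _ _ _ _ _)) ad; apply: keep.
    apply: nthP => i; rewrite sv => lt; have [+ _] := e i (ltnW lt); rewrite lt => <-.
    by apply: memv_img; apply: subs; rewrite mem_nth // su ltnW.
  apply: nthU => i; rewrite su => lt; have [-> _] := e i lt.
  by case: ifP => lt'; [apply: memv_span; rewrite mem_nth // sv | apply: mem0v].
- have [m0 sv su e] := (proj1 (adaptedJ _ _ _ _ _ _)) ad; apply: keep.
    apply: nthP => i; rewrite sv => lt; have [<- _] := e i lt.
    by apply: memv_img; apply: subs; rewrite mem_nth // su.
  apply: nthU => i; rewrite su => lt; have [-> _] := e i lt.
  by apply: memv_span; rewrite mem_nth // sv.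
have [m0 sv su e] := (proj1 (adaptedB _ _ _ _ _)) ad.
case: vs sv ad e {keep} => // z vs [sv] ad e.
have zW : z \in (al @: W)%VS.
  have [_ /= <-] := e 0%N m0; have : us`_0 \in U1 by apply: subs; rewrite mem_nth // su.
  by rewrite memv_cap -memv_preim => /andP[].
exists ((KW_B m.+1, t z :: us, be (t z) :: z :: vs) :: L), (z :: S), (vs ++ rs); split.
- rewrite /= h1 andbT; apply/adaptedB; rewrite /= sv su; split=> // -[|i] lt /=; first by rewrite tE.
  exact: e.
- rewrite -[vects (_ :: L)]/([:: t z] ++ us ++ vects L) -[map t (z :: S)]/([:: t z] ++ map t S).
  apply: (seq.perm_trans (y := [:: t z] ++ ((us ++ vects L1) ++ map t S))); last by rewrite perm_catCA.
  by rewrite perm_cat2l -catA perm_cat2l.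
- rewrite -[forms (_ :: L)]/([:: be (t z)] ++ (z :: vs) ++ forms L).
  rewrite -[map be (map t (z :: S))]/([:: be (t z)] ++ map be (map t S)).
  apply: (seq.perm_trans (y := [:: be (t z)] ++ (((z :: vs) ++ forms L1) ++ map be (map t S)))); last by rewrite perm_catCA.
  by rewrite perm_cat2l -catA perm_cat2l.
- rewrite /= perm_cons; apply: (seq.perm_trans (y := vs ++ (S ++ rs))); first by rewrite perm_cat2l.
  by rewrite perm_catCA.
split.
- move=> x; rewrite mem_cat => /orP[|/h5] //; move: x; apply: nthP => i; rewrite sv => lt.
  have [/= <- _] := e i lt; apply: memv_img; apply: subs; by rewrite mem_nth // su.
- by move=> x; rewrite inE => /orP[/eqP ->|/h6].
apply: span_rs; apply: nthU => i; rewrite su => lt; have [/= -> _] := e i lt.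
by apply: memv_span; rewrite mem_nth // sv.
Qed.

(** Induction through U1, the vectors of W that be sends into al W. The subspace N keeps the kernel
    of al inside U1, so W is U1 plus the vectors added at this stage. Forms that complete those of
    U1 to a basis of al W give the blocks [B_1]. *)
Lemma general_form al be W (N : {vspace U}) : (N <= W)%VS -> (W :&: lker al <= N)%VS ->
  (be @: N <= al @: N)%VS -> decomposed al be W predT.
Proof.
have [d] := ubnP (\dim W); elim: d al be W => // d IH al be W lt NW kerN beN.
pose U1 := (W :&: be @^-1: (al @: W))%VS.
have U1W : (U1 <= W)%VS by apply: capvSl.
have NU1 : (N <= U1)%VS.
  apply/subvP => x xN; rewrite memv_cap (subvP NW) // -memv_preim.
  by apply: (subvP (limgS al NW)); apply: (subvP beN); apply: memv_img.
have [eW|neW] := eqVneq U1 W.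
  apply: (decomposed_weaken (P := fun b => ~~ is_B b)) => //; apply: surjective_form.
  apply/subvP => _ /memv_imgP[x xW ->]; move: xW; rewrite -{1}eW memv_cap -memv_preim.
  by case/andP.
have dimlt : (\dim U1 < d)%N.
  apply: leq_trans (_ : \dim W <= d)%N; last by rewrite -ltnS.
  by rewrite ltn_neqAle dimvS // andbT (dimv_leqif_eq U1W).
have [|L1 [ad1 _ fv1 sp1 ff1]] := IH _ _ U1 dimlt NU1 _ beN.
  by apply: subv_trans kerN; apply: capvS.
have [t [tW tE]] := section_on al W.
have sub1 : {subset vects L1 <= U1} by move=> x xv; rewrite -sp1 memv_span.
have [L [S [rs [h1 h2 h3 h4 [h5 h6 h7]]]]] := extend_list tE ad1 sub1.
have f1W : (<<forms L1>> <= al @: W)%VS.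
  apply/span_subvP => x; rewrite (perm_mem h4) mem_cat => /orP[/h6 //|/h5].
  exact: (subvP (limgS al U1W)).
have [E [fE spE]] := complete_free ff1 f1W.
pose S' := S ++ E.
have fS : free (S' ++ rs).
  rewrite -(perm_free (X := forms L1 ++ E)) //.
  apply: (seq.perm_trans (y := (S ++ rs) ++ E)); first by rewrite perm_cat2r.
  by rewrite /S' -!catA perm_cat2l perm_catC.
have spS : <<S' ++ rs>>%VS = (al @: W)%VS.
  rewrite -spE; apply: eq_span => x; rewrite !mem_cat (perm_mem h4) !mem_cat.
  by rewrite -!orbA; congr (_ || _); rewrite orbC.
have EW : {subset S' <= (al @: W)%VS} by move=> x xS; rewrite -spS memv_span // mem_cat xS.
have tS : map al (map t S') = S'.
  rewrite -map_comp -[RHS]map_id; apply/eq_in_map => x xS /=; exact: tE (EW _ xS).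
have ftS : free (map al (map t S')) by rewrite tS; apply: catl_free fS.
have tSW : (<<map t S'>> <= W)%VS by apply/span_subvP => _ /mapP[x _ ->].
have alU1 u : u \in U1 -> al u \in <<rs>>%VS.
  rewrite -sp1 => uU1; have : al u \in (al @: <<vects L1>>)%VS by apply: memv_img.
  by rewrite limg_span; apply: subvP; apply/span_subvP => _ /mapP[x /h7 ? ->].
pose f := (modulo (al @: W) \o be)%VF.
have ffS : free (map f (map t S')).
  apply: free_map; first exact: free_of_map ftS.
  move=> x xS /eqP; rewrite comp_lfunE moduloP => bx.
  have xU1 : x \in U1 by rewrite memv_cap (subvP tSW) //= -memv_preim.
  apply: (free_map_inj ftS xS); move: fS; rewrite cat_free => /and3P[_ _ /directv_addP d0].
  apply/eqP; rewrite -memv0 -d0 memv_cap alU1 // andbT -tS -limg_span; exact: memv_img.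
pose EE := [seq (@KW_B k 1, [:: t x], [:: be (t x); x]) | x <- E].
have vE : vects EE = map t E by rewrite /EE /vects -map_comp /=; elim: (E) => //= x t' ->.
have fEE : perm_eq (forms EE) (map be (map t E) ++ E).
  rewrite /EE /forms -map_comp /=; elim: (E) => //= x E' IHE; rewrite perm_cons.
  apply: (seq.perm_trans (y := [:: x] ++ (map be (map t E') ++ E'))); first by rewrite /= perm_cons.
  by rewrite perm_catCA.
have pv : perm_eq (vects (L ++ EE)) (map t S' ++ vects L1).
  rewrite vects_cat vE perm_sym perm_catC perm_sym /S' map_cat catA perm_cat2r.
  exact: h2.
have pf : perm_eq (forms (L ++ EE)) (map be (map t S') ++ (forms L1 ++ E)).
  rewrite forms_cat /S' !map_cat.
  apply: (seq.perm_trans (perm_cat h3 fEE)); rewrite perm_sym perm_catC.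
  by rewrite -!catA perm_cat2l perm_catC -!catA perm_cat2l.
exists (L ++ EE); split.
- rewrite all_cat h1 /= all_map; apply/allP => x xE; apply/adaptedB; split=> // -[|//] _ /=.
  by rewrite tE //; apply: EW; rewrite mem_cat xE orbT.
- exact: all_predT.
- rewrite (perm_free pv); apply: (free_cat_map (f := f)) => // x /sub1.
  rewrite memv_cap -memv_preim => /andP[_ bx]; rewrite comp_lfunE; exact: modulo_eq0.
- rewrite (eq_span (perm_mem pv)) span_cat sp1; apply/eqP; rewrite eqEsubv subv_add tSW U1W /=.
  apply/subvP => x xW; have : al x \in (al @: W)%VS by apply: memv_img.
  rewrite -spS span_cat => /memv_addP[a aS [b br e]].
  move: aS; rewrite -{1}tS -limg_span => /memv_imgP[y yS ae].
  have /memv_imgP[z zU1 bE] : b \in (al @: U1)%VS by move: b br {e}; apply/subvP/span_subvP.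
  have -> : x = y + (x - y) by rewrite addrC subrK.
  apply: memv_add => //; rewrite -[x - y](subrK z); apply: rpredD => //.
  apply: (subvP NU1); apply: (subvP kerN); rewrite memv_cap memv_ker !linearB /= e ae bE.
  rewrite [al y + _]addrC addrK subrr eqxx andbT.
  apply: rpredB; last exact: (subvP U1W); apply: rpredB => //; exact: (subvP tSW).
rewrite (perm_free pf); apply: (free_cat_map (f := modulo (al @: W))).
- have -> : map (modulo (al @: W)) (map be (map t S')) = map f (map t S').
    by rewrite -map_comp; apply: eq_map => x; rewrite /= comp_lfunE.
  exact: ffS.
- by move=> x xE; apply: modulo_eq0; rewrite -spE memv_span.
exact: fE.
Qed.

End GeneralPencils.

Lemma exists_maximum (T : Type) (x0 : T) (f : T -> nat) b : (forall x, (f x <= b)%N) ->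
  exists x, forall y, (f y <= f x)%N.
Proof.
elim: b => [|b IH] fb; first by exists x0 => y; apply: leq_trans (fb y) (leq0n _).
have [[x fx]|no] := classic (exists x, f x = b.+1); first by exists x => y; rewrite fx.
by apply: IH => x; have := fb x; rewrite leq_eqVlt => /orP[/eqP e|//]; case: no; exists x.
Qed.

Section GenericMap.
Variables (k : closedFieldType) (n : nat).
Local Notation V := 'rV[k]_n.

Lemma free_nthP (s : seq V) : free s <-> forall c : nat -> k,
  \sum_(i < size s) c i *: s`_i = 0 -> forall i, (i < size s)%N -> c i = 0.
Proof.
split=> [/(@freeP _ _ _ (in_tuple s)) h c e i lt|h].
  exact: (h (fun i => c i) e (Ordinal lt)).
apply/(@freeP _ _ _ (in_tuple s)) => c e i.
have [c' cE] : exists c' : nat -> k, forall i : 'I_(size s), c' i = c i.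
  by exists (fun j => if insub j is Some j' then c j' else 0) => j; rewrite valK.
by rewrite -(cE i); apply: h => //; rewrite -[RHS]e; apply: eq_bigr => l _; rewrite cE.
Qed.

(** Freeness is open: a determinant polynomial in t is nonzero because its value at 0 is 1. The
    extra factor X in [p] keeps the chosen t away from 0. *)
Lemma perturb_free (s0 s1 : seq V) : size s1 = size s0 -> free s0 -> exists2 t : k, t != 0 &
  free [seq x.1 + t *: x.2 | x <- zip s0 s1].
Proof.
move=> ss /free_lmx/row_freeP[D MD]; pose M1 : 'M[k]_(size s0, n) := \matrix_i s1`_i.
pose p := 'X * \det (1%:M + 'X *: map_mx polyC (M1 *m D)) : {poly k}.
have evd t : (\det (1%:M + 'X *: map_mx polyC (M1 *m D))).[t] = \det (1%:M + t *: (M1 *m D)).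
  rewrite -[LHS]/(horner_eval t _) -det_map_mx; congr (\det _); apply/matrixP => i j.
  by rewrite !mxE /= /horner_eval !hornerE hornerMn hornerC.
have ev t : p.[t] = t * \det (1%:M + t *: (M1 *m D)) by rewrite hornerM hornerX evd.
have p0 : p != 0.
  rewrite mulf_neq0 ?polyX_eq0 //; apply: contraTneq (oner_neq0 k) => e.
  by have := evd 0; rewrite e horner0 scale0r addr0 det1 => <-; rewrite eqxx.
have [t] := closed_nonrootP p p0; rewrite /root ev mulf_eq0 negb_or => /andP[t0 dt].
exists t => //; apply/free_nthP => c; rewrite size_map size_zip ss minnn => e i lt.
pose v : 'rV[k]_(size s0) := \row_i c i.
have v0 : v = 0.
  have uni : 1%:M + t *: (M1 *m D) \in unitmx by rewrite unitmxE unitfE.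
  apply: (can_inj (mulmxK uni)); rewrite mul0mx -MD scalemxAl -mulmxDl mulmxA (_ : v *m _ = 0) ?mul0mx //.
  rewrite mulmx_sum_row -[RHS]e; apply: eq_bigr => j _; rewrite mxE; congr (_ *: _).
  rewrite (nth_map 0) ?size_zip ?ss ?minnn // nth_zip //=.
  by apply/rowP => l; rewrite !mxE.
by have /rowP/(_ (Ordinal lt)) := v0; rewrite !mxE.
Qed.

(** N is the limit of the increasing sequence ker al, al^-1 (be ker al), and so on. If be x left the
    image of al for some x in the sequence, then for a suitable t nonzero be x together with a
    perturbed basis of that image would be independent; all of it lies in the image of al + t be,
    against the maximality of the rank. *)
Lemma generic_invariant (U : vectType k) (al be : 'Hom(U, V)) :
    (forall t, (\dim (limg (al + t *: be)%R) <= \dim (limg al))%N) ->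
  exists N : {vspace U}, (lker al <= N)%VS /\ (be @: N <= al @: N)%VS.
Proof.
move=> mx; pose F (N : {vspace U}) := (al @^-1: (be @: N))%VS; pose Ni i := iter i F (lker al).
have img0 l x : x \in Ni l -> forall t, t != 0 -> be x \in limg (al + t *: be).
  elim: l x => [|l IH] x.
    rewrite /= memv_ker => /eqP ax t t0; have -> : be x = (al + t *: be) (t^-1 *: x).
      by rewrite linearZ /= add_lfunE scale_lfunE ax add0r scalerA mulVf // scale1r.
    exact: memv_img (memvf _).
  rewrite /= -memv_preim => /memv_imgP[x' /IH h ax] t t0.
  have /memv_imgP[y _ e] := h t t0; have -> : be x = (al + t *: be) (t^-1 *: (x - y)).
    rewrite linearZ linearB /= -e add_lfunE scale_lfunE ax addrAC subrr add0r scalerA mulVf // scale1r //.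
  exact: memv_img (memvf _).
have img l : (be @: Ni l <= limg al)%VS.
  apply/subvP => _ /memv_imgP[x xN ->]; apply: contraT => nin.
  pose ws := vbasis (fullv :\: lker al).
  have fal : free (map al ws).
    apply: free_map; first exact: basis_free (vbasisP _).
    move=> w; rewrite (span_basis (vbasisP _)) => wW aw; apply/eqP.
    by rewrite -memv0 -(capv_diff fullv (lker al)) memv_cap wW memv_ker aw eqxx.
  have sal : <<map al ws>>%VS = limg al.
    by rewrite -limg_span (span_basis (vbasisP _)) limg_ker_compl.
  have f0 : free (be x :: map al ws) by rewrite free_cons sal nin.
  have [|t t0] := @perturb_free _ (0 :: map be ws) _ f0; first by rewrite /= !size_map.
  rewrite /= scaler0 addr0; set st := map _ _ => fst.
  have : (<<be x :: st>> <= limg (al + t *: be)%R)%VS.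
    apply/span_subvP => v; rewrite inE => /orP[/eqP ->|]; first exact: img0 xN _ t0.
    rewrite /st zip_map -map_comp => /mapP[w _ ->] /=.
    by rewrite -scale_lfunE -add_lfunE; apply: memv_img (memvf _).
  have sst : size st = size (map al ws) by rewrite /st !size_map size_zip !size_map minnn.
  move/dimvS; rewrite (eqP fst) /= sst => h.
  have := leq_trans h (mx t); rewrite -sal.
  by rewrite (eqP fal) ltnn.
have mono i : (Ni i <= Ni i.+1)%VS.
  elim: i => [|i IH] /=; first by rewrite -lpreim0 lpreimS // sub0v.
  by apply: lpreimS; apply: limgS.
have [i Ni_eq] : exists i, Ni i.+1 = Ni i.
  apply: NNPP => no; have h i : (i <= \dim (Ni i))%N.
    elim: i => // i IH; apply: leq_ltn_trans IH _.
    rewrite ltn_neqAle dimvS // andbT; apply/negP => /eqP e; apply: no; exists i.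
    by apply/eqP; rewrite eq_sym -(dimv_leqif_eq (mono i)) e.
  have := leq_trans (h (\dim {:U}).+1) (dimvS (subvf _)); rewrite ltnn //.
exists (Ni i); split.
  by elim: (i) => //= j IH; apply: subv_trans IH (mono j).
by rewrite -{2}Ni_eq /= lpreimK.
Qed.

End GenericMap.

Section KroneckerWeierstrass.
Variables (k : closedFieldType) (n : nat).
Local Notation R := {mpoly k[n]}.

Lemma pform_add_equiv (A B : 'M[k]_(4, n)) e : KW_equiv (pform A B) (pform (A + e *: B) B).
Proof.
apply: KW_equiv_sym; pose P : 'M[k]_2 := \matrix_(i, j) if i == 0 then (if j == 0 then 1 else e) else (j != 0)%:R.
have uP : P \in unitmx by rewrite unitmxE det2 !mxE /= mulr0 subr0 mulr1 unitr1.
have -> : pform (A + e *: B) B = cmx n P *m pform A B *m cmx n 1%:M.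
  rewrite cmx1 mulmx1; apply/matrixP => i j; rewrite [RHS]mxE !big_ord_recl big_ord0 !mxE.
  case: i => [[|[|//]] ?] /=; last by rewrite mpolyC1 mul1r mpolyC0 mul0r !(add0r, addr0).
  rewrite addr0 mpolyC1 mul1r mul_mpolyC -linearZ -linearD /=; congr lform.
  by apply/rowP => l; rewrite !mxE.
exact: KW_equiv_mul uP (unitmx1 _ _).
Qed.

Lemma linear_pform (Theta : 'M[R]_(2, 4)) : (forall i j, Theta i j \is 1.-homog) ->
  exists A B, Theta = pform A B.
Proof.
move=> lin; pose w i j := epsilon (inhabits 0) (fun w : 'rV[k]_n => Theta i j = lform w).
have wE i j : Theta i j = lform (w i j).
  exact: (epsilon_spec (inhabits 0) (fun w : 'rV[k]_n => Theta i j = lform w) (lform_onto (lin i j))).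
exists (\matrix_j w 0 j), (\matrix_j w 1 j); apply/matrixP => i j; rewrite mxE wE.
by case: i => [[|[|//]] ?] /=; rewrite rowK; congr (lform (w _ _)); apply/val_inj.
Qed.

Theorem normal_form_exists (Theta : 'M[R]_(2, 4)) : (forall i j, Theta i j \is 1.-homog) ->
  exists bs, KW_normal_form Theta bs.
Proof.
move=> /linear_pform[A [B ->]].
pose lf (M : 'M[k]_(4, n)) : 'Hom('rV[k]_4, 'rV[k]_n) := linfun (mulmxr M).
have lfE M x : lf M x = x *m M by rewrite lfunE.
have [e emax] := exists_maximum 0 (f := fun e : k => \dim (limg (lf (A + e *: B)%R)))
  (b := \dim {:'rV[k]_n}) (fun e => dimvS (subvf _)).
pose al := lf (A + e *: B); pose be := lf B.
have [N [kN bN]] : exists N : {vspace 'rV[k]_4}, (lker al <= N)%VS /\ (be @: N <= al @: N)%VS.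
  apply: generic_invariant => t; have -> : al + t *: be = lf (A + (e + t) *: B); last exact: emax.
  apply/lfunP => x; rewrite add_lfunE scale_lfunE !lfE scalerDl addrA.
  by rewrite [in RHS]mulmxDr -scalemxAr.
have [|L [ad _ fr sp ff]] := @general_form _ _ _ al be fullv N (subvf _) _ bN.
  by rewrite capfv.
have sv : size (vects L) = 4 by have := eqP fr; rewrite sp dimvf /dim /= mul1n.
pose L' := [seq (x.1.1, x.2) | x <- L].
have fL' : lforms L' = forms L by rewrite /lforms /forms -map_comp.
have cL' : lcols L' = [seq (al u, be u) | u <- vects L].
  rewrite /lcols /L' /vects -map_comp; elim: (L) ad => //= x L0 IH /andP[/and3P[_ _ /eqP e1] /IH ->].
  by rewrite map_cat e1.
apply: (ex_intro _ (blocks L')); apply/normal_form_data; exists L' => //; split.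
- by rewrite /wf_data all_map; apply: sub_all ad => x /and3P[/= -> -> _].
- by rewrite fL'.
- by rewrite cL' size_map.
rewrite cL'; apply: KW_equiv_trans (pform_add_equiv A B e) _.
pose Q : 'M[k]_4 := \matrix_j (vects L)`_j.
have uQ : Q \in unitmx.
  rewrite -row_free_unit; apply: inj_row_free => c ce; have [/(_ fr) h _] := free_nthP (vects L).
  apply/rowP => i; rewrite mxE.
  have := h (fun j => c 0 (inord j)); rewrite sv => /(_ _ i (ltn_ord i)); rewrite inord_val; apply.
  by rewrite -[RHS]ce mulmx_sum_row; apply: eq_bigr => j _; rewrite inord_val rowK.
apply: KW_equiv_trans (pform_col_equiv _ _ uQ) _; rewrite form_mxE.
set X := pform _ _; set Y := pform _ _; suff -> : X = Y by apply: KW_equiv_refl.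
have nE j : nth (0, 0) [seq (al u, be u) | u <- vects L] j = (al (vects L)`_j, be (vects L)`_j).
  have [lt|ge] := ltnP j (size (vects L)); first by rewrite (nth_map 0).
  by rewrite !nth_default ?size_map // !linear0.
rewrite /X /Y; congr pform; apply/row_matrixP => j;
  by rewrite ?(proj1 (rowM _ _)) ?(proj2 (rowM _ _)) nE /= lfE row_mul rowK.
Qed.

End KroneckerWeierstrass.

(** * The theorem *)

Lemma exceptional_type (k : closedFieldType) m (Theta : 'M[{mpoly k[m.+3]}]_(2, 4)) :
    KW_normal_form Theta [:: KW_D 2; KW_B 1] ->
  [/\ has_Bour Theta 2, exists a, homological_type Theta a & ~ BR_type Theta].
Proof.
move=> /nf_dataP[v [_ [fr eqv]]]; move: fr eqv; rewrite /lcols /mkseq /= /addn /= => fr eqv.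
have fx := free_pick fr [:: 2; 3; 0; 1]%N isT isT.
have [B _ H] := invariants_equiv eqv (exc_invariants fx).
split=> //; last exact: exc_not_BR fx _ eqv.
by exists (mk_htype [:: 0; 0; 0; 0]%Z [:: 2; 2; 2; 2; 2]%Z [:: 3; 3; 3; 3]%Z [:: 4]%Z).
Qed.

Theorem theorem3 (k : closedFieldType) (char0 : [pchar k] =i pred0) :
  exists (bour indeg : seq (KW_block k) -> nat)
         (htype : seq (KW_block k) -> nat -> seq int),
  forall (n : nat) (Theta : 'M[{mpoly k[n]}]_(2, 4)),
  (3 <= n)%N -> admissible Theta ->
  [/\ exists bs, KW_normal_form Theta bs,
      forall bs, KW_normal_form Theta bs ->
        [/\ has_Bour Theta (bour bs), indeg_Syz Theta (indeg bs)
          & homological_type Theta (htype bs)],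
      [\/ is_free Theta,
          nearly_free Theta,
          BR_type Theta /\ has_Bour Theta 3
        | KW_normal_form Theta [:: KW_D 2; KW_B 1]]
    & KW_normal_form Theta [:: KW_D 2; KW_B 1] ->
        [/\ has_Bour Theta 2, exists a, homological_type Theta a
          & ~ BR_type Theta]].
Proof.
pose S bs (t : nat * nat * (nat -> seq int)) := forall m (Theta : 'M[{mpoly k[m.+3]}]_(2, 4)),
  admissible Theta -> KW_normal_form Theta bs -> solved Theta t.1.1 t.1.2 t.2.
(* Every list of width four is [good], so the chosen values hold for all matrices with this normal
   form, over every ring with at least three variables. *)
pose F bs := epsilon (inhabits (0%N, 0%N, fun=> [::])) (S bs).
have FS n (Theta : 'M[{mpoly k[n]}]_(2, 4)) bs : KW_normal_form Theta bs -> S bs (F bs).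
  move=> [wf [_ [w _]]]; apply: epsilon_spec.
  by have [b [e [h H]]] := good_all wf w; exists (b, e, h).
exists (fun bs => (F bs).1.1), (fun bs => (F bs).1.2), (fun bs => (F bs).2) => n Theta.
case: n Theta => [|[|[|m]]] // Theta _ adm.
have [bs nf] : exists bs, KW_normal_form Theta bs by apply: normal_form_exists; case: adm.
split; [by exists bs | | | exact: exceptional_type].
  by move=> bs' nf'; have [] := FS _ _ _ nf' _ _ adm nf'.
by have [] := FS _ _ _ nf _ _ adm nf.
Qed.
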